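(* Let $Y=\{Y(t),\ t\in\mathbb{R}\}$ be a supOU process with characteristic quadruple $(a,b,\mu,\pi)$, with $\mathbb{E}Y(t)=0$ and $\mathbb{E}Y(t)^2<\infty$, and let $X(t)=\int_0^tY(s)\,ds$, $t\ge0$, be the integrated process. Assume: (1) $\pi$ has a density $p$ with $p(x)\sim\alpha\,\ell(x^{-1})x^{\alpha-1}$ as $x\to0$, for some $\alpha>0$ and some function $\ell$ slowly varying at infinity; if $\alpha>1$ then $\alpha$ is an integer; (2) there exists $\theta>0$ with $\mathbb{E}e^{\theta|Y(t)|}<\infty$; (3) $Y$ is not purely Gaussian, i.e. $\mu\not\equiv0$; (4) one of the following holds, and $H$ is defined accordingly: (a) $b>0$ and $\alpha\in(0,1)$, with $H=1-\alpha/2$; (b) $b=0$, $\alpha\in(0,1)$ and $\beta_{BG}<1+\alpha$, with $H=1/(1+\alpha)$; (c) $b=0$, $\alpha\in(0,1)$, and $\mu([x,\infty))\sim c^+x^{-\beta}$, $\mu((-\infty,-x])\sim c^-x^{-\beta}$ as $x\to0$ for some $c^+,c^-\ge0$ with $c^++c^->0$ and some $\beta$ with $1+\alpha<\beta<2$, with $H=1-\alpha/\beta$; (d) $\alpha>1$, with $H=1/2$; (5) the scaling function $\tau(q)=\lim_{t\to\infty}\frac{\log\mathbb{E}|X(t)|^q}{\log t}$ exists in the extended reals for every $q\in\mathbb{R}$, and $0\in\operatorname{Int}(\mathcal{D}_\tau)$, where $\mathcal{D}_\tau=\{q\in\mathbb{R}:\tau(q)<\infty\}$. Then for every Borel set $A\subset\mathbb{R}$,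 $$-\inf_{x\in\operatorname{Int}(A)\cap\{H,1\}}\tau^*(x)\le\liminf_{t\to\infty}\frac{1}{\log t}\log P\left(\frac{\log|X(t)|}{\log t}\in A\right)\le\limsup_{t\to\infty}\frac{1}{\log t}\log P\left(\frac{\log|X(t)|}{\log t}\in A\right)\le-\inf_{x\in\operatorname{cl}(A)}\tau^*(x),$$ where $\tau^*(x)=\sup_{q\in\mathbb{R}}\{qx-\tau(q)\}$ is the Legendre transform of $\tau$, and it is given by $$\tau^*(x)=\begin{cases}\max\left\{\sup_{q<0}\{qx-\tau(q)\},\,0\right\},& x<H,\\[2pt] \dfrac{\alpha}{1-H}x-\dfrac{\alpha H}{1-H},& H\le x\le1,\\[2pt] \infty,& x>1.\end{cases}$$
   Context: A supOU process is $Y(t)=\int_{\mathbb{R}_+}\int_{\mathbb{R}}e^{-\xi t+s}\mathbf{1}_{[0,\infty)}(\xi t-s)\,\Lambda(d\xi,ds)$, where $\Lambda$ is a homogeneous infinitely divisible random measure (Lévy basis) on $\mathbb{R}_+\times\mathbb{R}$ with $\log\mathbb{E}e^{i\zeta\Lambda(A)}=(\pi\times\mathrm{Leb})(A)\,\kappa_L(\zeta)$ for Borel $A$, $\pi$ a probability measure on $\mathbb{R}_+$, and $\kappa_L(\zeta)=i\zeta a-\frac{\zeta^2}{2}b+\int_{\mathbb{R}}(e^{i\zeta x}-1-i\zeta x\mathbf{1}_{[-1,1]}(x))\mu(dx)$ the cumulant function of an infinitely divisible law with Lévy–Khintchine triplet $(a,b,\mu)$; $(a,b,\mu,\pi)$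 is the characteristic quadruple. $\beta_{BG}=\inf\{\gamma\ge0:\int_{|x|\le1}|x|^\gamma\mu(dx)<\infty\}$ is the Blumenthal–Getoor index of $\mu$. $\operatorname{cl}(A)$ denotes the closure; an infimum over the empty set is $+\infty$. *)

(* Defs.v *)
From HB Require Import structures.
From mathcomp Require Import all_boot all_order all_algebra.
From mathcomp Require Import all_classical all_reals all_analysis.
Set Implicit Arguments. Unset Strict Implicit. Unset Printing Implicit Defensive.
Import Order.TTheory GRing.Theory Num.Theory.
Import numFieldNormedType.Exports.
Local Open Scope classical_set_scope.
Local Open Scope ring_scope.

Section SupOUDefs.
Context {R : realType}.

Definition is_levy_measure (mu : {measure set R -> \bar R}) : Prop :=
  mu [set 0] = 0%E /\ (\int[mu]_x (Num.min 1 (x ^+ 2))%:E < +oo)%E.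

(** Real and imaginary parts of the cumulant function kappa_L of the
    infinitely divisible law with Lévy–Khintchine triplet (a, b, mu):
    kappa_L(z) = i z a - z^2 b / 2 + \int (e^{izx} - 1 - i z x 1_{[-1,1]}(x)) mu(dx). *)
Definition kappa_re (b : R) (mu : {measure set R -> \bar R}) (z : R) : R :=
  - (z ^+ 2 * b) / 2 + fine (\int[mu]_x (cos (z * x) - 1)%:E).
Definition kappa_im (a : R) (mu : {measure set R -> \bar R}) (z : R) : R :=
  z * a + fine (\int[mu]_x (sin (z * x) - z * x * (if `|x| <= 1 then 1 else 0))%:E).

Definition supOU_kernel (t xi s : R) : R :=
  expR (- (xi * t) + s) * (if 0 <= xi * t - s then 1 else 0).

(** Y is a (jointly measurable version of a) supOU process with characteristic
    quadruple (a, b, mu, pi): its finite-dimensional distributions are those of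
    Y(t) = \int\int supOU_kernel t xi s Lambda(dxi, ds), i.e. for all t_1..t_n,
    z_1..z_n,
      E exp(i sum_j z_j Y(t_j)) = exp( \int\int kappa_L(sum_j z_j f_{t_j}(xi,s))
                                        (pi x Leb)(dxi, ds) ),
    written out as real and imaginary parts. *)
Definition is_supOU d (T : measurableType d) (P : probability T R)
    (Y : R -> T -> R) (a b : R) (mu : {measure set R -> \bar R})
    (pi : probability R R) : Prop :=
  measurable_fun [set: R * T] (fun p : R * T => Y p.1 p.2) /\
  forall (n : nat) (ts zs : 'I_n -> R),
    let g := fun p : R * R => \sum_(j < n) zs j * supOU_kernel (ts j) p.1 p.2 in
    let Psi_re := fine (\int[(pi \x lebesgue_measure)%E]_p (kappa_re b mu (g p))%:E) in
    let Psi_im := fine (\int[(pi \x lebesgue_measure)%E]_p (kappa_im a mu (g p))%:E) in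
    (\int[P]_w (cos (\sum_(j < n) zs j * Y (ts j) w))%:E
       = (expR Psi_re * cos Psi_im)%:E)%E /\
    (\int[P]_w (sin (\sum_(j < n) zs j * Y (ts j) w))%:E
       = (expR Psi_re * sin Psi_im)%:E)%E.

Definition integrated d (T : measurableType d) (Y : R -> T -> R) (t : R) (w : T) : R :=
  fine (\int[lebesgue_measure]_(s in `[0, t]) (Y s w)%:E).

Definition slowly_varying (l : R -> R) : Prop :=
  measurable_fun [set: R] l /\ (\forall x \near +oo%R, 0 < l x) /\
  forall lam : R, 0 < lam -> (l (lam * x) / l x) @[x --> +oo%R] --> (1 : R).

Definition has_density (pi : probability R R) (p : R -> R) : Prop :=
  (forall x, 0 <= p x) /\ measurable_fun [set: R] p /\
  forall A : set R, measurable A ->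
    pi A = (\int[lebesgue_measure]_(x in A `&` `]0%R, +oo[%classic) (p x)%:E)%E.

Definition BG_index (mu : {measure set R -> \bar R}) : \bar R :=
  ereal_inf [set g%:E | g in [set g : R | 0 <= g /\
     (\int[mu]_(x in `[(-1)%R, 1%R]) (`|x| `^ g)%:E < +oo)%E]].

Definition abspow (x q : R) : \bar R :=
  if (x == 0) && (q < 0) then +oo%E else (`|x| `^ q)%:E.

Definition elog (x : \bar R) : \bar R :=
  match x with
  | EFin r => if 0 < r then (ln r)%:E else -oo%E
  | EPInf => +oo%E
  | ENInf => -oo%E
  end.

Definition liminf_infty (g : R -> \bar R) : \bar R :=
  ereal_sup [set ereal_inf [set g t | t in `[T0, +oo[%classic] | T0 in [set: R]].
Definition limsup_infty (g : R -> \bar R) : \bar R :=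
  ereal_inf [set ereal_sup [set g t | t in `[T0, +oo[%classic] | T0 in [set: R]].

Definition legendre (tau : R -> \bar R) (x : R) : \bar R :=
  ereal_sup [set ((q * x)%:E - tau q)%E | q in [set: R]].

End SupOUDefs.

(* Main.v *)
(* Symmetrizing the integrated process X(t) by an independent copy gives S_t with
   E cos (u S_t) = exp (- 2 V_t(u)), V_t(u) = int (b (u F_t)^2 / 2 + int (1 - cos (u F_t x)) mu(dx)),
   F_t being the kernel integrated over [0, t]; this is obtained from Riemann sums,
   which converge in L1 both for the process and for the kernel.
   Since F_t <= min(t, 1/xi) and F_t is of order t on {xi <= 1/t} x [-1, 0], whose
   mass is about t^-alpha, the 2j-th cumulant is at most about t^max(1, 2j - alpha) and
   at least about t^(2j - alpha); the cumulant recursion turns this into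
   tau(2m) = 2m - alpha for 2m >= 2 alpha.  For alpha < 1, bounds V_t(u) <= C u^g t^(g - p)
   give tau(q) <= H q on [1, alpha/(1-H)[, and V_t(t^(-H + e)) >= c gives tau(1) >= H; for
   integer alpha, tau(2 alpha) <= alpha and tau(2) >= 1 suffice.
   By convexity tau(q) >= max(H q, q - alpha) everywhere, which yields the Legendre
   transform.  The upper bound of the theorem is Chernoff's inequality, and the
   lower bounds at H and 1 hold because tau is affine with these slopes around some
   q > 0: the measure tilted by |X(t)|^q concentrates where log |X(t)| / log t is
   close to the slope. *)

Require Import Defs.
From HB Require Import structures.
From mathcomp Require Import all_boot all_order all_algebra.
From mathcomp Require Import all_classical all_reals all_analysis.
From mathcomp Require Import measurable_realfun.
From mathcomp Require Import ring lra.
Import Order.TTheory GRing.Theory Num.Theory.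
Import numFieldNormedType.Exports.
Local Open Scope classical_set_scope.
Local Open Scope ring_scope.
Set Implicit Arguments. Unset Strict Implicit. Unset Printing Implicit Defensive.

(** * Cosine remainders *)

Section RealAnalysis.
Context {R : realType}.
Implicit Types x y z : R.

(** The hypotheses bound moments of Y, whereas [is_supOU] only prescribes characteristic functions:
    that mu has moments at all must be read off from E cos (u S) near u = 0. Passing to the
    difference with an independent copy removes the phase, so that the logarithm is real, and kills
    the odd cumulants; the even ones are nonnegative, so the recursion bounds moments by cumulants
    and conversely by positivity alone. Taylor remainders of the cosine, signed so as to be
    nonnegative, let Fatou's lemma do the work of differentiating under the integral.

    Since [tau] does not see a factor t^e with e > 0 arbitrarily small, every estimate may lose one.
    This loss absorbs the slowly varying function, and the regular variation of p is only used
    between x and x / 2.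

    The constant alpha / (1 - H) is the order q at which the lines H q and q - alpha cross. The
    interiority of 0 rules out the degenerate case in which every Y(t) vanishes almost surely and
    the negative moments of X(t) are infinite. *)

Lemma is_derive_MVT (f df : R -> R) (a b : R) : a <= b ->
  (forall x, is_derive x 1 f (df x)) ->
  exists2 c, a <= c <= b & f b - f a = df c * (b - a).
Proof.
move=> ab fdf; have [| c] := @MVT_segment R f df a b ab.
- apply: derivable_within_continuous => x _.
  by have [] := fdf x.
- by rewrite in_itv /= => cab fE; exists c.
Qed.

Lemma derive_ge0_ge0 (f df : R -> R) : (forall x, is_derive x 1 f (df x)) ->
  f 0 = 0 -> (forall x, 0 <= x -> 0 <= df x) -> forall x, 0 <= x -> 0 <= f x.
Proof.
move=> fdf f0 df0 x x0; have [c /andP[c0 _]] := is_derive_MVT x0 fdf.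
by rewrite f0 !subr0 => ->; rewrite mulr_ge0// df0.
Qed.

(** (-1)^m times the remainder of the cosine series after m terms. The sign makes it nonnegative for
    m > 0, so that its integral makes sense against any measure. [sinrem] does the same for the
    sine; the two families differentiate into one another. *)
Fixpoint cosrem (m : nat) x : R :=
  if m is k.+1 then x ^+ k.*2 / k.*2`!%:R - cosrem k x else cos x.

Fixpoint sinrem (m : nat) x : R :=
  if m is k.+1 then x ^+ k.*2.+1 / k.*2.+1`!%:R - sinrem k x else sin x.

Lemma is_derive_monomial n x :
  is_derive x 1 (fun y : R => y ^+ n.+1 / n.+1`!%:R) (x ^+ n / n`!%:R).
Proof.
have -> : (fun y : R => y ^+ n.+1 / n.+1`!%:R) = (n.+1`!%:R^-1) \*: (@idfun R) ^+ n.+1.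
  by apply/funext => y; rewrite fctE mulrC.
apply: is_derive_eq.
rewrite /= factS natrM /GRing.scale /= mulr1.
by rewrite invfM mulrACA mulVf ?pnatr_eq0// mul1r mulrC.
Qed.

Lemma is_derive_sinrem m x : is_derive x 1 (sinrem m) (cosrem m x).
Proof.
elim: m x => [|m ih] x /=; first exact: is_derive_sin.
by apply: is_deriveB => //; exact: is_derive_monomial.
Qed.

Lemma is_derive_cosremS m x : is_derive x 1 (cosrem m.+1) (sinrem m x).
Proof.
elim: m x => [|m ih] x.
  have -> : cosrem 1 = cst 1 - cos :> (R -> R).
    by apply/funext => y /=; rewrite double0 expr0 fact0 divr1.
  by apply: is_derive_eq; rewrite sub0r opprK.
by apply: is_deriveB; exact: is_derive_monomial.
Qed.

Lemma cosrem_sinremS0 m : cosrem m.+1 (0:R) = 0 /\ sinrem m (0:R) = 0.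
Proof.
elim: m => [|m [ih1 ih2]] /=.
  by rewrite double0 expr0 fact0 cos0 sin0 divr1 subrr.
rewrite -[_ - cosrem m 0]/(cosrem m.+1 0) ih1 ih2.
by rewrite doubleS !exprS !mul0r subrr.
Qed.

(** Every remainder vanishes at 0 and has the preceding one as derivative, so positivity on the
    half-line climbs up from 1 - cos x >= 0. *)
Lemma sinrem_cosremS_ge0 m x : 0 <= x -> 0 <= sinrem m.+1 x /\ 0 <= cosrem m.+1 x.
Proof.
elim: m x => [|m ih] x x0.
  have h y : 0 <= cosrem 1 y by rewrite /= double0 expr0 fact0 divr1 subr_ge0 cos_le1.
  split=> //; apply: (@derive_ge0_ge0 (sinrem 1) (cosrem 1)) x x0 => [x||] //.
  - exact: is_derive_sinrem.
  - by have [] := cosrem_sinremS0 1.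
have h y : 0 <= y -> 0 <= cosrem m.+2 y.
  move: y; apply: (@derive_ge0_ge0 (cosrem m.+2) (sinrem m.+1)) => [y||y].
  - exact: is_derive_cosremS.
  - by have [] := cosrem_sinremS0 m.+1.
  - by move=> /ih[].
split; last exact: h.
move: x x0; apply: (@derive_ge0_ge0 (sinrem m.+2) (cosrem m.+2)) => [y||y].
- exact: is_derive_sinrem.
- by have [] := cosrem_sinremS0 m.+2.
- exact: h.
Qed.

Lemma cosremN m x : cosrem m (- x) = cosrem m x.
Proof.
elim: m => [|m ih] /=; first by rewrite cosN.
by rewrite ih -mul2n exprM sqrrN -exprM.
Qed.

Lemma cosrem_ge0 m x : (0 < m)%N -> 0 <= cosrem m x.
Proof.
case: m => // m _; have [x0|x0] := leP 0 x; first by have [] := sinrem_cosremS_ge0 m x0.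
by rewrite -cosremN; have [|] := @sinrem_cosremS_ge0 m (- x) _; first by rewrite oppr_ge0 ltW.
Qed.

(** The difference of the two sides is the next remainder. *)
Lemma cosrem_le m x : cosrem m x <= x ^+ m.*2 / m.*2`!%:R.
Proof. by rewrite -subr_ge0 (cosrem_ge0 (m := m.+1)). Qed.

Lemma continuous_cosrem m : continuous (cosrem m : R -> R).
Proof.
elim: m => [|m ih] x /=; first exact: continuous_cos.
by apply: cvgB; [apply: cvgMl; exact: exprn_continuous|exact: ih].
Qed.

Lemma sub1cos_le_sqr x : 1 - cos x <= x ^+ 2 / 2.
Proof. by have := cosrem_le 1 x; rewrite /= double0 expr0 fact0 divr1. Qed.

Lemma sub1cos_ge_sqr x : `|x| <= 1 -> x ^+ 2 / 4 <= 1 - cos x.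
Proof.
(* The third remainder gives 1 - cos x >= x^2 / 2 - x^4 / 24, and x^4 <= x^2 here. *)
move=> x1; have := cosrem_ge0 x (isT : (0 < 3)%N).
rewrite /= double0 expr0 fact0 divr1 => h.
have x21 : x ^+ 2 <= 1 by rewrite -real_normK ?num_real// exprn_ile1.
have : 0 <= x ^+ 2 := sqr_ge0 x.
move: h; rewrite (_ : 2.*2 = 2 * 2)%N// exprM.
rewrite (_ : (2 * 2)`!%:R = 24 :> R)// (_ : 1.*2`!%:R = 2 :> R)//.
rewrite (_ : 1.*2 = 2)%N//.
move: (x ^+ 2) (cos x) x21 => y c; nra.
Qed.

End RealAnalysis.

(** * Logarithm of a truncated power series *)

Section LogExpansion.
Context {R : realType}.
Implicit Types (a l : nat -> R) (z u : R).

Lemma normr_horner_le (p : {poly R}) z : `|z| <= 1 ->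
  `|p.[z]| <= \sum_(i < size p) `|p`_i|.
Proof.
move=> z1; rewrite horner_coef (le_trans (ler_norm_sum _ _ _))// ler_sum// => i _.
by rewrite normrM normrX ler_piMr// exprn_ile1.
Qed.

(** The recursion says that A' = L' A up to order m, that is, A = exp L as truncated power series.
    Hence A exp (- L) has derivative (A' - L' A) exp (- L) = O(z^m), and the mean value theorem from
    0 gains one power. The range of z is that of - u^2 for |u| <= 1. *)
Lemma mul_expN_expansion a l m : a 0%N = 1 -> l 0%N = 0 ->
  (forall k, (k < m)%N ->
    k.+1%:R * a k.+1 = \sum_(i < k.+1) i.+1%:R * l i.+1 * a (k - i)%N) ->
  exists C, forall z, -1 <= z <= 0 ->
    `|(\poly_(i < m.+1) a i).[z] * expR (- (\poly_(i < m.+1) l i).[z]) - 1|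
      <= C * `|z| ^+ m.+1.
Proof.
move=> a0 l0 al; set A := \poly_(i < m.+1) a i; set L := \poly_(i < m.+1) l i.
pose D := A^`() - L^`() * A.
have takeD : take_poly m D = 0.
  apply/polyP => k; rewrite coef_take_poly coef0; case: ifP => // km.
  rewrite coefB coef_deriv coefM coef_poly ltnS km -mulr_natl al//.
  apply/eqP; rewrite subr_eq0; apply/eqP; apply: eq_bigr => i _.
  have ik : (i <= k)%N by rewrite -ltnS.
  rewrite coef_deriv !coef_poly ltnS (leq_ltn_trans ik km).
  by rewrite mulr_natl ifT// ltnS (leq_trans (leq_subr _ _) (ltnW km)).
pose Q := drop_poly m D.
have DE z : D.[z] = Q.[z] * z ^+ m.
  by rewrite -[D in LHS](poly_take_drop m) takeD add0r hornerM hornerXn.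
pose f z := A.[z] * expR (- L.[z]).
have fdf z : is_derive z 1 f (D.[z] * expR (- L.[z])).
  have h1 : is_derive z 1 (fun x => expR (- L.[x])) (- L^`().[z] * expR (- L.[z])).
    have := @is_derive1_comp _ expR (fun x => - L.[x]) z _ _ _ _.
    by move=> h; apply: is_derive_eq; rewrite mulrC.
  have := @is_deriveM _ _ (horner A) (fun x => expR (- L.[x])) z 1 _ _ _ h1.
  move=> h; apply: is_derive_eq.
  by rewrite /D hornerD hornerN hornerM /GRing.scale /=; ring.
pose B := (\sum_(i < size Q) `|Q`_i|) * expR (\sum_(i < size L) `|L`_i|).
exists B => z /andP[z1 z0].
have nz c : z <= c <= 0 -> `|c| <= `|z|.
  by move=> /andP[zc c0]; rewrite !ler0_norm// lerN2.
have nz1 : `|z| <= 1 by rewrite ler0_norm// lerNl.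
have [c cz] := is_derive_MVT z0 fdf.
have -> : f 0 = 1.
  by rewrite /f !horner_coef0 !coef_poly/= a0 l0 oppr0 expR0 mulr1.
rewrite sub0r -/(f z) distrC => ->.
rewrite normrM normrN exprS [`|z| * _]mulrC mulrA ler_wpM2r//.
rewrite DE !normrM -mulrA [_ * `|expR _|]mulrC mulrA normrX.
apply: ler_pM => //; last by rewrite lerXn2r ?nnegrE ?nz.
have nc1 : `|c| <= 1 by rewrite (le_trans (nz _ cz)).
apply: ler_pM => //; first exact: normr_horner_le.
rewrite ger0_norm ?expR_ge0// ler_expR (le_trans _ (normr_horner_le _ nc1))//.
by rewrite -[leRHS]normrN ler_norm.
Qed.

Lemma norm_le_2_expR1 z : 2^-1 <= expR z -> `|z| <= 2 * `|expR z - 1|.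
Proof.
move=> h; have h1 := expR_ge1Dx z; have h2 := expR_ge1Dx (- z).
rewrite expRN in h2; have e0 := expR_gt0 z.
have h3 : (expR z)^-1 <= 1 + 2 * `|expR z - 1|.
  rewrite -[leLHS]mul1r ler_pdivrMr//.
  have := ler_norm (expR z - 1); have := ler_norm (- (expR z - 1)); rewrite normrN.
  move: `|_| => n; nra.
rewrite ler_norml; apply/andP; split; first lra.
by have := ler_norm (expR z - 1); have := normr_ge0 (expR z - 1); lra.
Qed.

(** Comparison with A exp (- L) shows that exp (- (V + L)) - 1 is of order u^(2m+2). Undoing the
    exponential costs the restriction to u <= d. *)
Lemma log_expansion a l m (V : R -> R) (C1 : R) : a 0%N = 1 -> l 0%N = 0 ->
  (forall k, (k < m)%N ->
    k.+1%:R * a k.+1 = \sum_(i < k.+1) i.+1%:R * l i.+1 * a (k - i)%N) ->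
  (forall u, `|expR (- V u) - (\poly_(i < m.+1) a i).[- u ^+ 2]| <=
     C1 * u ^+ m.+1.*2) ->
  exists C d, 0 < d /\ forall u, 0 <= u <= d ->
    `|V u + (\poly_(i < m.+1) l i).[- u ^+ 2]| <= C * u ^+ m.+1.*2.
Proof.
move=> a0 l0 al Vu; have [C2 hC2] := mul_expN_expansion a0 l0 al.
set L := \poly_(i < m.+1) l i in hC2 *; set A := \poly_(i < m.+1) a i in Vu hC2.
pose B := expR (\sum_(i < size L) `|L`_i|).
pose C3 := `|C1| * B + `|C2|.
have B0 : 0 < B by exact: expR_gt0.
have C30 : 0 <= C3 by rewrite /C3 addr_ge0 ?mulr_ge0 ?expR_ge0.
(* Makes C3 u^(2m+2) at most 1/2, so that the exponential is at least 1/2 and [norm_le_2_expR1]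
   applies. *)
pose d := Num.min 1 (2 * C3 + 1)^-1.
exists (2 * C3), d; split.
  by rewrite lt_min ltr01 invr_gt0; lra.
move=> u /andP[u0]; rewrite le_min => /andP[u1 ud].
have u21 : u ^+ 2 <= 1 by rewrite exprn_ile1.
have nu : `|- u ^+ 2| = u ^+ 2 by rewrite normrN ger0_norm ?sqr_ge0.
have key : `|expR (- (V u + L.[- u ^+ 2])) - 1| <= C3 * u ^+ m.+1.*2.
  rewrite opprD expRD.
  have -> : expR (- V u) * expR (- L.[- u ^+ 2]) - 1 =
     (expR (- V u) - A.[- u ^+ 2]) * expR (- L.[- u ^+ 2]) +
     (A.[- u ^+ 2] * expR (- L.[- u ^+ 2]) - 1) by ring.
  rewrite (le_trans (ler_normD _ _))// [C3 * _]mulrDl lerD//.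
    rewrite normrM mulrAC ler_pM//.
      by rewrite (le_trans (Vu u))// ler_wpM2r ?exprn_ge0// ler_norm.
    rewrite ger0_norm ?expR_ge0// ler_expR.
    have nu1 : `|- u ^+ 2| <= 1 by rewrite nu.
    rewrite (le_trans _ (normr_horner_le L nu1))//.
    by rewrite -[leRHS]normrN ler_norm.
  rewrite (le_trans (hC2 _ _)) ?lerN2 ?u21 ?oppr_le0 ?sqr_ge0//.
  by rewrite nu -exprM -mul2n ler_wpM2r ?exprn_ge0// ler_norm.
have uk : C3 * u ^+ m.+1.*2 <= 2^-1.
  have h : u ^+ m.+1.*2 <= (2 * C3 + 1)^-1.
    rewrite (le_trans _ ud)// doubleS exprS ler_piMr// exprn_ile1//.
  rewrite (le_trans (ler_wpM2l C30 h))//.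
  by rewrite ler_pdivrMr; lra.
rewrite -normrN (le_trans (norm_le_2_expR1 _))//; last by rewrite -mulrA ler_wpM2l.
by move: key; rewrite ler_norml => /andP[+ _]; lra.
Qed.

End LogExpansion.

(** * Moments and cumulants from the characteristic function *)

Section FatouBound.
Context d (T : measurableType d) (R : realType) (m : {measure set T -> \bar R}).
Local Open Scope ereal_scope.

Lemma cvg_EFin_real (f : nat -> R) (a : R) :
  f @ \oo --> a -> (EFin \o f) @ \oo --> a%:E.
Proof. by move=> fa; apply: cvg_EFin; [exact: nearW|exact: fa]. Qed.

Lemma fatou_le (f : nat -> T -> R) (g : T -> R) (B : nat -> R) (M : R) :
  (forall n, measurable_fun setT (f n)) -> (forall n x, (0 <= f n x)%R) ->
  (forall x, f ^~ x @ \oo --> g x) ->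
  (forall n, \int[m]_x (f n x)%:E <= (B n)%:E) -> B @ \oo --> M ->
  \int[m]_x (g x)%:E <= M%:E.
Proof.
move=> mf f0 fg fB BM.
have -> : \int[m]_x (g x)%:E = \int[m]_x limn_einf (fun n => (f n x)%:E).
  apply: eq_integral => x _; apply/esym.
  by have [] := cvg_limn_einf_sup (cvg_EFin_real (fg x)).
apply: (le_trans (fatou _ _ _ _)) => //.
- by move=> n; exact/measurable_EFinP.
- by move=> n x _; rewrite lee_fin.
rewrite limn_einf_lim -(cvg_lim _ (cvg_EFin_real BM))//.
apply: lee_lim.
- exact: is_cvg_einfs.
- by apply/cvg_ex; exists M%:E; exact: cvg_EFin_real.
- apply: nearW => n /=; apply: le_trans (fB n).
  by apply: ereal_inf_lbound; exists n => /=.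
Qed.

Lemma cosrem_integral_fin (h : T -> R) (u : R) n : measurable_fun setT h ->
  (0 < n)%N -> \int[m]_x (h x ^+ n.*2)%:E < +oo ->
  exists2 I : R, \int[m]_x (cosrem n (u * h x))%:E = I%:E &
    (0 <= I <= u ^+ n.*2 * (fine (\int[m]_x (h x ^+ n.*2)%:E) / n.*2`!%:R))%R.
Proof.
move=> mh n0 hn.
have mc : measurable_fun setT (fun x => cosrem n (u * h x)).
  apply: measurableT_comp; last exact: measurable_funM.
  by apply: continuous_measurable_fun; exact: continuous_cosrem.
have h0 x : (0 <= h x ^+ n.*2)%R by rewrite -mul2n exprM exprn_ge0 ?sqr_ge0.
have f0 : 0 <= \int[m]_x (h x ^+ n.*2)%:E.
  by apply: integral_ge0 => x _; rewrite lee_fin.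
have ffin : \int[m]_x (h x ^+ n.*2)%:E \is a fin_num by rewrite ge0_fin_numE.
have le : \int[m]_x (cosrem n (u * h x))%:E <=
    (u ^+ n.*2 * (fine (\int[m]_x (h x ^+ n.*2)%:E) / n.*2`!%:R))%:E.
  rewrite (_ : (_ * _)%R = (u ^+ n.*2 / n.*2`!%:R * fine (\int[m]_x (h x ^+ n.*2)%:E)))%R; last first.
    by rewrite mulrCA mulrC.
  rewrite EFinM fineK// -ge0_integralZl_EFin//; last 3 first.
  - by move=> x _; rewrite lee_fin.
  - by apply/measurable_EFinP; exact: measurable_funX.
  - by rewrite divr_ge0// -mul2n exprM exprn_ge0 ?sqr_ge0.
  apply: ge0_le_integral => //=.
  - by move=> x _; rewrite lee_fin cosrem_ge0.
  - exact/measurable_EFinP.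
  - by apply/measurable_EFinP; apply: measurable_funM => //; exact: measurable_funX.
  - by move=> x _; rewrite -EFinM lee_fin mulrAC -exprMn cosrem_le.
have ge : 0 <= \int[m]_x (cosrem n (u * h x))%:E.
  by apply: integral_ge0 => x _; rewrite lee_fin cosrem_ge0.
exists (fine (\int[m]_x (cosrem n (u * h x))%:E)).
  by rewrite fineK// ge0_fin_numE// (le_lt_trans le)// ltry.
have fi : \int[m]_x (cosrem n (u * h x))%:E \is a fin_num.
  by rewrite ge0_fin_numE// (le_lt_trans le)// ltry.
by rewrite fine_ge0//= -lee_fin fineK.
Qed.

(** Two consecutive remainders add up to a monomial. The relation is kept additive because
    nonnegative integrals may be added before the higher one is known to be finite. *)
Lemma cosrem_integralS (h : T -> R) (u : R) n : measurable_fun setT h ->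
  (0 < n)%N -> \int[m]_x (h x ^+ n.*2)%:E < +oo ->
  \int[m]_x (cosrem n.+1 (u * h x))%:E + \int[m]_x (cosrem n (u * h x))%:E =
  (u ^+ n.*2 * (fine (\int[m]_x (h x ^+ n.*2)%:E) / n.*2`!%:R))%:E.
Proof.
move=> mh n0 hn.
have mc k : measurable_fun setT (fun x => cosrem k (u * h x)).
  apply: measurableT_comp; last exact: measurable_funM.
  by apply: continuous_measurable_fun; exact: continuous_cosrem.
have h0 x : (0 <= h x ^+ n.*2)%R by rewrite -mul2n exprM exprn_ge0 ?sqr_ge0.
rewrite -ge0_integralD//; last 4 first.
- by move=> x _; rewrite lee_fin cosrem_ge0.
- by apply/measurable_EFinP; exact: (mc n.+1).
- by move=> x _; rewrite lee_fin cosrem_ge0.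
- by apply/measurable_EFinP; exact: (mc n).
rewrite (_ : (_ * _)%R = (u ^+ n.*2 / n.*2`!%:R * fine (\int[m]_x (h x ^+ n.*2)%:E)))%R; last first.
  by rewrite mulrCA mulrC.
rewrite EFinM fineK; last first.
  by rewrite ge0_fin_numE//; apply: integral_ge0 => x _; rewrite lee_fin.
rewrite -ge0_integralZl_EFin//; last 3 first.
- by move=> x _; rewrite lee_fin.
- by apply/measurable_EFinP; exact: measurable_funX.
- by rewrite divr_ge0// -mul2n exprM exprn_ge0 ?sqr_ge0.
apply: eq_integral => x _; rewrite -EFinD -EFinM; congr EFin.
by rewrite /= subrK exprMn mulrAC.
Qed.

(* Only Fatou is needed: the remainders lie below their own limit. *)
Lemma cosrem_integral_asymp (h : T -> R) n (la C d0 : R) :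
  measurable_fun setT h -> (0 < n)%N -> (0 < d0)%R ->
  (forall u : R, (0 < u <= d0)%R -> exists2 I : R,
     \int[m]_x (cosrem n (u * h x))%:E = I%:E &
     (`|I - la * u ^+ n.*2| <= C * u ^+ n.+1.*2)%R) ->
  \int[m]_x (h x ^+ n.*2)%:E = (n.*2`!%:R * la)%:E.
Proof.
move=> mh n0 d00 hI.
have h0 x : (0 <= h x ^+ n.*2)%R by rewrite -mul2n exprM exprn_ge0 ?sqr_ge0.
have mc k u : measurable_fun setT (fun x => cosrem k (u * h x)).
  apply: measurableT_comp; last exact: measurable_funM.
  by apply: continuous_measurable_fun; exact: continuous_cosrem.
pose u k : R := (d0 * k.+1%:R^-1)%R.
have u0 k : (0 < u k)%R by rewrite mulr_gt0.
have ud k : (0 < u k <= d0)%R by rewrite u0/= ler_piMr ?(ltW d00)// invf_le1// ler1n.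
have u_cvg : u @ \oo --> 0%R.
  by rewrite -(mulr0 d0); apply: cvgMr; exact: cvg_harmonic.
clearbody u.
have f0 : (0 < n.*2`!%:R :> R)%R by rewrite ltr0n fact_gt0.
have up k : (0 < u k ^+ n.*2)%R by rewrite exprn_gt0.
have u2_cvg (D : R) : (fun k => D * u k ^+ 2)%R @ \oo --> 0%R.
  rewrite -[X in _ --> X](mulr0 D); apply: cvgMr.
  by rewrite -[X in _ --> X](mulr0 0%R); apply: cvgM.
have fE k : \int[m]_x ((n.*2`!%:R / u k ^+ n.*2) * cosrem n (u k * h x))%:E =
   (n.*2`!%:R / u k ^+ n.*2)%:E * \int[m]_x (cosrem n (u k * h x))%:E.
  under eq_integral do rewrite EFinM.
  rewrite ge0_integralZl_EFin//.
  - by move=> x _; rewrite lee_fin cosrem_ge0.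
  - by apply/measurable_EFinP; exact: mc.
  - by rewrite divr_ge0// ltW.
apply/eqP; rewrite eq_le; apply/andP; split.
- pose B k : R := (n.*2`!%:R * (la + C * u k ^+ 2))%R.
  pose f k x : R := ((n.*2`!%:R / u k ^+ n.*2) * cosrem n (u k * h x))%R.
  apply: (@fatou_le f _ B).
  + by move=> k; apply: measurable_funM => //; exact: mc.
  + by move=> k x; rewrite mulr_ge0 ?cosrem_ge0// divr_ge0// ltW.
  (* The next remainder squeezes the rescaled one between h^(2n) - D u^2 and h^(2n). *)
  + move=> x; pose D : R := (n.*2`!%:R * (h x ^+ n.+1.*2 / n.+1.*2`!%:R))%R.
    have c1 : (fun k => h x ^+ n.*2 - D * u k ^+ 2)%R @ \oo --> (h x ^+ n.*2)%R.
      by rewrite -[X in _ --> X]subr0; apply: cvgB; [exact: cvg_cst|exact: u2_cvg].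
    apply: (squeeze_cvgr _ c1 (cvg_cst _)); apply: nearW => k.
    have e : (h x ^+ n.*2 = n.*2`!%:R / u k ^+ n.*2 *
                ((u k * h x) ^+ n.*2 / n.*2`!%:R))%R.
      rewrite exprMn; move: (up k) f0; move: (u k ^+ _)%R (_%:R)%R => U F U0 F0.
      by field; rewrite !gt_eqF.
    apply/andP; split; rewrite /f.
      have -> : (D * u k ^+ 2 = n.*2`!%:R / u k ^+ n.*2 *
                ((u k * h x) ^+ n.+1.*2 / n.+1.*2`!%:R))%R.
        rewrite /D exprMn (_ : u k ^+ n.+1.*2 = u k ^+ n.*2 * u k ^+ 2)%R; last by rewrite -exprD addn2 doubleS.
        have : (0 < n.+1.*2`!%:R :> R)%R by rewrite ltr0n fact_gt0.
        move: (up k) f0; move: (n.+1.*2`!%:R)%R => F'.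
        move: (u k ^+ n.*2)%R (n.*2`!%:R)%R (u k ^+ 2)%R => U F v U0 F0 F'0.
        by field; rewrite !gt_eqF.
      rewrite e -mulrBr ler_wpM2l ?divr_ge0//; first exact: ltW.
      by have := cosrem_le n.+1 (u k * h x); rewrite /=; lra.
    by rewrite e ler_wpM2l ?cosrem_le// divr_ge0// ltW.
  + move=> k; rewrite /f fE; have [I -> hu] := hI _ (ud k).
    rewrite -EFinM lee_fin /B mulrAC ler_pdivrMr// -mulrA ler_pM2l//.
    rewrite mulrDl -mulrA -exprD add2n -doubleS.
    by move: hu; rewrite ler_norml => /andP[_]; lra.
  + apply: cvgMr; rewrite -[X in _ --> X]addr0.
    by apply: cvgD; [exact: cvg_cst|exact: u2_cvg].
- have hk k : (n.*2`!%:R * (la - C * u k ^+ 2))%:E <= \int[m]_x (h x ^+ n.*2)%:E.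
    apply: (@le_trans _ _ (\int[m]_x ((n.*2`!%:R / u k ^+ n.*2) * cosrem n (u k * h x))%:E)).
      rewrite fE; have [I -> hu] := hI _ (ud k).
      rewrite -EFinM lee_fin mulrAC ler_pdivlMr// -mulrA ler_pM2l//.
      rewrite mulrBl -mulrA -exprD add2n -doubleS.
      by move: hu; rewrite ler_norml => /andP[]; lra.
    apply: ge0_le_integral => //=.
    + by move=> x _; rewrite lee_fin mulr_ge0 ?cosrem_ge0// divr_ge0// ltW.
    + by apply/measurable_EFinP; apply: measurable_funM => //; exact: mc.
    + by apply/measurable_EFinP; exact: measurable_funX.
    + move=> x _; rewrite lee_fin.
      rewrite (le_trans (ler_wpM2l _ (cosrem_le _ _))) ?divr_ge0//; first exact: ltW.
      rewrite le_eqVlt; apply/orP; left; apply/eqP.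
      rewrite exprMn; move: (up k) f0; move: (u k ^+ _)%R (_%:R)%R => U F U0 F0.
      by field; rewrite !gt_eqF.
  have c : (fun k => (n.*2`!%:R * (la - C * u k ^+ 2))%R) @ \oo --> (n.*2`!%:R * la)%R.
    apply: cvgMr; rewrite -[X in _ --> X]subr0.
    by apply: cvgB; [exact: cvg_cst|exact: u2_cvg].
  rewrite -(cvg_lim _ (cvg_EFin_real c))//.
  apply: lime_le; first by apply/cvg_ex; eexists; exact: cvg_EFin_real c.
  by apply: nearW => k; exact: hk.
Qed.

End FatouBound.

(** The coefficient of (- u^2)^n in the expansion of the integral of cos (u h). *)
Definition smom {R : realType} d (T : measurableType d) (m : {measure set T -> \bar R})
  (h : T -> R) (n : nat) : R := fine (\int[m]_x (h x ^+ n.*2)%:E)%E / n.*2`!%:R.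

Lemma smom_ge0 {R : realType} d (T : measurableType d) (m : {measure set T -> \bar R})
  (h : T -> R) (n : nat) : 0 <= smom m h n.
Proof.
rewrite divr_ge0// fine_ge0//; apply: integral_ge0 => x _.
by rewrite lee_fin -mul2n exprM exprn_ge0 ?sqr_ge0.
Qed.

Lemma smom_prob0 {R : realType} d (T : measurableType d) (P : probability T R)
  (h : T -> R) : smom P h 0 = 1.
Proof.
rewrite /smom double0 fact0 divr1.
under eq_integral do rewrite expr0.
by rewrite integral_cst//= probability_setT mule1.
Qed.

(** Under an infinite measure cos (u h) is not integrable, so the expansion starts from the integral
    of 1 - cos (u h) and its sum from the moment of order 2. *)
Lemma cosrem_integral_expansion {R : realType} d (T : measurableType d)
    (m : {measure set T -> \bar R}) (h : T -> R) (u I : R) n :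
  measurable_fun setT h ->
  (forall j, (0 < j <= n)%N -> \int[m]_x (h x ^+ j.*2)%:E < +oo)%E ->
  (\int[m]_x (1 - cos (u * h x))%:E)%E = I%:E ->
  (\int[m]_x (cosrem n.+1 (u * h x))%:E)%E =
  ((-1) ^+ n * (I + \sum_(j < n) (- u ^+ 2) ^+ j.+1 * smom m h j.+1))%:E.
Proof.
move=> mh; elim: n => [|n ih] hm hI.
  rewrite big_ord0 addr0 expr0 mul1r -hI; apply: eq_integral => x _.
  by rewrite /= double0 expr0 fact0 divr1.
have {}ih := ih _ hI; have := @cosrem_integralS _ _ _ m h u n.+1 mh isT.
rewrite ih; last by move=> j /andP[j0 jn]; apply: hm; rewrite j0 leqW.
move=> /(_ (hm _ _)) -/(_ (leqnn _)).
case: (\int[m]_x (cosrem n.+2 _)%:E)%E => [J| |]// [/esym/eqP].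
rewrite -subr_eq => /eqP <-; congr EFin.
rewrite big_ord_recr /= -/(smom m h n.+1) [(- u ^+ 2) ^+ n.+1]exprNn.
rewrite -[in u ^+ n.+1.*2]mul2n exprM [(-1) ^+ n.+1]exprS.
have e : (-1) ^+ n * (-1) ^+ n = 1 :> R by rewrite -expr2 sqrr_sign.
set S1 := \sum_(i < n) _; set k := smom _ _ _; set v := (u ^+ 2) ^+ n.+1.
move: ((-1) ^+ n) e => w e.
transitivity ((w * w) * v * k - w * (I + S1)); first by rewrite e mul1r.
by ring.
Qed.

Section Cumulants.
Context {R : realType} d (T : measurableType d) (P : probability T R)
  d' (T' : measurableType d') (nu : {measure set T' -> \bar R}).
Variables (S : T -> R) (h : T' -> R) (s c : R) (I : R -> R).
Hypotheses (mS : measurable_fun setT S) (mh : measurable_fun setT h) (c0 : 0 < c).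
Hypothesis Smom : forall m, (\int[P]_x (S x ^+ m.*2)%:E < +oo)%E.
Hypothesis hI : forall u, (\int[nu]_x (1 - cos (u * h x))%:E = (I u)%:E)%E.
Hypothesis hV : forall u, (\int[P]_x (cos (u * S x))%:E =
  (expR (- (s * u ^+ 2 / 2 + c * I u)))%:E)%E.

(** The coefficient of (- u^2)^j in log E cos (u S), that is, the cumulant of order 2j over (2j)!.
    The Gaussian variance s contributes to j = 1 alone. *)
Definition cumul (j : nat) : R :=
  if j is 0%N then 0 else c * smom nu h j + (j == 1%N)%:R * (s / 2).

Let a := smom P S.

Lemma chf_moment_expansion m u :
  `|expR (- (s * u ^+ 2 / 2 + c * I u)) - (\poly_(i < m.+1) a i).[- u ^+ 2]| <=
    a m.+1 * u ^+ m.+1.*2.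
Proof.
have e : (\int[P]_x (1 - cos (u * S x))%:E)%E =
    (1 - expR (- (s * u ^+ 2 / 2 + c * I u)))%:E.
  under eq_integral do rewrite EFinB.
  have intcos : P.-integrable [set: T] (EFin \o (fun x => cos (u * S x))).
    apply: (@le_integrable _ _ _ _ _ _ _ (cst 1%:E)) => //.
    - apply/measurable_EFinP; apply: measurableT_comp.
        by apply: continuous_measurable_fun; exact: continuous_cos.
      exact: measurable_funM.
    - by move=> x _ /=; rewrite lee_fin normr1 cos_max.
    - exact: finite_measure_integrable_cst.
  rewrite integralB_EFin//=; last exact: finite_measure_integrable_cst.
  by rewrite hV integral_cst//= probability_setT mule1.
have := @cosrem_integral_expansion R d T P S u _ m mS (fun j _ => Smom j) e.
have [I' -> /andP[I'0 I'u] h'] := cosrem_integral_fin u mS (ltn0Sn m) (Smom m.+1).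
have -> : (\poly_(i < m.+1) a i).[- u ^+ 2] =
    1 + \sum_(j < m) (- u ^+ 2) ^+ j.+1 * smom P S j.+1.
  rewrite horner_poly big_ord_recl /= expr0 mulr1 /a smom_prob0; congr (1 + _).
  by apply: eq_bigr => j _; rewrite mulrC.
set A := \sum_(j < m) _ in h' *; set E := expR _ in h' *.
have [h''] := h'.
rewrite [leRHS]mulrC (le_trans _ I'u)// le_eqVlt; apply/orP; left; apply/eqP.
have : `|I'| = I' by rewrite ger0_norm.
rewrite {1}h'' normrM normrX normrN1 expr1n mul1r => <-.
by rewrite -normrN; congr `|_|; ring.
Qed.

(** Both claims are proved in one induction on the order. The moments already known expand the
    exponent; what is left over is the integral of a cosine remainder of h, and its behaviour as u
    tends to 0 decides the finiteness and the value of the next moment of h. *)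
Lemma cumulants : (forall j, (0 < j)%N -> (\int[nu]_x (h x ^+ j.*2)%:E < +oo)%E) /\
  forall k, k.+1%:R * a k.+1 = \sum_(i < k.+1) i.+1%:R * cumul i.+1 * a (k - i)%N.
Proof.
suff Q m : (forall j, (0 < j <= m)%N -> (\int[nu]_x (h x ^+ j.*2)%:E < +oo)%E) /\
  forall k, (k < m)%N -> k.+1%:R * a k.+1 =
    \sum_(i < k.+1) i.+1%:R * cumul i.+1 * a (k - i)%N.
  split=> [j j0|k]; first by apply: (Q j).1; rewrite j0 /=.
  exact: (Q k.+1).2.
elim: m => [|m [ih1 ih2]]; first by split=> // j; case: j.
(* The value that the recursion forces on the next cumulant, written down before the moment of nu
   behind it is known to be finite. *)
pose la := (m.+1%:R * a m.+1 - \sum_(i < m) i.+1%:R * cumul i.+1 * a (m - i)%N) / m.+1%:R.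
have laE : m.+1%:R * la = m.+1%:R * a m.+1 - \sum_(i < m) i.+1%:R * cumul i.+1 * a (m - i)%N.
  by rewrite /la mulrC divfK ?pnatr_eq0.
pose l' j := if j == m.+1 then la else cumul j.
have l'E j : (j <= m)%N -> l' j = cumul j.
  by rewrite /l'; case: eqP => // ->; rewrite ltnn.
have a0 : a 0 = 1 by exact: smom_prob0.
have rec' k : (k < m.+1)%N -> k.+1%:R * a k.+1 =
    \sum_(i < k.+1) i.+1%:R * l' i.+1 * a (k - i)%N.
  rewrite ltnS leq_eqVlt => /predU1P[->|km].
    rewrite big_ord_recr /= subnn a0 mulr1 {2}/l' eqxx laE.
    rewrite (eq_bigr (fun i : 'I_m => i.+1%:R * cumul i.+1 * a (m - i)%N)).
      by rewrite [RHS]addrC subrK.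
    by move=> i _; rewrite l'E.
  rewrite ih2//; apply: eq_bigr => i _; rewrite l'E//.
  by rewrite (leq_trans _ km)// ltnS -ltnS.
have [C [d0 [d00 hC]]] := log_expansion (l := l') a0 (erefl _) rec' (chf_moment_expansion m.+1).
(* The Gaussian part is removed; this concerns the first step m = 0 only. *)
pose la' := la - (m == 0%N)%:R * (s / 2).
have key u : 0 < u <= d0 -> exists2 J : R,
    (\int[nu]_x (cosrem m.+1 (u * h x))%:E)%E = J%:E &
    `|J - la' / c * u ^+ m.+1.*2| <= C / c * u ^+ m.+2.*2.
  move=> /andP[u0 ud].
  have := @cosrem_integral_expansion R d' T' nu h u _ m mh ih1 (hI u).
  move=> hJ; eexists; first exact: hJ.
  have /hC : 0 <= u <= d0 by rewrite ltW.
  set J := (-1) ^+ m * _.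
  suff -> : s * u ^+ 2 / 2 + c * I u + (\poly_(i < m.+2) l' i).[- u ^+ 2] =
      (-1) ^+ m * (c * (J - la' / c * u ^+ m.+1.*2)).
    rewrite !normrM normrX normrN1 expr1n mul1r (gtr0_norm c0).
    by rewrite [C / c * _]mulrAC ler_pdivlMr// [_ * c]mulrC.
  have -> : c * (J - la' / c * u ^+ m.+1.*2) = c * J - la' * u ^+ m.+1.*2.
    by rewrite mulrBr; congr (_ - _); rewrite mulrA [c * _]mulrC divfK ?gt_eqF.
  rewrite horner_poly big_ord_recl big_ord_recr /= {1}/l' /= mul0r add0r {2}/l' eqxx.
  have -> : \sum_(i < m) l' (bump 0 i) * (- u ^+ 2) ^+ (bump 0 i) =
     c * (\sum_(j < m) (- u ^+ 2) ^+ j.+1 * smom nu h j.+1)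
     - (m != 0%N)%:R * (s * u ^+ 2 / 2).
    rewrite mulr_sumr; case: (m) l'E => [|n] l'E /=.
      by rewrite !big_ord0 mul0r subrr.
    rewrite !big_ord_recl /= mul1r addrAC; congr (_ + _).
      rewrite l'E//= mul1r !expr1; by field.
    apply: eq_bigr => i _; rewrite l'E ?ltnS// /= mul0r addr0.
    by rewrite -mulrA [smom _ _ _ * _]mulrC.
  rewrite /J /la' -[in u ^+ m.+1.*2]mul2n exprM.
  rewrite [(- u ^+ 2) ^+ m.+1]exprNn [(-1) ^+ m.+1]exprS.
  have m01 : (m != 0%N)%:R = 1 - (m == 0%N)%:R :> R.
    by case: (m == 0%N); rewrite /= ?subrr ?subr0.
  have mv : (m == 0%N)%:R * (s / 2) * (u ^+ 2) ^+ m.+1 * (-1) ^+ m =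
      (m == 0%N)%:R * (s * u ^+ 2 / 2).
    by case: (m) => [|n] /=; rewrite ?mul0r// expr1 expr0; ring.
  have ww : (-1) ^+ m * (-1) ^+ m = 1 :> R by rewrite -expr2 sqrr_sign.
  rewrite m01.
  move: mv ww; move: (\sum_(j < m) _) ((u ^+ 2) ^+ m.+1) ((-1) ^+ m) (m == 0%N)%:R
    => X v w b mv ww.
  transitivity (c * (I u + X) * (w * w) - la * v * w + b * (s / 2) * v * w).
    by rewrite ww mv; field.
  by ring.
have e := cosrem_integral_asymp mh (ltn0Sn m) d00 key.
split=> [j|].
  move=> /andP[j0]; rewrite leq_eqVlt => /predU1P[->|jm]; first by rewrite e ltry.
  by apply: ih1; rewrite j0.
have lac : la = cumul m.+1.
  have F0 : m.+1.*2`!%:R != 0 :> R by rewrite pnatr_eq0 -lt0n fact_gt0.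
  rewrite /cumul /smom e /fine [_ * (la' / c)]mulrC -(mulrA (la' / c)) divff// mulr1.
  rewrite [c * _]mulrC divfK; last by rewrite gt_eqF.
  by rewrite /la' (_ : (m.+1 == 1%N) = (m == 0%N))// subrK.
move=> k; rewrite ltnS leq_eqVlt => /predU1P[->|]; last exact: ih2.
rewrite rec'//; apply: eq_bigr => i _; congr (_ * _ * _).
by rewrite /l'; case: eqP => // ->.
Qed.

(* Both bounds use that every term of the recursion is nonnegative. *)
Lemma cumul_le_smom k : 0 <= s -> cumul k.+1 <= smom P S k.+1.
Proof.
move=> s0; have [_ /(_ k)] := cumulants.
rewrite big_ord_recr /= subnn /a smom_prob0 mulr1 => e.
have : 0 < k.+1%:R :> R by [].
move=> /ler_pM2l <-; rewrite e lerDr sumr_ge0// => i _.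
rewrite mulr_ge0 ?smom_ge0// mulr_ge0//= addr_ge0//.
  by rewrite mulr_ge0 ?smom_ge0// ltW.
by rewrite mulr_ge0// divr_ge0.
Qed.

Lemma smom_le_cumul k : 0 <= s ->
  smom P S k.+1 <= \sum_(i < k.+1) cumul i.+1 * smom P S (k - i)%N.
Proof.
move=> s0; have [_ /(_ k)] := cumulants; rewrite -/a.
have : 0 < k.+1%:R :> R by [].
move=> /ler_pM2l <- ->; rewrite mulr_sumr ler_sum// => i _; rewrite -mulrA.
apply: ler_wpM2r; last by rewrite ler_nat.
rewrite mulr_ge0 ?smom_ge0//= addr_ge0//.
  by rewrite mulr_ge0 ?smom_ge0// ltW.
by rewrite mulr_ge0// divr_ge0.
Qed.

End Cumulants.

(** * The law pi near the origin *)

Section AtRight.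
Context {R : realType}.
Implicit Types (x y : R) (p l f : R -> R).

Lemma near_at_right0P (Q : R -> Prop) :
  (\forall x \near 0^'+, Q x) <-> exists2 e : R, 0 < e & forall x, 0 < x < e -> Q x.
Proof.
split=> [[e /= e0 h]|[e e0 h]].
  exists e => // x /andP[x0 xe]; apply: h => //=.
  by rewrite sub0r normrN gtr0_norm.
exists e => //= x /=; rewrite sub0r normrN => xe x0; apply: h.
by rewrite x0 -[X in X < _]gtr0_norm.
Qed.

Lemma cvg_half_at_right0 : (fun x : R => x / 2) @ 0^'+ --> 0^'+.
Proof.
move=> A /near_at_right0P[e e0 h]; apply/near_at_right0P; exists e => // x /andP[x0 xe].
by apply: h; lra.
Qed.

Lemma cvg_inv_at_right0 : (fun x : R => x^-1) @ 0^'+ --> +oo.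
Proof.
move=> A [M [_ hM]]; apply/near_at_right0P; exists (`|M| + 1)^-1.
  by rewrite invr_gt0 ltr_pwDr.
move=> x /andP[x0 xM]; apply: hM.
rewrite (@lt_le_trans _ _ (`|M| + 1))//; first by rewrite (le_lt_trans (ler_norm _))// ltrDl.
by rewrite -[leLHS]invrK lef_pV2 ?posrE ?invr_gt0 ?ltW// ltr_pwDr.
Qed.

(** p(x/2) / p(x) factors into p/q at x/2, the ratio of l at 2/x and 1/x, the power 2^(1 - alpha),
    and q/p at x. All factors but the power tend to 1. The positivity of l near infinity gives that
    of p near 0. *)
Lemma half_ratio p l alpha : 0 < alpha -> slowly_varying l ->
  (p x / (alpha * l x^-1 * x `^ (alpha - 1))) @[x --> 0^'+] --> (1 : R) ->
  (p (x / 2) / p x) @[x --> 0^'+] --> 2 `^ (1 - alpha) /\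
  (\forall x \near 0^'+, 0 < p x).
Proof.
move=> a0 [_ [lpos lsv]] pq.
pose q x := alpha * l x^-1 * x `^ (alpha - 1).
have q0 : \forall x \near 0^'+, 0 < q x.
  have := cvg_inv_at_right0 lpos; rewrite nbhs_filterE => lp.
  near=> x; rewrite /q mulr_gt0 ?powR_gt0//.
  by rewrite mulr_gt0//; near: x.
have p0 : \forall x \near 0^'+, 0 < p x.
  have h1 : \forall x \near 0^'+, 0 < p x / q x.
    by apply: (cvgr_gt (1 : R)).
  near=> x; have qx : 0 < q x by near: x.
  have : 0 < p x / q x by near: x.
  by rewrite pmulr_lgt0 ?invr_gt0.
split=> //.
have c1 : (p (x / 2) / q (x / 2)) @[x --> 0^'+] --> (1:R).
  exact: (cvg_comp _ _ cvg_half_at_right0 pq).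
have c2 : (l (2 * x^-1) / l (x^-1)) @[x --> 0^'+] --> (1:R).
  by apply: (cvg_comp _ _ cvg_inv_at_right0 (lsv 2 _)).
have c3 : (q x / p x) @[x --> 0^'+] --> (1:R).
  have -> : (fun x => q x / p x) = (fun x => (p x / q x)^-1).
    by apply/funext => x; rewrite invfM invrK mulrC.
  rewrite -[X in _ --> X]invr1; apply: cvgV => //; exact: oner_neq0.
have : (p (x / 2) / q (x / 2)) * ((l (2 * x^-1) / l (x^-1)) * 2 `^ (1 - alpha)) * (q x / p x) @[x --> 0^'+] --> 2 `^ (1 - alpha).
  rewrite -[X in _ --> X]mulr1; apply: cvgM => //.
  rewrite -[X in _ --> X]mul1r; apply: cvgM => //.
  rewrite -[X in _ --> X]mul1r; apply: cvgM => //; exact: cvg_cst.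
apply: cvg_trans; apply: near_eq_cvg.
near=> x.
have x0 : 0 < x by near: x; exact: nbhs_right_gt.
have qx : 0 < q x by near: x.
have px : 0 < p x by near: x.
have qx2 : 0 < q (x / 2).
  by near: x; exact: cvg_half_at_right0 q0.
have e : q (x / 2) / q x = l (2 * x^-1) / l x^-1 * 2 `^ (1 - alpha).
  rewrite /q invfM invrK mulrC [x^-1 * 2]mulrC.
  rewrite [(x / 2) `^ _]powRM ?invr_ge0 ?ltW//.
  have lx : l x^-1 != 0.
    by apply/eqP => lx; move: qx; rewrite /q lx mulr0 mul0r ltxx.
  have xa : x `^ (alpha - 1) != 0 by rewrite gt_eqF ?powR_gt0.
  have -> : 2^-1 `^ (alpha - 1) = 2 `^ (1 - alpha) :> R.
    by rewrite -[2^-1]powR_inv1// -powRrM; congr (_ `^ _); ring.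
  by field; rewrite xa lx gt_eqF.
rewrite -e; field; by rewrite !gt_eqF.
Unshelve. all: by end_near. Qed.

End AtRight.

(** * Halving and dyadic blocks *)

Section Dyadic.
Context {R : realType}.
Implicit Types (a b : R).
Local Notation leb := (@lebesgue_measure R).

(** Scaled by 1/2, the image of Lebesgue measure under x / 2 gives intervals their length, and
    uniqueness of Lebesgue measure does the rest. *)
Lemma lebesgue_measure_half (A : set R) : measurable A ->
  (leb ((fun x => (x / 2)%R) @^-1` A) = 2%:E * leb A)%E.
Proof.
move=> mA.
have mh : measurable_fun [set: measurableTypeR R] (fun x : R => (x / 2 : measurableTypeR R)).
  exact: measurable_funM.
pose m1 := pushforward leb (fun x : measurableTypeR R => (x / 2 : measurableTypeR R)).
have i0 : (0 <= 2^-1 :> R) by [].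
pose m3 : {measure set (measurableTypeR R) -> \bar R} := mscale (NngNum i0) m1.
pose m2 := m3 mh.
have e : leb A = m2 A.
  apply: lebesgue_measure_unique => // _ [[u v]] _ <- /=.
  rewrite /m2 /m3 /= /mscale /= /m1 /pushforward.
  have -> : (fun x : R => x / 2) @^-1` `]u, v] = `](2 * u), (2 * v)]%classic.
    by apply/seteqP; split => x /=; rewrite !in_itv/=; lra.
  rewrite !lebesgue_measure_itv /= !lte_fin ltr_pM2l//.
  case: ifP => _; last by rewrite mule0.
  by rewrite -!EFinB -EFinM -mulrBr mulrA mulVf// mul1r.
by rewrite e /m2 /m3 /= /mscale /= muleA -EFinM mulfV// mul1e.
Qed.

Lemma ge0_integral_half (f : R -> \bar R) (D : set R) : measurable D ->
  measurable_fun D f -> (forall x : R, D x -> 0 <= f x)%E ->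
  (\int[leb]_(x in (fun x => (x / 2)%R) @^-1` D) f (x / 2)%R = 2%:E * \int[leb]_(x in D) f x)%E.
Proof.
move=> mD mf f0.
have mh : measurable_fun [set: measurableTypeR R] (fun x : R => (x / 2 : measurableTypeR R)).
  exact: measurable_funM.
have := @ge0_integral_pushforward _ _ _ _ R _ mh leb D f mD mf.
rewrite /comp => <-; last by move=> y; rewrite inE; exact: f0.
have i0 : (0 <= 2 :> R) by [].
have := ge0_integral_mscale leb mD (NngNum i0) mf f0.
move=> /= <-.
apply: eq_measure_integral => A mA AD.
by rewrite /= /mscale /= -lebesgue_measure_half.
Qed.

Definition dyblock (h : R) (n : nat) : Prop := 2^-1 ^+ n.+1 < h <= 2^-1 ^+ n.

Lemma dyblock_ex (h : R) : 0 < h <= 1 -> exists n, dyblock h n.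
Proof.
move=> /andP[h0 h1].
have ex : exists n, (2^-1 ^+ n.+1 < h).
  have : (fun n => 2^-1 ^+ n : R) @ \oo --> (0:R).
    by apply: cvg_expr; rewrite gtr0_norm ?invf_lt1 ?ltr1n.
  move=> /cvgr_lt /(_ _ h0) [N _ hN]; exists N; apply: hN => /=; exact: leqnSn.
exists (ex_minn ex); case: ex_minnP => n hn nmin; rewrite /dyblock hn /=.
case: n hn nmin => [|n] hn nmin; first by rewrite expr0.
by rewrite leNgt; apply/negP => /nmin; rewrite ltnn.
Qed.

Lemma dyblock_inj (h : R) m n : dyblock h m -> dyblock h n -> m = n.
Proof.
wlog : m n / (m <= n)%N => [w hm hn|].
  by have [mn|/ltnW nm] := leqP m n; [exact: w|apply/esym; exact: w].
rewrite leq_eqVlt => /predU1P[//|mn] /andP[hm _] /andP[_ hn].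
have : 2^-1 ^+ n <= 2^-1 ^+ m.+1 :> R by rewrite ler_wiXn2l// invf_le1 ?ler1n.
by move=> /(le_trans hn) /(lt_le_trans hm); rewrite ltxx.
Qed.

(** Serves three times: with h = x / r0 for the negative moments of pi, with h = 1 / (u0 |S|) for
    the fractional moments of S, and with h = |x| / z0 for the moments of mu near 0. *)
Lemma geometric_integral_le d (T : measurableType d) (m : {measure set T -> \bar R})
    (h : T -> R) (f : T -> \bar R) (C rho : R) :
  measurable_fun setT h -> measurable_fun setT f -> (forall x, 0 <= f x)%E ->
  0 <= C -> 0 <= rho < 1 ->
  (forall n, \int[m]_(x in [set x | dyblock (h x) n]) f x <= (C * rho ^+ n)%:E)%E ->
  (\int[m]_(x in [set x | (0 < h x <= 1)%R]) f x <= (C / (1 - rho))%:E)%E.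
Proof.
move=> mh mf f0 C0 /andP[rho0 rho1] hn.
have mB n : measurable [set x | dyblock (h x) n].
  have -> : [set x | dyblock (h x) n] = h @^-1` `]2^-1 ^+ n.+1, 2^-1 ^+ n]%classic.
    by apply/seteqP; split => x /=; rewrite /dyblock in_itv.
  by rewrite -[X in measurable X]setTI; exact: mh.
have -> : [set x | (0 < h x <= 1)%R] = \bigcup_n [set x | dyblock (h x) n].
  apply/seteqP; split => x /=.
    by move=> /dyblock_ex[n hx]; exists n.
  move=> [n _ /andP[h1 h2]]; rewrite (lt_trans _ h1) ?exprn_gt0//=.
  by rewrite (le_trans h2)// exprn_ile1// invf_le1// ler1n.
rewrite ge0_integral_bigcup//; last 2 first.
- exact: measurable_funTS.
- by move=> i j _ _ [x [hi hj]]; exact: (dyblock_inj hi hj).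
apply: (@le_trans _ _ (\sum_(i <oo) (C * rho ^+ i)%:E)%E).
  by apply: lee_nneseries => // n _ _; exact: integral_ge0.
have c : series (geometric C rho) @ \oo --> C / (1 - rho).
  by apply: cvg_geometric_series; rewrite ger0_norm.
rewrite -(cvg_lim _ (cvg_EFin_real c))//.
have -> : EFin \o series (geometric C rho) =
    (fun n => \sum_(0 <= i < n) (C * rho ^+ i)%:E)%E.
  by apply/funext => n; rewrite /= /series /= sumEFin.
by [].
Qed.

End Dyadic.

Lemma gt1_ltr_powRr {R : realType} (a x y : R) : 1 < a -> x < y -> a `^ x < a `^ y.
Proof.
move=> a1 xy; have a0 : 0 < a by rewrite (lt_trans _ a1).
by rewrite /powR !gt_eqF// ltr_expR ltr_pM2r// ln_gt0.
Qed.

Lemma powRX {R : realType} (a x : R) n : (a `^ x) ^+ n = a `^ (n%:R * x).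
Proof. by rewrite -powR_mulrn ?powR_ge0// -powRrM mulrC. Qed.

Lemma powR_half {R : realType} (x : R) n : (2^-1 ^+ n) `^ x = (2 `^ (- x)) ^+ n.
Proof.
rewrite powRX -[2^-1]powR_inv1// powRX -powRrM; congr (_ `^ _); ring.
Qed.

Section DensityAtZero.
Context {R : realType}.
Variables (pi : probability R R) (p l : R -> R) (alpha : R).
Hypotheses (pip : has_density pi p) (a0 : 0 < alpha) (lsv : slowly_varying l).
Hypothesis pl : (p x / (alpha * l x^-1 * x `^ (alpha - 1))) @[x --> 0^'+] --> (1 : R).
Local Notation leb := (@lebesgue_measure R).

Definition hblock (r : R) : set R := `]r / 2, r]%classic.

Lemma measurable_hblock r : measurable (hblock r).
Proof. exact: measurable_itv. Qed.
Hint Resolve measurable_hblock : core.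

Lemma density_pos : pi `]-oo, 0%R]%classic = 0%E.
Proof.
have [_ [_ ->//]] := pip.
rewrite (_ : _ `&` _ = set0) ?integral_set0//.
by apply/seteqP; split => x //=; rewrite !in_itv/= andbT => -[]; rewrite leNgt => /negP.
Qed.

Lemma density_itv (a b : R) : 0 <= a -> (pi `]a, b]%classic = \int[leb]_(x in `]a, b]) (p x)%:E)%E.
Proof.
move=> ha; have [_ [_ ->//]] := pip; congr (integral _ _ _).
apply/seteqP; split => x /=; rewrite !in_itv/= andbT; first by case.
by move=> /andP[ax ->]; rewrite ax (le_lt_trans ha ax).
Qed.

(** The change of variables x / 2 contributes a factor 1/2 and the densities a factor close to 2^(1
    - alpha), whence the threshold 2^(- alpha). *)
Lemma mass_half (lo hi : R) : 0 <= lo -> lo < 2 `^ (- alpha) < hi ->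
  exists2 r0 : R, 0 < r0 & forall r, 0 < r <= r0 ->
    (lo%:E * pi (hblock r) <= pi (hblock (r / 2)%R))%E /\
    (pi (hblock (r / 2)%R) <= hi%:E * pi (hblock r))%E.
Proof.
move=> lo0 /andP[loa ahi]; have [p_ge0 [mp _]] := pip.
have [pr ppos] := half_ratio a0 lsv pl.
have e2 : 2 `^ (1 - alpha) = 2 * 2 `^ (- alpha) :> R.
  by rewrite powRD ?powRr1// pnatr_eq0 implybT.
have h1 : \forall x \near 0^'+, 2 * lo < p (x / 2) / p x.
  by apply: (cvgr_gt (2 `^ (1 - alpha))) => //; rewrite e2 ltr_pM2l.
have h2 : \forall x \near 0^'+, p (x / 2) / p x < 2 * hi.
  by apply: (cvgr_lt (2 `^ (1 - alpha))) => //; rewrite e2 ltr_pM2l.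
have : \forall x \near 0^'+, 2 * lo * p x <= p (x / 2) <= 2 * hi * p x.
  near=> x; have px : 0 < p x by near: x.
  apply/andP; split; [rewrite -ler_pdivlMr//|rewrite -ler_pdivrMr//].
  - by apply: ltW; near: x.
  - by apply: ltW; near: x.
move=> /near_at_right0P[e e0 he].
exists (e / 2); first by rewrite divr_gt0.
move=> r /andP[r0 re].
have mpD (D : set R) : measurable_fun D (fun x => (p x)%:E).
  by apply/measurable_EFinP; exact: measurable_funTS.
have mp2D (D : set R) : measurable_fun D (fun x : R => (p (x / 2))%:E).
  apply/measurable_EFinP; apply: measurable_funTS.
  by apply: measurableT_comp => //; exact: measurable_funM.
have he' x : hblock r x -> 2 * lo * p x <= p (x / 2) <= 2 * hi * p x.
  by rewrite /hblock /= in_itv /= => /andP[x1 x2]; apply: he; lra.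
have key : (2%:E * pi (hblock (r / 2)%R) = \int[leb]_(x in hblock r) (p (x / 2)%R)%:E)%E.
  rewrite /hblock density_itv; last by lra.
  rewrite -(@ge0_integral_half R (fun x => (p x)%:E))//; last by move=> x _; rewrite lee_fin.
  congr (integral _ _ _); apply/seteqP; split => x /=; rewrite !in_itv/=; lra.
have cM (c : R) : 0 <= c -> (\int[leb]_(x in hblock r) (c * p x)%:E = c%:E * pi (hblock r))%E.
  move=> c0; rewrite /hblock density_itv; last by lra.
  rewrite -ge0_integralZl_EFin//.
    by move=> x _; rewrite lee_fin.
  exact: mpD.
have hi0 : 0 <= hi by rewrite (le_trans _ (ltW ahi))// powR_ge0.
split.
  rewrite -(@lee_pmul2l _ 2%:E)// key muleA -EFinM -cM ?mulr_ge0//.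
  apply: ge0_le_integral.
  - exact: measurable_hblock.
  - by move=> x _; rewrite lee_fin !mulr_ge0.
  - by apply/measurable_EFinP; apply: measurable_funTS; exact: measurable_funM.
  - exact: mp2D.
  - by move=> x /he' /andP[]; rewrite lee_fin.
rewrite -(@lee_pmul2l _ 2%:E)// key muleA -EFinM -cM ?mulr_ge0//.
apply: ge0_le_integral.
- exact: measurable_hblock.
- by move=> x _; rewrite lee_fin.
- exact: mp2D.
- by apply/measurable_EFinP; apply: measurable_funTS; exact: measurable_funM.
- by move=> x /he' /andP[]; rewrite lee_fin.
Unshelve. all: by end_near. Qed.

Lemma mass_blocks (lo hi : R) : 0 <= lo -> lo < 2 `^ (- alpha) < hi ->
  exists2 r0 : R, 0 < r0 & forall n,
    ((lo ^+ n)%:E * pi (hblock r0) <=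
       pi (hblock (r0 * 2^-1 ^+ n)%R))%E /\
    (pi (hblock (r0 * 2^-1 ^+ n)%R) <= (hi ^+ n)%:E * pi (hblock r0))%E.
Proof.
move=> lo0 h; have [r0 r00 hr0] := mass_half lo0 h.
have hi0 : 0 <= hi by move: h => /andP[_ ahi]; rewrite (le_trans _ (ltW ahi))// powR_ge0.
exists r0 => //; elim=> [|n [ih1 ih2]].
  by rewrite !expr0 mulr1 mul1e.
have [] := hr0 (r0 * 2^-1 ^+ n).
  rewrite mulr_gt0 ?exprn_gt0//= ler_piMr// ?exprn_ile1 ?invf_le1 ?ler1n//; exact: ltW.
rewrite -!mulrA -!exprSr => h1 h2; split.
  apply: le_trans h1; rewrite exprS EFinM -muleA.
  by rewrite lee_pmul// mule_ge0// lee_fin exprn_ge0.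
apply: (le_trans h2); rewrite exprS EFinM -muleA.
by rewrite lee_wpmul2l// lee_fin.
Qed.

(** On the block of index n the integrand is of order 2^(q n) and the mass at most [hi]^n. The
    exponent of [hi] is taken halfway between q and alpha: this is admissible in [mass_blocks] and
    makes 2^q hi < 1. *)
Lemma integral_inv_powR (q : R) : 0 <= q < alpha ->
  (\int[pi]_(x in `]0%R, +oo[) (x `^ (- q))%:E < +oo)%E.
Proof.
move=> /andP[q0 qa].
pose hi := 2 `^ (- ((alpha + q) / 2)) : R.
have hih : 0 < 2 `^ (- alpha) < hi.
  by rewrite powR_gt0//= gt1_ltr_powRr ?ltr1n//; lra.
have [r0 r00 hr0] := mass_blocks (lexx 0) hih.
have mf : measurable_fun [set: R] (fun x : R => (x `^ (- q))%:E).
  by apply/measurable_EFinP; exact: measurable_powR.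
have f0 (x : R) : (0 <= (x `^ (- q))%:E)%E by rewrite lee_fin powR_ge0.
have blockE n : [set x | dyblock (x / r0) n] = hblock (r0 * 2^-1 ^+ n).
  have e : r0 * 2^-1 ^+ n.+1 = r0 * 2^-1 ^+ n / 2 by rewrite exprSr mulrA.
  by apply/seteqP; split => x /=; rewrite /dyblock /hblock /= in_itv/= ltr_pdivlMr// ler_pdivrMr// ![_ * r0]mulrC e.
pose K := (r0 / 2) `^ (- q); pose rho := 2 `^ q * hi.
have K0 : 0 <= K by rewrite powR_ge0.
have rho0 : 0 <= rho by rewrite mulr_ge0// powR_ge0.
have rho1 : rho < 1.
  rewrite /rho /hi -powRD ?pnatr_eq0 ?implybT// -[ltRHS](powRr0 2) gt1_ltr_powRr ?ltr1n//; lra.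
have hb n : (\int[pi]_(x in [set x | dyblock (x / r0) n]) (x `^ (- q))%:E <= (K * rho ^+ n)%:E)%E.
  rewrite blockE.
  apply: (@le_trans _ _ (\int[pi]_(x in hblock (r0 * 2^-1 ^+ n)%R) (K * (2 `^ q) ^+ n)%:E)%E).
    apply: ge0_le_integral => //.
    - exact: measurable_funTS.
    - move=> x; rewrite /hblock /= in_itv /= => /andP[x1 x2]; rewrite lee_fin.
      have {}x1 : r0 * 2^-1 ^+ n.+1 < x by rewrite exprSr mulrA.
      have b0 : 0 < r0 * 2^-1 ^+ n.+1 by rewrite mulr_gt0 ?exprn_gt0.
      have -> : K * (2 `^ q) ^+ n = (r0 * 2^-1 ^+ n.+1) `^ (- q).
        rewrite exprS mulrA powRM ?exprn_ge0 ?mulr_ge0 ?ltW//.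
        by rewrite powR_half opprK.
      rewrite !powRN lef_pV2 ?posrE ?powR_gt0//; last exact: lt_trans x1.
      by apply: ge0_ler_powR; rewrite ?nnegrE// ltW// (lt_trans b0 x1).
  rewrite integral_cst//= /rho exprMn mulrA [X in (_ <= X)%E]EFinM lee_pmul//.
  - by rewrite lee_fin mulr_ge0 ?exprn_ge0 ?powR_ge0.
  - have [_ h] := hr0 n; apply: (le_trans h).
    by rewrite -[leRHS]mule1 lee_wpmul2l ?lee_fin ?exprn_ge0 ?powR_ge0//; exact: probability_le1.
have i1 := geometric_integral_le (h := fun x : R => x / r0) _ mf f0 K0 _ hb.
have {}i1 : (\int[pi]_(x in [set x | (0 < x / r0 <= 1)%R]) (x `^ (- q))%:E < +oo)%E.
  apply: le_lt_trans (i1 _ _) _; rewrite ?ltry// ?rho0//.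
  exact: measurable_funM.
have setE : [set x | 0 < x / r0 <= 1] = `]0, r0]%classic.
  by apply/seteqP; split => x /=; rewrite in_itv/= pmulr_lgt0 ?invr_gt0// ler_pdivrMr// mul1r.
rewrite setE in i1.
have -> : `]0, +oo[%classic = `]0, r0] `|` `]r0, +oo[ :> set R.
  by rewrite -itv_bndbnd_setU//= bnd_simp ltW.
rewrite ge0_integral_setU//; last 2 first.
- exact: measurable_funTS.
- apply/disj_setPS => x /= []; rewrite !in_itv/= andbT => /andP[_ h1].
  by move=> /(le_lt_trans h1); rewrite ltxx.
rewrite lte_add_pinfty//.
apply: (@le_lt_trans _ _ (\int[pi]_(x in `]r0, +oo[) (r0 `^ (- q))%:E)%E).
  apply: ge0_le_integral => //.
  - exact: measurable_funTS.
  - move=> x /=; rewrite in_itv /= andbT => rx; rewrite lee_fin.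
    rewrite !powRN lef_pV2 ?posrE ?powR_gt0//; last exact: lt_trans rx.
    by apply: ge0_ler_powR; rewrite ?nnegrE// ltW// (lt_trans r00 rx).
rewrite integral_cst//= lte_mul_pinfty// ?lee_fin ?powR_ge0//.
by rewrite (le_lt_trans (probability_le1 _ _))// ltry.
Qed.

(** The block masses decay no faster than [lo]^n, and [x, 4 x] is long enough to contain a whole
    block. The loss e covers the slowly varying factor. *)
Lemma mass_lower (e : R) : 0 < e -> exists c r : R, [/\ 0 < c, 0 < r &
  forall x, 0 < x <= r -> ((c * x `^ (alpha + e))%:E <= pi `[x, (4 * x)%R]%classic)%E].
Proof.
move=> e0; have [p_ge0 [mp _]] := pip.
pose lo := 2 `^ (- (alpha + e)) : R.
have loh : lo < 2 `^ (- alpha) < 2 `^ (- alpha) + 1.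
  by rewrite ltrDl ltr01 andbT gt1_ltr_powRr ?ltr1n//; lra.
have [r0 r00 hr0] := mass_blocks (powR_ge0 _ _ : 0 <= lo) loh.
have [e1 e10 pe1] := (near_at_right0P _).1 (half_ratio a0 lsv pl).2.
(* the blocks of index at least N lie inside the region where p is positive *)
have [N hN] : exists N, r0 * 2^-1 ^+ N < e1.
  have : (fun n => r0 * 2^-1 ^+ n) @ \oo --> (0:R).
    rewrite -[X in _ --> X](mulr0 r0); apply: cvgMr.
    by apply: cvg_expr; rewrite gtr0_norm ?invf_lt1 ?ltr1n.
  by move=> /cvgr_lt /(_ _ e10) [N _ hN]; exists N; apply: hN => /=.
have piN : (0 < pi (hblock (r0 * 2^-1 ^+ N)%R))%E.
  rewrite lt0e measure_ge0 andbT; apply/eqP.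
  set r := r0 * _; have rp : 0 < r by rewrite mulr_gt0 ?exprn_gt0.
  rewrite /hblock density_itv; last by lra.
  move=> int0.
  (* Were the integral 0, p would vanish almost everywhere on a block of positive length on which it
     is positive. *)
  have := (@ae_eq_integral_abs _ _ R leb `]r / 2, r]%classic (measurable_itv _) (EFin \o p) _).1.
  move=> []; first by apply/measurable_EFinP; exact: measurable_funTS.
    rewrite -[RHS]int0; apply: eq_integral => x _ /=; by rewrite ger0_norm.
  move=> A [mA A0 hA].
  have : (leb `](r / 2)%R, r]%classic <= leb A)%E.
    apply: le_measure; rewrite ?inE; [exact: measurable_itv|exact: mA|].
    move=> x hx; apply: hA => /= /(_ hx) /eqP; rewrite eqe gt_eqF// pe1//.
    move: hx; rewrite /= in_itv/= => /andP[h1 h2]; rewrite (le_lt_trans h2 hN) andbT; lra.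
  rewrite A0 lebesgue_measure_itv /= lte_fin ifT; last by lra.
  by rewrite -EFinD lee_fin; lra.
have pi0 : (0 < pi (hblock r0))%E.
  rewrite lt0e measure_ge0 andbT; apply/eqP => e2.
  by have [_] := hr0 N; rewrite e2 mule0 leNgt piN.
have pifin : pi (hblock r0) \is a fin_num by exact: fin_num_measure.
pose a := fine (pi (hblock r0)).
have a_gt0 : 0 < a by rewrite fine_gt0// pi0 (le_lt_trans (probability_le1 _ _)) ?ltry.
exists (a * r0 `^ (- (alpha + e))), (r0 / 4); split.
- by rewrite mulr_gt0// powR_gt0.
- by rewrite divr_gt0.
move=> x /andP[x0 xr].
have y0 : 0 < x / r0 by rewrite divr_gt0.
have y1 : x / r0 <= 4^-1 by rewrite ler_pdivrMr// mulrC.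
have [|n] := @dyblock_ex _ (x / r0); first by rewrite y0 (le_trans y1)// invf_le1 ?ler1n.
(* Since x <= r0 / 4 the block index of x is positive, and the preceding, larger block lies in
   [x, 4 x]. *)
case: n => [|k] /andP[h1 h2]; first by exfalso; move: h1; rewrite expr1; lra.
have [+ _] := hr0 k; move=> h3.
apply: (@le_trans _ _ (pi (hblock (r0 * 2^-1 ^+ k)%R))).
  apply: le_trans h3; rewrite -(fineK pifin) -EFinM lee_fin -/a -mulrA [leRHS]mulrC.
  rewrite ler_pM2l// /lo -powR_half.
  have -> : r0 `^ (- (alpha + e)) = r0^-1 `^ (alpha + e).
    by rewrite -(powR_inv1 (ltW r00)) -powRrM mulN1r.
  have s0 : 0 <= alpha + e by rewrite addr_ge0 ?ltW.
  rewrite -powRM ?invr_ge0 ?(ltW r00) ?(ltW x0)// [_^-1 * x]mulrC.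
  apply: ge0_ler_powR; rewrite ?nnegrE ?exprn_ge0//; first exact: ltW.
  by apply: (le_trans h2); rewrite exprS ler_piMl ?exprn_ge0// invf_le1 ?ler1n.
apply: le_measure; rewrite ?inE; [exact: measurable_hblock|exact: measurable_itv|].
move: h1 h2; rewrite ltr_pdivlMr// ler_pdivrMr// !exprS => h1 h2.
by move=> z; rewrite /hblock /= !in_itv/= => /andP[z1 z2]; lra.
Qed.

End DensityAtZero.

(** * The supOU kernel *)

Section Kernel.
Context {R : realType}.
Local Notation leb := (@lebesgue_measure R).
Implicit Types (r t k a b : R) (q : R * R).

Lemma is_derive_expR_affine k b (x : R) :
  is_derive x 1 (fun x : R => expR (k * x + b)) (k * expR (k * x + b)).
Proof.
have h : is_derive x 1 (fun x : R => k * x + b) k.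
  have -> : (fun x : R => k * x + b) = (k \*: (@idfun R)) + cst b by [].
  by apply: is_derive_eq; rewrite addr0 /GRing.scale /= mulr1.
have := @is_derive1_comp _ expR (fun x : R => k * x + b) x _ _ _ h.
by move=> h'; apply: is_derive_eq; rewrite mulrC.
Qed.

Lemma continuous_expR_affine k b : continuous (fun x : R => expR (k * x + b)).
Proof.
move=> x; apply: differentiable_continuous; apply/derivable1_diffP.
by have [] := is_derive_expR_affine k b x.
Qed.

Lemma integral_expR_affine k b (u v : R) : k != 0 -> u < v ->
  (\int[leb]_(x in `[u, v]) (expR (k * x + b))%:E =
   ((expR (k * v + b) - expR (k * u + b)) / k)%:E)%E.
Proof.
move=> k0 uv; pose F (x : R) := k^-1 * expR (k * x + b).
have dF (x : R) : is_derive x 1 F (expR (k * x + b)).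
  have := @is_deriveZ _ _ _ (fun x : R => expR (k * x + b)) k^-1 x 1 _ (is_derive_expR_affine k b x).
  by rewrite /GRing.scale /= mulKf.
have cF : continuous F.
  by move=> x; apply: differentiable_continuous; apply/derivable1_diffP; have [] := dF x.
rewrite (@continuous_FTC2 _ _ F)//.
- by rewrite -EFinB /F -mulrBr mulrC.
- by apply: continuous_subspaceT; exact: continuous_expR_affine.
- split.
  + by move=> x _; have [] := dF x.
  + by apply: cvg_at_right_filter; exact: cF.
  + by apply: cvg_at_left_filter; exact: cF.
- by move=> x _; rewrite derive1E; have [] := dF x.
Qed.

Definition ker r q : R := supOU_kernel r q.1 q.2.

Lemma ker_ge0 r q : 0 <= ker r q.
Proof. by rewrite mulr_ge0 ?expR_ge0//; case: ifP. Qed.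

Lemma ker_le1 r q : ker r q <= 1.
Proof.
rewrite /ker /supOU_kernel; case: ifP => h; last by rewrite mulr0.
by rewrite mulr1 -expR0 ler_expR; lra.
Qed.

Lemma kerE r q : ker r q = if q.2 <= q.1 * r then expR (- (q.1 * r) + q.2) else 0.
Proof. by rewrite /ker /supOU_kernel subr_ge0; case: ifP; rewrite ?mulr1 ?mulr0. Qed.

Lemma measurable_ker : measurable_fun [set: R * (R * R)] (fun z : R * (R * R) => ker z.1 z.2).
Proof.
have m1 : measurable_fun [set: R * (R * R)] (fun z : R * (R * R) => z.1) by exact: measurable_fst.
have m21 : measurable_fun [set: R * (R * R)] (fun z : R * (R * R) => z.2.1).
  by apply: measurableT_comp; [exact: measurable_fst|exact: measurable_snd].
have m22 : measurable_fun [set: R * (R * R)] (fun z : R * (R * R) => z.2.2).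
  by apply: measurableT_comp; [exact: measurable_snd|exact: measurable_snd].
apply: measurable_funM.
  apply: measurableT_comp; first exact: measurable_expR.
  apply: measurable_funD => //; apply: (measurableT_comp (@oppr_measurable R _)).
  exact: measurable_funM.
apply: measurable_fun_ifT => //.
apply: measurable_fun_ler => //.
by apply: measurable_funB => //; exact: measurable_funM.
Qed.

Lemma measurable_ker_r r : measurable_fun [set: R * R] (ker r).
Proof. exact: (measurableT_comp measurable_ker (pair1_measurable r)). Qed.

(** Exact integration over the windows [c - n - 1, c] stays below 1, and Fatou's lemma removes the
    window. *)
Lemma integral_ker_le1 r (xi : R) : (\int[leb]_v (ker r (xi, v))%:E <= 1)%E.
Proof.
set c := xi * r.
pose f (n : nat) (v : R) : R := expR (1 * v + (- c)) * \1_(`[c - n.+1%:R, c]) v.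
have -> : (1 = (1:R)%:E)%E by [].
apply: (@fatou_le _ _ _ leb f _ (fun=> 1)) => //; last 3 first.
- move=> v; have [cv|vc] := ltP c v.
    rewrite kerE /= leNgt cv /=.
    have -> : (fun n => f n v) = (fun=> 0); last exact: cvg_cst.
    apply/funext => n; rewrite /f indicE memNset ?mulr0//= in_itv/= => /andP[_].
    by rewrite leNgt cv.
  rewrite kerE /= vc.
  have -> : expR (- (xi * r) + v) = expR (1 * v + - c) by congr expR; rewrite mul1r addrC.
  apply: cvg_near_cst.
  near=> n; rewrite /f indicE mem_set ?mulr1//= in_itv/= vc andbT.
  have : c - v <= n.+1%:R.
    rewrite (@le_trans _ _ n%:R)// ?ler_nat//; near: n; exact: nbhs_infty_ger.
  by lra.
- move=> n; rewrite /f.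
  have -> : (\int[leb]_v (expR (1 * v + - c) * \1_(`[(c - n.+1%:R)%R, c]) v)%:E =
     \int[leb]_(v in `[(c - n.+1%:R)%R, c]) (expR (1 * v + - c))%:E)%E.
    rewrite [RHS]integral_mkcond; apply: eq_integral => v _.
    rewrite patchE indicE; case: ifP => _; rewrite ?mulr1 ?mulr0//.
  rewrite integral_expR_affine ?oner_neq0//; last by rewrite ltrBlDr ltrDl.
  rewrite divr1 mul1r subrr expR0 lee_fin; have := expR_ge0 (1 * (c - n.+1%:R) + - c); lra.
- exact: cvg_cst.
- move=> n; apply: measurable_funM; last exact: measurable_indic.
  by apply: continuous_measurable_fun; exact: continuous_expR_affine.
- by move=> n v; rewrite mulr_ge0 ?expR_ge0.
Unshelve. all: by end_near. Qed.

(** Up to xi r both kernels are exponentials, with ratio exp (- xi (r' - r)) >= 1 - xi (r' - r).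
    Between xi r and xi r' the earlier one is 0 and the later one at most 1. *)
Lemma ker_diff_le r r' (xi v : R) : 0 <= xi -> r <= r' ->
  `|ker r (xi, v) - ker r' (xi, v)| <=
  xi * (r' - r) * ker r (xi, v) + \1_(`[xi * r, xi * r']) v.
Proof.
move=> xi0 rr; rewrite !kerE /= indicE.
have h : xi * r <= xi * r' by rewrite ler_wpM2l.
have [vr|rv] := leP v (xi * r).
  rewrite (le_trans vr h).
  have e : expR (- (xi * r') + v) = expR (- (xi * r) + v) * expR (- (xi * (r' - r))).
    by rewrite -expRD; congr expR; ring.
  have p0 := expR_gt0 (- (xi * r) + v).
  have h1 : 1 - xi * (r' - r) <= expR (- (xi * (r' - r))) by exact: expR_ge1Dx.
  have h2 : expR (- (xi * (r' - r))) <= 1.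
    by rewrite -expR0 ler_expR oppr_le0 mulr_ge0// subr_ge0.
  rewrite e ger0_norm; last by rewrite subr_ge0 ler_piMr// ltW.
  rewrite -[X in X <= _]addr0 lerD//.
  move: (expR (- (xi * r) + v)) p0 (expR _) h1 h2 => E E0 G; nra.
rewrite sub0r normrN mulr0 add0r.
case: ifP => [vr'|_]; last by rewrite normr0.
rewrite mem_set/= ?in_itv/= ?(ltW rv)//.
by rewrite ger0_norm ?expR_ge0// -expR0 ler_expR; lra.
Qed.

Lemma integral_ker_diff_le r r' (xi : R) : 0 <= xi -> r <= r' ->
  (\int[leb]_v (`|ker r (xi, v) - ker r' (xi, v)|)%:E <= (2 * (xi * (r' - r)))%:E)%E.
Proof.
move=> xi0 rr.
have mk s : measurable_fun [set: R] (fun v : R => ker s (xi, v)).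
  exact: (measurableT_comp (measurable_ker_r s) (pair1_measurable xi)).
have c0 : 0 <= xi * (r' - r) by rewrite mulr_ge0// subr_ge0.
apply: (@le_trans _ _ (\int[leb]_v ((xi * (r' - r) * ker r (xi, v))%:E +
   (\1_(`[(xi * r)%R, (xi * r')%R]) v)%:E))%E).
  apply: ge0_le_integral => //=.
  - apply/measurable_EFinP; apply: measurableT_comp => //; apply: measurable_funB; exact: mk.
  - apply/measurable_EFinP; apply: measurable_funD; first by apply: measurable_funM => //; exact: mk.
    exact: measurable_indic.
  - by move=> v _; rewrite -EFinD lee_fin ker_diff_le.
rewrite ge0_integralD//=; last 3 first.
- by move=> v _; rewrite lee_fin mulr_ge0// ker_ge0.
- by apply/measurable_EFinP; apply: measurable_funM => //; exact: mk.
- by apply/measurable_EFinP; exact: measurable_indic.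
under eq_integral do rewrite EFinM.
rewrite ge0_integralZl_EFin//; last 2 first.
- by move=> v _; rewrite lee_fin ker_ge0.
- by apply/measurable_EFinP; exact: mk.
rewrite integral_indic// setIT mulr2n mulrDl mul1r EFinD leeD//.
  by rewrite -[leRHS]mule1 lee_wpmul2l ?lee_fin ?integral_ker_le1.
apply: (@le_trans _ _ (leb `[(xi * r)%R, (xi * r')%R]%classic)); first by [].
rewrite lebesgue_measure_itv /=; case: ifP => _; last by rewrite lee_fin.
by rewrite -EFinB lee_fin mulrBr.
Qed.

End Kernel.

(** * Tonelli's theorem in the time variable *)

Section TimeIntegral.
Context {R : realType} d (T : measurableType d) (m : {sigma_finite_measure set T -> \bar R}).
Variables (D : set R) (f : R * T -> R).
Hypotheses (mD : measurable D) (mf : measurable_fun setT f) (f0 : forall z, 0 <= f z).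
Local Notation leb := (@lebesgue_measure R).

Let g (z : R * T) : \bar R := (f z * \1_D z.1)%:E.

Let mg : measurable_fun setT g.
Proof.
apply/measurable_EFinP; apply: measurable_funM => //.
by apply: measurableT_comp; [exact: measurable_indic|exact: measurable_fst].
Qed.

Let g0 z : (0 <= g z)%E.
Proof. by rewrite lee_fin mulr_ge0. Qed.

Let gE w : (\int[leb]_(r in D) (f (r, w))%:E = \int[leb]_r g (r, w))%E.
Proof.
rewrite integral_mkcond; apply: eq_integral => r _.
by rewrite patchE /g /= indicE; case: ifP => _; rewrite ?mulr1 ?mulr0.
Qed.

Lemma measurable_time_integral :
  measurable_fun setT (fun w => (\int[leb]_(r in D) (f (r, w))%:E)%E).
Proof.
have := @measurable_fun_fubini_tonelli_G _ _ _ _ R leb g mg g0.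
by apply: eq_measurable_fun => w _; rewrite gE.
Qed.

Lemma tonelli_time : (\int[m]_w \int[leb]_(r in D) (f (r, w))%:E =
  \int[leb]_(r in D) \int[m]_w (f (r, w))%:E)%E.
Proof.
under eq_integral do rewrite gE.
have := @fubini_tonelli _ _ _ _ R leb m g mg g0.
rewrite /fubini_F /fubini_G => <-.
rewrite [RHS]integral_mkcond; apply: eq_integral => r _.
rewrite patchE; case: ifP => rD.
  by apply: eq_integral => w _; rewrite /g /= indicE rD mulr1.
by rewrite integral0_eq// => w _; rewrite /g /= indicE rD mulr0.
Qed.

End TimeIntegral.

Section IntegratedKernel.
Context {R : realType}.
Local Notation leb := (@lebesgue_measure R).
Implicit Types (t : R) (q : R * R).

Definition Fk t q : R := fine (\int[leb]_(r in `[0%R, t]) (ker r q)%:E)%E.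

Lemma measurable_ker_t q : measurable_fun [set: R] (fun r : R => ker r q).
Proof. exact: (measurableT_comp (@measurable_ker R) (pair2_measurable q)). Qed.

Lemma lebesgue_0t t : 0 <= t -> leb `[0, t]%classic = t%:E.
Proof.
move=> t0; rewrite lebesgue_measure_itv /= lte_fin.
by case: ltgtP t0 => // [_|<-] _; rewrite -?EFinB ?subr0.
Qed.

Lemma FkE t q : 0 <= t ->
  (\int[leb]_(r in `[0%R, t]) (ker r q)%:E = (Fk t q)%:E)%E /\ 0 <= Fk t q <= t.
Proof.
move=> t0.
have h : (\int[leb]_(r in `[0%R, t]) (ker r q)%:E <= t%:E)%E.
  apply: (@le_trans _ _ (\int[leb]_(r in `[0%R, t]) (cst 1%:E) r)%E).
    apply: ge0_le_integral => //.
    - by move=> r _; rewrite lee_fin ker_ge0.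
    - by apply/measurable_EFinP; apply: measurable_funTS; exact: measurable_ker_t.
    - by move=> r _; rewrite lee_fin ker_le1.
  by rewrite integral_cst//= mul1e lebesgue_0t.
have h0 : (0 <= \int[leb]_(r in `[0%R, t]) (ker r q)%:E)%E.
  by apply: integral_ge0 => r _; rewrite lee_fin ker_ge0.
have hf : (\int[leb]_(r in `[0%R, t]) (ker r q)%:E)%E \is a fin_num.
  by rewrite ge0_fin_numE// (le_lt_trans h)// ltry.
by rewrite /Fk fineK// fine_ge0//=; split=> //; rewrite -lee_fin fineK.
Qed.

Lemma Fk_ge0 t q : 0 <= t -> 0 <= Fk t q.
Proof. by move=> /(FkE q)[_ /andP[]]. Qed.

Lemma Fk_le_t t q : 0 <= t -> Fk t q <= t.
Proof. by move=> /(FkE q)[_ /andP[]]. Qed.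

Lemma measurable_Fk t : measurable_fun [set: R * R] (Fk t).
Proof.
have h := @measurable_time_integral R _ (R * R)%type `[0, t]%classic (fun z => ker z.1 z.2)
  (measurable_itv _) (@measurable_ker R) (fun z => ker_ge0 z.1 z.2).
exact: (measurableT_comp (fine_measurable measurableT) h).
Qed.

Lemma integral_Fk_le t (xi : R) : 0 <= t -> (\int[leb]_v (Fk t (xi, v))%:E <= t%:E)%E.
Proof.
move=> t0.
under eq_integral do rewrite -(FkE _ t0).1.
have mk : measurable_fun setT (fun z : R * R => ker z.1 (xi, z.2)).
  have h : measurable_fun setT (fun z : R * R => (z.1, (xi, z.2))).
    by apply: measurable_fun_pair => //; exact: measurable_fun_pair.
  exact: (measurableT_comp (@measurable_ker R) h).
rewrite (@tonelli_time R _ _ leb `[0, t]%classic (fun z => ker z.1 (xi, z.2)))//; last first.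
  by move=> z; exact: ker_ge0.
apply: (@le_trans _ _ (\int[leb]_(r in `[0%R, t]) (cst 1%:E) r)%E).
  apply: ge0_le_integral => //.
  - by move=> r _; apply: integral_ge0 => v _; rewrite lee_fin ker_ge0.
  - apply: measurable_funTS.
    have := @measurable_fun_fubini_tonelli_F _ _ _ _ R leb (fun z : R * R => (ker z.1 (xi, z.2))%:E).
    apply; first exact/measurable_EFinP.
    by move=> z; rewrite lee_fin ker_ge0.
  - by move=> r _; exact: integral_ker_le1.
by rewrite integral_cst//= mul1e lebesgue_0t.
Qed.

Lemma Fk_le_inv t (xi v : R) : 0 <= t -> 0 < xi -> Fk t (xi, v) <= xi^-1.
Proof.
move=> t0 xi0; rewrite -lee_fin -(FkE _ t0).1.
(* [c] is the time at which the kernel starts; from then on it is exp (v - xi r), whose whole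
   integral is 1 / xi. [T] is any endpoint beyond t and c. *)
pose c := v / xi; pose T := Num.max (t + 1) (c + 1).
have cT : c < T by rewrite lt_max [X in _ || X]ltrDl ltr01 orbT.
have e : (\int[leb]_(r in `[c, T]) (expR (- xi * r + v))%:E <= xi^-1%:E)%E.
  rewrite integral_expR_affine ?oppr_eq0 ?gt_eqF//.
  have -> : - xi * c + v = 0 by rewrite /c mulNr mulrCA mulfV ?gt_eqF// mulr1 addNr.
  rewrite expR0 invrN mulrN -mulNr opprB lee_fin -[leRHS]mul1r ler_wpM2r ?invr_ge0 ?(ltW xi0)//.
apply: le_trans e; rewrite integral_mkcond [leRHS]integral_mkcond.
apply: ge0_le_integral => //.
- by move=> r _; rewrite patchE; case: ifP => // _; rewrite lee_fin ker_ge0.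
- apply/(measurable_restrictT _ _).1 => //; apply/measurable_EFinP.
  by apply: measurable_funTS; exact: measurable_ker_t.
- apply/(measurable_restrictT _ _).1 => //; apply/measurable_EFinP.
  by apply: measurable_funTS; apply: continuous_measurable_fun; exact: continuous_expR_affine.
move=> r _; rewrite !patchE; case: ifPn; last first.
  by move=> _; case: ifP => // _; rewrite lee_fin expR_ge0.
rewrite inE /= in_itv/= => /andP[r0 rt]; rewrite kerE /=; case: ifPn => vr; last first.
  by case: ifP => // _; rewrite lee_fin expR_ge0.
rewrite mem_set; first by rewrite mulNr.
by rewrite /= in_itv/= le_max ler_pdivrMr// [r * _]mulrC vr (le_trans rt) ?lerDl.
Qed.

Lemma Fk_ge_small t (xi v : R) : 0 < t -> 0 <= xi <= t^-1 -> -1 <= v <= 0 ->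
  t * expR (- 2) <= Fk t (xi, v).
Proof.
move=> t0 /andP[xi0 xit] /andP[v1 v0]; rewrite -lee_fin -(FkE _ (ltW t0)).1.
have -> : ((t * expR (- 2))%:E = \int[leb]_(r in `[0%R, t]) (cst (expR (- 2))%:E) r)%E.
  by rewrite integral_cst//= lebesgue_0t ?ltW// -EFinM mulrC.
apply: ge0_le_integral => //.
- by move=> r _; rewrite lee_fin expR_ge0.
- by apply/measurable_EFinP; apply: measurable_funTS; exact: measurable_ker_t.
move=> r /=; rewrite in_itv/= => /andP[r0 rt]; rewrite lee_fin kerE /=.
have h : 0 <= xi * r by rewrite mulr_ge0.
have h1 : xi * r <= 1.
  rewrite (le_trans (ler_pM _ _ xit rt))// mulVf ?gt_eqF//.
by rewrite (le_trans v0 h) ler_expR; lra.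
Qed.

(** From time v / xi on, for a duration 1 / xi, the kernel is at least exp (- 1); the last
    hypothesis keeps this window within [0, t]. *)
Lemma Fk_ge_large t (xi v : R) : 0 <= t -> 0 < xi -> 0 <= v -> v + 1 <= xi * t ->
  expR (- 1) / xi <= Fk t (xi, v).
Proof.
move=> t0 xi0 v0 vt; rewrite -lee_fin -(FkE _ t0).1.
have -> : ((expR (- 1) / xi)%:E = \int[leb]_(r in `[(v / xi)%R, ((v + 1) / xi)%R]) (cst (expR (- 1))%:E) r)%E.
  rewrite integral_cst//= lebesgue_measure_itv /= lte_fin ltr_pM2r ?invr_gt0// ltrDl ltr01.
  by rewrite -EFinB -EFinM; congr EFin; rewrite mulrDl mul1r addrAC subrr add0r.
apply: (@le_trans _ _ (\int[leb]_(r in `[(v / xi)%R, ((v + 1) / xi)%R]) (ker r (xi, v))%:E)%E).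
  apply: ge0_le_integral => //.
  - by move=> r _; rewrite lee_fin expR_ge0.
  - by apply/measurable_EFinP; apply: measurable_funTS; exact: measurable_ker_t.
  move=> r /=; rewrite in_itv/= ler_pdivrMr// ler_pdivlMr// [r * _]mulrC => /andP[r1 r2].
  by rewrite lee_fin kerE /= r1 ler_expR; lra.
apply: ge0_subset_integral => //.
- by apply/measurable_EFinP; apply: measurable_funTS; exact: measurable_ker_t.
- by move=> r _; rewrite lee_fin ker_ge0.
- move=> r /=; rewrite !in_itv/= => /andP[r1 r2].
  rewrite (le_trans _ r1) ?divr_ge0 ?(ltW xi0)//= (le_trans r2)// ler_pdivrMr//.
  by rewrite mulrC.
Qed.

End IntegratedKernel.

(** * Riemann sums and symmetrization *)

Section RiemannSums.
Context {R : realType}.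
Local Notation leb := (@lebesgue_measure R).

Definition blk (h : R) (j : nat) : set R := `]j%:R * h, j.+1%:R * h]%classic.

Lemma riemann_pointwise (f : R -> R) (h : R) (k : nat) : 0 <= h ->
  measurable_fun [set: R] f ->
  (\int[leb]_(r in `]0%R, (k%:R * h)%R]) `|f r|%:E < +oo)%E ->
  (`| \int[leb]_(r in `]0%R, (k%:R * h)%R]) (f r)%:E - (h * \sum_(j < k) f (j%:R * h)%R)%:E | <=
   \sum_(j < k) \int[leb]_(r in blk h j) `|f r - f (j%:R * h)%R|%:E)%E.
Proof.
move=> h0 mf; elim: k => [|k ih] fin.
  by rewrite !big_ord0 mul0r mulr0 sube0 set_itvoc0 integral_set0 abse0.
have kS : k%:R * h <= k.+1%:R * h by rewrite ler_wpM2r// ler_nat.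
have U : `]0, k.+1%:R * h]%classic = `]0, k%:R * h]%classic `|` blk h k.
  rewrite /blk -itv_bndbnd_setU// bnd_simp//.
  by rewrite mulr_ge0.
have dis : [disjoint `]0, k%:R * h]%classic & blk h k].
  apply/disj_setPS => x /= []; rewrite /blk /= !in_itv/= => /andP[_ h1] /andP[h2 _].
  by move: (le_lt_trans h1 h2); rewrite ltxx.
have mU : measurable_fun [set: R] (fun r => (f r)%:E) by exact/measurable_EFinP.
have mfn : measurable_fun [set: R] (fun r => `|f r|%:E).
  by apply/measurable_EFinP; exact: measurableT_comp.
have mblk : measurable (blk h k) by exact: measurable_itv.
have sub (A : set R) : measurable A -> A `<=` `]0, k.+1%:R * h]%classic ->
    (\int[leb]_(r in A) `|f r|%:E < +oo)%E.
  move=> mA sA; apply: le_lt_trans fin; apply: ge0_subset_integral => //.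
  by apply: measurable_funTS.
have fi (A : set R) : measurable A -> A `<=` `]0, k.+1%:R * h]%classic ->
    leb.-integrable A (EFin \o f).
  move=> mA sA; apply/integrableP; split; first exact/measurable_EFinP/measurable_funTS.
  exact: sub.
have s1 : `]0, k%:R * h]%classic `<=` `]0, k.+1%:R * h]%classic by rewrite U; exact: subsetUl.
have s2 : blk h k `<=` `]0, k.+1%:R * h]%classic by rewrite U; exact: subsetUr.
have lblk : leb (blk h k) = h%:E.
  rewrite /blk lebesgue_measure_itv /= lte_fin.
  have -> : k.+1%:R * h = k%:R * h + h by rewrite -natr1 mulrDl mul1r.
  rewrite ltrDl; case: ifPn => h1; last first.
    by rewrite -leNgt in h1; congr EFin; apply/eqP; rewrite eq_le h0 h1.
  by rewrite -EFinB addrAC subrr add0r.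
have cfi : leb.-integrable (blk h k) (EFin \o cst (f (k%:R * h))).
  apply/integrableP; split; first by apply/measurable_EFinP.
  by rewrite /= integral_cst//= lblk ltry.
rewrite U integral_setU//; last exact: measurable_funTS.
rewrite !big_ord_recr /=.
have f1 := fi _ (measurable_itv _) s1; have f2 := fi _ mblk s2.
have i1 : (\int[leb]_(r in `]0%R, (k%:R * h)%R]) (f r)%:E)%E \is a fin_num.
  by apply: integrable_fin_num => //; exact: f1.
have i2 : (\int[leb]_(r in blk h k) (f r)%:E)%E \is a fin_num.
  by apply: integrable_fin_num => //; exact: f2.
have e2 : (\int[leb]_(r in blk h k) (f r - f (k%:R * h)%R)%:E =
   \int[leb]_(r in blk h k) (f r)%:E - (h * f (k%:R * h)%R)%:E)%E.
  under eq_integral do rewrite EFinB.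
  rewrite integralB_EFin//.
  rewrite integral_cst//= lblk.
  by rewrite -EFinM mulrC.
have le2 : (`|\int[leb]_(r in blk h k) (f r - f (k%:R * h)%R)%:E| <=
    \int[leb]_(r in blk h k) `|f r - f (k%:R * h)%R|%:E)%E.
  apply: le_abse_integral => //; apply/measurable_EFinP; apply: measurable_funB => //.
  exact: measurable_funTS.
have {}ih := ih (sub _ (measurable_itv _) s1).
apply: (@le_trans _ _ (`|\int[leb]_(r in `]0%R, (k%:R * h)%R]) (f r)%:E - (h * \sum_(j < k) f (j%:R * h)%R)%:E| +
   `|\int[leb]_(r in blk h k) (f r - f (k%:R * h)%R)%:E|)%E); last by rewrite leeD.
rewrite e2; apply: le_trans (lee_abs_add _ _).
rewrite -(fineK i1) -(fineK i2) -!EFinD !abse_EFin lee_fin.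
by rewrite le_eqVlt; apply/orP; left; apply/eqP; congr `|_|; ring.
Qed.

(** The positive and negative parts are measurable by Tonelli; [fine] is applied to their difference
    and reads 0 on the paths where it is infinite. *)
Lemma measurable_fine_time_integral d (T : measurableType d) (f : R * T -> R) (D : set R) :
  measurable D -> measurable_fun setT f ->
  measurable_fun setT (fun w => fine (\int[leb]_(r in D) (f (r, w))%:E)%E).
Proof.
move=> mD mf.
have mp : measurable_fun setT (fun z => Num.max (f z) 0) by exact: measurable_maxr.
have mn : measurable_fun setT (fun z => Num.max (- f z) 0).
  by apply: measurable_maxr => //; exact: (measurableT_comp (@oppr_measurable R _)).
have p0 z : 0 <= Num.max (f z) 0 by rewrite le_max lexx orbT.
have n0 z : 0 <= Num.max (- f z) 0 by rewrite le_max lexx orbT.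
have hp := measurable_time_integral mD mp p0.
have hn := measurable_time_integral mD mn n0.
apply: (measurableT_comp (fine_measurable measurableT)).
apply: eq_measurable_fun (emeasurable_funB hp hn) => w _.
rewrite [RHS]integralE; congr (_ - _)%E; apply: eq_integral => r _.
  by rewrite funeposE EFin_max.
by rewrite funenegE EFin_max EFinN.
Qed.

Section L1.
Context d (T : measurableType d) (m : {sigma_finite_measure set T -> \bar R}).
Variables (f : R * T -> R) (C om h : R) (N : nat).
Hypotheses (mf : measurable_fun setT f) (h0 : 0 <= h) (C0 : 0 <= C) (om0 : 0 <= om).
Let t := N%:R * h.
Hypothesis fC : forall r, 0 <= r <= t -> (\int[m]_w `|f (r, w)|%:E <= C%:E)%E.
Hypothesis fom : forall r r', 0 <= r -> r <= r' <= t -> r' - r <= h ->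
  (\int[m]_w `|f (r', w) - f (r, w)|%:E <= om%:E)%E.

(** Stated for a sigma-finite m so as to serve both the process (m = P) and the kernel (m = pi x
    Lebesgue). The pointwise bound is integrated block by block with the order of integration
    exchanged, and each block contributes at most h om. *)
Lemma riemann_L1 :
  (\int[m]_w `|fine (\int[leb]_(r in `[0%R, t]) (f (r, w))%:E) -
     h * \sum_(j < N) f (j%:R * h, w)|%:E <= (t * om)%:E)%E.
Proof.
have t0 : 0 <= t by rewrite mulr_ge0.
have mfr r : measurable_fun setT (fun w => f (r, w)).
  exact: (measurableT_comp mf (pair1_measurable r)).
have mfw w : measurable_fun setT (fun r => f (r, w)).
  exact: (measurableT_comp mf (pair2_measurable w)).
have maf : measurable_fun setT (fun z => `|f z|) by exact: measurableT_comp.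
have e0t w : (\int[leb]_(r in `[0%R, t]) (f (r, w))%:E = \int[leb]_(r in `]0%R, t]) (f (r, w))%:E)%E.
  by rewrite integral_itv_obnd_cbnd//; apply/measurable_EFinP; exact: measurable_funTS.
pose A w := (\int[leb]_(r in `]0%R, t]) `|f (r, w)|%:E)%E.
have mA : measurable_fun setT A.
  exact: (@measurable_time_integral R _ T `]0, t]%classic (fun z => `|f z|) (measurable_itv _) maf).
have A0 w : (0 <= A w)%E by apply: integral_ge0 => r _; rewrite lee_fin.
have iA : (\int[m]_w A w < +oo)%E.
  rewrite /A (@tonelli_time R _ _ m `]0, t]%classic (fun z => `|f z|))//.
  apply: (@le_lt_trans _ _ (\int[leb]_(r in `]0%R, t]) (cst C%:E) r)%E).
    apply: ge0_le_integral => //.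
    - by move=> r _; apply: integral_ge0 => w _; rewrite lee_fin.
    - apply: measurable_funTS.
      apply: (@measurable_fun_fubini_tonelli_F _ _ _ _ R m (fun z => `|f z|%:E)).
        exact/measurable_EFinP.
      by move=> z; rewrite lee_fin.
    - by move=> r /=; rewrite in_itv /= => /andP[/ltW r0 rt]; apply: fC; rewrite r0.
  rewrite integral_cst//= lebesgue_measure_itv /=.
  by case: ifP => _; rewrite -?EFinB -?EFinM ?mule0 ltry.
(* The pointwise bound asks for an integrable path; almost all are, as the integral of [A] is
   finite. *)
have aeA : {ae m, forall w, (A w < +oo)%E}.
  have : m.-integrable setT A.
    apply/integrableP; split => //.
    by under eq_integral do rewrite gee0_abs//.
  move=> /integrable_ae => /(_ measurableT); apply: filterS => w /(_ I).
  by rewrite ge0_fin_numE.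
pose B w := (\sum_(j < N) \int[leb]_(r in blk h j) `|f (r, w) - f (j%:R * h, w)|%:E)%E.
have mdf j : measurable_fun setT (fun z : R * T => `|f z - f (j%:R * h, z.2)|).
  apply: measurableT_comp => //; apply: measurable_funB => //.
  exact: (measurableT_comp (mfr (j%:R * h)) measurable_snd).
have mBj j : measurable_fun setT (fun w => \int[leb]_(r in blk h j) `|f (r, w) - f (j%:R * h, w)|%:E)%E.
  exact: (@measurable_time_integral R _ T (blk h j) (fun z => `|f z - f (j%:R * h, z.2)|)
    (measurable_itv _) (mdf j)).
have Bj0 j w : (0 <= \int[leb]_(r in blk h j) `|f (r, w) - f (j%:R * h, w)|%:E)%E.
  by apply: integral_ge0 => r _; rewrite lee_fin.
apply: (@le_trans _ _ (\int[m]_w B w)%E).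
  apply: ae_ge0_le_integral => //.
  - apply/measurable_EFinP; apply: measurableT_comp => //; apply: measurable_funB.
      exact: measurable_fine_time_integral.
    apply: measurable_funM => //; apply: measurable_sum => j; exact: mfr.
  - by move=> w _; apply: sume_ge0 => j _.
  - by apply: emeasurable_sum => j; exact: mBj.
  - apply: filterS aeA => w Aw _.
    have := @riemann_pointwise (fun r => f (r, w)) h N h0 (mfw w) Aw.
    rewrite -e0t /B -/t.
    have i1 : (\int[leb]_(r in `[0%R, t]) (f (r, w))%:E)%E \is a fin_num.
      rewrite e0t; apply: integrable_fin_num => //.
      apply/integrableP; split; last exact: Aw.
      by apply/measurable_EFinP; apply: measurable_funTS; exact: mfw.
    by rewrite -{1}(fineK i1) -EFinB abse_EFin.
rewrite ge0_integral_sum//.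
have -> : (t * om)%:E = (\sum_(j < N) (h * om)%:E)%E.
  by rewrite sumEFin sumr_const card_ord -[in RHS]mulr_natl mulrA.
apply: lee_sum => j _.
rewrite (@tonelli_time R _ _ m (blk h j) (fun z => `|f z - f (j%:R * h, z.2)|))//; last exact: measurable_itv.
have jN : j.+1%:R * h <= t by rewrite /t ler_wpM2r// ler_nat.
have jS : j.+1%:R * h = j%:R * h + h by rewrite -natr1 mulrDl mul1r.
apply: (@le_trans _ _ (\int[leb]_(r in blk h j) (cst om%:E) r)%E).
  apply: ge0_le_integral => //.
  - exact: measurable_itv.
  - by move=> r _; apply: integral_ge0 => w _; rewrite lee_fin.
  - apply: measurable_funTS.
    apply: (@measurable_fun_fubini_tonelli_F _ _ _ _ R m (fun z => `|f z - f (j%:R * h, z.2)|%:E)).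
      exact/measurable_EFinP.
    by move=> z; rewrite lee_fin.
  - move=> r; rewrite /blk /= in_itv /= => /andP[r0 rt]; apply: fom.
    + by rewrite mulr_ge0.
    + by rewrite (ltW r0) (le_trans rt).
    + by rewrite lerBlDl -jS.
rewrite integral_cst /=; last exact: measurable_itv.
rewrite /blk lebesgue_measure_itv /= lte_fin.
case: ifP => _; last by rewrite mule0 lee_fin mulr_ge0.
by rewrite -EFinB -EFinM lee_fin jS addrAC subrr add0r mulrC.
Qed.

End L1.
End RiemannSums.

Lemma powR_normB_le {R : realType} (x y q : R) : 0 <= q ->
  `|x - y| `^ q <= 2 `^ q * (`|x| `^ q + `|y| `^ q).
Proof.
move=> q0; wlog xy : x y / `|x| <= `|y|.
  move=> h; have [/h//|/ltW/h] := leP `|x| `|y|.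
  by rewrite distrC [X in _ * X]addrC.
rewrite (@le_trans _ _ (2 `^ q * `|y| `^ q))//; last first.
  by rewrite ler_wpM2l ?powR_ge0// lerDr powR_ge0.
rewrite -powRM//; apply: ge0_ler_powR; rewrite ?nnegrE ?mulr_ge0//.
by rewrite (le_trans (ler_normB _ _))// mulr2n mulrDl mul1r lerD2r.
Qed.

(** Up to a factor q, this says that y^q lies above its tangent at a. It is Young's inequality for q
    > 1; the conjugate exponent degenerates at q = 1. *)
Lemma young_powR {R : realType} (y a q : R) : 0 <= y -> 0 <= a -> 1 <= q ->
  y * a `^ (q - 1) <= y `^ q / q + (1 - q^-1) * a `^ q.
Proof.
move=> y0 a0; rewrite le_eqVlt => /predU1P[<-|q1].
  by rewrite subrr powRr0 invr1 !mulr1 powRr1// subrr mul0r addr0.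
have q0 : 0 < q by rewrite (lt_trans _ q1).
have qN : q - 1 != 0 by rewrite subr_eq0 gt_eqF.
have p0 : 0 < q / (q - 1) by rewrite divr_gt0// subr_gt0.
have := @conjugate_powR R y (a `^ (q - 1)) q (q / (q - 1)) y0 (powR_ge0 _ _) q0 p0.
have -> : q^-1 + (q / (q - 1))^-1 = 1.
  by field; rewrite qN gt_eqF.
move=> /(_ erefl); rewrite -powRrM.
have -> : (q - 1) * (q / (q - 1)) = q by rewrite mulrCA mulfV ?mulr1.
have -> : a `^ q / (q / (q - 1)) = (1 - q^-1) * a `^ q.
  by field; rewrite qN gt_eqF.
by [].
Qed.

Section Jensen.
Context {R : realType} d (T : measurableType d) (m : {measure set T -> \bar R}).

(** The tangent inequality is integrated at a = |mean of f|. The mass M is kept general: it is 1 for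
    a probability and t for Lebesgue measure on [0, t]. An infinite integral of f is read as 0 by
    [fine] and makes the left side vanish. *)
Lemma jensen_powR (D : set T) (f : T -> R) (M q : R) : measurable D ->
  measurable_fun D f -> m D = M%:E -> 0 < M -> 1 <= q ->
  ((M * (`|fine (\int[m]_(x in D) (f x)%:E)| / M) `^ q)%:E <=
   \int[m]_(x in D) (`|f x| `^ q)%:E)%E.
Proof.
move=> mD mf mDM M0 q1.
set c := `|fine _|; pose a := c / M.
have a0 : 0 <= a by apply: divr_ge0; [exact: normr_ge0|exact: ltW].
have q0 : 0 < q by rewrite (lt_le_trans _ q1).
have maf : measurable_fun D (fun x => `|f x|) by exact: measurableT_comp.
have mafq : measurable_fun D (fun x => `|f x| `^ q).
  exact: (measurableT_comp (@measurable_powR R q) maf).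
set J := (\int[m]_(x in D) (`|f x| `^ q)%:E)%E.
have J0 : (0 <= J)%E by apply: integral_ge0 => x _; rewrite lee_fin powR_ge0.
have [Joo|Jfin] := eqVneq J +oo%E; first by rewrite Joo leey.
have {}Jfin : J \is a fin_num by rewrite ge0_fin_numE// lt_neqAle Jfin leey.
have cI : (c%:E <= \int[m]_(x in D) `|f x|%:E)%E.
  apply: le_trans (_ : _ <= `|\int[m]_(x in D) (f x)%:E|)%E _.
    by rewrite /c; case: (\int[m]_(x in D) _)%E => [r| |] //=; rewrite normr0 leey.
  apply: le_abse_integral => //; exact/measurable_EFinP.
have h1 : ((a `^ (q - 1) * c)%:E <= (q^-1)%:E * J + ((1 - q^-1) * a `^ q * M)%:E)%E.
  apply: (@le_trans _ _ ((a `^ (q - 1))%:E * \int[m]_(x in D) `|f x|%:E)%E).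
    by rewrite EFinM lee_wpmul2l// lee_fin powR_ge0.
  rewrite -ge0_integralZl_EFin ?powR_ge0//; last by apply/measurable_EFinP.
  rewrite /J -ge0_integralZl_EFin ?invr_ge0 ?(ltW q0)//; last exact/measurable_EFinP.
  have q01 : 0 <= 1 - q^-1 by rewrite subr_ge0 invf_le1.
  have -> : (((1 - q^-1) * a `^ q * M)%:E = \int[m]_(x in D) (cst ((1 - q^-1) * a `^ q)%:E) x)%E.
    by rewrite integral_cst// mDM -EFinM.
  rewrite -ge0_integralD//; last 3 first.
  - by move=> x _; rewrite mule_ge0// lee_fin ?invr_ge0 ?powR_ge0// ltW.
  - by apply: measurable_funeM; exact/measurable_EFinP.
  - by move=> x _; rewrite lee_fin mulr_ge0// powR_ge0.
  apply: ge0_le_integral => //.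
  - by move=> x _; rewrite lee_fin mulr_ge0// powR_ge0.
  - by apply: measurable_funeM; exact/measurable_EFinP.
  - by apply: emeasurable_funD => //; apply: measurable_funeM; exact/measurable_EFinP.
  - move=> x _; rewrite -EFinM -EFinM -EFinD lee_fin mulrC [q^-1 * _]mulrC.
    exact: young_powR.
have h2 : a `^ (q - 1) * c = M * a `^ q.
  by rewrite -(@mulr_powRB1 _ a q)// mulrA /a [M * _]mulrC divfK ?gt_eqF// mulrC.
move: h1; rewrite h2 -(fineK Jfin) -EFinM -EFinD !lee_fin.
rewrite -/(c / M) -/a.
have q1' : 0 < q^-1 by rewrite invr_gt0.
have -> : (1 - q^-1) * a `^ q * M = M * a `^ q - q^-1 * (M * a `^ q) by ring.
by rewrite addrCA -[X in X <= _]addr0 lerD2l subr_ge0 ler_pM2l.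
Qed.

End Jensen.

Section Symmetrization.
Context {R : realType} d (T : measurableType d) (P : probability T R) (Z : T -> R).
Hypothesis mZ : measurable_fun setT Z.
Local Notation Q := (P \x P)%E.

Definition sym (w : T * T) : R := Z w.1 - Z w.2.

Lemma measurable_sym : measurable_fun setT sym.
Proof.
apply: measurable_funB.
  exact: (measurableT_comp mZ measurable_fst).
exact: (measurableT_comp mZ measurable_snd).
Qed.

Lemma bounded_integrable d' (T' : measurableType d') (P' : probability T' R) (f : T' -> R) (M : R) :
  measurable_fun setT f -> (forall x, `|f x| <= M) -> P'.-integrable setT (EFin \o f).
Proof.
move=> mf fM; apply: (@le_integrable _ _ _ _ _ _ _ (EFin \o cst M)) => //.
- exact/measurable_EFinP.
- by move=> x _ /=; rewrite lee_fin (le_trans (fM x))// ler_norm.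
- exact: finite_measure_integrable_cst.
Qed.

(** The characteristic function of Z - Z' is the squared modulus of that of Z, so the phase
    disappears. *)
Lemma sym_chf u (a b : R) :
  (\int[P]_w (cos (u * Z w))%:E = a%:E)%E ->
  (\int[P]_w (sin (u * Z w))%:E = b%:E)%E ->
  (\int[Q]_w (cos (u * sym w))%:E = (a ^+ 2 + b ^+ 2)%:E)%E.
Proof.
move=> ha hb.
have mc : measurable_fun setT (fun w => cos (u * Z w)).
  apply: measurableT_comp; last exact: measurable_funM.
  by apply: continuous_measurable_fun; exact: continuous_cos.
have ms : measurable_fun setT (fun w => sin (u * Z w)).
  apply: measurableT_comp; last exact: measurable_funM.
  by apply: continuous_measurable_fun; exact: continuous_sin.
have ic : P.-integrable setT (EFin \o (fun w => cos (u * Z w))).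
  by apply: (@bounded_integrable _ _ _ _ 1) => // w; exact: cos_max.
have is' : P.-integrable setT (EFin \o (fun w => sin (u * Z w))).
  by apply: (@bounded_integrable _ _ _ _ 1) => // w; exact: sin_max.
have iQ : (P \x P)%E.-integrable setT (fun w => (cos (u * sym w))%:E).
  apply: (@bounded_integrable _ _ _ _ 1) => [|w]; last exact: cos_max.
  apply: measurableT_comp; last by apply: measurable_funM => //; exact: measurable_sym.
  by apply: continuous_measurable_fun; exact: continuous_cos.
rewrite -(integral12_prod_meas1 iQ) /fubini_F.
have e w : (\int[P]_y (cos (u * sym (w, y)))%:E =
    (cos (u * Z w))%:E * a%:E + (sin (u * Z w))%:E * b%:E)%E.
  under eq_integral do rewrite /sym /= mulrBr cosB EFinD !EFinM.
  rewrite integralD//; last 2 first.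
  - exact: integrableZl.
  - exact: integrableZl.
  by rewrite !integralZl// ha hb.
under eq_integral do rewrite e.
rewrite integralD//; last 2 first.
- exact: integrableZr.
- exact: integrableZr.
by rewrite !integralZr// ha hb -!EFinM -EFinD.
Qed.

(** Jensen's inequality for fixed w: as Z' has mean 0, Z w is the mean of Z w - Z' over the second
    copy. *)
Lemma le_sym_moment q : 1 <= q -> P.-integrable setT (EFin \o Z) ->
  (\int[P]_w (Z w)%:E = 0)%E ->
  (\int[P]_w (`|Z w| `^ q)%:E <= \int[Q]_w (`|sym w| `^ q)%:E)%E.
Proof.
move=> q1 iZ Z0.
have mq : measurable_fun setT (fun w => (`|sym w| `^ q)%:E).
  apply/measurable_EFinP; apply: (measurableT_comp (@measurable_powR R q)).
  by apply: measurableT_comp => //; exact: measurable_sym.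
rewrite (@fubini_tonelli1 _ _ _ _ R P P (fun w => (`|sym w| `^ q)%:E))//.
apply: ge0_le_integral => //.
- apply/measurable_EFinP; apply: (measurableT_comp (@measurable_powR R q)).
  exact: measurableT_comp.
- exact: (@measurable_fun_fubini_tonelli_F _ _ _ _ R P (fun w => (`|sym w| `^ q)%:E)).
- move=> w _; rewrite /fubini_F.
  have ms : measurable_fun setT (fun y => sym (w, y)) by exact: (measurableT_comp measurable_sym (pair1_measurable w)).
  have := @jensen_powR R _ T P setT _ 1 q measurableT ms (probability_setT P) ltr01 q1.
  rewrite mul1r divr1 /sym /=.
  have -> : (\int[P]_x (Z w - Z x)%:E)%E = (Z w)%:E.
    under eq_integral do rewrite EFinB.
    rewrite integralB_EFin//; last exact: finite_measure_integrable_cst.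
    by rewrite Z0 integral_cst//= probability_setT mule1 sube0.
  by [].
Qed.

Lemma sym_moment_le q : 0 <= q ->
  (\int[Q]_w (`|sym w| `^ q)%:E <= (2 `^ q * 2)%:E * \int[P]_w (`|Z w| `^ q)%:E)%E.
Proof.
move=> q0.
have mZq : measurable_fun setT (fun w => `|Z w| `^ q).
  by apply: (measurableT_comp (@measurable_powR R q)); exact: measurableT_comp.
pose g1 (w : T * T) := (`|Z w.1| `^ q)%:E; pose g2 (w : T * T) := (`|Z w.2| `^ q)%:E.
have mg1 : measurable_fun setT g1.
  by apply/measurable_EFinP; exact: (measurableT_comp mZq measurable_fst).
have mg2 : measurable_fun setT g2.
  by apply/measurable_EFinP; exact: (measurableT_comp mZq measurable_snd).
have g10 w : (0 <= g1 w)%E by rewrite lee_fin powR_ge0.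
have g20 w : (0 <= g2 w)%E by rewrite lee_fin powR_ge0.
apply: (@le_trans _ _ (\int[Q]_w ((2 `^ q)%:E * (g1 w + g2 w)))%E).
  apply: ge0_le_integral => //.
  - apply/measurable_EFinP; apply: (measurableT_comp (@measurable_powR R q)).
    by apply: measurableT_comp => //; exact: measurable_sym.
  - by apply: measurable_funeM; exact: emeasurable_funD.
  - move=> w _; rewrite -EFinD -EFinM lee_fin /sym.
    exact: powR_normB_le.
rewrite ge0_integralZl_EFin ?powR_ge0//; last 2 first.
- by move=> w _; exact: adde_ge0.
- exact: emeasurable_funD.
rewrite ge0_integralD// fubini_tonelli1// [X in (_ * (_ + X))%E]fubini_tonelli1//.
rewrite /fubini_F /g1 /g2 /=.
under eq_integral do rewrite integral_cst//= probability_setT mule1.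
rewrite [X in (_ * (_ + X))%E]integral_cst//= probability_setT mule1.
by rewrite EFinM -muleA mule_natl mule2n.
Qed.

End Symmetrization.

(** * The real part of the exponent *)

Section LevyMeasure.
Context {R : realType} (mu : {sigma_finite_measure set R -> \bar R}).
Hypothesis levy : is_levy_measure mu.
Implicit Types (z u : R).

Definition jumpexp z : R := fine (\int[mu]_x (1 - cos (z * x))%:E)%E.

Lemma measurable_1cos d (T : measurableType d) (f : T -> R) :
  measurable_fun setT f -> measurable_fun setT (fun x => 1 - cos (f x)).
Proof.
move=> mf; apply: measurable_funB => //; apply: measurableT_comp => //.
by apply: continuous_measurable_fun; exact: continuous_cos.
Qed.

Lemma sub1cos_ge0 (x : R) : 0 <= 1 - cos x.
Proof. by rewrite subr_ge0 cos_le1. Qed.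

Lemma sub1cos_le_min (x z : R) : 1 - cos (z * x) <= (2 + z ^+ 2) * Num.min 1 (x ^+ 2).
Proof.
have z2 : 0 <= z ^+ 2 := sqr_ge0 z.
rewrite minr_pMr; last by lra.
rewrite le_min; apply/andP; split.
  by have := cos_geN1 (z * x); lra.
have := sub1cos_le_sqr (z * x); have := sqr_ge0 x; rewrite exprMn.
by move: (x ^+ 2) (z ^+ 2) z2 => X Z; nra.
Qed.

Lemma jumpexpE z : (\int[mu]_x (1 - cos (z * x))%:E)%E = (jumpexp z)%:E.
Proof.
rewrite /jumpexp fineK// ge0_fin_numE; last first.
  by apply: integral_ge0 => x _; rewrite lee_fin sub1cos_ge0.
apply: (@le_lt_trans _ _ (\int[mu]_x ((2 + z ^+ 2)%:E * (Num.min 1 (x ^+ 2))%:E))%E).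
  apply: ge0_le_integral => //.
  - by apply/measurable_EFinP; apply: measurable_1cos; exact: measurable_funM.
  - by apply: measurable_funeM; apply/measurable_EFinP; apply: measurable_minr.
  - by move=> x _; rewrite -EFinM lee_fin sub1cos_le_min.
rewrite ge0_integralZl_EFin ?addr_ge0 ?sqr_ge0//; last 2 first.
- by move=> x _; rewrite lee_fin le_min ler01 sqr_ge0.
- by apply/measurable_EFinP; apply: measurable_minr.
by rewrite lte_mul_pinfty// ?lee_fin ?addr_ge0 ?sqr_ge0//; exact: levy.2.
Qed.

Lemma jumpexp_ge0 z : 0 <= jumpexp z.
Proof. by apply: fine_ge0; apply: integral_ge0 => x _; rewrite lee_fin sub1cos_ge0. Qed.

Lemma kappa_reE b z : kappa_re b mu z = - (b * z ^+ 2 / 2 + jumpexp z).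
Proof.
rewrite /kappa_re opprD [b * _]mulrC mulNr; congr (_ + _).
rewrite (_ : (\int[mu]_x (cos (z * x) - 1)%:E)%E = (- jumpexp z)%:E)//.
rewrite EFinN -jumpexpE -integral_ge0N; last by move=> x _; rewrite lee_fin sub1cos_ge0.
by apply: eq_integral => x _; rewrite -EFinN opprB.
Qed.

End LevyMeasure.

Section ParamSpace.
Context {R : realType} (pi : probability R R).

Let sf : sigma_finite [set: (R * measurableTypeR R)%type] (pi \x (@lebesgue_measure R))%E.
Proof.
exists (fun n => setT `*` `[(- n%:R)%R, n%:R]%classic).
  apply/esym/seteqP; split=> // -[x y] _.
  exists (Num.truncn `|y|).+1 => //; split => //=.
  rewrite in_itv/= -ler_norml ltW//.
  by have /andP[] := truncn_itv (normr_ge0 y).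
move=> n; split; first exact: measurableX.
rewrite product_measure1E//= probability_setT mul1e.
by rewrite lebesgue_measure_itv /=; case: ifP => _; rewrite -?EFinB ltry.
Qed.

(** Packed as a sigma-finite measure, so that Tonelli's theorem applies to its product with mu. *)
Definition paramm : {sigma_finite_measure set (R * measurableTypeR R)%type -> \bar R} :=
  HB.pack (pi \x (@lebesgue_measure R))%E (Measure_isSigmaFinite.Build _ _ _ (pi \x (@lebesgue_measure R))%E sf).
End ParamSpace.

Section JumpExponent.
Context {R : realType} (mu : {sigma_finite_measure set R -> \bar R}) (pi : probability R R).
Variable b : R.
Hypotheses (levy : is_levy_measure mu) (b0 : 0 <= b).
Local Notation PT := (R * measurableTypeR R)%type.
Local Notation PL := (paramm pi).
Local Notation nu := (PL \x mu)%E.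

Definition jump (g : PT -> R) (z : PT * R) : R := g z.1 * z.2.

Variable g : PT -> R.
Hypothesis mg : measurable_fun setT g.

Lemma measurable_jump : measurable_fun setT (jump g).
Proof.
apply: measurable_funM; last exact: measurable_snd.
exact: (measurableT_comp mg measurable_fst).
Qed.

(** The exponent attached to a kernel g. It is kept in the extended reals, since its jump part may
    be infinite as long as the second moment of mu is not known to be finite. *)
Definition chexp (u : R) : \bar R :=
  (\int[PL]_q (b * (u * g q) ^+ 2 / 2)%:E + \int[nu]_z (1 - cos (u * jump g z))%:E)%E.

Lemma integral_jumpexp u :
  (\int[PL]_q (jumpexp mu (u * g q))%:E = \int[nu]_z (1 - cos (u * jump g z))%:E)%E.
Proof.
rewrite (@fubini_tonelli1 _ _ _ _ R PL mu (fun z => (1 - cos (u * jump g z))%:E))//.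
- apply: eq_integral => q _; rewrite -jumpexpE// /fubini_F.
  by apply: eq_integral => x _; rewrite /jump mulrA.
- apply/measurable_EFinP; apply: measurable_1cos; apply: measurable_funM => //.
  exact: measurable_jump.
Qed.

Lemma measurable_jumpexp u : measurable_fun setT (fun q => (jumpexp mu (u * g q))%:E).
Proof.
have := @measurable_fun_fubini_tonelli_F _ _ _ _ R mu (fun z : PT * R => (1 - cos (u * jump g z))%:E).
move=> h; apply: eq_measurable_fun (h _ _) => [q _||].
- rewrite -jumpexpE// /fubini_F.
  by apply: eq_integral => x _; rewrite /jump mulrA.
- apply/measurable_EFinP; apply: measurable_1cos; apply: measurable_funM => //.
  exact: measurable_jump.
- by move=> z; rewrite lee_fin sub1cos_ge0.
Qed.

Lemma integral_kappa_re u :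
  (\int[PL]_q (kappa_re b mu (u * g q))%:E = - chexp u)%E.
Proof.
have bg0 q : 0 <= b * (u * g q) ^+ 2 / 2 by rewrite divr_ge0// mulr_ge0// sqr_ge0.
under eq_integral do rewrite kappa_reE// EFinN EFinD.
rewrite integral_ge0N; last first.
  by move=> q _; rewrite -EFinD lee_fin addr_ge0// jumpexp_ge0.
rewrite ge0_integralD//.
- by rewrite integral_jumpexp.
- by move=> q _; rewrite lee_fin.
- apply/measurable_EFinP; apply: measurable_funM => //; apply: measurable_funM => //.
  by apply: measurable_funX; exact: measurable_funM.
- by move=> q _; rewrite lee_fin jumpexp_ge0.
- exact: measurable_jumpexp.
Qed.

Lemma chexp_ge0 u : (0 <= chexp u)%E.
Proof.
by apply: adde_ge0; apply: integral_ge0 => q _; rewrite lee_fin ?sub1cos_ge0//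
  divr_ge0// mulr_ge0// sqr_ge0.
Qed.

Lemma integral_jump_even j :
  (\int[nu]_z (jump g z ^+ j.*2)%:E =
   \int[PL]_q (g q ^+ j.*2)%:E * \int[mu]_x (x ^+ j.*2)%:E)%E.
Proof.
have ev (y : R) : 0 <= y ^+ j.*2 by rewrite -mul2n exprM exprn_ge0 ?sqr_ge0.
rewrite (@fubini_tonelli1 _ _ _ _ R PL mu (fun z => (jump g z ^+ j.*2)%:E))//; last 2 first.
- by apply/measurable_EFinP; apply: measurable_funX; exact: measurable_jump.
- by move=> z; rewrite lee_fin.
rewrite muleC -ge0_integralZl//; last 3 first.
- by apply/measurable_EFinP; exact: measurable_funX.
- by move=> q _; rewrite lee_fin.
- by apply: integral_ge0 => x _; rewrite lee_fin.
apply: eq_integral => q _; rewrite /fubini_F /jump.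
under eq_integral do rewrite /= exprMn EFinM.
rewrite ge0_integralZl_EFin//; [exact: muleC| |by apply/measurable_EFinP; exact: measurable_funX].
by move=> x _; rewrite lee_fin.
Qed.

Hypothesis g2 : (\int[PL]_q (g q ^+ 2)%:E < +oo)%E.

Lemma integral_gauss u : (\int[PL]_q (b * (u * g q) ^+ 2 / 2)%:E =
  (2 * b * fine (\int[PL]_q (g q ^+ 2)%:E) * u ^+ 2 / 2 / 2)%:E)%E.
Proof.
have g20 : (0 <= \int[PL]_q (g q ^+ 2)%:E)%E.
  by apply: integral_ge0 => q _; rewrite lee_fin sqr_ge0.
have gf : (\int[PL]_q (g q ^+ 2)%:E)%E \is a fin_num by rewrite ge0_fin_numE.
transitivity ((b * u ^+ 2 / 2)%:E * \int[PL]_q (g q ^+ 2)%:E)%E.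
  rewrite -ge0_integralZl_EFin//.
  - by apply: eq_integral => q _; rewrite -EFinM exprMn; congr EFin; ring.
  - by move=> q _; rewrite lee_fin sqr_ge0.
  - by apply/measurable_EFinP; exact: measurable_funX.
  - by rewrite divr_ge0// mulr_ge0// sqr_ge0.
by rewrite -(fineK gf) -EFinM /=; congr EFin; field.
Qed.

Hypothesis m2 : (\int[mu]_x (x ^+ 2)%:E < +oo)%E.

Lemma jump_sqr_integral_lty : (\int[nu]_z (jump g z ^+ 2)%:E < +oo)%E.
Proof.
have := integral_jump_even 1; rewrite (_ : 1.*2 = 2)%N// => ->.
rewrite lte_mul_pinfty//; first by apply: integral_ge0 => q _; rewrite lee_fin sqr_ge0.
rewrite ge0_fin_numE//; by apply: integral_ge0 => q _; rewrite lee_fin sqr_ge0.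
Qed.

Definition chI (u : R) : R := fine (\int[nu]_z (1 - cos (u * jump g z))%:E)%E.

Lemma chIE u : (\int[nu]_z (1 - cos (u * jump g z))%:E = (chI u)%:E)%E.
Proof.
rewrite /chI fineK// ge0_fin_numE; last by apply: integral_ge0 => z _; rewrite lee_fin sub1cos_ge0.
apply: (@le_lt_trans _ _ (\int[nu]_z ((u ^+ 2 / 2)%:E * (jump g z ^+ 2)%:E))%E).
  apply: ge0_le_integral => //.
  - apply/measurable_EFinP; apply: measurable_1cos; apply: measurable_funM => //.
    exact: measurable_jump.
  - apply: measurable_funeM; apply/measurable_EFinP; apply: measurable_funX.
    exact: measurable_jump.
  - move=> z _; rewrite -EFinM lee_fin (le_trans (sub1cos_le_sqr _))// exprMn.
    by rewrite mulrAC.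
rewrite ge0_integralZl_EFin ?divr_ge0 ?sqr_ge0//; last 2 first.
- by move=> z _; rewrite lee_fin sqr_ge0.
- by apply/measurable_EFinP; apply: measurable_funX; exact: measurable_jump.
by rewrite lte_mul_pinfty// ?lee_fin ?divr_ge0 ?sqr_ge0//; exact: jump_sqr_integral_lty.
Qed.

Lemma chexpE u : chexp u =
  (2 * b * fine (\int[PL]_q (g q ^+ 2)%:E) * u ^+ 2 / 2 / 2 + chI u)%:E%E.
Proof. by rewrite /chexp integral_gauss chIE. Qed.

End JumpExponent.

(** * Finite-dimensional laws and moments of the process *)

Lemma cos_quot_cvg {R : realType} (u : nat -> R) (y : R) :
  (forall n, 0 < u n) -> u @ \oo --> 0 ->
  (fun n => (1 - cos (u n * y)) / u n ^+ 2) @ \oo --> y ^+ 2 / 2.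
Proof.
move=> u0 uc.
have c1 : (fun n => y ^+ 2 / 2 - (y ^+ 4 / 24) * (u n * u n)) @ \oo --> y ^+ 2 / 2.
  rewrite -[X in _ --> X]subr0; apply: cvgB; first exact: cvg_cst.
  rewrite -[X in _ --> X](mulr0 (y ^+ 4 / 24)); apply: cvgMr.
  by rewrite -[X in _ --> X](mulr0 0); apply: cvgM.
apply: (squeeze_cvgr _ c1 (cvg_cst _)); apply: nearW => n.
have un := u0 n; have un2 : 0 < u n ^+ 2 by rewrite exprn_gt0.
apply/andP; split.
  rewrite ler_pdivlMr//.
  have := cosrem_ge0 (u n * y) (isT : (0 < 3)%N).
  rewrite /= double0 expr0 fact0 divr1.
  rewrite (_ : 2.*2`!%:R = 24 :> R)// (_ : 1.*2`!%:R = 2 :> R)//.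
  rewrite (_ : 1.*2 = 2)%N// (_ : 2.*2 = 4)%N// !exprMn.
  lra.
rewrite ler_pdivrMr// (le_trans (sub1cos_le_sqr _))// exprMn.
by lra.
Qed.

Section Process.
Context {R : realType} d (T : measurableType d) (P : probability T R).
Variables (Y : R -> T -> R) (a b : R) (mu : {sigma_finite_measure set R -> \bar R})
  (pi : probability R R).
Hypotheses (b0 : 0 <= b) (levy : is_levy_measure mu) (supY : is_supOU P Y a b mu pi).
Hypothesis Y0 : forall t, P.-integrable [set: T] (fun w => (Y t w)%:E) /\
             (\int[P]_w (Y t w)%:E = 0)%E.
Hypothesis Yexp : exists2 theta : R, 0 < theta &
     forall t, (\int[P]_w (expR (theta * `|Y t w|))%:E < +oo)%E.
Local Notation PT := (R * measurableTypeR R)%type.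
Local Notation PL := (paramm pi).
Local Notation nu := (PL \x mu)%E.
Local Notation Q := (P \x P)%E.

Lemma measurable_Y t : measurable_fun setT (Y t).
Proof. exact: (measurableT_comp supY.1 (pair1_measurable t)). Qed.

Lemma measurable_kerPT r : measurable_fun [set: PT] (ker r).
Proof. exact: (@measurable_ker_r R r). Qed.

(** With the coefficients u z_j the definition of the process gives E exp (i u Z); the squared
    modulus doubles the real exponent and removes [Psi_im]. *)
Lemma fdd_chf n (ts zs : 'I_n -> R) (Z : T -> R) (g : PT -> R) u :
  (forall w, Z w = \sum_(j < n) zs j * Y (ts j) w) ->
  (forall q, g q = \sum_(j < n) zs j * ker (ts j) q) ->
  (\int[Q]_w (cos (u * sym Z w))%:E = (expR (- (2 * fine (chexp mu pi b g u))))%:E)%E.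
Proof.
move=> ZE gE.
have mg : measurable_fun setT g.
  apply: eq_measurable_fun (_ : measurable_fun setT (fun q => \sum_(j < n) zs j * ker (ts j) q)).
    by move=> q _; rewrite gE.
  apply: measurable_sum => j; apply: measurable_funM => //; exact: measurable_kerPT.
have mZ : measurable_fun setT Z.
  apply: eq_measurable_fun (_ : measurable_fun setT (fun w => \sum_(j < n) zs j * Y (ts j) w)).
    by move=> w _; rewrite ZE.
  apply: measurable_sum => j; apply: measurable_funM => //; exact: measurable_Y.
have := supY.2 n ts (fun j => u * zs j); cbv zeta.
have gu q : \sum_(j < n) u * zs j * supOU_kernel (ts j) q.1 q.2 = u * g q.
  by rewrite gE mulr_sumr; apply: eq_bigr => j _; rewrite mulrA.
have Zu w : \sum_(j < n) u * zs j * Y (ts j) w = u * Z w.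
  by rewrite ZE mulr_sumr; apply: eq_bigr => j _; rewrite mulrA.
under eq_integral do rewrite Zu.
rewrite (_ : (\int[pi \x lebesgue_measure]_p _)%E = (- chexp mu pi b g u)%E); last first.
  rewrite -(integral_kappa_re pi levy b0 mg u).
  apply: eq_integral.
  move=> q _.
  by rewrite gu.
set Psi_re := fine (- _)%E; set Psi_im := fine _; move=> [].
under [X in _ -> X = _ -> _]eq_integral do rewrite Zu.
move=> hc hs; rewrite (sym_chf mZ hc hs); congr EFin.
rewrite !exprMn -mulrDr cos2Dsin2 mulr1 -expRM_natl.
congr expR.
rewrite /Psi_re fineN; ring.
Qed.

Lemma integral_Y_powR n t : (\int[P]_w (`|Y t w| `^ n%:R)%:E < +oo)%E.
Proof.
have [theta th0 hth] := Yexp.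
case: n => [|n].
  under eq_integral do rewrite powRr0.
  by rewrite integral_cst//= probability_setT mule1 ltry.
pose c := n.+1`!%:R / theta ^+ n.+1.
have c0 : 0 < c by rewrite divr_gt0 ?exprn_gt0// ltr0n fact_gt0.
apply: (@le_lt_trans _ _ (\int[P]_w (c%:E * (expR (theta * `|Y t w|))%:E))%E).
  have mexp : measurable_fun setT (fun w => expR (theta * `|Y t w|)).
    apply: measurableT_comp => //; apply: measurable_funM => //.
    by apply: measurableT_comp => //; exact: measurable_Y.
  apply: ge0_le_integral => //.
  - apply/measurable_EFinP; apply: (measurableT_comp (@measurable_powR R _)).
    by apply: measurableT_comp => //; exact: measurable_Y.
  - by apply: measurable_funeM; exact/measurable_EFinP.
  - move=> w _; rewrite -EFinM lee_fin powR_mulrn// /c mulrAC ler_pdivlMr ?exprn_gt0//.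
    rewrite -exprMn -ler_pdivrMl ?ltr0n ?fact_gt0// [`|_| * _]mulrC.
    have th : 0 <= theta * `|Y t w| by rewrite mulr_ge0// ltW.
    by have := expR_ge1Dxn n th; lra.
rewrite ge0_integralZl_EFin ?(ltW c0)//; last first.
  apply/measurable_EFinP; apply: measurableT_comp => //; apply: measurable_funM => //.
  by apply: measurableT_comp => //; exact: measurable_Y.
by rewrite lte_mul_pinfty// lee_fin ltW.
Qed.

Lemma expr2_powR (x : R) n : x ^+ n.*2 = `|x| `^ (n.*2)%:R.
Proof. by rewrite powR_mulrn// -normrX ger0_norm// -mul2n exprM exprn_ge0 ?sqr_ge0. Qed.

Lemma sym_moment_fin (Z : T -> R) n : measurable_fun setT Z ->
  (\int[P]_w (`|Z w| `^ (n.*2)%:R)%:E < +oo)%E ->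
  (\int[Q]_w (sym Z w ^+ n.*2)%:E < +oo)%E.
Proof.
move=> mZ Zn; under eq_integral do rewrite expr2_powR.
apply: (le_lt_trans (sym_moment_le P mZ _)) => //.
by rewrite lte_mul_pinfty// lee_fin mulr_ge0 ?powR_ge0.
Qed.

(** The kernel is at least exp (- 1) on the strip xi r - 1 <= v <= xi r, of length 1 for each xi.
    Positivity allows this factor to be divided out of [integral_jump_even]. *)
Lemma integral_ker_expn_gt0 n r : (0 < \int[PL]_q (ker r q ^+ n)%:E)%E.
Proof.
have m2 : measurable_fun [set: PT] (fun q : PT => (ker r q ^+ n)%:E).
  by apply/measurable_EFinP; apply: measurable_funX; exact: measurable_kerPT.
have k0 (q : PT) : (0 <= (ker r q ^+ n)%:E)%E by rewrite lee_fin exprn_ge0 ?ker_ge0.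
have -> := @fubini_tonelli1 _ _ _ _ R pi (@lebesgue_measure R) (fun q : PT => (ker r q ^+ n)%:E) m2 k0.
have e0 : 0 < expR (-1) ^+ n :> R by rewrite exprn_gt0// expR_gt0.
apply: (@lt_le_trans _ _ (\int[pi]_x (cst (expR (-1) ^+ n)%:E) x)%E).
  by rewrite integral_cst//= probability_setT mule1 lte_fin.
apply: ge0_le_integral => //.
- by move=> x _; rewrite lee_fin ltW.
- exact: (@measurable_fun_fubini_tonelli_F _ _ _ _ R (@lebesgue_measure R) (fun q : PT => (ker r q ^+ n)%:E) m2 k0).
move=> xi _; rewrite /fubini_F.
have -> : (cst (expR (-1) ^+ n)%:E xi =
    \int[(@lebesgue_measure R)]_(v in `[(xi * r - 1)%R, (xi * r)%R]) (cst (expR (-1) ^+ n)%:E) v :> \bar R)%E.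
  rewrite integral_cst//= lebesgue_measure_itv /= lte_fin ltrBlDr ltrDl ltr01.
  by rewrite -EFinB -EFinM opprB addrCA subrr addr0 mulr1.
rewrite [leLHS]integral_mkcond; apply: ge0_le_integral => //.
- by move=> v _; rewrite patchE; case: ifP => // _; rewrite lee_fin ltW.
- by apply/(measurable_restrictT _ _).1.
- by apply: (measurableT_comp m2); exact: pair1_measurable.
- move=> v _; rewrite patchE; case: ifPn => [|_]; last by rewrite lee_fin exprn_ge0 ?ker_ge0.
  rewrite inE /= in_itv/= => /andP[v1 v2]; rewrite kerE /= v2 lee_fin.
  by rewrite lerXn2r ?nnegrE ?expR_ge0// ler_expR; lra.
Qed.

(* [kappa_re] takes [fine] of a possibly infinite integral, so that a divergent
   exponent is read as 0: either [u |-> K u] is finite along some u -> 0 and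
   Fatou's lemma bounds the second moment of mu, or K is infinite near 0 and the
   characteristic function of Y r is 1 there. *)
Lemma levy_sqr_or_degenerate :
  (\int[mu]_x (x ^+ 2)%:E < +oo)%E \/
  forall r, (\int[P]_w (`|Y r w| `^ 2)%:E = 0)%E.
Proof.
have [|/existsNP] := pselect (forall r, (\int[P]_w (`|Y r w| `^ 2)%:E = 0)%E); first by right.
move=> [r Yr0]; left.
have mY := measurable_Y r; have mS := measurable_sym mY.
set S := sym (Y r); pose K u := chexp mu pi b (ker r) u.
have K0 u : (0 <= K u)%E by exact: chexp_ge0.
have hK u : (\int[Q]_w (cos (u * S w))%:E = (expR (- (2 * fine (K u))))%:E)%E.
  apply: (@fdd_chf 1 (fun=> r) (fun=> 1)) => [w|q]; by rewrite big_ord1 mul1r.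
have S2fin : (\int[Q]_w (S w ^+ 2)%:E < +oo)%E.
  have := @sym_moment_fin (Y r) 1 mY (integral_Y_powR 2 r).
  by rewrite (_ : 1.*2 = 2)%N.
have S20 : (0 <= \int[Q]_w (S w ^+ 2)%:E)%E by apply: integral_ge0 => w _; rewrite lee_fin sqr_ge0.
pose e2 := fine (\int[Q]_w (S w ^+ 2)%:E)%E.
have e20 : 0 <= e2 by rewrite fine_ge0.
have e2E : (\int[Q]_w (S w ^+ 2)%:E)%E = e2%:E by rewrite fineK// ge0_fin_numE.
have cosint u : (\int[Q]_w (1 - cos (u * S w))%:E = (1 - expR (- (2 * fine (K u))))%:E)%E.
  under eq_integral do rewrite EFinB.
  rewrite integralB_EFin//=.
  - by rewrite hK integral_cst//= probability_setT mule1.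
  - by apply: (@bounded_integrable R _ _ _ _ 1) => // w; rewrite normr1.
  - apply: (@bounded_integrable R _ _ _ _ 1) => [|w]; last exact: cos_max.
    apply: measurableT_comp; last exact: measurable_funM.
    by apply: continuous_measurable_fun; exact: continuous_cos.
have coslE u : 1 - expR (- (2 * fine (K u))) <= u ^+ 2 / 2 * e2.
  rewrite -lee_fin -cosint EFinM -e2E -ge0_integralZl_EFin ?divr_ge0 ?sqr_ge0//; last 2 first.
  - by move=> w _; rewrite lee_fin sqr_ge0.
  - by apply/measurable_EFinP; exact: measurable_funX.
  apply: ge0_le_integral => //.
  - by apply/measurable_EFinP; apply: measurable_1cos; exact: measurable_funM.
  - by apply: measurable_funeM; apply/measurable_EFinP; exact: measurable_funX.
  - by move=> w _; rewrite -EFinM lee_fin (le_trans (sub1cos_le_sqr _))// exprMn mulrAC.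
(* For 0 < u < dl one has u^2 e2 <= 1, hence exp (- 2 K u) >= 1/2 (with K u read through [fine]), as
   [norm_le_2_expR1] demands. *)
pose dl : R := (1 + e2)^-1.
have dl0 : 0 < dl by rewrite invr_gt0; lra.
have dl1 : dl <= 1 by rewrite invf_le1; lra.
have dle : dl * e2 <= 1 by rewrite mulrC ler_pdivrMr ?mul1r; lra.
have u_cvg (u : nat -> R) : (forall n, 0 < u n < dl / n.+1%:R) -> u @ \oo --> 0.
  move=> hu; have c : (fun n => dl * (n.+1%:R)^-1) @ \oo --> 0.
    by rewrite -[X in _ --> X](mulr0 dl); apply: cvgMr; exact: cvg_harmonic.
  apply: (squeeze_cvgr _ (cvg_cst 0) c); apply: nearW => n.
  by have /andP[/ltW -> /ltW ->] := hu n.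
have [hA|/existsNP[N hN]] := pselect (forall n : nat, exists u, 0 < u < dl / n.+1%:R /\ K u <> +oo%E).
  have [u hu] := choice hA.
  have u0 n : 0 < u n by have [/andP[]] := hu n.
  have uc := u_cvg u (fun n => (hu n).1).
  have u1 n : u n ^+ 2 * e2 <= 1.
    have [/andP[_ h] _] := hu n.
    have h1 : u n <= dl by rewrite (le_trans (ltW h))// ler_piMr ?(ltW dl0)// invf_le1// ler1n.
    rewrite (le_trans _ dle)// ler_wpM2r// expr2 -[leRHS]mulr1 ler_pM// ?(ltW (u0 n))//.
    exact: le_trans h1 dl1.
  have KC n : fine (K (u n)) <= u n ^+ 2 * e2 / 2.
    have h1 := coslE (u n).
    have h2 : 0 <= fine (K (u n)) by rewrite fine_ge0.
    have h3 : 2^-1 <= expR (- (2 * fine (K (u n)))) by have := u1 n; lra.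
    have := norm_le_2_expR1 h3; rewrite normrN ger0_norm ?mulr_ge0//.
    rewrite ler0_norm; last by rewrite subr_le0 -expR0 ler_expR oppr_le0 mulr_ge0.
    by lra.
  have J2 : (\int[nu]_z (jump (ker r : PT -> R) z ^+ 2 / 2)%:E <= (e2 / 2)%:E)%E.
    have mj := measurable_jump (measurable_kerPT r).
    apply: (@fatou_le _ _ _ nu (fun n z => (1 - cos (u n * jump (ker r : PT -> R) z)) / u n ^+ 2) _ (fun=> e2 / 2)).
    - by move=> n; apply: measurable_funM => //; apply: measurable_1cos; exact: measurable_funM.
    - by move=> n z; rewrite divr_ge0 ?sub1cos_ge0 ?sqr_ge0.
    - by move=> z; exact: cos_quot_cvg.
    - move=> n; have [_ Kn] := hu n.
      have Kf : K (u n) \is a fin_num by rewrite ge0_fin_numE// ltey; exact/eqP.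
      under eq_integral do rewrite mulrC EFinM.
      rewrite ge0_integralZl_EFin ?invr_ge0 ?sqr_ge0//; last first.
        by apply/measurable_EFinP; apply: measurable_1cos; exact: measurable_funM.
      apply: (@le_trans _ _ ((u n ^+ 2)^-1%:E * K (u n))%E).
        rewrite lee_wpmul2l ?lee_fin ?invr_ge0 ?sqr_ge0// /K /chexp leeDr//.
        by apply: integral_ge0 => q _; rewrite lee_fin divr_ge0// mulr_ge0// sqr_ge0.
      rewrite -(fineK Kf) -EFinM lee_fin ler_pdivrMl ?exprn_gt0//.
      by rewrite mulrA; exact: KC.
    - exact: cvg_cst.
  have J2' : (\int[nu]_z (jump (ker r : PT -> R) z ^+ 2)%:E < +oo)%E.
    have mj := measurable_jump (measurable_kerPT r).
    have e z : (jump (ker r : PT -> R) z ^+ 2)%:E = (2%:E * (jump (ker r : PT -> R) z ^+ 2 / 2)%:E)%E.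
      by rewrite -EFinM; congr EFin; field.
    under eq_integral do rewrite e.
    rewrite ge0_integralZl_EFin//; last 2 first.
    + by move=> z _; rewrite lee_fin divr_ge0// sqr_ge0.
    + by apply/measurable_EFinP; apply: measurable_funM => //; exact: measurable_funX.
    by rewrite lte_mul_pinfty// (le_lt_trans J2)// ltry.
  have := integral_jump_even mu pi (measurable_kerPT r) 1.
  rewrite (_ : 1.*2 = 2)%N// => E; rewrite E in J2'.
  have kp := integral_ker_expn_gt0 2 r.
  rewrite ltey; apply/eqP => m2oo; move: J2'; rewrite m2oo.
  by rewrite gt0_muley// ltxx.
exfalso; apply: Yr0; apply/eqP; rewrite eq_le; apply/andP; split; last first.
  by apply: integral_ge0 => w _; rewrite lee_fin powR_ge0.
have Koo u : 0 < u < dl / N.+1%:R -> K u = +oo%E.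
  by move=> hu; apply/eqP; apply: contrapT => h; apply: hN; exists u; split=> //; apply/eqP/negP.
pose u (n : nat) : R := dl / N.+1%:R / n.+2%:R.
have c0 : 0 < dl / N.+1%:R by rewrite divr_gt0.
have u0 n : 0 < u n by rewrite divr_gt0.
have uN n : 0 < u n < dl / N.+1%:R.
  by rewrite u0/= ltr_pdivrMr// ltr_pMr// ltr1n.
have uc : u @ \oo --> 0.
  apply: u_cvg => n; rewrite u0/= /u ltr_pdivrMr//.
  rewrite (@le_lt_trans _ _ dl)// ?ler_piMr ?(ltW dl0)// ?invf_le1 ?ler1n//.
  by rewrite mulrAC ltr_pdivlMr// ltr_pM2l// ltr_nat.
apply: (@le_trans _ _ (\int[Q]_w (`|sym (Y r) w| `^ 2)%:E)%E).
  have [y1 y2] := Y0 r.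
  by apply: (@le_sym_moment R d T P (Y r) mY 2); rewrite ?ler1n.
have -> : (0 = (0:R)%:E)%E by [].
have -> : (\int[Q]_w (`|sym (Y r) w| `^ 2)%:E = 2%:E * \int[Q]_w (S w ^+ 2 / 2)%:E)%E.
  rewrite -ge0_integralZl_EFin//.
  - by apply: eq_integral => w _; rewrite powR_mulrn// real_normK ?num_real// -EFinM; congr EFin; rewrite mulrC divfK.
  - by move=> w _; rewrite lee_fin divr_ge0// sqr_ge0.
  - by apply/measurable_EFinP; apply: measurable_funM => //; exact: measurable_funX.
rewrite -[leRHS](mule0 2%:E) lee_wpmul2l//.
apply: (@fatou_le _ _ _ Q (fun n z => (1 - cos (u n * S z)) / u n ^+ 2) _ (fun=> 0)).
- by move=> n; apply: measurable_funM => //; apply: measurable_1cos; exact: measurable_funM.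
- by move=> n z; rewrite divr_ge0 ?sub1cos_ge0 ?sqr_ge0.
- by move=> z; exact: cos_quot_cvg.
- move=> n; under eq_integral do rewrite mulrC EFinM.
  rewrite ge0_integralZl_EFin ?invr_ge0 ?sqr_ge0//; last first.
    by apply/measurable_EFinP; apply: measurable_1cos; exact: measurable_funM.
  by rewrite cosint Koo//= mulr0 oppr0 expR0 subrr mule0.
- exact: cvg_cst.
Qed.

End Process.

(** * Cumulants of a symmetrized variable with a given kernel *)

Section Pair.
Context {R : realType} dQ (TQ : measurableType dQ) (Q : probability TQ R).
Variables (b : R) (mu : {sigma_finite_measure set R -> \bar R}) (pi : probability R R).
Hypotheses (b0 : 0 <= b) (m2 : (\int[mu]_x (x ^+ 2)%:E < +oo)%E).
Local Notation PT := (R * measurableTypeR R)%type.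
Local Notation PL := (paramm pi).
Local Notation nu := (PL \x mu)%E.

Variables (S : TQ -> R) (g : PT -> R).
Hypotheses (mS : measurable_fun setT S) (mg : measurable_fun setT g).
Hypothesis g2 : (\int[PL]_q (g q ^+ 2)%:E < +oo)%E.
Hypothesis Smom : forall m, (\int[Q]_w (S w ^+ m.*2)%:E < +oo)%E.
Hypothesis hS : forall u,
  (\int[Q]_w (cos (u * S w))%:E = (expR (- (2 * fine (chexp mu pi b g u))))%:E)%E.

(** The variance of the Gaussian component of the symmetrized variable; the factor 2 comes from the
    two copies. *)
Definition gvar : R := 2 * b * fine (\int[PL]_q (g q ^+ 2)%:E)%E.

Lemma gvar_ge0 : 0 <= gvar.
Proof.
rewrite !mulr_ge0// fine_ge0//; apply: integral_ge0 => q _.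
by rewrite lee_fin sqr_ge0.
Qed.

Lemma pair_chf u :
  (\int[Q]_w (cos (u * S w))%:E = (expR (- (gvar * u ^+ 2 / 2 + 2 * chI mu pi g u)))%:E)%E.
Proof. by rewrite hS chexpE//=; do 2 congr (_ _); rewrite /gvar; lra. Qed.

Definition pair_cumulants := cumulants mS (measurable_jump mg) (ltr0Sn R 1) Smom
  (chIE mg g2 m2) pair_chf.

Lemma jump_even_lty j : (0 < j)%N -> (\int[nu]_z (jump g z ^+ j.*2)%:E < +oo)%E.
Proof. exact: pair_cumulants.1. Qed.

Definition pair_cumul j := cumul nu (jump g) gvar 2 j.

Lemma pair_smom_rec k : smom Q S k.+1 <= \sum_(i < k.+1) pair_cumul i.+1 * smom Q S (k - i).
Proof. exact: (smom_le_cumul mS (measurable_jump mg) (ltr0Sn R 1) Smom (chIE mg g2 m2) pair_chf _ gvar_ge0). Qed.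

Lemma pair_cumul_le k : pair_cumul k.+1 <= smom Q S k.+1.
Proof. exact: (cumul_le_smom mS (measurable_jump mg) (ltr0Sn R 1) Smom (chIE mg g2 m2) pair_chf _ gvar_ge0). Qed.

(** The recursion at k = 0: an isometry, up to a constant, from kernels to variables. It measures
    the increments of Y by those of the kernel. *)
Lemma pair_sqr : (\int[Q]_w (S w ^+ 2)%:E =
  (2 * (fine (\int[mu]_x (x ^+ 2)%:E) + b) * fine (\int[PL]_q (g q ^+ 2)%:E))%:E)%E.
Proof.
have e21 : 1.*2 = 2%N by [].
have f2 : 2`!%:R = 2 :> R by [].
have h0 : 1 * smom Q S 1 = 1 * (2 * smom nu (jump g) 1 + 1 * (gvar / 2)) * 1.
  by have := pair_cumulants.2 0%N; rewrite big_ord1 subnn smom_prob0.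
move: h0; rewrite /smom integral_jump_even// e21 f2.
have S2 := Smom 1; rewrite e21 in S2.
have S20 : (0 <= \int[Q]_w (S w ^+ 2)%:E)%E by apply: integral_ge0 => w _; rewrite lee_fin sqr_ge0.
have m20 : (0 <= \int[mu]_x (x ^+ 2)%:E)%E by apply: integral_ge0 => w _; rewrite lee_fin sqr_ge0.
have g20 : (0 <= \int[PL]_q (g q ^+ 2)%:E)%E by apply: integral_ge0 => w _; rewrite lee_fin sqr_ge0.
rewrite fineM ?ge0_fin_numE// => h.
have S2f : (\int[Q]_w (S w ^+ 2)%:E)%E \is a fin_num by rewrite ge0_fin_numE.
rewrite -(fineK S2f).
by congr EFin; move: h; rewrite /gvar; lra.
Qed.

Lemma pair_cumulE j : (0 < j)%N -> pair_cumul j = 2 * (fine (\int[PL]_q (g q ^+ j.*2)%:E *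
   \int[mu]_x (x ^+ j.*2)%:E)%E / j.*2`!%:R) + (j == 1)%:R * (gvar / 2).
Proof.
by case: j => // j _; rewrite /pair_cumul /cumul /smom integral_jump_even.
Qed.

End Pair.

Lemma pair_cumul_ge0 {R : realType} (b : R) (mu : {sigma_finite_measure set R -> \bar R})
  (pi : probability R R) (g : (R * measurableTypeR R)%type -> R) j :
  0 <= b -> 0 <= pair_cumul b mu pi g j.
Proof.
move=> b0; case: j => [|j]; first by rewrite /pair_cumul.
apply: addr_ge0; apply: mulr_ge0 => //; first exact: smom_ge0.
by apply: divr_ge0 => //; exact: gvar_ge0.
Qed.

Section ProcessMoments.
Context {R : realType} d (T : measurableType d) (P : probability T R).
Variables (Y : R -> T -> R) (a b : R) (mu : {sigma_finite_measure set R -> \bar R})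
  (pi : probability R R).
Hypotheses (b0 : 0 <= b) (levy : is_levy_measure mu) (supY : is_supOU P Y a b mu pi).
Hypothesis Y0 : forall t, P.-integrable [set: T] (fun w => (Y t w)%:E) /\
             (\int[P]_w (Y t w)%:E = 0)%E.
Hypothesis Yexp : exists2 theta : R, 0 < theta &
     forall t, (\int[P]_w (expR (theta * `|Y t w|))%:E < +oo)%E.
Hypothesis m2 : (\int[mu]_x (x ^+ 2)%:E < +oo)%E.
Hypothesis pi0 : pi `]-oo, 0%R[%classic = 0%E.
Local Notation PT := (R * measurableTypeR R)%type.
Local Notation PL := (paramm pi).
Local Notation nu := (PL \x mu)%E.
Local Notation Q := (P \x P)%E.
Local Notation leb := (@lebesgue_measure R).
Let fdd := @fdd_chf R d T P Y a b mu pi b0 levy supY.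
Let mY := @measurable_Y R d T P Y a b mu pi supY.

Lemma integral_ker_expn_le1 n r : (\int[PL]_q (ker r q ^+ n.+1)%:E <= 1)%E.
Proof.
have mk (j : nat) : measurable_fun [set: PT] (fun q : PT => (ker r q ^+ j)%:E).
  by apply/measurable_EFinP; apply: measurable_funX; exact: measurable_kerPT.
have k0 (q : PT) : (0 <= (ker r q ^+ n.+1)%:E)%E by rewrite lee_fin exprn_ge0// ker_ge0.
rewrite (@fubini_tonelli1 _ _ _ _ R pi leb (fun q : PT => (ker r q ^+ n.+1)%:E) (mk n.+1) k0).
apply: (@le_trans _ _ (\int[pi]_x (cst 1%:E) x)%E); last first.
  by rewrite integral_cst//= probability_setT mule1.
apply: ge0_le_integral => //.
- by move=> x _; apply: integral_ge0.
- exact: (@measurable_fun_fubini_tonelli_F _ _ _ _ R leb (fun q : PT => (ker r q ^+ n.+1)%:E) (mk n.+1) k0).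
move=> xi _; rewrite /fubini_F; apply: (le_trans _ (integral_ker_le1 r xi)).
have mp (j : nat) := measurableT_comp (mk j) (pair1_measurable xi).
apply: ge0_le_integral => //.
- exact: mp.
- exact: (mp 1%N).
- move=> v _; rewrite lee_fin exprS ler_piMr ?ker_ge0// exprn_ile1 ?ker_ge0 ?ker_le1//.
Qed.

Lemma sym_Y_chf r u : (\int[Q]_w (cos (u * sym (Y r) w))%:E =
  (expR (- (2 * fine (chexp mu pi b (ker r) u))))%:E)%E.
Proof.
by apply: (@fdd 1 (fun=> r) (fun=> 1)) => [w|q]; rewrite big_ord1 mul1r.
Qed.

Lemma sym_Y_mom r m : (\int[Q]_w (sym (Y r) w ^+ m.*2)%:E < +oo)%E.
Proof. exact: (sym_moment_fin (mY r) (integral_Y_powR supY Yexp m.*2 r)). Qed.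

Lemma ker_sqr_lty r : (\int[PL]_q (ker r q ^+ 2)%:E < +oo)%E.
Proof. exact: le_lt_trans (integral_ker_expn_le1 1 r) (ltry _). Qed.

Let mker r : measurable_fun [set: PT] (ker r) := measurable_kerPT r.

(** Applied to Y(0), the cumulant lemma makes the product of a kernel moment and a moment of mu
    finite, and the first factor is positive. *)
Lemma levy_even_lty j : (0 < j)%N -> (\int[mu]_x (x ^+ j.*2)%:E < +oo)%E.
Proof.
move=> j0; have := jump_even_lty b0 m2 (measurable_sym (mY 0)) (mker 0)
  (ker_sqr_lty 0) (sym_Y_mom 0) (sym_Y_chf 0) j0.
rewrite integral_jump_even// => h.
rewrite ltey; apply/eqP => moo; move: h; rewrite moo.
by rewrite gt0_muley ?ltxx// integral_ker_expn_gt0.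
Qed.

(** The powers of the kernel have integral at most 1 at every time, so the recursion yields one
    bound for all r. This stands in for stationarity. *)
Lemma sym_Y_smom_bounded k : exists2 B : R, 0 <= B & forall r j, (j <= k)%N -> smom Q (sym (Y r)) j <= B.
Proof.
elim: k => [|k [B B0 hB]].
  by exists 1 => // r [|//] _; rewrite smom_prob0.
pose M j := 2 * fine (\int[mu]_x (x ^+ j.*2)%:E)%E + b.
have M0 j : 0 <= M j.
  rewrite addr_ge0// mulr_ge0// fine_ge0//; apply: integral_ge0 => x _.
  by rewrite lee_fin -mul2n exprM exprn_ge0 ?sqr_ge0.
exists (B + \sum_(i < k.+1) M i.+1 * B); first by rewrite addr_ge0// sumr_ge0// => i _; rewrite mulr_ge0.
move=> r j; rewrite leq_eqVlt => /predU1P[->|]; last first.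
  by rewrite ltnS => /hB; move=> /(_ r); move/le_trans; apply; rewrite lerDl sumr_ge0// => i _; rewrite mulr_ge0.
apply: (le_trans (pair_smom_rec b0 m2 (measurable_sym (mY r)) (mker r)
  (ker_sqr_lty r) (sym_Y_mom r) (sym_Y_chf r) k)).
apply: (@le_trans _ _ (\sum_(i < k.+1) M i.+1 * B)); last by rewrite lerDr.
apply: ler_sum => i _.
have bd : pair_cumul b mu pi (ker r : PT -> R) i.+1 <= M i.+1.
  rewrite pair_cumulE//.
  have G1 n : 0 <= fine (\int[PL]_q (ker r q ^+ n.+1)%:E)%E <= 1.
    rewrite fine_ge0 ?integral_ge0//=; last by move=> q _; rewrite lee_fin exprn_ge0// ker_ge0.
    rewrite -lee_fin fineK ?integral_ker_expn_le1// ge0_fin_numE ?(le_lt_trans (integral_ker_expn_le1 _ _)) ?ltry//.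
    by apply: integral_ge0 => q _; rewrite lee_fin exprn_ge0// ker_ge0.
  have mfin : (\int[mu]_x (x ^+ i.+1.*2)%:E)%E \is a fin_num.
    rewrite ge0_fin_numE ?levy_even_lty//; apply: integral_ge0 => x _.
    by rewrite lee_fin -mul2n exprM exprn_ge0 ?sqr_ge0.
  have Gfin n : (\int[PL]_q (ker r q ^+ n.+1)%:E)%E \is a fin_num.
    rewrite ge0_fin_numE ?(le_lt_trans (integral_ker_expn_le1 _ _)) ?ltry//.
    by apply: integral_ge0 => q _; rewrite lee_fin exprn_ge0// ker_ge0.
  have Gf' : (\int[PL]_q (ker r q ^+ i.+1.*2)%:E)%E \is a fin_num := Gfin i.*2.+1.
  rewrite fineM// /M lerD//.
    rewrite ler_pM2l// -[leRHS]mul1r -mulrA ler_pM//.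
    - by have /andP[] := G1 i.*2.+1.
    - by rewrite divr_ge0// fine_ge0// integral_ge0// => x _; rewrite lee_fin -mul2n exprM exprn_ge0 ?sqr_ge0.
    - by have /andP[] := G1 i.*2.+1.
    - rewrite ler_piMr ?invf_le1 ?ler1n ?ltr0n ?fact_gt0//.
      by rewrite fine_ge0// integral_ge0// => x _; rewrite lee_fin -mul2n exprM exprn_ge0 ?sqr_ge0.
  have /andP[g0 g1] := G1 1%N.
  rewrite /gvar; case: eqP => _; rewrite ?mul1r ?mul0r//.
  by have := ler_piMr b0 g1; lra.
rewrite ler_pM//; last 2 first.
- exact: smom_ge0.
- exact: (hB r (k - i)%N (leq_subr _ _)).
exact: pair_cumul_ge0.
Qed.

Lemma Y_moment_bounded k : exists2 C : R, 0 <= C &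
  forall r, (\int[P]_w (`|Y r w| `^ (k.+1.*2)%:R)%:E <= C%:E)%E.
Proof.
have [B B0 hB] := sym_Y_smom_bounded k.+1.
exists (B * k.+1.*2`!%:R) => [|r]; first by rewrite mulr_ge0.
have [y1 y2] := Y0 r.
apply: (@le_trans _ _ (\int[Q]_w (`|sym (Y r) w| `^ (k.+1.*2)%:R)%:E)%E).
  by apply: (@le_sym_moment R d T P (Y r) (mY r)) => //; rewrite ler1n.
under eq_integral do rewrite -expr2_powR.
have Sf : (\int[Q]_w (sym (Y r) w ^+ k.+1.*2)%:E)%E \is a fin_num.
  rewrite ge0_fin_numE ?sym_Y_mom//; apply: integral_ge0 => x _.
  by rewrite lee_fin -mul2n exprM exprn_ge0 ?sqr_ge0.
have := hB r k.+1 (leqnn _); rewrite /smom ler_pdivrMr ?ltr0n ?fact_gt0//.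
by rewrite -lee_fin fineK.
Qed.

End ProcessMoments.

(** * The characteristic function of the integrated process *)

Section KernelModulus.
Context {R : realType} (pi : probability R R).
Hypothesis pi0 : pi `]-oo, 0%R[%classic = 0%E.
Local Notation PT := (R * measurableTypeR R)%type.
Local Notation PL := (paramm pi).
Local Notation leb := (@lebesgue_measure R).

(** Half a bound for the L1 distance in v between kernels at most h apart in time. Since pi may lack
    a first moment, |xi| h is capped by 1; the indicator covers negative xi, a pi-null set on which
    only the crude bound 2 is used. *)
Let phi (h xi : R) : R := Num.min 1 (`|xi| * h) + \1_(`]-oo, 0%R[%classic) xi.

Let phi_ge0 h xi : 0 <= h -> 0 <= phi h xi.
Proof. by move=> h0; rewrite addr_ge0// le_min ler01 mulr_ge0. Qed.

Let phi_le2 h xi : phi h xi <= 2.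
Proof.
by rewrite (_ : 2 = 1 + 1 :> R)// lerD ?ge_min ?lexx//.
Qed.

Let mphi h : measurable_fun setT (phi h).
Proof.
apply: measurable_funD; last exact: measurable_indic.
apply: measurable_minr => //; apply: measurable_funM => //; exact: measurableT_comp.
Qed.

Definition kmod h : R := 2 * fine (\int[pi]_xi (phi h xi)%:E)%E.

Let int_phi_fin h : 0 <= h -> (\int[pi]_xi (phi h xi)%:E)%E \is a fin_num.
Proof.
move=> h0; rewrite ge0_fin_numE; last by apply: integral_ge0 => x _; rewrite lee_fin phi_ge0.
apply: (@le_lt_trans _ _ (\int[pi]_x (cst 2%:E) x)%E); last first.
  by rewrite integral_cst//= probability_setT mule1 ltry.
apply: ge0_le_integral => //.
- by move=> x _; rewrite lee_fin phi_ge0.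
- exact/measurable_EFinP.
- by move=> x _; rewrite lee_fin.
Qed.

Lemma kmod_ge0 h : 0 <= h -> 0 <= kmod h.
Proof.
move=> h0; rewrite mulr_ge0// fine_ge0// integral_ge0// => x _.
by rewrite lee_fin phi_ge0.
Qed.

(** Dominated convergence with the constant 2; the limit of [phi] is the indicator of the negative
    half-line, which is pi-null. *)
Lemma kmod_cvg (u : nat -> R) : (forall n, 0 <= u n) -> u @ \oo --> 0 -> kmod (u n) @[n --> \oo] --> 0.
Proof.
move=> u0 uc; rewrite -[X in _ --> X](mulr0 2); apply: cvgMr.
have := @dominated_cvg _ _ R pi setT measurableT (fun n xi => (phi (u n) xi)%:E)
  (fun xi => (\1_(`]-oo, 0%R[%classic) xi)%:E) (cst 2%:E).
have -> : (\int[pi]_x (\1_(`]-oo, 0%R[%classic) x)%:E = 0)%E.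
  by rewrite integral_indic// setIT.
move=> h; apply: fine_cvg; apply: h => //.
- by move=> n; apply/measurable_EFinP.
- move=> x _; apply: cvg_EFin; first by apply: nearW.
  rewrite -[X in _ --> X]add0r; apply: cvgD; last exact: cvg_cst.
  rewrite [X in _ --> X](_ : 0 = Num.min 1 0); last by rewrite min_r.
  apply: continuous_cvg.
    by have := @continuous_min R R (cst 1) id; move=> hh; apply: hh => //; exact: cst_continuous.
  by rewrite -[X in _ --> X](mulr0 `|x|); apply: cvgMr.
- by apply/integrableP; split=> //; rewrite integral_cst//= probability_setT mule1 normr_nat ltry.
- by move=> n x _; rewrite abse_EFin lee_fin ger0_norm ?phi_ge0.
Qed.

Lemma integral_kerB_le h r r' : r <= r' -> r' - r <= h ->
  (\int[PL]_q `|ker r' q - ker r q|%:E <= (kmod h)%:E)%E.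
Proof.
move=> rr rh.
have h0 : 0 <= h by lra.
have mk : measurable_fun [set: PT] (fun q : PT => `|ker r' q - ker r q|%:E).
  apply/measurable_EFinP; apply: measurableT_comp => //; apply: measurable_funB; exact: measurable_kerPT.
have k0 (q : PT) : (0 <= `|ker r' q - ker r q|%:E)%E by rewrite lee_fin.
rewrite (@fubini_tonelli1 _ _ _ _ R pi leb (fun q : PT => `|ker r' q - ker r q|%:E) mk k0).
rewrite /kmod EFinM fineK ?int_phi_fin// -ge0_integralZl_EFin//; last 2 first.
- by move=> x _; rewrite lee_fin phi_ge0.
- exact/measurable_EFinP.
apply: ge0_le_integral => //.
- by move=> x _; apply: integral_ge0.
- exact: (@measurable_fun_fubini_tonelli_F _ _ _ _ R leb (fun q : PT => `|ker r' q - ker r q|%:E) mk k0).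
- by apply: measurable_funeM; exact/measurable_EFinP.
move=> xi _; rewrite /fubini_F -EFinM.
have mkv s : measurable_fun setT (fun v => ker s (xi, v)).
  exact: (measurableT_comp (measurable_kerPT s) (pair1_measurable xi)).
have mkE s : measurable_fun setT (fun v => (ker s (xi, v))%:E) by exact/measurable_EFinP.
have le2 : (\int[leb]_v `|ker r' (xi, v) - ker r (xi, v)|%:E <= 2%:E)%E.
  apply: (@le_trans _ _ (\int[leb]_v ((ker r' (xi, v))%:E + (ker r (xi, v))%:E))%E).
    apply: ge0_le_integral => //.
    - exact: (measurableT_comp mk (pair1_measurable xi)).
    - exact: (emeasurable_funD (mkE r') (mkE r)).
    - move=> v _; rewrite -EFinD lee_fin (le_trans (ler_normB _ _))//.
      by rewrite !ger0_norm ?ker_ge0.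
  rewrite ge0_integralD//.
  - by rewrite (_ : 2 = 1 + 1 :> R)// EFinD leeD// integral_ker_le1.
  - by move=> v _; rewrite lee_fin ker_ge0.
  - exact: mkE.
  - by move=> v _; rewrite lee_fin ker_ge0.
  - exact: mkE.
have [xi0|xi0] := leP 0 xi; last first.
  apply: (le_trans le2); rewrite lee_fin /phi indicE mem_set/= ?in_itv//=.
  have : 0 <= Num.min 1 (`|xi| * h) by rewrite le_min ler01 mulr_ge0.
  by lra.
apply: (@le_trans _ _ (2 * Num.min 1 (`|xi| * h))%:E); last first.
  by rewrite lee_fin ler_pM2l// lerDl.
rewrite minEle; case: ifPn => _; rewrite ?mulr1//.
under eq_integral do rewrite distrC.
apply: (le_trans (integral_ker_diff_le xi0 rr)).
by rewrite lee_fin ler_pM2l// ger0_norm// ler_wpM2l.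
Qed.

End KernelModulus.

Lemma normr_sin_le {R : realType} (x : R) : `|sin x| <= `|x|.
Proof.
wlog x0 : x / 0 <= x.
  by move=> h; have [/h//|/ltW] := leP 0 x; rewrite -oppr_ge0 => /h; rewrite sinN !normrN.
have [c _] := is_derive_MVT x0 (@is_derive_sin R).
by rewrite sin0 !subr0 => ->; rewrite normrM ler_piMl// cos_max.
Qed.

Lemma cosB_normE {R : realType} (x y : R) :
  `|cos x - cos y| = 2 * `|sin ((x + y) / 2)| * `|sin ((x - y) / 2)|.
Proof.
have -> : cos x - cos y = - (2 * sin ((x + y) / 2) * sin ((x - y) / 2)).
  have -> : cos x = cos ((x + y) / 2 + (x - y) / 2) by congr cos; lra.
  have -> : cos y = cos ((x + y) / 2 - (x - y) / 2) by congr cos; lra.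
  by rewrite cosD cosB; ring.
by rewrite normrN !normrM normr_nat.
Qed.

Lemma cos_lip {R : realType} (x y : R) : `|cos x - cos y| <= `|x - y|.
Proof.
rewrite cosB_normE; have h1 := sin_max ((x + y) / 2).
have := normr_sin_le ((x - y) / 2); rewrite normrM [`|2^-1|]ger0_norm// => h2.
rewrite (@le_trans _ _ (2 * 1 * (`|x - y| / 2)))//; last by lra.
by rewrite ler_pM// ler_pM2l.
Qed.

Lemma cos_lip_sqr {R : realType} (x y : R) : `|cos x - cos y| <= `|x - y| * `|x + y| / 2.
Proof.
rewrite cosB_normE.
have := normr_sin_le ((x + y) / 2); rewrite normrM [`|2^-1|]ger0_norm// => h1.
have := normr_sin_le ((x - y) / 2); rewrite normrM [`|2^-1|]ger0_norm// => h2.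
rewrite (@le_trans _ _ (2 * (`|x + y| / 2) * (`|x - y| / 2)))//; last by lra.
by rewrite ler_pM// ler_pM2l.
Qed.

Section IntegratedProcess.
Context {R : realType} d (T : measurableType d) (P : probability T R).
Variables (Y : R -> T -> R) (a b : R) (mu : {sigma_finite_measure set R -> \bar R})
  (pi : probability R R).
Hypotheses (b0 : 0 <= b) (levy : is_levy_measure mu) (supY : is_supOU P Y a b mu pi).
Hypothesis Y0 : forall t, P.-integrable [set: T] (fun w => (Y t w)%:E) /\
             (\int[P]_w (Y t w)%:E = 0)%E.
Hypothesis Yexp : exists2 theta : R, 0 < theta &
     forall t, (\int[P]_w (expR (theta * `|Y t w|))%:E < +oo)%E.
Hypothesis m2 : (\int[mu]_x (x ^+ 2)%:E < +oo)%E.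
Hypothesis pi0 : pi `]-oo, 0%R[%classic = 0%E.
Local Notation PT := (R * measurableTypeR R)%type.
Local Notation PL := (paramm pi).
Local Notation nu := (PL \x mu)%E.
Local Notation Q := (P \x P)%E.
Local Notation leb := (@lebesgue_measure R).
Let fdd := @fdd_chf R d T P Y a b mu pi b0 levy supY.
Let mY := @measurable_Y R d T P Y a b mu pi supY.
Let mker r : measurable_fun [set: PT] (ker r) := measurable_kerPT r.
Let C2 : R := 2 * (fine (\int[mu]_x (x ^+ 2)%:E)%E + b).

Let C20 : 0 <= C2.
Proof.
rewrite mulr_ge0// addr_ge0// fine_ge0// integral_ge0// => x _.
by rewrite lee_fin sqr_ge0.
Qed.

(** The isometry computes the second moment of the symmetrized increment; Jensen's inequality
    carries the bound over to the increment itself, and then to its first moment. *)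
Lemma integral_YB_le h r r' : r <= r' -> r' - r <= h ->
  (\int[P]_w `|Y r' w - Y r w|%:E <= (Num.sqrt (C2 * kmod pi h))%:E)%E.
Proof.
move=> rr rh; have h0 : 0 <= h by lra.
pose Z w := Y r' w - Y r w; pose g (q : PT) := ker r' q - ker r q.
have mZ : measurable_fun setT Z by apply: measurable_funB.
have mg : measurable_fun setT g by apply: measurable_funB; exact: mker.
have Zmom m : (\int[Q]_w (sym Z w ^+ m.*2)%:E < +oo)%E.
  apply: sym_moment_fin => //.
  have mp s : measurable_fun setT (fun w => (`|Y s w| `^ m.*2%:R)%:E).
    by apply/measurable_EFinP; apply: (measurableT_comp (@measurable_powR R _)); exact: measurableT_comp.
  apply: (@le_lt_trans _ _ (\int[P]_w ((2 `^ m.*2%:R)%:E * ((`|Y r' w| `^ m.*2%:R)%:E + (`|Y r w| `^ m.*2%:R)%:E)))%E).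
    apply: ge0_le_integral => //.
    - by apply/measurable_EFinP; apply: (measurableT_comp (@measurable_powR R _)); exact: measurableT_comp.
    - by apply: measurable_funeM; exact: (emeasurable_funD (mp r') (mp r)).
    - by move=> w _; rewrite -EFinD -EFinM lee_fin powR_normB_le.
  rewrite ge0_integralZl_EFin ?powR_ge0//; last 2 first.
  - by move=> w _; rewrite -EFinD lee_fin addr_ge0 ?powR_ge0.
  - exact: (emeasurable_funD (mp r') (mp r)).
  rewrite ge0_integralD//.
  rewrite lte_mul_pinfty ?lee_fin ?powR_ge0// lte_add_pinfty//; exact: (integral_Y_powR supY Yexp).
(* Differences of kernels lie in [-1, 1], so squares are below absolute values and the L1 modulus
   suffices. *)
have g2 : (\int[PL]_q (g q ^+ 2)%:E <= (kmod pi h)%:E)%E.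
  have hh := integral_kerB_le pi rr rh.
  apply: (le_trans _ hh); apply: ge0_le_integral => //.
  - by move=> q _; rewrite lee_fin sqr_ge0.
  - by apply/measurable_EFinP; exact: measurable_funX.
  - by apply/measurable_EFinP; exact: measurableT_comp.
  move=> q _; rewrite lee_fin -real_normK ?num_real// expr2 ler_piMl// /g.
  by rewrite ler_norml; have := ker_ge0 r' q; have := ker_ge0 r q; have := ker_le1 r' q; have := ker_le1 r q; lra.
have g20 : (0 <= \int[PL]_q (g q ^+ 2)%:E)%E by apply: integral_ge0 => q _; rewrite lee_fin sqr_ge0.
have hS u : (\int[Q]_w (cos (u * sym Z w))%:E = (expR (- (2 * fine (chexp mu pi b g u))))%:E)%E.
  apply: (@fdd 2 (fun i => if i == 0 :> 'I_2 then r' else r) (fun i => if i == 0 :> 'I_2 then 1 else -1)).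
    by move=> w; rewrite big_ord_recl big_ord1/= mul1r mulN1r.
  by move=> q; rewrite big_ord_recl big_ord1/= mul1r mulN1r.
have sq := pair_sqr b0 m2 (measurable_sym mZ) mg (le_lt_trans g2 (ltry _)) Zmom hS.
have iZ r0 : P.-integrable [set: T] (EFin \o Y r0) := (Y0 r0).1.
have EZ0 : (\int[P]_w (Z w)%:E = 0)%E.
  rewrite /Z; under eq_integral do rewrite EFinB.
  by rewrite integralB_EFin// (Y0 r').2 (Y0 r).2 sube0.
have Z2 : (\int[P]_w (`|Z w| `^ 2)%:E <= (C2 * kmod pi h)%:E)%E.
  apply: (@le_trans _ _ (\int[Q]_w (`|sym Z w| `^ 2)%:E)%E).
    apply: (@le_sym_moment R d T P Z mZ 2) => //; first by rewrite ler1n.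
    rewrite (_ : EFin \o Z = (EFin \o Y r') \- (EFin \o Y r))%E; first exact: integrableB.
    by apply/funext => w.
  under eq_integral do rewrite powR_mulrn// real_normK ?num_real//.
  rewrite sq lee_fin ler_wpM2l// -lee_fin fineK// ge0_fin_numE//.
  exact: le_lt_trans g2 (ltry _).
have mnZ : measurable_fun setT (fun w => `|Z w|) by exact: measurableT_comp.
have := @jensen_powR R d T P setT (fun w => `|Z w|) 1 2 measurableT mnZ (probability_setT P) ltr01 (ler1n _ 2).
rewrite mul1r divr1.
have -> : (\int[P]_w (`| `|Z w| | `^ 2)%:E = \int[P]_w (`|Z w| `^ 2)%:E)%E.
  by apply: eq_integral => w _; rewrite normr_id.
move=> /le_trans/(_ Z2); rewrite lee_fin => h3.
have Zfin : (\int[P]_w `|Z w|%:E)%E \is a fin_num.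
  rewrite ge0_fin_numE; last by apply: integral_ge0.
  by have /integrableP[] : P.-integrable setT (EFin \o Z); [
    rewrite (_ : EFin \o Z = (EFin \o Y r') \- (EFin \o Y r))%E; [exact: integrableB|exact/funext]|].
rewrite -(fineK Zfin) lee_fin.
have f0 : 0 <= fine (\int[P]_w `|Z w|%:E)%E by rewrite fine_ge0// integral_ge0.
rewrite -(ger0_norm f0) -sqrtr_sqr ler_sqrt; last first.
  by apply: mulr_ge0; [exact: C20|exact: kmod_ge0].
by move: h3; rewrite powR_mulrn// real_normK ?num_real.
Qed.

Local Notation X := (integrated Y).

Lemma measurable_X t : measurable_fun setT (X t).
Proof. exact: (measurable_fine_time_integral (measurable_itv `[0, t]) supY.1). Qed.

(** Jensen's inequality in time, then Tonelli and the bound on E |Y(s)|^(2n) uniform in s. *)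
Lemma X_moment t n : 0 < t -> (\int[P]_w (X t w ^+ n.*2)%:E < +oo)%E.
Proof.
move=> t0; case: n => [|n].
  under eq_integral do rewrite expr0.
  by rewrite integral_cst//= probability_setT mule1 ltry.
have [C C0 hC] := Y_moment_bounded b0 levy supY Y0 Yexp m2 n.
pose q : R := n.+1.*2%:R.
have q1 : 1 <= q by rewrite ler1n.
pose f (z : R * T) := `|Y z.1 z.2| `^ q.
have mf : measurable_fun setT f.
  apply: (measurableT_comp (@measurable_powR R q)); apply: measurableT_comp => //; exact: supY.1.
have mfE : measurable_fun setT (EFin \o f) by exact/measurable_EFinP.
have fE0 z : (0 <= (EFin \o f) z)%E by rewrite lee_fin powR_ge0.
have mYw w : measurable_fun `[0, t]%classic (fun s => Y s w).
  by apply: measurable_funTS; exact: (measurableT_comp supY.1 (pair2_measurable w)).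
have J w := @jensen_powR R _ _ leb `[0, t]%classic (fun s => Y s w) t q
  (measurable_itv _) (mYw w) (lebesgue_0t (ltW t0)) t0 q1.
pose c := t ^+ n.+1.*2 / t.
have c0 : 0 <= c by rewrite divr_ge0 ?exprn_ge0 ?(ltW t0).
have mi : measurable_fun setT (fun w => \int[leb]_(s in `[0%R, t]) (f (s, w))%:E)%E.
  by apply: measurable_time_integral => // z; exact: powR_ge0.
have i0 w : (0 <= \int[leb]_(s in `[0%R, t]) (f (s, w))%:E)%E.
  by apply: integral_ge0 => s _; rewrite lee_fin powR_ge0.
apply: (@le_lt_trans _ _ (\int[P]_w (c%:E * \int[leb]_(s in `[0%R, t]) (f (s, w))%:E))%E).
  apply: ge0_le_integral => //.
  - by move=> w _; rewrite lee_fin -mul2n exprM exprn_ge0 ?sqr_ge0.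
  - by apply/measurable_EFinP; apply: measurable_funX; exact: measurable_X.
  - exact: measurable_funeM.
  - move=> w _; have := @lee_wpmul2l R c%:E c0 _ _ (J w).
    apply: le_trans; rewrite -EFinM lee_fin /c -/(X t w) expr2_powR -/q.
    rewrite !powR_mulrn ?divr_ge0 ?(ltW t0)// expr_div_n.
    set u := t ^+ _; have u0 : 0 < u by rewrite exprn_gt0.
    by rewrite le_eqVlt; apply/orP; left; apply/eqP; field; rewrite !gt_eqF.
rewrite ge0_integralZl_EFin//.
rewrite (tonelli_time P (measurable_itv `[0, t]) mf); last by move=> z; exact: powR_ge0.
rewrite lte_mul_pinfty//.
apply: (@le_lt_trans _ _ (\int[leb]_(s in `[0%R, t]) (cst C%:E) s)%E).
  apply: ge0_le_integral => //.
  - by move=> s _; apply: integral_ge0 => w _; rewrite lee_fin powR_ge0.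
  - apply: measurable_funTS.
    exact: (@measurable_fun_fubini_tonelli_F _ _ _ _ R P (EFin \o f) mfE fE0).
  - by move=> s _; exact: hC.
by rewrite integral_cst//= lebesgue_0t ?(ltW t0)// -EFinM ltry.
Qed.

End IntegratedProcess.

Lemma ge0_integral_prodM {R : realType} d1 d2 (T1 : measurableType d1) (T2 : measurableType d2)
  (m1 : {sigma_finite_measure set T1 -> \bar R}) (m2 : {sigma_finite_measure set T2 -> \bar R})
  (f : T1 -> R) (g : T2 -> R) : measurable_fun setT f -> measurable_fun setT g ->
  (forall x, 0 <= f x) -> (forall x, 0 <= g x) ->
  (\int[m1 \x m2]_z (f z.1 * g z.2)%:E = \int[m1]_x (f x)%:E * \int[m2]_y (g y)%:E)%E.
Proof.
move=> mf mg f0 g0.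
have mz : measurable_fun setT (fun z : T1 * T2 => (f z.1 * g z.2)%:E).
  apply/measurable_EFinP; apply: measurable_funM.
    exact: (measurableT_comp mf measurable_fst).
  exact: (measurableT_comp mg measurable_snd).
have z0 (z : T1 * T2) : (0 <= (f z.1 * g z.2)%:E)%E by rewrite lee_fin mulr_ge0.
rewrite (@fubini_tonelli1 _ _ _ _ R m1 m2 (fun z => (f z.1 * g z.2)%:E) mz z0) /fubini_F /=.
under eq_integral do (under eq_integral do rewrite EFinM).
have g0' : (0 <= \int[m2]_y (g y)%:E)%E by apply: integral_ge0 => y _; rewrite lee_fin.
rewrite [LHS](_ : _ = \int[m1]_x (\int[m2]_y (g y)%:E * (f x)%:E)%E)%E; last first.
  apply: eq_integral => x _; rewrite ge0_integralZl_EFin//.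
  - by rewrite muleC.
  - by move=> y _; rewrite lee_fin.
  - exact/measurable_EFinP.
rewrite ge0_integralZl//; last 2 first.
- exact/measurable_EFinP.
- by move=> x _; rewrite lee_fin.
by rewrite muleC.
Qed.

Section ExponentLipschitz.
Context {R : realType} (mu : {sigma_finite_measure set R -> \bar R}) (pi : probability R R).
Variable b : R.
Hypotheses (levy : is_levy_measure mu) (b0 : 0 <= b).
Hypothesis m2 : (\int[mu]_x (x ^+ 2)%:E < +oo)%E.
Local Notation PT := (R * measurableTypeR R)%type.
Local Notation PL := (paramm pi).
Local Notation nu := (PL \x mu)%E.

Let M2 : R := fine (\int[mu]_x (x ^+ 2)%:E)%E.

(** Both parts of the exponent are controlled by the square of the kernel, so between 0 and t they
    are Lipschitz for the L1 distance, with constant proportional to t. The inequality is one-sided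
    so as to make sense in the extended reals; it is used twice, with g and g' exchanged. *)
Lemma chexp_le_dist (g g' : PT -> R) t u : measurable_fun setT g -> measurable_fun setT g' ->
  (forall q, 0 <= g q <= t) -> (forall q, 0 <= g' q <= t) ->
  (chexp mu pi b g u <= chexp mu pi b g' u +
    (u ^+ 2 * t * (b + M2))%:E * \int[PL]_q `|g q - g' q|%:E)%E.
Proof.
move=> mg mg' gt gt'.
have t0 : 0 <= t by have := gt (0, 0); lra.
pose c := u ^+ 2 * t.
have c0 : 0 <= c by rewrite mulr_ge0 ?sqr_ge0.
have M20 : 0 <= M2 by rewrite fine_ge0// integral_ge0// => x _; rewrite lee_fin sqr_ge0.
have M2E : (\int[mu]_x (x ^+ 2)%:E = M2%:E)%E.
  by rewrite fineK// ge0_fin_numE// integral_ge0// => x _; rewrite lee_fin sqr_ge0.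
pose D (q : PT) := `|g q - g' q|.
have mD : measurable_fun setT D by apply: measurableT_comp => //; exact: measurable_funB.
have D0 q : 0 <= D q by exact: normr_ge0.
have mDE : measurable_fun [set: PT] (fun q => (D q)%:E) by exact/measurable_EFinP.
have D0E q : (0 <= (D q)%:E)%E by rewrite lee_fin.
have iD0 : (0 <= \int[PL]_q (D q)%:E)%E by apply: integral_ge0 => q _; rewrite lee_fin.
have mb h : measurable_fun setT h -> measurable_fun [set: PT] (fun q : PT => (b * (u * h q) ^+ 2 / 2)%:E).
  move=> mh; apply/measurable_EFinP; apply: measurable_funM => //; apply: measurable_funM => //.
  by apply: measurable_funX; exact: measurable_funM.
have mj h : measurable_fun setT h -> measurable_fun setT (fun z : PT * R => (1 - cos (u * jump h z))%:E).
  move=> mh; apply/measurable_EFinP; apply: measurable_1cos; apply: measurable_funM => //.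
  exact: measurable_jump.
have bp h (q : PT) : (0 <= (b * (u * h q) ^+ 2 / 2)%:E)%E.
  by rewrite lee_fin divr_ge0// mulr_ge0// sqr_ge0.
have jp h (z : PT * R) : (0 <= (1 - cos (u * jump h z))%:E)%E by rewrite lee_fin sub1cos_ge0.
have dl q : 0 <= g q + g' q <= 2 * t by have := gt q; have := gt' q; lra.
have G : (\int[PL]_q (b * (u * g q) ^+ 2 / 2)%:E <=
    \int[PL]_q (b * (u * g' q) ^+ 2 / 2)%:E + (c * b)%:E * \int[PL]_q (D q)%:E)%E.
  have cb0 : 0 <= c * b by exact: mulr_ge0.
  rewrite -ge0_integralZl_EFin//.
  rewrite -ge0_integralD//; last 3 first.
  - exact: mb.
  - by move=> q _; apply: mule_ge0 => //; rewrite lee_fin mulr_ge0.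
  - by apply: measurable_funeM; exact/measurable_EFinP.
  apply: ge0_le_integral => //.
  - exact: mb.
  - by apply: emeasurable_funD; [exact: mb|apply: measurable_funeM; exact/measurable_EFinP].
  move=> q _; rewrite -EFinM -EFinD lee_fin /c.
  have h1 : g q ^+ 2 - g' q ^+ 2 <= D q * (2 * t).
    rewrite subr_sqr; have /andP[p1 p2] := dl q.
    apply: (@le_trans _ _ (D q * (g q + g' q))); last exact: ler_wpM2l.
    by apply: ler_wpM2r => //; exact: ler_norm.
  have bu : 0 <= b * u ^+ 2 / 2 by rewrite divr_ge0// mulr_ge0// sqr_ge0.
  by have := ler_wpM2l bu h1; rewrite !exprMn; lra.
have mx2 : measurable_fun setT (fun x : R => x ^+ 2) by exact: measurable_funX.
have mDx : measurable_fun setT (fun z : PT * R => (D z.1 * z.2 ^+ 2)%:E).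
  apply/measurable_EFinP; apply: measurable_funM.
    exact: (measurableT_comp mD measurable_fst).
  exact: (measurableT_comp mx2 measurable_snd).
have J : (\int[nu]_z (1 - cos (u * jump g z))%:E <=
    \int[nu]_z (1 - cos (u * jump g' z))%:E + (c * M2)%:E * \int[PL]_q (D q)%:E)%E.
  rewrite EFinM -M2E -muleA [(_ * \int[PL]_q _)%E]muleC.
  rewrite -(@ge0_integral_prodM _ _ _ _ _ PL mu D (fun x => x ^+ 2))//; last by move=> x; exact: sqr_ge0.
  rewrite -ge0_integralZl_EFin//; last first.
    by move=> z _; rewrite lee_fin mulr_ge0// sqr_ge0.
  rewrite -ge0_integralD//; last 3 first.
  - exact: mj.
  - by move=> q _; apply: mule_ge0 => //; rewrite lee_fin mulr_ge0 ?sqr_ge0.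
  - exact: measurable_funeM.
  apply: ge0_le_integral => //.
  - exact: mj.
  - by apply: emeasurable_funD; [exact: mj|exact: measurable_funeM].
  move=> [q x] _; rewrite -EFinM -EFinD lee_fin /jump /=.
  have := cos_lip_sqr (u * (g' q * x)) (u * (g q * x)).
  have /andP[p1 p2] := dl q.
  have ns : `|g' q + g q| = g q + g' q by rewrite addrC ger0_norm.
  rewrite -mulrBr -mulrDr -mulrBl -mulrDl !normrM ns.
  rewrite [`|g' q - _|]distrC -/(D q) => h.
  have h2 := le_trans (ler_norm _) h.
  have {h2} : cos (u * (g' q * x)) - cos (u * (g q * x)) <= (u ^+ 2 * x ^+ 2 * D q / 2) * (g q + g' q).
    apply: (le_trans h2); rewrite -(real_normK (num_real u)) -(real_normK (num_real x)); lra.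
  have k0 : 0 <= u ^+ 2 * x ^+ 2 * D q / 2 by apply: divr_ge0 => //; apply: mulr_ge0 => //; rewrite mulr_ge0 ?sqr_ge0.
  have := ler_wpM2l k0 p2; rewrite /c; lra.
rewrite /chexp mulrDr EFinD ge0_muleDl; last 2 first.
- by rewrite lee_fin; exact: (mulr_ge0 c0 b0).
- by rewrite lee_fin; exact: (mulr_ge0 c0 M20).
rewrite [leRHS]addeACA.
apply: leeD; [exact: G|exact: J].
Qed.

End ExponentLipschitz.

(** * Passage to the limit in the Riemann sums *)

Section IntegratedChf.
Context {R : realType} d (T : measurableType d) (P : probability T R).
Variables (Y : R -> T -> R) (a b : R) (mu : {sigma_finite_measure set R -> \bar R})
  (pi : probability R R).
Hypotheses (b0 : 0 <= b) (levy : is_levy_measure mu) (supY : is_supOU P Y a b mu pi).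
Hypothesis Y0 : forall t, P.-integrable [set: T] (fun w => (Y t w)%:E) /\
             (\int[P]_w (Y t w)%:E = 0)%E.
Hypothesis Yexp : exists2 theta : R, 0 < theta &
     forall t, (\int[P]_w (expR (theta * `|Y t w|))%:E < +oo)%E.
Hypothesis m2 : (\int[mu]_x (x ^+ 2)%:E < +oo)%E.
Hypothesis pi0 : pi `]-oo, 0%R[%classic = 0%E.
Local Notation PT := (R * measurableTypeR R)%type.
Local Notation PL := (paramm pi).
Local Notation nu := (PL \x mu)%E.
Local Notation Q := (P \x P)%E.
Local Notation leb := (@lebesgue_measure R).
Local Notation X := (integrated Y).
Let C2 : R := 2 * (fine (\int[mu]_x (x ^+ 2)%:E)%E + b).
Variable t : R.
Hypothesis t0 : 0 < t.
Let h (n : nat) : R := t / n.+1%:R.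
Let om n : R := Num.sqrt (C2 * kmod pi (h n)).
Let RY n w : R := h n * \sum_(j < n.+1) Y (j%:R * h n) w.
Let RK n (q : PT) : R := h n * \sum_(j < n.+1) ker (j%:R * h n) q.
Let mY := @measurable_Y R d T P Y a b mu pi supY.
Let mX : measurable_fun setT (X t) := measurable_X supY t.

Let h0 n : 0 <= h n. Proof. by rewrite divr_ge0// ltW. Qed.

Let hn n : n.+1%:R * h n = t.
Proof. by rewrite /h mulrC divfK. Qed.

Let h_cvg : h @ \oo --> 0.
Proof.
by rewrite -[X in _ --> X](mulr0 t); apply: cvgMr; exact: cvg_harmonic.
Qed.

Let om_cvg : om @ \oo --> 0.
Proof.
rewrite -[X in _ --> X](sqrtr0 R); apply: continuous_cvg; first exact: sqrt_continuous.
by rewrite -[X in _ --> X](mulr0 C2); apply: cvgMr; exact: kmod_cvg.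
Qed.

Let mRY n : measurable_fun setT (RY n).
Proof. by apply: measurable_funM => //; apply: measurable_sum => j; exact: mY. Qed.

Let mRK n : measurable_fun setT (RK n).
Proof. by apply: measurable_funM => //; apply: measurable_sum => j; exact: measurable_kerPT. Qed.

Let Ybound : exists C, forall r, (\int[P]_w `|Y r w|%:E <= C%:E)%E.
Proof.
have [C C0 hC] := Y_moment_bounded b0 levy supY Y0 Yexp m2 0.
exists (1 + C) => r.
have m1 : measurable_fun setT (fun w => (`|Y r w| `^ 1.*2%:R)%:E).
  by apply/measurable_EFinP; apply: (measurableT_comp (@measurable_powR R _)); exact: measurableT_comp.
apply: (@le_trans _ _ (\int[P]_w ((cst 1%:E) w + (`|Y r w| `^ 1.*2%:R)%:E)%E)%E).
  apply: ge0_le_integral => //.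
  - by apply/measurable_EFinP; exact: measurableT_comp.
  - by apply: emeasurable_funD => //; exact: measurable_cst.
  - move=> w _; rewrite /= -EFinD lee_fin powR_mulrn//.
    rewrite (_ : 1.*2 = 2%N)//.
    by have := sqr_ge0 (`|Y r w| - 1); rewrite sqrrB expr1n mulr1; have := normr_ge0 (Y r w); lra.
rewrite ge0_integralD//= integral_cst//= probability_setT mule1 EFinD leeD2l//.
Qed.

Let XRY n : (\int[P]_w `|X t w - RY n w|%:E <= (t * om n)%:E)%E.
Proof.
have [C hC] := Ybound.
have := @riemann_L1 R d T P (fun z => Y z.1 z.2) C (om n) (h n) n.+1 supY.1 (h0 n) (sqrtr_ge0 _).
rewrite hn; apply => [r _|r r' r0 /andP[rr _] rh]; first exact: hC.
exact: (integral_YB_le b0 levy supY Y0 Yexp m2 rr rh).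
Qed.

Let FRK n : (\int[PL]_q `|Fk t q - RK n q|%:E <= (t * kmod pi (h n))%:E)%E.
Proof.
have := @riemann_L1 R _ PT PL (fun z => ker z.1 z.2) 1 (kmod pi (h n)) (h n) n.+1
  (@measurable_ker R) (h0 n) (kmod_ge0 pi (h0 n)).
rewrite hn; apply => [r _|r r' r0 /andP[rr _] rh]; last exact: integral_kerB_le.
apply: le_trans (integral_ker_expn_le1 pi 0 r).
rewrite le_eqVlt; apply/orP; left; apply/eqP; apply: eq_integral => q _ /=.
by rewrite ger0_norm ?ker_ge0.
Qed.

Let iX : P.-integrable setT (EFin \o X t).
Proof.
have X2 := X_moment b0 levy supY Y0 Yexp m2 1 t0.
have m1 : measurable_fun setT (fun w => (X t w ^+ 1.*2)%:E).
  by apply/measurable_EFinP; exact: measurable_funX.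
apply/integrableP; split; first exact/measurable_EFinP.
apply: (@le_lt_trans _ _ (\int[P]_w ((cst 1%:E) w + (X t w ^+ 1.*2)%:E)%E)%E).
  apply: ge0_le_integral => //.
  - by apply: measurableT_comp => //; exact/measurable_EFinP.
  - exact: (emeasurable_funD (measurable_cst 1%:E) m1).
  - move=> w _; rewrite /= -EFinD lee_fin (_ : 1.*2 = 2%N)//.
    rewrite -(real_normK (num_real (X t w))).
    by have := sqr_ge0 (`|X t w| - 1); rewrite sqrrB expr1n mulr1; have := normr_ge0 (X t w); lra.
have p1 w : (0 <= (X t w ^+ 1.*2)%:E)%E by rewrite lee_fin sqr_ge0.
by rewrite ge0_integralD//= integral_cst//= probability_setT mule1 lte_add_pinfty// ltry.
Qed.

Let iRY n : P.-integrable setT (EFin \o RY n) /\ (\int[P]_w (RY n w)%:E = 0)%E.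
Proof.
have iS : P.-integrable setT (fun w => \sum_(j < n.+1) (Y (j%:R * h n) w)%:E)%E.
  by apply: integrable_sum => // j _; exact: (Y0 _).1.
have e w : (RY n w)%:E = ((h n)%:E * \sum_(j < n.+1) (Y (j%:R * h n) w)%:E)%E.
  by rewrite /RY EFinM sumEFin.
have -> : EFin \o RY n = (fun w => (h n)%:E * \sum_(j < n.+1) (Y (j%:R * h n) w)%:E)%E.
  by apply/funext => w; rewrite /= e.
split; first exact: integrableZl.
under eq_integral do rewrite e.
rewrite integralZl// integral_sum//; last by move=> j; exact: (Y0 _).1.
by rewrite big1 ?mule0// => j _; exact: (Y0 _).2.
Qed.

Lemma integrated_integrable : P.-integrable setT (EFin \o X t).
Proof. exact: iX. Qed.

Lemma integrated_mean0 : (\int[P]_w (X t w)%:E = 0)%E.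
Proof.
have Xfin : (\int[P]_w (X t w)%:E)%E \is a fin_num by exact: (integrable_fin_num measurableT iX).
have le n : `|fine (\int[P]_w (X t w)%:E)%E| <= t * om n.
  rewrite -lee_fin -abse_EFin fineK//.
  have -> : (\int[P]_w (X t w)%:E = \int[P]_w (X t w - RY n w)%:E)%E.
    under [RHS]eq_integral do rewrite EFinB.
    have iR := (iRY n).1; have hX := iX.
    by rewrite integralB_EFin// (iRY n).2 sube0.
  apply: le_trans (XRY n); apply: le_abse_integral => //.
  by apply/measurable_EFinP; exact: measurable_funB.
rewrite -(fineK Xfin); congr EFin; apply/eqP; rewrite -normr_le0.
have c : (fun n => t * om n) @ \oo --> 0.
  by rewrite -[X in _ --> X](mulr0 t); exact: cvgMr.
by apply: (cvgr_to_ge c); exact: nearW.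
Qed.

Let mrk q : 0 <= Fk t q <= t.
Proof. exact: (FkE q (ltW t0)).2. Qed.

Let rkb n q : 0 <= RK n q <= t.
Proof.
rewrite mulr_ge0 ?h0 ?sumr_ge0//=; last by move=> j _; exact: ker_ge0.
apply: (@le_trans _ _ (h n * n.+1%:R)); last by rewrite mulrC hn.
rewrite /RK ler_wpM2l ?h0//.
apply: (@le_trans _ _ (\sum_(j < n.+1) 1)); first by apply: ler_sum => j _; exact: ker_le1.
by rewrite sumr_const card_ord.
Qed.

Lemma sym_integrated_chf u : (\int[Q]_w (cos (u * sym (X t) w))%:E =
  (expR (- (2 * fine (chexp mu pi b (Fk t) u))))%:E)%E.
Proof.
have mF : measurable_fun [set: PT] (Fk t) by exact: measurable_Fk.
pose M2 := fine (\int[mu]_x (x ^+ 2)%:E)%E.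
pose V g := fine (chexp mu pi b g u).
(* Bounded integrable kernels are square integrable, which makes their exponents finite. *)
have sqint (g : PT -> R) : measurable_fun setT g -> (forall q, 0 <= g q <= t) ->
    (\int[PL]_q (g q)%:E <= t%:E)%E -> (\int[PL]_q (g q ^+ 2)%:E < +oo)%E.
  move=> mg gt gi; apply: (@le_lt_trans _ _ (\int[PL]_q (t%:E * (g q)%:E))%E).
    apply: ge0_le_integral => //.
    - by move=> q _; rewrite lee_fin sqr_ge0.
    - by apply/measurable_EFinP; exact: measurable_funX.
    - by apply: measurable_funeM; exact/measurable_EFinP.
    - by move=> q _; rewrite -EFinM lee_fin expr2; have /andP[g1 g2] := gt q; rewrite ler_wpM2r.
  rewrite ge0_integralZl_EFin ?(ltW t0)//.
  - by rewrite lte_mul_pinfty ?lee_fin ?(ltW t0)// (le_lt_trans gi) ?ltry.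
  - by move=> q _; rewrite lee_fin; have /andP[] := gt q.
  - exact/measurable_EFinP.
have RKi n : (\int[PL]_q (RK n q)%:E <= t%:E)%E.
  under eq_integral do rewrite EFinM -sumEFin.
  have k0 r (q : PT) : (0 <= (ker r q)%:E)%E by rewrite lee_fin ker_ge0.
  have mk r : measurable_fun [set: PT] (fun q : PT => (ker r q)%:E).
    by apply/measurable_EFinP; exact: measurable_kerPT.
  rewrite ge0_integralZl_EFin//; last 2 first.
  - by move=> q _; exact: sume_ge0.
  - exact: emeasurable_sum.
  rewrite ge0_integral_sum//.
  apply: (@le_trans _ _ ((h n)%:E * \sum_(j < n.+1) 1%:E)%E).
    rewrite lee_wpmul2l ?lee_fin//; apply: lee_sum => j _.
    exact: (integral_ker_expn_le1 pi 0).
  by rewrite sumEFin -EFinM sumr_const card_ord mulrC hn.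
have Fi : (\int[PL]_q (Fk t q)%:E <= t%:E)%E.
  have FE : measurable_fun [set: PT] (fun q : PT => (Fk t q)%:E) by exact/measurable_EFinP.
  have F0 (q : PT) : (0 <= (Fk t q)%:E)%E by rewrite lee_fin; have /andP[] := mrk q.
  rewrite (@fubini_tonelli1 _ _ _ _ R pi leb (fun q : PT => (Fk t q)%:E) FE F0).
  apply: (@le_trans _ _ (\int[pi]_x (cst t%:E) x)%E); last first.
    by rewrite integral_cst//= probability_setT mule1.
  apply: ge0_le_integral => //.
  - by move=> x _; apply: integral_ge0.
  - exact: (@measurable_fun_fubini_tonelli_F _ _ _ _ R leb (fun q : PT => (Fk t q)%:E) FE F0).
  - by move=> xi _; apply: integral_Fk_le; exact: ltW.
have Vfin (g : PT -> R) : measurable_fun setT g -> (\int[PL]_q (g q ^+ 2)%:E < +oo)%E ->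
    (chexp mu pi b g u = (V g)%:E)%E.
  by move=> mg g2; rewrite /V chexpE.
have F2 := sqint _ mF mrk Fi.
have R2 n := sqint _ (mRK n) (rkb n) (RKi n).
pose K := u ^+ 2 * t * (b + M2).
have K0 : 0 <= K.
  apply: mulr_ge0; first by apply: mulr_ge0; [exact: sqr_ge0|exact: ltW].
  by rewrite addr_ge0// fine_ge0// integral_ge0// => x _; rewrite lee_fin sqr_ge0.
have Vd n : `|V (RK n) - V (Fk t)| <= K * (t * kmod pi (h n)).
  have h1 := chexp_le_dist pi b0 m2 u (mRK n) mF (rkb n) mrk.
  have h2 := chexp_le_dist pi b0 m2 u mF (mRK n) mrk (rkb n).
  have h3 := FRK n; have Kp : (0 <= K%:E)%E by rewrite lee_fin.
  have h4 := lee_wpmul2l Kp h3.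
  have e : (\int[PL]_q `|RK n q - Fk t q|%:E = \int[PL]_q `|Fk t q - RK n q|%:E)%E.
    by apply: eq_integral => q _; rewrite distrC.
  rewrite e in h1; have h1' := le_trans h1 (leeD2l _ h4).
  have := le_trans h2 (leeD2l _ h4).
  move: h1'; rewrite !Vfin// -!EFinM -!EFinD !lee_fin ler_norml => h5 h6.
  by rewrite lerNl opprB !lerBlDl h5 h6.
have Vc : (fun n => V (RK n)) @ \oo --> V (Fk t).
  apply/cvgrPdist_le => e e0.
  have c : (fun n => K * (t * kmod pi (h n))) @ \oo --> 0.
    rewrite -[X in _ --> X](mulr0 K); apply: cvgMr.
    by rewrite -[X in _ --> X](mulr0 t); apply: cvgMr; exact: kmod_cvg.
  move/cvgrPdist_le : c => /(_ _ e0); apply: filterS => n.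
  rewrite sub0r normrN => h1; rewrite distrC (le_trans (Vd n))//.
  exact: le_trans (ler_norm _) h1.
pose A := fine (\int[Q]_w (cos (u * sym (X t) w))%:E)%E.
(* The values for the Riemann sums. They tend to [A] because the cosine is Lipschitz and the sums of
   Y converge in L1, and to the announced exponential because the exponents of the kernel sums
   converge. *)
pose An n := expR (- (2 * V (RK n))).
have mc (Z : T -> R) : measurable_fun setT Z -> measurable_fun setT (fun w => cos (u * sym Z w)).
  move=> mZ; apply: measurableT_comp; last by apply: measurable_funM => //; exact: measurable_sym.
  by apply: continuous_measurable_fun; exact: continuous_cos.
have ic (Z : T -> R) : measurable_fun setT Z -> Q.-integrable setT (EFin \o (fun w => cos (u * sym Z w))).
  by move=> mZ; apply: (@bounded_integrable R _ _ _ _ 1) => [|w]; [exact: mc|exact: cos_max].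
have AE : (\int[Q]_w (cos (u * sym (X t) w))%:E = A%:E)%E.
  by rewrite fineK//; exact: integrable_fin_num (ic _ mX).
have AnE n : (\int[Q]_w (cos (u * sym (RY n) w))%:E = (An n)%:E)%E.
  apply: (@fdd_chf R d T P Y a b mu pi b0 levy supY n.+1 (fun j => j%:R * h n) (fun=> h n)).
    by move=> w; rewrite /RY mulr_sumr.
  by move=> q; rewrite /RK mulr_sumr.
have Ad n : `|A - An n| <= `|u| * (4 * (t * om n)).
  pose Z w := X t w - RY n w.
  have mZ : measurable_fun setT Z by exact: measurable_funB.
  rewrite -lee_fin -abse_EFin EFinB -AE -AnE -integralB_EFin//; [|exact: ic|exact: ic].
  apply: (@le_trans _ _ (\int[Q]_w (`|u|%:E * (`|sym Z w| `^ 1)%:E))%E).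
    apply: le_trans (le_abse_integral _ _ _) _ => //.
      by apply/measurable_EFinP; apply: measurable_funB; exact: mc.
    apply: ge0_le_integral => //.
    - by apply: measurableT_comp => //; apply/measurable_EFinP; apply: measurable_funB; exact: mc.
    - apply: measurable_funeM; apply/measurable_EFinP; apply: (measurableT_comp (@measurable_powR R _)).
      by apply: measurableT_comp => //; exact: measurable_sym.
    - move=> w _; rewrite -EFinB abse_EFin -EFinM lee_fin powRr1//.
      apply: (le_trans (cos_lip _ _)); rewrite -mulrBr normrM ler_wpM2l//.
      by rewrite /sym /Z le_eqVlt; apply/orP; left; apply/eqP; congr `|_|; ring.
  rewrite ge0_integralZl_EFin//; last first.
    apply/measurable_EFinP; apply: (measurableT_comp (@measurable_powR R _)).
    by apply: measurableT_comp => //; exact: measurable_sym.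
  rewrite EFinM lee_wpmul2l ?lee_fin//.
  apply: (le_trans (sym_moment_le P mZ ler01)).
  rewrite [leRHS]EFinM powRr1// (_ : 2 * 2 = 4 :> R); last by lra.
  rewrite lee_wpmul2l//; apply: le_trans (XRY n).
  by rewrite le_eqVlt; apply/orP; left; apply/eqP; apply: eq_integral => w _; rewrite powRr1.
have Ac : An @ \oo --> A.
  apply/cvgrPdist_le => e e0.
  have c : (fun n => `|u| * (4 * (t * om n))) @ \oo --> 0.
    rewrite -[X in _ --> X](mulr0 `|u|); apply: cvgMr.
    rewrite -[X in _ --> X](mulr0 4); apply: cvgMr.
    by rewrite -[X in _ --> X](mulr0 t); exact: cvgMr.
  move/cvgrPdist_le : c => /(_ _ e0); apply: filterS => n.
  rewrite sub0r normrN => h1; rewrite (le_trans (Ad n))//.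
  exact: le_trans (ler_norm _) h1.
have Ac' : An @ \oo --> expR (- (2 * V (Fk t))).
  apply: continuous_cvg; first exact: continuous_expR.
  by apply: cvgN; exact: cvgMr.
by rewrite AE; congr EFin; exact: (cvg_unique _ Ac Ac').
Qed.

End IntegratedChf.

(** * Moment exponents *)

Lemma powR_le_powRN {R : realType} (v s q : R) : 0 < v -> 0 <= s -> 0 <= q -> v * s <= 1 ->
  s `^ q <= v `^ (- q).
Proof.
move=> v0 s0 q0 vs; rewrite powRN -[leRHS]mul1r ler_pdivlMr ?powR_gt0//.
rewrite -powRM ?(ltW v0)//.
rewrite (_ : 1 = 1 `^ q); last by rewrite powR1.
rewrite ge0_ler_powR ?nnegrE//.
- by rewrite mulr_ge0// ltW.
- by rewrite mulrC.
Qed.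

Lemma sub1cos_le_powR {R : realType} (y g : R) : 0 <= g <= 2 -> 1 - cos y <= 2 * `|y| `^ g.
Proof.
move=> /andP[g0 g2]; have [y1|y1] := leP 1 `|y|.
  have e1 : 1 `^ g = 1 :> R by rewrite powR1.
  have h1 : 1 <= `|y| `^ g.
    by have := @ge0_ler_powR R g g0 1 `|y|; rewrite e1 !nnegrE; apply.
  by have := cos_max y; rewrite ler_norml => /andP[h _]; lra.
have [->|y0] := eqVneq y 0.
  by rewrite cos0 subrr mulr_ge0 ?powR_ge0.
have h1 : y ^+ 2 <= `|y| `^ g.
  rewrite -real_normK ?num_real// -powR_mulrn// /powR !normr_eq0 (negPf y0).
  rewrite ler_expR ler_wnM2r// ln_le0// ltW//.
by have := sub1cos_le_sqr y; have := sqr_ge0 y; lra.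
Qed.

Lemma sub1cos_le_norm {R : realType} (y : R) : 1 - cos y <= `|y|.
Proof.
have := cos_lip 0 y; rewrite cos0 sub0r normrN.
exact: le_trans (ler_norm _).
Qed.

Section MomentBounds.
Context {R : realType} d (T : measurableType d) (P : probability T R).
Variable (S : T -> R).
Hypothesis mS : measurable_fun setT S.

Let mabs q : measurable_fun setT (fun w => (`|S w| `^ q)%:E).
Proof.
apply/measurable_EFinP; apply: (measurableT_comp (@measurable_powR R q)).
exact: measurableT_comp.
Qed.

Let mcos u : measurable_fun setT (fun w => (1 - cos (u * S w))%:E).
Proof. by apply/measurable_EFinP; apply: measurable_1cos; exact: measurable_funM. Qed.

Lemma first_moment_ge u : 0 <= u ->
  (\int[P]_w (1 - cos (u * S w))%:E <= u%:E * \int[P]_w `|S w|%:E)%E.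
Proof.
move=> u0; rewrite -ge0_integralZl_EFin//; last first.
  by apply/measurable_EFinP; exact: measurableT_comp.
apply: ge0_le_integral => //.
- by apply: measurable_funeM; apply/measurable_EFinP; exact: measurableT_comp.
- by move=> w _; rewrite -EFinM lee_fin (le_trans (sub1cos_le_norm _))// normrM ger0_norm.
Qed.

(* Sum over the dyadic blocks [2^n <= u0 |S| < 2^(n+1)], on which
   [1 - cos (u S)] is bounded below for [u = u0 / 2^(n+1)]; then optimize [u0]. *)
Lemma chf_moment_le (A g q : R) : 0 < A -> 0 < q < g ->
  (forall u, 0 < u -> (\int[P]_w (1 - cos (u * S w))%:E <= (A * u `^ g)%:E)%E) ->
  (\int[P]_w (`|S w| `^ q)%:E <=
    ((1 + 16 * (2 `^ (q - g) / (1 - 2 `^ (q - g)))) * A `^ (q / g))%:E)%E.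
Proof.
move=> A0 /andP[q0 qg] hA; have g0 : 0 < g by lra.
pose rho := 2 `^ (q - g) : R.
have rho0 : 0 < rho by rewrite powR_gt0.
have rho1 : rho < 1 by rewrite -(powRr0 2) gt1_ltr_powRr ?ltr1n//; lra.
(* Balances the two parts: A u0^g = 1, while the part u0 |S| < 1 contributes at most u0^(- q) = A^(q
   / g). *)
pose u0 := A `^ (- g^-1).
have u00 : 0 < u0 by rewrite powR_gt0.
have u0q : u0 `^ (- q) = A `^ (q / g) by rewrite -powRrM mulrNN mulrC.
pose h w := (u0 * `|S w|) `^ (-1).
have mh : measurable_fun setT h.
  apply: (measurableT_comp (@measurable_powR R (-1))).
  by apply: measurable_funM => //; exact: measurableT_comp.
have hE w : S w != 0 -> h w = (u0 * `|S w|)^-1.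
  by move=> s0; rewrite /h powR_inv1// mulr_ge0// ltW.
pose C := 16 * A `^ (q / g) * rho.
have C0 : 0 <= C by rewrite mulr_ge0 ?(ltW rho0)// mulr_ge0 ?powR_ge0.
pose D := [set w | (0 < h w <= 1)%R].
have blk n : (\int[P]_(w in [set w | dyblock (h w) n]) (`|S w| `^ q)%:E <= (C * rho ^+ n)%:E)%E.
  pose v : R := u0 * 2^-1 ^+ n.+1.
  have v0 : 0 < v by rewrite mulr_gt0// exprn_gt0.
  pose K : R := 16 * v `^ (- q).
  have K0 : 0 <= K by rewrite mulr_ge0 ?powR_ge0.
  apply: (@le_trans _ _ (\int[P]_w (K%:E * (1 - cos (v * S w))%:E))%E).
    rewrite integral_mkcond; apply: ge0_le_integral => //.
    - by move=> w _; rewrite patchE; case: ifP => // _; rewrite lee_fin powR_ge0.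
    - apply/(measurable_restrictT _ _).1.
        rewrite (_ : [set w | dyblock (h w) n] = setT `&` h @^-1` `](2^-1 ^+ n.+1), (2^-1 ^+ n)]%classic); last first.
          by apply/seteqP; split => w /=; rewrite /dyblock in_itv/=; [split|case].
        exact: mh.
      exact: measurable_funTS.
    - exact: measurable_funeM.
    move=> w _; rewrite patchE -EFinM; case: ifPn => [|_]; last first.
      by rewrite lee_fin mulr_ge0// sub1cos_ge0.
    rewrite inE /= /dyblock => /andP[h1 h2]; rewrite lee_fin.
    (* 0 to the power -1 is 0, so the points with S = 0 have h = 0 and belong to no block. *)
    have s0 : S w != 0.
      apply/eqP => s0; move: h1; rewrite /h s0 normr0 mulr0 powR0 ?oppr_eq0 ?oner_eq0//.
      by rewrite ltNge exprn_ge0// invr_ge0.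
    move: h1 h2; rewrite hE// => h1 h2.
    have us : 0 < u0 * `|S w| by rewrite mulr_gt0// normr_gt0.
    have p2 m : 0 < 2^-1 ^+ m :> R by rewrite exprn_gt0.
    have a1 : `|v * S w| <= 1.
      rewrite normrM (gtr0_norm v0) /v mulrAC -ler_pdivlMl// mulr1 ltW//.
    have a2 : 2^-1 <= `|v * S w|.
      rewrite normrM (gtr0_norm v0) /v mulrAC exprS mulrCA ler_peMr//.
      by rewrite -ler_pdivrMl// mulr1.
    (* |v S| lies between 1/2 and 1, where 1 - cos y >= y^2 / 4. *)
    have c1 : 16^-1 <= 1 - cos (v * S w).
      apply: le_trans (sub1cos_ge_sqr a1); rewrite -real_normK ?num_real//.
      have : 2^-1 * 2^-1 <= `|v * S w| ^+ 2 by rewrite expr2 ler_pM.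
      by lra.
    have c2 : `|S w| `^ q <= v `^ (- q).
      apply: powR_le_powRN => //; first exact: ltW.
      by move: a1; rewrite normrM (gtr0_norm v0).
    rewrite /K mulrC mulrA.
    apply: (@le_trans _ _ (16^-1 * 16 * v `^ (- q))); first by rewrite mulVf ?mul1r.
    by rewrite ler_wpM2r ?powR_ge0// ler_wpM2r.
  rewrite ge0_integralZl_EFin//.
  apply: (@le_trans _ _ (K%:E * (A * v `^ g)%:E)%E); first by rewrite lee_wpmul2l ?lee_fin// hA.
  rewrite -EFinM lee_fin /K /C.
  have e1 : v `^ (- q) * v `^ g = v `^ (g - q).
    rewrite -powRD; last by rewrite (gt_eqF v0) implybT.
    by rewrite addrC.
  have e2 : v `^ (g - q) = u0 `^ (g - q) * rho ^+ n.+1.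
    rewrite /v powRM ?(ltW u00) ?exprn_ge0// /rho powRX.
    have -> : 2^-1 ^+ n.+1 = 2 `^ (- n.+1%:R) :> R by rewrite powRN powR_mulrn// exprVn.
    by rewrite -powRrM; congr (_ * 2 `^ _); ring.
  have e3 : A * u0 `^ (g - q) = A `^ (q / g).
    rewrite /u0 -powRrM -[X in X * _](powRr1 (ltW A0)) -powRD; last by rewrite (gt_eqF A0) implybT.
    by congr (_ `^ _); field; rewrite gt_eqF.
  have -> : 16 * v `^ (- q) * (A * v `^ g) = 16 * (A * (v `^ (- q) * v `^ g)) by ring.
  by rewrite e1 e2 (mulrA A) e3 exprS le_eqVlt; apply/orP; left; apply/eqP; ring.
have := @geometric_integral_le R d T P h (fun w => (`|S w| `^ q)%:E) C rho mh (mabs q) _ C0 _ blk.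
move=> /(_ (fun w => _)) G.
have {}G : (\int[P]_(w in D) (`|S w| `^ q)%:E <= (C / (1 - rho))%:E)%E.
  by apply: G => [w|]; rewrite ?lee_fin ?powR_ge0// (ltW rho0) rho1.
have mD : measurable D.
  rewrite /D (_ : [set w | _] = setT `&` h @^-1` `]0, 1]%classic); first exact: mh.
  by apply/seteqP; split => w /=; rewrite in_itv/=; [split|case].
apply: (@le_trans _ _ (\int[P]_w ((cst (A `^ (q / g))%:E) w + ((fun w => (`|S w| `^ q)%:E) \_ D) w)%E)%E).
  have mDf : measurable_fun setT ((fun w => (`|S w| `^ q)%:E) \_ D).
    by apply/(measurable_restrictT _ _).1 => //; exact: measurable_funTS.
  apply: ge0_le_integral => //.
  - by apply: emeasurable_funD => //; exact: measurable_cst.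
  move=> w _; rewrite /= patchE; case: ifPn => wD.
    by rewrite -EFinD lee_fin lerDr powR_ge0.
  rewrite adde0 lee_fin -u0q.
  move: wD; rewrite notin_setE /D /= => /negP wD.
  have [s0|s0] := eqVneq (S w) 0; first by rewrite s0 normr0 powR0 ?gt_eqF ?powR_ge0.
  have us : 0 < u0 * `|S w| by rewrite mulr_gt0// normr_gt0.
  move: wD; rewrite hE// invr_gt0 us/= -ltNge => wD.
  have {}wD : u0 * `|S w| < 1 by move: wD; rewrite invf_gt1.
  by apply: powR_le_powRN => //; rewrite ltW.
rewrite ge0_integralD//=; last 3 first.
- by move=> _ _; rewrite lee_fin powR_ge0.
- by move=> w _; rewrite patchE; case: ifP => // _; rewrite lee_fin powR_ge0.
- by apply/(measurable_restrictT _ _).1 => //; exact: measurable_funTS.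
rewrite integral_cst//= probability_setT mule1 -integral_mkcond.
apply: (le_trans (leeD2l _ G)).
by rewrite -EFinD lee_fin /C -/rho; lra.
Qed.

End MomentBounds.

(** * Integrals of powers of the integrated kernel *)

Section FkBounds.
Context {R : realType} (pi : probability R R).
Hypothesis pi0 : pi `]-oo, 0%R]%classic = 0%E.
Local Notation PT := (R * measurableTypeR R)%type.
Local Notation PL := (paramm pi).
Local Notation leb := (@lebesgue_measure R).

Lemma integral_pi_pos (f : R -> \bar R) : measurable_fun setT f -> (forall x, 0 <= f x)%E ->
  (\int[pi]_x f x = \int[pi]_(x in `]0%R, +oo[) f x)%E.
Proof.
move=> mf f0; have -> : [set: R] = `]-oo, 0%R]%classic `|` `]0%R, +oo[%classic.
  by apply/seteqP; split => x //= _; rewrite !in_itv/= andbT; case: leP; [left|right].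
rewrite ge0_integral_setU//; last 2 first.
- exact: measurable_funTS.
- by apply/disj_setPS => x /=; rewrite !in_itv/= andbT => -[] /le_lt_trans h /h; rewrite ltxx.
by rewrite null_set_integral ?add0e//; exact: measurable_funTS.
Qed.

(** In F^g = F F^(g - 1 - p) F^p the second factor is bounded through F <= t and the third through F
    <= 1 / xi; the first integrates over v to at most t. *)
Lemma integral_Fk_powR_le t g p : 0 < t -> 0 <= p <= g - 1 ->
  (\int[PL]_q (Fk t q `^ g)%:E <=
   (t `^ (g - p))%:E * \int[pi]_(x in `]0%R, +oo[) (x `^ (- p))%:E)%E.
Proof.
move=> t0 /andP[p0 pg]; have t0' := ltW t0.
have mF : measurable_fun [set: PT] (fun q : PT => (Fk t q `^ g)%:E).
  by apply/measurable_EFinP; apply: (measurableT_comp (@measurable_powR R g)); exact: measurable_Fk.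
have F0 (q : PT) : (0 <= (Fk t q `^ g)%:E)%E by rewrite lee_fin powR_ge0.
have mx : measurable_fun [set: R] (fun x : R => (x `^ (- p))%:E).
  by apply/measurable_EFinP; exact: (@measurable_powR R _).
rewrite (@fubini_tonelli1 _ _ _ _ R pi leb (fun q : PT => (Fk t q `^ g)%:E) mF F0).
rewrite integral_pi_pos; last 2 first.
- exact: (@measurable_fun_fubini_tonelli_F _ _ _ _ R leb (fun q : PT => (Fk t q `^ g)%:E) mF F0).
- by move=> x; apply: integral_ge0.
rewrite -ge0_integralZl_EFin ?powR_ge0//; last 2 first.
- by move=> x _; rewrite lee_fin powR_ge0.
- exact: measurable_funTS.
apply: ge0_le_integral => //.
- by move=> x _; apply: integral_ge0.
- apply: measurable_funTS.
  exact: (@measurable_fun_fubini_tonelli_F _ _ _ _ R leb (fun q : PT => (Fk t q `^ g)%:E) mF F0).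
- by apply: measurable_funeM; exact: measurable_funTS.
move=> xi; rewrite /= in_itv/= andbT => xi0; rewrite /fubini_F -EFinM.
pose c := t `^ (g - 1 - p) * xi `^ (- p).
have c0 : 0 <= c by rewrite mulr_ge0 ?powR_ge0.
have mFv : measurable_fun setT (fun v => (Fk t (xi, v))%:E).
  by apply/measurable_EFinP; exact: (measurableT_comp (@measurable_Fk R t) (pair1_measurable xi)).
apply: (@le_trans _ _ (\int[leb]_v (c%:E * (Fk t (xi, v))%:E))%E).
  apply: ge0_le_integral => //.
  - exact: (measurableT_comp mF (pair1_measurable xi)).
  - exact: measurable_funeM.
  move=> v _; rewrite -EFinM lee_fin.
  have f0 := Fk_ge0 (xi, v) t0'; have ft := Fk_le_t (xi, v) t0'.
  have fx := Fk_le_inv v t0' xi0.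
  rewrite le_eqVlt in f0; case/predU1P: f0 => [<-|f0].
    by rewrite mulr0 powR0// gt_eqF//; lra.
  rewrite (_ : g = 1 + ((g - 1 - p) + p)); last by ring.
  rewrite powRD ?(gt_eqF f0) ?implybT// powRr1 ?(ltW f0)// mulrC ler_wpM2r ?(ltW f0)//.
  rewrite powRD ?(gt_eqF f0) ?implybT// /c.
  apply: ler_pM; rewrite ?powR_ge0//.
    by apply: ge0_ler_powR; rewrite ?nnegrE ?(ltW f0)//; lra.
  apply: powR_le_powRN => //; first exact: ltW.
  by rewrite mulrC -ler_pdivlMr// div1r.
rewrite ge0_integralZl_EFin//; last by move=> v _; rewrite lee_fin Fk_ge0.
apply: (le_trans (lee_wpmul2l _ (integral_Fk_le xi t0'))); first by rewrite lee_fin.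
rewrite -EFinM lee_fin /c mulrAC ler_wpM2r ?powR_ge0//.
rewrite -[X in _ * X](powRr1 t0') -powRD ?(gt_eqF t0) ?implybT//.
by rewrite (_ : g - 1 - p + 1 = g - p)//; ring.
Qed.

Lemma measurable_box_fun (A : set R) (v1 v2 c : R) : measurable A ->
  measurable_fun [set: PT] (fun q : PT => (c * \1_A q.1) * \1_(`[v1, v2]%classic) q.2).
Proof.
move=> mA; have mcA : measurable_fun setT (fun x : R => c * \1_A x).
  by apply: measurable_funM => //; exact: measurable_indic.
have mI : measurable_fun setT (\1_(`[v1, v2]%classic) : measurableTypeR R -> R).
  exact: measurable_indic.
apply: measurable_funM; first exact: (measurableT_comp mcA measurable_fst).
exact: (measurableT_comp mI measurable_snd).
Qed.

Lemma integral_PL_box (f : PT -> R) (A : set R) (v1 v2 c : R) :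
  measurable_fun setT f -> (forall q, 0 <= f q) -> measurable A -> v1 <= v2 -> 0 <= c ->
  (forall xi v, A xi -> v1 <= v <= v2 -> c <= f (xi, v)) ->
  (c%:E * (pi A * (v2 - v1)%:E) <= \int[PL]_q (f q)%:E)%E.
Proof.
move=> mf f0 mA v12 c0 hf.
have -> : (c%:E * (pi A * (v2 - v1)%:E) =
    \int[PL]_q ((c * \1_A q.1) * \1_(`[v1, v2]%classic) q.2)%:E)%E.
  rewrite (@ge0_integral_prodM _ _ _ _ _ pi leb (fun x => c * \1_A x) (\1_(`[v1, v2]%classic : set R))).
  - under [X in (_ = X * _)%E]eq_integral do rewrite EFinM.
    rewrite ge0_integralZl_EFin//; last by apply/measurable_EFinP; exact: measurable_indic.
    have -> : (\int[pi]_x (\1_A x)%:E = pi A)%E by rewrite integral_indic// setIT.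
    have -> : (\int[leb]_y (\1_(`[v1, v2]%classic) y)%:E = (v2 - v1)%:E)%E.
      rewrite integral_indic//= setIT; have := @lebesgue_measure_itv R `[v1, v2].
      rewrite /= lte_fin => ->.
      by move: v12; rewrite le_eqVlt => /predU1P[->|->]; rewrite ?ltxx ?subrr.
    by rewrite muleA.
  - by apply: measurable_funM => //; exact: measurable_indic.
  - exact: measurable_indic.
  - by move=> x; rewrite mulr_ge0.
  - by move=> x.
apply: ge0_le_integral => //.
- by move=> q _; rewrite lee_fin !mulr_ge0.
- apply/measurable_EFinP; exact: measurable_box_fun.
- exact/measurable_EFinP.
move=> [xi v] _; rewrite lee_fin /= !indicE.
case: (boolP (xi \in A)) => [/set_mem xA|_]; last by rewrite mulr0 mul0r.
case: (boolP (v \in _)) => [/set_mem/=|_]; last by rewrite mulr0.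
by rewrite in_itv/= => vv; rewrite !mulr1 hf.
Qed.

End FkBounds.

Section JumpBox.
Context {R : realType} (pi : probability R R) (mu : {sigma_finite_measure set R -> \bar R}) (b : R).
Hypothesis b0 : 0 <= b.
Local Notation PT := (R * measurableTypeR R)%type.
Local Notation PL := (paramm pi).
Local Notation nu := (PL \x mu)%E.

(** On the box the argument y of the cosine satisfies c <= |y| <= 1, where 1 - cos y >= y^2 / 4. The
    lower bounds for the jump part of the exponent amount to the choice of such a box. *)
Lemma chexp_ge_box (g : PT -> R) (A B : set R) (v1 v2 c u : R) :
  measurable_fun setT g -> measurable A -> measurable B -> v1 <= v2 -> 0 <= c ->
  (forall xi v x, A xi -> v1 <= v <= v2 -> B x -> c <= `|u * (g (xi, v) * x)| <= 1) ->
  ((c ^+ 2 / 4)%:E * (pi A * (v2 - v1)%:E * mu B) <= chexp mu pi b g u)%E.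
Proof.
move=> mg mA mB v12 c0 hf.
have mj : measurable_fun setT (fun z : PT * R => (1 - cos (u * jump g z))%:E).
  apply/measurable_EFinP; apply: measurable_1cos; apply: measurable_funM => //.
  exact: measurable_jump.
have j0 (z : PT * R) : (0 <= (1 - cos (u * jump g z))%:E)%E by rewrite lee_fin sub1cos_ge0.
apply: (@le_trans _ _ (\int[nu]_z (1 - cos (u * jump g z))%:E)%E); last first.
  rewrite /chexp leeDr//; apply: integral_ge0 => q _.
  by rewrite lee_fin divr_ge0// mulr_ge0// sqr_ge0.
pose k (q : PT) : R := (c ^+ 2 / 4 * \1_A q.1) * \1_(`[v1, v2]%classic) q.2.
have c40 : 0 <= c ^+ 2 / 4 by rewrite divr_ge0// sqr_ge0.
have mk : measurable_fun [set: PT] k.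
  exact: measurable_box_fun.
have k0 q : 0 <= k q by rewrite !mulr_ge0.
apply: (@le_trans _ _ (\int[nu]_z (k z.1 * \1_B z.2)%:E)%E).
  rewrite (@ge0_integral_prodM _ _ _ _ _ PL mu k (\1_B))//.
  rewrite integral_indic// setIT muleA lee_wpmul2r//.
  apply: integral_PL_box => // xi v xA vv.
  by rewrite /k /= !indicE !mem_set//= ?mulr1// in_itv.
apply: ge0_le_integral => //.
- by move=> z _; rewrite lee_fin mulr_ge0.
- apply/measurable_EFinP; apply: measurable_funM.
    exact: (measurableT_comp mk measurable_fst).
  have mI : measurable_fun setT (\1_B : R -> R) by exact: measurable_indic.
  exact: (measurableT_comp mI measurable_snd).
move=> [[xi v] x] _; rewrite lee_fin /k /jump /= !indicE.
have [xA|_] := boolP (xi \in A); last by rewrite mulr0 !mul0r sub1cos_ge0.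
have [vv|_] := boolP (v \in _); last by rewrite mulr0 mul0r sub1cos_ge0.
have [xB|_] := boolP (x \in B); last by rewrite mulr0 sub1cos_ge0.
move: vv; rewrite inE /= in_itv/= => vv.
have /andP[h1 h2] := hf xi v x (set_mem xA) vv (set_mem xB).
rewrite !mulr1; apply: (le_trans _ (sub1cos_ge_sqr h2)).
by rewrite ler_pM2r// -[leRHS]real_normK ?num_real// lerXn2r ?nnegrE.
Qed.

End JumpBox.

Lemma powRD_gt0 {R : realType} (t x y : R) : 0 < t -> t `^ (x + y) = t `^ x * t `^ y.
Proof. by move=> t0; rewrite powRD// (gt_eqF t0) implybT. Qed.

Lemma powR_inv_mul {R : realType} (k t x : R) : 0 <= k -> 0 <= t ->
  ((k * t)^-1) `^ x = k `^ (- x) * t `^ (- x).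
Proof.
move=> k0 t0; rewrite -powR_inv1 ?mulr_ge0// -powRrM mulN1r powRM//.
Qed.

Lemma half_le_pred {R : realType} (y : R) : 2 <= y -> y / 2 <= y - 1.
Proof. lra. Qed.

(** * Growth in t of moments and exponents *)

Section Family.
Context {R : realType} dQ (TQ : measurableType dQ) (Q : probability TQ R).
Variables (b alpha : R) (mu : {sigma_finite_measure set R -> \bar R}) (pi : probability R R).
Variable (S : R -> TQ -> R).
Local Notation PT := (R * measurableTypeR R)%type.
Local Notation PL := (paramm pi).
Local Notation nu := (PL \x mu)%E.
Hypotheses (b0 : 0 <= b) (a0 : 0 < alpha).
Hypothesis mu_even : forall j, (0 < j)%N -> (\int[mu]_x (x ^+ j.*2)%:E < +oo)%E.
Hypothesis pi0 : pi `]-oo, 0%R]%classic = 0%E.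
Hypothesis Hinv : forall q, 0 <= q < alpha ->
  (\int[pi]_(x in `]0%R, +oo[) (x `^ (- q))%:E < +oo)%E.
Hypothesis Hlow : forall e, 0 < e -> exists c r : R, [/\ 0 < c, 0 < r &
  forall x, 0 < x <= r -> ((c * x `^ (alpha + e))%:E <= pi `[x, (4 * x)%R]%classic)%E].
Hypothesis mS : forall t, measurable_fun setT (S t).
Hypothesis Smom : forall t n, 0 < t -> (\int[Q]_w (S t w ^+ n.*2)%:E < +oo)%E.
Hypothesis hS : forall t u, 0 < t ->
  (\int[Q]_w (cos (u * S t w))%:E = (expR (- (2 * fine (chexp mu pi b (Fk t) u))))%:E)%E.

Let m2 : (\int[mu]_x (x ^+ 2)%:E < +oo)%E := mu_even (ltn0Sn 0).

Let mF t : measurable_fun [set: PT] (Fk t : PT -> R). Proof. exact: measurable_Fk. Qed.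

Let even_ge0 n (x : R) : 0 <= x ^+ n.*2.
Proof. by rewrite -mul2n exprM exprn_ge0 ?sqr_ge0. Qed.

Let M j := fine (\int[mu]_x (x ^+ j.*2)%:E)%E.

Let ME j : (0 < j)%N -> (\int[mu]_x (x ^+ j.*2)%:E = (M j)%:E)%E.
Proof.
by move=> j0; rewrite fineK// ge0_fin_numE ?mu_even// integral_ge0// => x _; rewrite lee_fin.
Qed.

Let M0 j : 0 <= M j.
Proof. by rewrite fine_ge0// integral_ge0// => x _; rewrite lee_fin. Qed.

Let Ipow p := fine (\int[pi]_(x in `]0%R, +oo[) (x `^ (- p))%:E)%E.

Let IpowE p : 0 <= p < alpha ->
  (\int[pi]_(x in `]0%R, +oo[) (x `^ (- p))%:E = (Ipow p)%:E)%E.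
Proof.
by move=> pa; rewrite fineK// ge0_fin_numE ?Hinv// integral_ge0// => x _; rewrite lee_fin powR_ge0.
Qed.

Let Ipow_ge0 p : 0 <= Ipow p.
Proof. by rewrite fine_ge0// integral_ge0// => x _; rewrite lee_fin powR_ge0. Qed.

Let F_le t g p : 0 < t -> 0 <= p < alpha -> p <= g - 1 ->
  (\int[PL]_q (Fk t q `^ g)%:E <= (t `^ (g - p) * Ipow p)%:E)%E.
Proof.
move=> t0 pa pg; rewrite EFinM -IpowE//; apply: integral_Fk_powR_le => //.
by rewrite pg andbT; have /andP[] := pa.
Qed.

Let Fpow t n (q : PT) : 0 < t -> Fk t q ^+ n = Fk t q `^ n%:R.
Proof. by move=> t0; rewrite powR_mulrn// Fk_ge0// ltW. Qed.

Lemma Fk_sqr_lty t : 0 < t -> (\int[PL]_q (Fk t q ^+ 2)%:E < +oo)%E.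
Proof.
move=> t0; under eq_integral do rewrite Fpow//.
by apply: (le_lt_trans (@F_le t 2 0 _ _ _)) => //; rewrite ?lexx ?a0 ?ltry//; lra.
Qed.

Let G t j := fine (\int[PL]_q (Fk t q ^+ j.*2)%:E)%E.

Let G_le t j p : 0 < t -> (0 < j)%N -> 0 <= p < alpha -> p <= j.*2%:R - 1 ->
  (\int[PL]_q (Fk t q ^+ j.*2)%:E = (G t j)%:E)%E /\ 0 <= G t j <= t `^ (j.*2%:R - p) * Ipow p.
Proof.
move=> t0 j0 pa pj.
have i0 : (0 <= \int[PL]_q (Fk t q ^+ j.*2)%:E)%E by apply: integral_ge0 => q _; rewrite lee_fin.
have le : (\int[PL]_q (Fk t q ^+ j.*2)%:E <= (t `^ (j.*2%:R - p) * Ipow p)%:E)%E.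
  by under eq_integral do rewrite Fpow//; exact: F_le.
have fin : (\int[PL]_q (Fk t q ^+ j.*2)%:E)%E \is a fin_num.
  by rewrite ge0_fin_numE// (le_lt_trans le) ?ltry.
by rewrite /G fineK// fine_ge0//= -lee_fin fineK.
Qed.

Let cumt t j := pair_cumul b mu pi (Fk t : PT -> R) j.

Let G_E t j : 0 < t -> (0 < j)%N -> (\int[PL]_q (Fk t q ^+ j.*2)%:E = (G t j)%:E)%E.
Proof.
move=> t0 j0; have pj : 0 <= j.*2%:R - 1 :> R by rewrite subr_ge0 ler1n double_gt0.
have pa : (0 : R) <= 0 < alpha by rewrite lexx a0.
by have [] := G_le t0 j0 pa pj.
Qed.

Let G0 t j : 0 <= G t j.
Proof. by rewrite fine_ge0// integral_ge0// => q _; rewrite lee_fin. Qed.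

Let cumtE t j : 0 < t -> (0 < j)%N ->
  cumt t j = 2 * (G t j * M j / j.*2`!%:R) + (j == 1)%:R * (b * G t 1).
Proof.
move=> t0 j0; rewrite /cumt pair_cumulE//.
rewrite G_E// ME// -EFinM [fine _]/= /gvar; congr (_ + _ * _).
by rewrite /G (_ : 1.*2 = 2)%N//; lra.
Qed.

(** The exponent allowed, up to e, for the growth of the moment of order 2k: t^k is the growth of a
    sum of weakly dependent terms, t^(2k - alpha) comes from the slow rates xi <= 1 / t. *)
Let E_ (k : nat) : R := Num.max k%:R (k.*2%:R - alpha).

(** [E_] is superadditive, so the recursion propagates the exponent. Each cumulant costs one e, and
    a moment of order 2j involves products of at most j of them. *)
Lemma smom_upper (e : R) : 0 < e <= alpha -> forall k, exists2 C : R, 0 <= C &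
  forall j t, (j <= k)%N -> 1 <= t -> smom Q (S t) j <= C * t `^ (E_ j + j%:R * e).
Proof.
move=> /andP[e0 ea].
have cum_le j : (0 < j)%N -> exists2 K : R, 0 <= K & forall t, 1 <= t -> cumt t j <= K * t `^ (E_ j + e).
  move=> j0; have j1 : 1 <= j%:R :> R by rewrite ler1n.
  have j2 : j.*2%:R = 2 * j%:R :> R by rewrite -mul2n natrM.
  (* The best choice: p < alpha for the integral of xi^(- p), and p <= 2j - 1 for [G_le]. Then 2j -
     p is at most E_ j + e. *)
  pose p : R := Num.min (alpha - e) (j.*2%:R - 1).
  have pa : 0 <= p < alpha.
    by rewrite /p le_min gt_min; apply/andP; split; [apply/andP; split|apply/orP; left]; lra.
  have pj : p <= j.*2%:R - 1 by rewrite ge_min lexx orbT.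
  exists ((2 * M j + b) * Ipow p) => [|t t1]; first by rewrite mulr_ge0// addr_ge0// mulr_ge0.
  have t0 : 0 < t by lra.
  have [_ /andP[g0 gle]] := G_le t0 j0 pa pj.
  have le1 : cumt t j <= (2 * M j + b) * G t j.
    have f1 : 1 <= j.*2`!%:R :> R by rewrite ler1n fact_gt0.
    have h1 : G t j * M j / j.*2`!%:R <= M j * G t j.
      by rewrite ler_pdivrMr ?(lt_le_trans ltr01)// [M j * _]mulrC ler_peMr// mulr_ge0.
    have h2 : (j == 1)%:R * (b * G t 1) <= b * G t j.
      by case: eqP => [->|_]; rewrite ?mul1r ?mul0r// mulr_ge0.
    by rewrite cumtE//; lra.
  apply: (le_trans le1); rewrite -mulrA ler_wpM2l ?addr_ge0 ?mulr_ge0//.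
  apply: (le_trans gle); rewrite mulrC ler_wpM2l// ler_powR//.
  rewrite /p /E_; case: (leP (alpha - e) _) => h.
    have : j.*2%:R - alpha <= Num.max j%:R (j.*2%:R - alpha) :> R by rewrite le_max lexx orbT.
    by lra.
  have : j%:R <= Num.max j%:R (j.*2%:R - alpha) :> R by rewrite le_max lexx.
  by lra.
elim=> [|k [C C0 hC]].
  exists 1 => // j t; rewrite leqn0 => /eqP -> t1.
  rewrite smom_prob0 mul1r /E_ double0 sub0r max_l ?mul0r ?addr0 ?powRr0//; lra.
have /choice[K hK] : forall j, exists K : R, 0 <= K /\ ((0 < j)%N -> forall t, 1 <= t -> cumt t j <= K * t `^ (E_ j + e)).
  move=> [|j]; first by exists 0.
  by have [K K0 hK] := cum_le j.+1 isT; exists K.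
have K0 j := (hK j).1.
pose B := \sum_(i < k.+1) K i.+1 * C.
have B0 : 0 <= B by rewrite sumr_ge0// => i _; rewrite mulr_ge0.
exists (C + B) => [|j t]; first exact: addr_ge0.
rewrite leq_eqVlt => /predU1P[->|]; last first.
  rewrite ltnS => jk t1; apply: (le_trans (hC j t jk t1)).
  by rewrite ler_wpM2r ?powR_ge0// lerDl.
move=> t1; have t0 : 0 < t by lra.
have h := pair_smom_rec b0 m2 (mS t) (mF t) (Fk_sqr_lty t0) (fun n => Smom n t0) (fun u => hS u t0) k.
apply: (le_trans h).
apply: (@le_trans _ _ (B * t `^ (E_ k.+1 + k.+1%:R * e))); last first.
  by rewrite ler_wpM2r ?powR_ge0// lerDr.
rewrite /B mulr_suml; apply: ler_sum => i _.
have ik : (i <= k)%N by rewrite -ltnS.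
apply: (@le_trans _ _ ((K i.+1 * t `^ (E_ i.+1 + e)) * (C * t `^ (E_ (k - i)%N + (k - i)%N%:R * e)))).
  apply: ler_pM; rewrite ?smom_ge0//.
  - exact: pair_cumul_ge0.
  - exact: (hK i.+1).2.
  - by apply: hC => //; rewrite leq_subr.
rewrite mulrACA -powRD_gt0// ler_wpM2l ?mulr_ge0// ler_powR//.
have kE : k.+1%:R = i.+1%:R + (k - i)%N%:R :> R by rewrite -natrD addSn subnKC.
have i1 : 1 <= i.+1%:R :> R by rewrite ler1n.
have ki0 : 0 <= (k - i)%N%:R :> R by [].
have : E_ i.+1 + E_ (k - i)%N <= E_ k.+1.
  rewrite /E_ -!mul2n !natrM kE.
  rewrite le_max; apply/orP.
  have [?|?] := leP i.+1%:R (2 * i.+1%:R - alpha : R);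
  have [?|?] := leP (k - i)%N%:R (2 * (k - i)%N%:R - alpha : R);
  by [right; lra|left; lra].
have : e + (k - i)%N%:R * e <= k.+1%:R * e.
  by rewrite kE mulrDl lerD2r ler_peMl// ltW.
lra.
Qed.

Let G_ge j c t A (v1 v2 : R) : 0 < t -> (0 < j)%N -> measurable A -> v1 <= v2 -> 0 <= c ->
  (forall xi v, A xi -> v1 <= v <= v2 -> c <= Fk t (xi, v)) ->
  ((c ^+ j.*2)%:E * (pi A * (v2 - v1)%:E) <= (G t j)%:E)%E.
Proof.
move=> t0 j0 mA v12 c0 hc.
rewrite -G_E//.
apply: (@integral_PL_box R pi (fun q => Fk t q ^+ j.*2)) => //.
- by apply: measurable_funX; exact: mF.
- by move=> xi v xA vv; rewrite lerXn2r ?nnegrE ?(ltW t0)// ?Fk_ge0 ?(ltW t0)//; exact: hc.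
Qed.

Let small_mass e : 0 < e -> exists c t1 : R, [/\ 0 < c, 1 <= t1 &
  forall t, t1 <= t -> exists A : set R, [/\ measurable A,
    (forall xi, A xi -> 0 < xi <= t^-1) & ((c * t `^ (- (alpha + e)))%:E <= pi A)%E]].
Proof.
move=> e0; have [c [r [c0 r0 hr]]] := Hlow e0.
exists (c * 4 `^ (- (alpha + e))), (Num.max 1 r^-1); split.
- by rewrite mulr_gt0// powR_gt0.
- by rewrite le_max lexx.
move=> t; rewrite ge_max => /andP[t1 rt]; have t0 : 0 < t by lra.
have x0 : 0 < (4 * t)^-1 by rewrite invr_gt0 mulr_gt0.
exists `[(4 * t)^-1, (4 * (4 * t)^-1)]%classic; split => //.
  move=> xi; rewrite /= in_itv/= => /andP[x1 x2]; rewrite (lt_le_trans x0 x1)/=.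
  by rewrite (le_trans x2)// invfM mulrA mulfV ?mul1r.
rewrite -mulrA -powR_inv_mul ?(ltW t0)//; apply: hr; rewrite x0/=.
rewrite -[leRHS]invrK lef_pV2 ?posrE ?invr_gt0 ?mulr_gt0//.
by rewrite (le_trans rt)// ler_peMl ?(ltW t0)// ler1n.
Qed.

Lemma G_lower j e : 0 < e -> (0 < j)%N -> exists c t1 : R, [/\ 0 < c, 1 <= t1 &
  forall t, t1 <= t -> c * t `^ (j.*2%:R - alpha - e) <= G t j].
Proof.
move=> e0 j0; have [c [t1 [c0 t11 h]]] := small_mass e0.
exists (expR (- 2) ^+ j.*2 * c), t1; split=> //; first by rewrite mulr_gt0// exprn_gt0// expR_gt0.
move=> t tt; have t0 : 0 < t by lra.
have [A [mA hA pA]] := h t tt.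
have := @G_ge j (t * expR (- 2)) t A (-1) 0 t0 j0 mA.
rewrite lerN10 mulr_ge0 ?expR_ge0 ?(ltW t0)// => /(_ isT isT) gg.
have {}gg : (((t * expR (- 2)) ^+ j.*2)%:E * (pi A * (0 - -1)%:E) <= (G t j)%:E)%E.
  by apply: gg => xi v /hA/andP[/ltW x1 x2] vv; apply: Fk_ge_small => //; rewrite x1.
rewrite -lee_fin; apply: le_trans gg.
rewrite opprK add0r mule1.
apply: (@le_trans _ _ (((t * expR (- 2)) ^+ j.*2)%:E * (c * t `^ (- (alpha + e)))%:E)%E); last first.
  by rewrite lee_wpmul2l// lee_fin exprn_ge0// mulr_ge0 ?expR_ge0 ?(ltW t0).
rewrite -EFinM lee_fin exprMn -[t ^+ _](powR_mulrn _ (ltW t0)).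
rewrite (_ : j.*2%:R - alpha - e = j.*2%:R + (- (alpha + e))); last by ring.
by rewrite powRD_gt0// le_eqVlt; apply/orP; left; apply/eqP; ring.
Qed.

(** The box [r, 4 r] x [0, r t - 1] has length linear in t, and the integrated kernel is bounded
    below on it by a constant. *)
Lemma G1_linear : exists c t1 : R, [/\ 0 < c, 1 <= t1 & forall t, t1 <= t -> c * t <= G t 1].
Proof.
have [c [r [c0 r0 hr]]] := Hlow ltr01.
pose k := (expR (- 1) / (4 * r)) ^+ 2.
have k0 : 0 < k by rewrite exprn_gt0// divr_gt0 ?expR_gt0// mulr_gt0.
exists (k * (c * r `^ (alpha + 1)) * (r / 2)), (Num.max 1 (2 / r)); split.
- by rewrite mulr_gt0 ?divr_gt0// mulr_gt0// mulr_gt0// powR_gt0.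
- by rewrite le_max lexx.
move=> t; rewrite ge_max => /andP[t1 tr]; have t0 : 0 < t by lra.
have rt : 2 <= t * r by rewrite -ler_pdivrMr.
have := @G_ge 1 (expR (- 1) / (4 * r)) t `[r, (4 * r)]%classic 0 (r * t - 1) t0 isT (measurable_itv _).
rewrite (_ : 1.*2 = 2)%N// -/k => gg.
have {}gg : (k%:E * (pi `[r, (4 * r)%R]%classic * (r * t - 1 - 0)%:E) <= (G t 1)%:E)%E.
  apply: gg; [by lra|by rewrite divr_ge0 ?expR_ge0// mulr_ge0// ltW|].
  move=> xi v; rewrite /= in_itv/= => /andP[x1 x2] /andP[v1 v2].
  have xi0 : 0 < xi by lra.
  apply: (@le_trans _ _ (expR (- 1) / xi)).
    by rewrite ler_wpM2l ?expR_ge0// lef_pV2 ?posrE ?mulr_gt0.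
  apply: Fk_ge_large => //; first exact: ltW.
  have : r * t <= xi * t by rewrite ler_wpM2r// ltW.
  by lra.
rewrite -lee_fin; apply: le_trans gg.
have -> : k * (c * r `^ (alpha + 1)) * (r / 2) * t = k * ((c * r `^ (alpha + 1)) * (r / 2 * t)).
  by ring.
rewrite EFinM lee_wpmul2l ?lee_fin ?(ltW k0)// EFinM subr0.
apply: lee_pmul; rewrite ?lee_fin.
- by rewrite mulr_ge0 ?powR_ge0// ltW.
- by rewrite mulr_ge0 ?(ltW t0)// divr_ge0// ltW.
- by apply: hr; rewrite r0 lexx.
- lra.
Qed.

Hypothesis Mpos : forall j, (0 < j)%N -> 0 < M j.

Lemma smom_lower j e : 0 < e -> (0 < j)%N -> exists c t1 : R, [/\ 0 < c, 1 <= t1 &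
  forall t, t1 <= t -> c * t `^ (j.*2%:R - alpha - e) <= smom Q (S t) j].
Proof.
move=> e0 j0; have [c [t1 [c0 t11 h]]] := G_lower e0 j0.
pose k := 2 * (M j / j.*2`!%:R).
have k0 : 0 < k by rewrite mulr_gt0// divr_gt0 ?Mpos// ltr0n fact_gt0.
exists (k * c), t1; split=> //; first exact: mulr_gt0.
move=> t tt; have t0 : 0 < t by lra.
case: j j0 @k k0 h => // j j0 k k0 h.
apply: (le_trans _ (pair_cumul_le b0 m2 (mS t) (mF t) (Fk_sqr_lty t0) (fun n => Smom n t0) (fun u => hS u t0) j)).
rewrite -/(cumt t j.+1) cumtE//.
apply: (@le_trans _ _ (k * G t j.+1)); first by rewrite -mulrA ler_wpM2l ?(ltW k0)// h.
have -> : k * G t j.+1 = 2 * (G t j.+1 * M j.+1 / j.+1.*2`!%:R) by rewrite /k; ring.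
by rewrite lerDl mulr_ge0// mulr_ge0.
Qed.

Lemma smom1_linear : exists c t1 : R, [/\ 0 < c, 1 <= t1 &
  forall t, t1 <= t -> c * t <= smom Q (S t) 1].
Proof.
have [c [t1 [c0 t11 h]]] := G1_linear.
exists (M 1 * c), t1; split=> //; first by rewrite mulr_gt0// Mpos.
move=> t tt; have t0 : 0 < t by lra.
apply: (le_trans _ (pair_cumul_le b0 m2 (mS t) (mF t) (Fk_sqr_lty t0) (fun n => Smom n t0) (fun u => hS u t0) 0)).
rewrite -/(cumt t 1) cumtE//.
have Gp := G0 t 1.
apply: (@le_trans _ _ (M 1 * G t 1)); first by rewrite -mulrA ler_wpM2l// h.
rewrite (_ : 1.*2`!%:R = 2 :> R)// mul1r.
have : 0 <= b * G t 1 by rewrite mulr_ge0.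
by lra.
Qed.

Let Q1 t u : 0 < t -> (\int[Q]_w (1 - cos (u * S t w))%:E =
  (1 - expR (- (2 * fine (chexp mu pi b (Fk t) u))))%:E)%E.
Proof.
move=> t0; under eq_integral do rewrite EFinB.
rewrite integralB_EFin//=.
- by rewrite hS// integral_cst//= probability_setT mule1.
- by apply: (@bounded_integrable R _ _ _ _ 1) => // w; rewrite normr1.
- apply: (@bounded_integrable R _ _ _ _ 1) => [|w]; last exact: cos_max.
  apply: measurableT_comp; last by apply: measurable_funM => //; exact: mS.
  by apply: continuous_measurable_fun; exact: continuous_cos.
Qed.

Let chfin t u : 0 < t -> (chexp mu pi b (Fk t) u = (fine (chexp mu pi b (Fk t) u))%:E)%E.
Proof. by move=> t0; rewrite (chexpE b0 (mF t) (Fk_sqr_lty t0) m2). Qed.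

(** The Gaussian part scales like u^2, which forces g = 2 unless b = 0. The jump part uses 1 - cos y
    <= 2 |y|^g. *)
Lemma chexp_upper g u t : 0 < t -> 0 < u -> 1 <= g <= 2 -> b = 0 \/ g = 2 ->
  (\int[mu]_x (`|x| `^ g)%:E < +oo)%E ->
  (chexp mu pi b (Fk t) u <= ((b + 2 * fine (\int[mu]_x (`|x| `^ g)%:E)%E) * u `^ g)%:E *
     \int[PL]_q (Fk t q `^ g)%:E)%E.
Proof.
move=> t0 u0 /andP[g1 g2] bg mg.
have mpow : measurable_fun setT (fun x : R => `|x| `^ g).
  exact: (measurableT_comp (@measurable_powR R g) (@normr_measurable R setT)).
have mFg : measurable_fun [set: PT] (fun q : PT => Fk t q `^ g).
  by apply: (measurableT_comp (@measurable_powR R g)); exact: mF.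
have mFgE : measurable_fun [set: PT] (fun q : PT => (Fk t q `^ g)%:E) by exact/measurable_EFinP.
have p0 (q : PT) : (0 <= (Fk t q `^ g)%:E)%E by rewrite lee_fin powR_ge0.
have I0 : (0 <= \int[mu]_x (`|x| `^ g)%:E)%E by apply: integral_ge0 => x _; rewrite lee_fin powR_ge0.
have IE : (\int[mu]_x (`|x| `^ g)%:E)%E \is a fin_num by rewrite ge0_fin_numE.
rewrite mulrDl EFinD ge0_muleDl ?lee_fin ?mulr_ge0 ?powR_ge0 ?fine_ge0//.
rewrite /chexp leeD//.
  rewrite -ge0_integralZl_EFin ?mulr_ge0 ?powR_ge0//.
  apply: ge0_le_integral => //.
  - by move=> q _; rewrite lee_fin divr_ge0// mulr_ge0// sqr_ge0.
  - apply/measurable_EFinP; apply: measurable_funM => //; apply: measurable_funM => //.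
    by apply: measurable_funX; apply: measurable_funM => //; exact: mF.
  - exact: measurable_funeM.
  move=> q _; rewrite -EFinM lee_fin; case: bg => [->|->]; first by rewrite !mul0r.
  have Fq := Fk_ge0 q (ltW t0).
  rewrite !powR_mulrn ?(ltW u0)// exprMn.
  have : 0 <= b * (u ^+ 2 * Fk t q ^+ 2) by rewrite mulr_ge0// mulr_ge0// sqr_ge0.
  by lra.
apply: (@le_trans _ _ (\int[nu]_z ((2 * u `^ g)%:E * ((Fk t z.1 `^ g) * (`|z.2| `^ g))%:E))%E).
  have mz : measurable_fun setT (fun z : PT * R => ((Fk t z.1 `^ g) * (`|z.2| `^ g))%:E).
    apply/measurable_EFinP; apply: measurable_funM.
      exact: (measurableT_comp mFg measurable_fst).
    exact: (measurableT_comp mpow measurable_snd).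
  apply: ge0_le_integral => //.
  - apply/measurable_EFinP; apply: measurable_1cos; apply: measurable_funM => //.
    exact: (measurable_jump (mF t)).
  - exact: measurable_funeM.
  move=> z _; rewrite -EFinM lee_fin /jump.
  apply: (le_trans (@sub1cos_le_powR R _ g _)); first by apply/andP; split; lra.
  rewrite !normrM (gtr0_norm u0) (ger0_norm (Fk_ge0 z.1 (ltW t0))).
  rewrite powRM ?mulr_ge0 ?Fk_ge0 ?(ltW u0) ?(ltW t0)// powRM ?Fk_ge0 ?(ltW t0)//.
  by rewrite -!mulrA.
rewrite ge0_integralZl_EFin ?mulr_ge0 ?powR_ge0//; last 2 first.
- by move=> z _; rewrite lee_fin mulr_ge0 ?powR_ge0.
- apply/measurable_EFinP; apply: measurable_funM.
    exact: (measurableT_comp mFg measurable_fst).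
  exact: (measurableT_comp mpow measurable_snd).
rewrite (@ge0_integral_prodM _ _ _ _ _ PL mu (fun q => Fk t q `^ g) (fun x => `|x| `^ g))//.
rewrite -[(_ * \int[mu]_x _)%E]muleC -(fineK IE) muleA -EFinM.
by rewrite [2 * u `^ g * _]mulrAC.
Qed.

(** The exponent is at most a constant times u^g t^(g - p), to which [chf_moment_le] applies. The
    pair (g, p) will be near (2, alpha) with a Gaussian part, near (1 + alpha, alpha) when the index
    of mu is below 1 + alpha, and near (beta, alpha) when the tails of mu at 0 have index beta. *)
Lemma moment_upper g p q : 1 <= g <= 2 -> 0 <= p < alpha -> p <= g - 1 -> b = 0 \/ g = 2 ->
  (\int[mu]_x (`|x| `^ g)%:E < +oo)%E -> 0 < q < g ->
  exists2 C : R, 0 <= C & forall t, 1 <= t ->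
    (\int[Q]_w (`|S t w| `^ q)%:E <= (C * t `^ ((g - p) * (q / g)))%:E)%E.
Proof.
move=> g12 pa pg bg mg qg.
pose D := 1 + 16 * (2 `^ (q - g) / (1 - 2 `^ (q - g))) : R.
pose K := b + 2 * fine (\int[mu]_x (`|x| `^ g)%:E)%E.
have I0 : (0 <= \int[mu]_x (`|x| `^ g)%:E)%E by apply: integral_ge0 => x _; rewrite lee_fin powR_ge0.
have K0 : 0 <= K by rewrite addr_ge0// mulr_ge0// fine_ge0.
pose L := 2 * (K * Ipow p) + 1.
have L0 : 0 < L by rewrite ltr_pwDr// mulr_ge0// mulr_ge0.
have D0 : 0 <= D.
  have : 2 `^ (q - g) < 1 :> R by rewrite -[X in _ < X](powRr0 2) gt1_ltr_powRr ?ltr1n//; lra.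
  move=> h; rewrite addr_ge0// mulr_ge0// divr_ge0 ?powR_ge0//; lra.
exists (D * L `^ (q / g)) => [|t t1]; first by rewrite mulr_ge0 ?powR_ge0.
have t0 : 0 < t by lra.
have A0 : 0 < L * t `^ (g - p) by rewrite mulr_gt0 ?powR_gt0.
have key u : 0 < u -> (\int[Q]_w (1 - cos (u * S t w))%:E <= (L * t `^ (g - p) * u `^ g)%:E)%E.
  move=> u0; rewrite Q1// lee_fin.
  have h1 := chexp_upper t0 u0 g12 bg mg.
  have h2 := F_le t0 pa pg.
  have {h1} : (chexp mu pi b (Fk t) u <= (K * u `^ g)%:E * (t `^ (g - p) * Ipow p)%:E)%E.
    by apply: (le_trans h1); rewrite lee_wpmul2l// lee_fin mulr_ge0 ?powR_ge0.
  rewrite chfin// -EFinM lee_fin.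
  set V := fine _ => h3; have := expR_ge1Dx (- (2 * V)).
  have : 0 <= t `^ (g - p) * u `^ g by rewrite mulr_ge0 ?powR_ge0.
  rewrite /L; lra.
apply: (le_trans (chf_moment_le (mS t) A0 qg key)).
by rewrite lee_fin -/D powRM ?powR_ge0 ?(ltW L0)// -powRrM mulrA.
Qed.

(** At u = t^(- h), the inequality 1 - cos y <= |y| bounds t^(- h) E |S_t| below by 1 - exp (- 2
    c). *)
Lemma first_moment_lower c h t1 : 0 < c -> 1 <= t1 ->
  (forall t, t1 <= t -> (c%:E <= chexp mu pi b (Fk t) (t `^ (- h)))%E) ->
  exists2 c' : R, 0 < c' & forall t, t1 <= t -> ((c' * t `^ h)%:E <= \int[Q]_w `|S t w|%:E)%E.
Proof.
move=> c0 t11 hc.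
have c'0 : 0 < 1 - expR (- (2 * c)).
  by rewrite subr_gt0 -[ltRHS]expR0 ltr_expR oppr_lt0 mulr_gt0.
exists (1 - expR (- (2 * c))) => // t tt; have t0 : 0 < t by lra.
have := hc t tt; rewrite chfin// lee_fin; set V := fine _ => cV.
have := @first_moment_ge R _ _ Q (S t) (mS t) (t `^ (- h)) (powR_ge0 _ _).
rewrite Q1// -/V => le1.
have e : t `^ h * t `^ (- h) = 1 by rewrite -powRD_gt0// subrr powRr0.
have {le1} := lee_wpmul2l (_ : (0 <= (t `^ h)%:E)%E) le1.
rewrite lee_fin powR_ge0 => /(_ isT); rewrite muleA -!EFinM e mul1e.
apply: le_trans; rewrite lee_fin mulrC ler_wpM2l ?powR_ge0//.
by rewrite lerB// ler_expR lerN2 ler_pM2l.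
Qed.

Let pow_ge1 (t x : R) : 1 <= t -> 0 <= x -> 1 <= t `^ x.
Proof. by move=> t1 x0; rewrite -(powRr0 t) ler_powR. Qed.

Lemma chexp_lower_gauss e : 0 < b -> 0 < e -> exists c t1 : R, [/\ 0 < c, 1 <= t1 &
  forall t, t1 <= t -> (c%:E <= chexp mu pi b (Fk t) (t `^ (- (1 - alpha / 2 - e))))%E].
Proof.
move=> bpos e0.
have [c [t1 [c0 t11 h]]] := G_lower e0 (isT : (0 < 1)%N).
exists (b * c / 2), t1; split => //; first by rewrite divr_gt0// mulr_gt0.
move=> t tt; have t0 : 0 < t by lra.
set u := t `^ _; have u0 : 0 < u by rewrite powR_gt0.
have jI : 0 <= chI mu pi (Fk t : PT -> R) u.
  by rewrite fine_ge0// integral_ge0// => z _; rewrite lee_fin sub1cos_ge0.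
rewrite (chexpE b0 (mF t) (Fk_sqr_lty t0) m2) lee_fin.
have GE : G t 1 = fine (\int[PL]_q (Fk t q ^+ 2)%:E)%E by [].
rewrite -GE; have := h t tt; rewrite (_ : 1.*2 = 2)%N// => Gt.
have ut : t `^ (2%:R - alpha - e) * u ^+ 2 = t `^ e.
  by rewrite /u powRX -powRD_gt0//; congr (_ `^ _); field.
have : c * 1 <= G t 1 * u ^+ 2.
  apply: (@le_trans _ _ (c * t `^ (2%:R - alpha - e) * u ^+ 2)).
    by rewrite -mulrA ut ler_wpM2l ?(ltW c0)// pow_ge1 ?(ltW e0)//; lra.
  by rewrite ler_wpM2r// sqr_ge0.
move=> h2; have := ler_wpM2l b0 h2; lra.
Qed.

Let pow_large (x K : R) : 0 < x -> exists2 t1 : R, 1 <= t1 & forall t, t1 <= t -> K <= t `^ x.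
Proof.
move=> x0; pose k := Num.max 1 K; have k1 : 1 <= k by rewrite le_max lexx.
have p1 : 1 <= k `^ x^-1 by rewrite pow_ge1// invr_ge0 ltW.
exists (k `^ x^-1) => // t kt; apply: (@le_trans _ _ k); first by rewrite le_max lexx orbT.
have -> : k = (k `^ x^-1) `^ x by rewrite -powRrM mulVf ?powRr1 ?gt_eqF//; lra.
by apply: ge0_ler_powR; rewrite ?nnegrE ?(ltW x0)//; lra.
Qed.

(** At u = t^(- h), rates xi of order x1 u give kernels of order 1 / (x1 u), so that u F x is of
    order 1 for the jumps with x0 <= |x| <= x1. These rates have mass about u^alpha and v ranges
    over a length about u t: the exponent is about u^(1 + alpha) t, of order 1 for h = 1 / (1 +
    alpha). *)
Lemma chexp_lower_jump e (x0 x1 m : R) : 0 < e < (1 + alpha)^-1 -> 0 < x0 <= x1 -> 0 < m ->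
  (m%:E <= mu [set x | (x0 <= `|x| <= x1)%R])%E ->
  exists c t1 : R, [/\ 0 < c, 1 <= t1 &
  forall t, t1 <= t -> (c%:E <= chexp mu pi b (Fk t) (t `^ (- ((1 + alpha)^-1 - e))))%E].
Proof.
move=> /andP[e0 eh] /andP[x00 x01] m0 mB; have x10 : 0 < x1 by lra.
set h := (1 + alpha)^-1 - e.
have h0 : 0 < h by rewrite subr_gt0.
have a1 : 1 < 1 + alpha by rewrite ltrDl.
have h1 : 0 < 1 - h.
  have : (1 + alpha)^-1 < 1 by rewrite invf_lt1// (lt_trans ltr01 a1).
  by rewrite /h; lra.
have [c [r [c0 r0 hr]]] := Hlow e0.
(* [T1] keeps x1 u below r, where [Hlow] provides mass; [T2] makes x1 u t - 1 at least half of x1 u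
   t. *)
have [T1 T11 hT1] := pow_large (x1 / r) h0.
have [T2 T21 hT2] := pow_large (2 / x1) h1.
pose c1 := expR (- 1) * x0 / (4 * x1).
have c10 : 0 < c1 by rewrite divr_gt0 ?mulr_gt0// expR_gt0.
pose k := c1 ^+ 2 / 4 * (c * x1 `^ (alpha + e) * (x1 / 2) * m).
have k0 : 0 < k.
  rewrite mulr_gt0//; first by rewrite divr_gt0// exprn_gt0.
  rewrite mulr_gt0// mulr_gt0 ?divr_gt0// mulr_gt0// powR_gt0//.
exists k, (Num.max T1 T2); split=> //; first by rewrite le_max T11.
move=> t; rewrite ge_max => /andP[t1 t2]; have t0 : 0 < t by lra.
have tge1 : 1 <= t by lra.
set u := t `^ (- h); have u0 : 0 < u by rewrite powR_gt0.
have ur : x1 * u <= r.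
  have := hT1 t t1; rewrite ler_pdivrMr// => le1.
  by rewrite /u powRN -ler_pdivlMr ?invr_gt0 ?powR_gt0// invrK mulrC.
have ut : 2 <= x1 * u * t.
  have := hT2 t t2; rewrite ler_pdivrMr// => le1.
  apply: (le_trans le1); rewrite -mulrA mulrC ler_pM2l//.
  by rewrite -{2}[t](powRr1 (ltW t0)) -powRD_gt0// addrC.
have xu0 : 0 < x1 * u by rewrite mulr_gt0.
pose A := `[(x1 * u), (4 * (x1 * u))]%classic.
pose B := [set x : R | (x0 <= `|x| <= x1)%R].
have mBs : measurable B.
  rewrite (_ : B = setT `&` (fun x : R => `|x|) @^-1` `[x0, x1]%classic); last first.
    by apply/seteqP; split => x /=; rewrite in_itv/=; [split|case].
  exact: (@normr_measurable R setT).
have := @chexp_ge_box R pi mu b b0 (Fk t) A B 0 (x1 * u * t - 1) c1 u (mF t) (measurable_itv _) mBs.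
have v0 : 0 <= x1 * u * t - 1 by rewrite subr_ge0 (le_trans _ ut)// ler1n.
move=> /(_ v0 (ltW c10)) box; apply: le_trans (box _); last first.
  move=> xi v x; rewrite /A /B /= in_itv/= => /andP[xi1 xi2] /andP[v1 v2] /andP[xx0 xx1].
  have xi0 : 0 < xi by exact: lt_le_trans xu0 xi1.
  have F0 := Fk_ge0 (xi, v) (ltW t0).
  have Fle := Fk_le_inv v (ltW t0) xi0.
  have vv : v + 1 <= xi * t by apply: le_trans (ler_wpM2r (ltW t0) xi1); rewrite -lerBrDr.
  have Fge := Fk_ge_large (ltW t0) xi0 v1 vv.
  rewrite !normrM (gtr0_norm u0) (ger0_norm F0); apply/andP; split.
    have l1 : expR (- 1) / (4 * (x1 * u)) <= Fk t (xi, v).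
      by apply: (le_trans _ Fge); rewrite ler_pM2l ?expR_gt0// lef_pV2 ?posrE// mulr_gt0.
    have -> : c1 = u * (expR (- 1) / (4 * (x1 * u)) * x0).
      by rewrite /c1; field; rewrite !gt_eqF.
    rewrite ler_pM2l// ler_pM ?(ltW x00)//.
    by rewrite divr_ge0 ?expR_ge0// mulr_ge0// ltW.
  have l2 : Fk t (xi, v) <= (x1 * u)^-1.
    by apply: (le_trans Fle); rewrite lef_pV2 ?posrE.
  have -> : 1 = u * ((x1 * u)^-1 * x1) by field; rewrite !gt_eqF.
  by rewrite ler_pM2l// ler_pM.
rewrite subr0.
have pA : ((c * (x1 * u) `^ (alpha + e))%:E <= pi A)%E by apply: hr; rewrite xu0.
apply: (@le_trans _ _ ((c1 ^+ 2 / 4)%:E * ((c * (x1 * u) `^ (alpha + e))%:E * (x1 * u * t - 1)%:E * m%:E))%E).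
  rewrite -!EFinM lee_fin /k ler_pM2l ?divr_gt0 ?exprn_gt0// ler_pM2r//.
  rewrite powRM ?(ltW x10) ?(ltW u0)// -!mulrA ler_pM2l// ler_pM2l ?powR_gt0//.
  apply: (@le_trans _ _ (u `^ (alpha + e) * (x1 * u * t / 2))); last first.
    by rewrite ler_wpM2l ?powR_ge0// mulrA half_le_pred.
  have -> : u `^ (alpha + e) * (x1 * u * t / 2) = (u `^ (alpha + e) * u * t) * (x1 / 2) by ring.
  rewrite ler_peMl ?divr_ge0 ?(ltW x10)//.
  rewrite -{2}[u](powRr1 (ltW u0)) -powRD_gt0// /u -powRrM -{2}[t](powRr1 (ltW t0)) -powRD_gt0//.
  apply: pow_ge1 => //.
  have -> : - h * (alpha + e + 1) + 1 = e * ((1 + alpha + e) - (1 + alpha)^-1).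
    by rewrite /h; field; rewrite gt_eqF// (lt_trans ltr01 a1).
  have : (1 + alpha)^-1 < 1 by rewrite invf_lt1// (lt_trans ltr01 a1).
  move=> iv; rewrite mulr_ge0 ?(ltW e0)// subr_ge0 (le_trans (ltW iv))//.
  by rewrite -addrA lerDl addr_ge0// ltW.
apply: lee_wpmul2l; first by rewrite lee_fin divr_ge0// sqr_ge0.
apply: lee_pmul => //.
- by rewrite -EFinM lee_fin mulr_ge0// mulr_ge0 ?powR_ge0// ltW.
- by rewrite lee_fin ltW.
by apply: lee_wpmul2r.
Qed.

(** Here the slow rates xi <= 1 / t are used, with kernels of order t, together with the small jumps
    of size z = 1 / (u t). The two masses are about t^(- alpha - beta e) and z^(- beta), and the
    choice of h makes their product 1. *)
Lemma chexp_lower_stable e beta : 0 < e -> alpha < beta ->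
  (exists c z0 : R, [/\ 0 < c, 0 < z0 & forall z, 0 < z <= z0 ->
    ((c * z `^ (- beta))%:E <= mu [set x | (z / 2 <= `|x| <= z)%R])%E]) ->
  exists c t1 : R, [/\ 0 < c, 1 <= t1 &
  forall t, t1 <= t -> (c%:E <= chexp mu pi b (Fk t) (t `^ (- (1 - alpha / beta - e))))%E].
Proof.
move=> e0 ab [c2 [z0 [c20 z00 hz]]]; have be0 : 0 < beta := lt_trans a0 ab.
set h := 1 - alpha / beta - e.
have be : 0 < beta * e by rewrite mulr_gt0.
have [c [T1 [c0 T11 hA]]] := small_mass be.
have h1 : 0 < 1 - h by rewrite /h; have : 0 < alpha / beta by [rewrite divr_gt0]; lra.
have [T2 T21 hT2] := pow_large z0^-1 h1.
pose c1 := expR (- 2) / 2 : R.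
have c10 : 0 < c1 by rewrite divr_gt0// expR_gt0.
exists (c1 ^+ 2 / 4 * (c * c2)), (Num.max T1 T2); split.
- by rewrite mulr_gt0//; [rewrite divr_gt0// exprn_gt0|rewrite mulr_gt0].
- by rewrite le_max T11.
move=> t; rewrite ge_max => /andP[t1 t2]; have t0 : 0 < t by lra.
set u := t `^ (- h); have u0 : 0 < u by rewrite powR_gt0.
pose z := t `^ (- (1 - h)); have zpos : 0 < z by rewrite powR_gt0.
have utz : u * t * z = 1.
  rewrite /u /z -{2}[t](powRr1 (ltW t0)) -!powRD_gt0// (_ : _ + _ = 0) ?powRr0//.
  by ring.
have zz0 : 0 < z <= z0.
  rewrite zpos/= /z powRN -[leRHS]invrK lef_pV2 ?posrE ?invr_gt0 ?powR_gt0//.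
  exact: hT2.
have [A [mA xA pA]] := hA t t1.
pose B := [set x : R | (z / 2 <= `|x| <= z)%R].
have mBs : measurable B.
  rewrite (_ : B = setT `&` (fun x : R => `|x|) @^-1` `[z / 2, z]%classic); last first.
    by apply/seteqP; split => x /=; rewrite in_itv/=; [split|case].
  exact: (@normr_measurable R setT).
have := @chexp_ge_box R pi mu b b0 (Fk t) A B (-1) 0 c1 u (mF t) mA mBs.
rewrite lerN10 => /(_ isT (ltW c10)) box; apply: le_trans (box _); last first.
  move=> xi v x /xA/andP[xi0 xit] vv /andP[xx0 xx1].
  have F0 := Fk_ge0 (xi, v) (ltW t0).
  have Fle := Fk_le_t (xi, v) (ltW t0).
  have xi0t : 0 <= xi <= t^-1 by rewrite ltW.
  have Fge := Fk_ge_small t0 xi0t vv.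
  rewrite !normrM (gtr0_norm u0) (ger0_norm F0); apply/andP; split.
    have -> : c1 = u * ((t * expR (- 2)) * (z / 2)).
      transitivity (u * t * z * (expR (- 2) / 2)); first by rewrite utz mul1r.
      by ring.
    rewrite ler_pM2l// ler_pM ?mulr_ge0 ?expR_ge0 ?divr_ge0 ?(ltW t0) ?(ltW zpos)//.
  rewrite -utz -mulrA ler_pM2l// ler_pM//.
rewrite opprK add0r mule1.
have e1 : t `^ (- (alpha + beta * e)) * z `^ (- beta) = 1.
  rewrite /z -powRrM -powRD_gt0// (_ : _ + _ = 0) ?powRr0//.
  by rewrite /h; field; rewrite gt_eqF.
apply: (@le_trans _ _ ((c1 ^+ 2 / 4)%:E * ((c * t `^ (- (alpha + beta * e)))%:E * (c2 * z `^ (- beta))%:E))%E).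
  rewrite -!EFinM lee_fin (_ : c * _ * (c2 * _) = c * c2 * (t `^ (- (alpha + beta * e)) * z `^ (- beta))); last by ring.
  by rewrite e1 mulr1.
apply: lee_wpmul2l; first by rewrite lee_fin divr_ge0// sqr_ge0.
apply: lee_pmul => //.
- by rewrite lee_fin mulr_ge0 ?powR_ge0// ltW.
- by rewrite lee_fin mulr_ge0 ?powR_ge0// ltW.
exact: hz.
Qed.

End Family.

(** * The scaling function and large deviations *)

Lemma expR_convex2 {R : realType} (lam u v : R) : 0 <= lam <= 1 ->
  expR (lam * u + (1 - lam) * v) <= lam * expR u + (1 - lam) * expR v.
Proof.
move=> /andP[l0 l1]; set m := lam * u + (1 - lam) * v.
have h z : expR m * (1 + (z - m)) <= expR z.
  have -> : expR z = expR m * expR (z - m) by rewrite -expRD; congr expR; ring.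
  by rewrite ler_pM2l ?expR_gt0// expR_ge1Dx.
have l1' : 0 <= 1 - lam by rewrite subr_ge0.
have h1 := ler_wpM2l l0 (h u); have h2 := ler_wpM2l l1' (h v).
have e : lam * (expR m * (1 + (u - m))) + (1 - lam) * (expR m * (1 + (v - m))) = expR m.
  by rewrite /m; ring.
by rewrite -[leLHS]e lerD.
Qed.

Lemma elog_le_powR {R : realType} (t y : R) (E : \bar R) : 1 < t -> (0 <= E)%E ->
  ((elog E * ((ln t)^-1)%:E <= y%:E) = (E <= (t `^ y)%:E))%E.
Proof.
move=> t1 E0; have t0 : 0 < t by lra.
have lt0 : 0 < ln t by rewrite ln_gt0.
have lti : 0 < (ln t)^-1 by rewrite invr_gt0.
case: E E0 => [r||//]; last first.
  by move=> _ /=; rewrite gt0_mulye ?lte_fin// leNgt ltey/= leNgt ltey.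
rewrite lee_fin => r0 /=; case: ifPn => [rp|].
  rewrite -EFinM !lee_fin ler_pdivrMr// -ln_powR ler_ln ?posrE ?powR_gt0//.
rewrite -leNgt => r0'; rewrite gt0_mulNye ?lte_fin// leNye lee_fin.
by rewrite (le_trans r0')// powR_ge0.
Qed.

Lemma near_powR_ge {R : realType} (x K : R) : 0 < x -> \forall t \near +oo, K <= t `^ x.
Proof.
move=> x0; pose k := Num.max 1 K; have k1 : 1 <= k by rewrite le_max lexx.
near=> t; apply: (@le_trans _ _ k); first by rewrite le_max lexx orbT.
have -> : k = (k `^ x^-1) `^ x by rewrite -powRrM mulVf ?powRr1 ?gt_eqF//; lra.
have kt : k `^ x^-1 <= t by near: t; apply: nbhs_pinfty_ge; exact: num_real.
apply: ge0_ler_powR => //; first exact: ltW.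
- by rewrite nnegrE powR_ge0.
- by rewrite nnegrE (le_trans _ kt)// powR_ge0.
Unshelve. all: by end_near. Qed.

Lemma abspow_ge0 {R : realType} (x q : R) : (0 <= abspow x q)%E.
Proof. by rewrite /abspow; case: ifP => // _; rewrite lee_fin powR_ge0. Qed.

Lemma abspowE {R : realType} (x q : R) : x != 0 \/ 0 <= q -> abspow x q = (`|x| `^ q)%:E.
Proof.
rewrite /abspow; case: eqP => [->|_]//= [//|q0].
by rewrite ltNge q0.
Qed.

Section Tau.
Context {R : realType} d (T : measurableType d) (P : probability T R).
Variables (X : R -> T -> R) (tau : R -> \bar R).
Hypothesis mX : forall t, measurable_fun setT (X t).
Hypothesis tauE : forall q : R,
    (elog (\int[P]_w abspow (X t w) q) * ((ln t)^-1)%:E)%E @[t --> +oo%R] --> tau q.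

Let E t q := (\int[P]_w abspow (X t w) q)%E.

Lemma measurable_abspow t q : measurable_fun setT (fun w => abspow (X t w) q).
Proof.
have mp : measurable_fun setT (fun w => (`|X t w| `^ q)%:E).
  apply/measurable_EFinP; apply: (measurableT_comp (@measurable_powR R q)).
  exact: measurableT_comp.
have [q0|q0] := ltP q 0; last first.
  by apply: eq_measurable_fun mp => w _; rewrite abspowE//; right.
apply: measurable_fun_ifT => //.
by apply: measurable_and => //; exact: measurable_fun_eqr.
Qed.

Let E0 t q : (0 <= E t q)%E.
Proof. by apply: integral_ge0 => w _; exact: abspow_ge0. Qed.

Let near1 : \forall t \near +oo, (1 : R) < t.
Proof. by apply: nbhs_pinfty_gt; exact: num_real. Qed.

Lemma tau_le q y C : (\forall t \near +oo, (E t q <= (C * t `^ y)%:E)%E) -> (tau q <= y%:E)%E.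
Proof.
move=> h; apply/lee_addgt0Pr => e e0; apply: (cvge_to_le (@tauE q)).
near=> t; have t1 : 1 < t by near: t; exact: near1.
rewrite -EFinD (elog_le_powR _ t1 (E0 t q)).
have t0 : 0 < t by apply: (@lt_trans _ _ 1) => //; near: t; exact: near1.
apply: (@le_trans _ _ (C * t `^ y)%:E); first by near: t.
rewrite lee_fin powRD_gt0// mulrC ler_wpM2l ?powR_ge0//.
by near: t; exact: near_powR_ge.
Unshelve. all: by end_near. Qed.

Lemma tau_ge q y c : 0 < c -> (\forall t \near +oo, ((c * t `^ y)%:E <= E t q)%E) -> (y%:E <= tau q)%E.
Proof.
move=> c0 h; apply/lee_subgt0Pr => e e0; apply: (cvge_to_ge (@tauE q)).
near=> t; have t1 : 1 < t by near: t; exact: near1.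
have t0 : 0 < t by lra.
rewrite -EFinB leNgt; apply/negP => /ltW; rewrite (elog_le_powR _ t1 (E0 t q)) => h1.
have h2 : ((c * t `^ y)%:E <= E t q)%E by near: t.
have := le_trans h2 h1; rewrite lee_fin.
have -> : y = (y - e) + e by lra.
rewrite addrK powRD_gt0// mulrCA ger_pMr ?powR_gt0// leNgt => /negP; apply.
have : c^-1 + 1 <= t `^ e by near: t; exact: near_powR_ge.
move=> h3; rewrite -ltr_pdivrMl// mulr1; lra.
Unshelve. all: by end_near. Qed.

Lemma tau_lt_near q y : (tau q < y%:E)%E -> \forall t \near +oo, (E t q <= (t `^ y)%:E)%E.
Proof.
move=> h; have := tauE (open_ereal_lt' h); rewrite near_simpl => h1.
near=> t; have t1 : 1 < t by near: t; exact: near1.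
rewrite -(elog_le_powR _ t1 (E0 t q)).
by apply: ltW; near: t.
Unshelve. all: by end_near. Qed.

Lemma tau_gt_near q y : (y%:E < tau q)%E -> \forall t \near +oo, ((t `^ y)%:E <= E t q)%E.
Proof.
move=> h; have := tauE (open_ereal_gt' h); rewrite near_simpl => h1.
near=> t; have t1 : 1 < t by near: t; exact: near1.
apply: ltW; rewrite ltNge -(elog_le_powR _ t1 (E0 t q)).
by rewrite -ltNge; near: t.
Unshelve. all: by end_near. Qed.

(** Convexity of the exponential, in the role of Hölder's inequality: the powers of t balance the
    terms, so that moments of orders p and r at most t^y and t^z give one of order q at most t^m.
    The inequality also covers x = 0, where negative powers are infinite. *)
Lemma abspow_convex (lam p q r y z t x m : R) : 0 < lam < 1 -> 0 < t ->
  q = lam * p + (1 - lam) * r -> m = lam * y + (1 - lam) * z ->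
  (abspow x q <= (lam * t `^ (m - y))%:E * abspow x p + ((1 - lam) * t `^ (m - z))%:E * abspow x r)%E.
Proof.
move=> /andP[l0 l1] t0 qE mE; have l1' : 0 < 1 - lam by rewrite subr_gt0.
have key l : expR (q * l) <= lam * t `^ (m - y) * expR (p * l) + (1 - lam) * t `^ (m - z) * expR (r * l).
  rewrite /powR (gt_eqF t0) -!mulrA -!expRD.
  have lam01 : 0 <= lam <= 1 by rewrite !ltW.
  apply: le_trans (expR_convex2 _ _ lam01).
  rewrite le_eqVlt; apply/orP; left; apply/eqP; congr expR; rewrite qE mE; ring.
have k1 : 0 < lam * t `^ (m - y) by rewrite mulr_gt0 ?powR_gt0.
have k2 : 0 < (1 - lam) * t `^ (m - z) by rewrite mulr_gt0 ?powR_gt0.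
have [->|x0] := eqVneq x 0.
  have n1 : (0 <= (lam * t `^ (m - y))%:E * abspow 0 p)%E by rewrite mule_ge0 ?abspow_ge0// lee_fin ltW.
  have n2 : (0 <= ((1 - lam) * t `^ (m - z))%:E * abspow 0 r)%E by rewrite mule_ge0 ?abspow_ge0// lee_fin ltW.
  have [p0|p0] := ltP p 0.
    rewrite [abspow 0 p]/abspow eqxx p0/= gt0_muley ?lte_fin// addye ?leey//.
    by rewrite gt_eqF// (lt_le_trans _ n2)// ltNyr.
  have [r0|r0] := ltP r 0.
    rewrite [abspow 0 r]/abspow eqxx r0/= gt0_muley ?lte_fin// addey ?leey//.
    by rewrite gt_eqF// (lt_le_trans _ n1)// ltNyr.
  have q0 : 0 <= q by rewrite qE addr_ge0// mulr_ge0// ltW.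
  rewrite !abspowE; [|by right..].
  rewrite normr0 -!EFinM -EFinD lee_fin.
  have [q1|q1] := eqVneq q 0; last by rewrite powR0// addr_ge0// mulr_ge0 ?powR_ge0// ltW.
  have p1 : p = 0.
    apply/eqP; rewrite eq_le p0 andbT leNgt; apply/negP => pp.
    have : 0 < q by rewrite qE ltr_pwDl ?mulr_gt0// mulr_ge0// ltW.
    by rewrite q1 ltxx.
  have r1 : r = 0.
    apply/eqP; rewrite eq_le r0 andbT leNgt; apply/negP => rr.
    have : 0 < q by rewrite qE ltr_wpDl ?mulr_gt0// mulr_ge0// ltW.
    by rewrite q1 ltxx.
  by have := key 0; rewrite p1 q1 r1 !powRr0 mul0r expR0.
rewrite !abspowE; [|by left..].
rewrite -!EFinM -EFinD lee_fin.
by have := key (ln `|x|); rewrite /powR normr_eq0 (negPf x0).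
Qed.

(** Otherwise interpolation between p and r would put [tau] strictly below the affine function at q,
    which lies between them. The real bounds y and z stand for values of [tau] that may be
    infinite. *)
Lemma tau_convex_ge (lam p q r c dd : R) : 0 < lam < 1 -> q = lam * p + (1 - lam) * r ->
  (tau r <= (c * r + dd)%:E)%E -> ((c * q + dd)%:E <= tau q)%E -> ((c * p + dd)%:E <= tau p)%E.
Proof.
move=> lam01 qE tr tq; have /andP[l0 l1] := lam01.
rewrite leNgt; apply/negP => tp.
have [y [tpy yL]] : exists y, (tau p < y%:E)%E /\ y < c * p + dd.
  move: tp; case: (tau p) => [s|//|].
  - rewrite lte_fin => sL; exists ((s + (c * p + dd)) / 2); rewrite lte_fin; split; lra.
  - by move=> _; exists (c * p + dd - 1); split; [rewrite ltNyr|lra].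
(* The excess allowed at r is lam times half the gap at p, too little to lift the interpolated value
   back to the line at q. *)
pose z := c * r + dd + lam * (c * p + dd - y) / 2.
have gap : 0 < lam * (c * p + dd - y) by rewrite mulr_gt0//; lra.
have trz : (tau r < z%:E)%E by apply: (le_lt_trans tr); rewrite lte_fin /z; lra.
pose m := lam * y + (1 - lam) * z.
have : (tau q <= m%:E)%E.
  apply: (@tau_le q m 1).
  near=> t; have t1 : 1 < t by near: t; exact: near1.
  have t0 : 0 < t by lra.
  have k1 : 0 <= lam * t `^ (m - y) by rewrite mulr_ge0 ?powR_ge0// ltW.
  have k2 : 0 <= (1 - lam) * t `^ (m - z) by rewrite mulr_ge0 ?powR_ge0//; lra.
  apply: (@le_trans _ _ (\int[P]_w ((lam * t `^ (m - y))%:E * abspow (X t w) p +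
      ((1 - lam) * t `^ (m - z))%:E * abspow (X t w) r))%E).
    apply: ge0_le_integral => //.
    - by move=> w _; exact: abspow_ge0.
    - exact: measurable_abspow.
    - by apply: emeasurable_funD; apply: measurable_funeM; exact: measurable_abspow.
    - by move=> w _; exact: abspow_convex.
  rewrite ge0_integralD//; last 4 first.
  - by move=> w _; rewrite mule_ge0 ?abspow_ge0.
  - by apply: measurable_funeM; exact: measurable_abspow.
  - by move=> w _; rewrite mule_ge0 ?abspow_ge0.
  - by apply: measurable_funeM; exact: measurable_abspow.
  rewrite !ge0_integralZl_EFin//; last 4 first.
  - by move=> w _; exact: abspow_ge0.
  - exact: measurable_abspow.
  - by move=> w _; exact: abspow_ge0.
  - exact: measurable_abspow.
  have h1 : (E t p <= (t `^ y)%:E)%E by near: t; exact: tau_lt_near.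
  have h2 : (E t r <= (t `^ z)%:E)%E by near: t; exact: tau_lt_near.
  apply: (@le_trans _ _ ((lam * t `^ (m - y))%:E * (t `^ y)%:E + ((1 - lam) * t `^ (m - z))%:E * (t `^ z)%:E)%E).
    by apply: leeD; apply: lee_wpmul2l => //; rewrite lee_fin.
  rewrite -!EFinM -EFinD lee_fin -!mulrA -!powRD_gt0// !subrK; lra.
move=> /(le_trans tq); rewrite lee_fin /m qE /z.
by have g2 := mulr_gt0 l0 gap; lra.
Unshelve. all: by end_near. Qed.

Lemma tau0 : tau 0 = 0%E.
Proof.
have E1 t : E t 0 = 1%E.
  have -> : E t 0 = (\int[P]_w (cst 1%:E) w)%E.
    by apply: eq_integral => w _; rewrite abspowE ?powRr0//; right.
  by rewrite integral_cst//= probability_setT mule1.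
apply/eqP; rewrite eq_le; apply/andP; split.
  apply: (@tau_le 0 0 1); near=> t; by rewrite E1 powRr0 mulr1.
apply: (@tau_ge 0 0 1) => //; near=> t; by rewrite E1 powRr0 mulr1.
Unshelve. all: by end_near. Qed.

End Tau.

Lemma has_inf_closure {R : realType} (A : set R) : has_inf A -> closure A (inf A).
Proof.
move=> hA B /nbhs_ballP[e /= e0 hB]; have [z Az zl] := inf_adherent e0 hA.
have le : inf A <= z by apply: ge_inf => //; exact: (proj2 hA).
exists z; split=> //; apply: hB; rewrite /ball /= ltr_norml; apply/andP; split; lra.
Qed.

Lemma half_le_of_le_add {R : realType} (x y z : R) : y * 4 <= x -> x <= z + (y + y) -> x / 2 <= z.
Proof. lra. Qed.

(** * Probabilities of the events log |X(t)| / log t in A *)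

Section LargeDeviations.
Context {R : realType} d (T : measurableType d) (P : probability T R).
Variables (X : R -> T -> R) (tau : R -> \bar R).
Hypothesis mX : forall t, measurable_fun setT (X t).
Hypothesis tauE : forall q : R,
    (elog (\int[P]_w abspow (X t w) q) * ((ln t)^-1)%:E)%E @[t --> +oo%R] --> tau q.

Let tau_lt_near q y := @tau_lt_near R d T P X tau tauE q y.
Let tau_gt_near q y := @tau_gt_near R d T P X tau tauE q y.
Let mabs := @measurable_abspow R d T X mX.

(** [ln 0] is 0 by convention, whereas log 0 stands for minus infinity and lies in no set of reals;
    the first conjunct excludes that case. *)
Definition scale_event (A : set R) (t : R) : set T :=
  [set w | (X t w != 0)%R /\ A (ln `|X t w| / ln t)%R].

Lemma measurable_scale_event A t : measurable A -> measurable (scale_event A t).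
Proof.
move=> mA; have mf : measurable_fun setT (fun w => ln `|X t w| / ln t).
  apply: measurable_funM => //; apply: measurableT_comp => //; exact: measurableT_comp.
have m0 : measurable [set~ (0 : R)] by exact: measurableC.
rewrite (_ : scale_event A t = (setT `&` X t @^-1` [set~ 0]) `&` (setT `&` (fun w => ln `|X t w| / ln t) @^-1` A)).
  by apply: measurableI; [exact: mX|exact: mf].
apply/seteqP; split => w /=.
  by move=> [/eqP x0 xA]; split; split.
by move=> [[_ /eqP x0] [_ xA]].
Qed.

Let near1 : \forall t \near +oo, (1 : R) < t.
Proof. by apply: nbhs_pinfty_gt; exact: num_real. Qed.

Lemma powR_scale (t x q : R) : 1 < t -> x != 0 -> `|x| `^ q = t `^ (q * (ln `|x| / ln t)).
Proof.
move=> t1 x0; have t0 : 0 < t by lra.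
have lt0 : 0 < ln t by rewrite ln_gt0.
rewrite /powR normr_eq0 (negPf x0) (gt_eqF t0); congr expR.
by rewrite -mulrA divfK// gt_eqF.
Qed.

(** Markov's inequality for |X|^q. The half-line extends to the right or to the left of x according
    to the sign of q. *)
Lemma chernoff q x y : (tau q < (q * x - y)%:E)%E ->
  \forall t \near +oo, (P (scale_event [set z | (q * x <= q * z)%R] t) <= (t `^ (- y))%:E)%E.
Proof.
move=> h; have h1 := tau_lt_near h.
have mA : measurable [set z : R | (q * x <= q * z)%R].
  rewrite (_ : [set z : R | _] = setT `&` (fun z => q * z) @^-1` `[(q * x)%R, +oo[%classic).
    exact: (measurable_funM (measurable_cst q) (@measurable_id _ R setT)).
  by apply/seteqP; split => z /=; rewrite in_itv/= andbT; [split|case].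
near=> t; have t1 : 1 < t by near: t; exact: near1.
have t0 : 0 < t by lra.
set B := scale_event _ t; have mB : measurable B by exact: measurable_scale_event.
have -> : P B = (\int[P]_w (\1_B w)%:E)%E by rewrite integral_indic// setIT.
apply: (@le_trans _ _ (\int[P]_w ((t `^ (- (q * x)))%:E * abspow (X t w) q))%E).
  apply: ge0_le_integral => //.
  - by apply/measurable_EFinP; exact: measurable_indic.
  - by apply: measurable_funeM; exact: mabs.
  move=> w _; rewrite indicE; case: (boolP (w \in B)) => [|_]; last first.
    by rewrite mule_ge0 ?abspow_ge0// lee_fin powR_ge0.
  rewrite inE => -[/eqP/eqP x0 /= qz]; rewrite abspowE; last by left.
  rewrite -EFinM lee_fin (powR_scale _ t1 x0) -powRD_gt0//.
  by rewrite -[leLHS](powRr0 t) ler_powR//; lra.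
have a0 w : (0 <= abspow (X t w) q)%E by exact: abspow_ge0.
have k0 : 0 <= t `^ (- (q * x)) by exact: powR_ge0.
have mq := mabs t q.
rewrite ge0_integralZl_EFin//.
apply: (@le_trans _ _ ((t `^ (- (q * x)))%:E * (t `^ (q * x - y))%:E)%E).
  by rewrite lee_wpmul2l ?lee_fin ?powR_ge0//; near: t.
by rewrite -EFinM -powRD_gt0// lee_fin le_eqVlt; apply/orP; left; apply/eqP; congr powR; ring.
Unshelve. all: by end_near. Qed.

(** Above the ball |X|^q is at most t^(- s (x0 + e)) |X|^(q + s), below it at most t^(s (x0 - e))
    |X|^(q - s). Both expectations fall short of t^(x0 q + c) by a factor t^(- s e), so the ball
    carries the bulk of E |X|^q. *)
Lemma tilting x0 c q s e : 0 < q -> 0 < s <= q -> 0 < e ->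
  ((x0 * q + c)%:E <= tau q)%E ->
  (tau (q - s) <= (x0 * (q - s) + c)%:E)%E -> (tau (q + s) <= (x0 * (q + s) + c)%:E)%E ->
  \forall t \near +oo, ((t `^ (c - (s + q) * e))%:E <= P (scale_event (ball x0 e) t))%E.
Proof.
move=> q0 /andP[s0 sq] e0 tq tm tp.
(* The tolerance in the three moment estimates. With a quarter of s e a factor t^(2 dl) of room is
   left, which beats the constants. *)
pose dl := s * e / 4; have se : 0 < s * e by rewrite mulr_gt0.
have dl0 : 0 < dl by rewrite divr_gt0.
have nq : \forall t \near +oo, ((t `^ (x0 * q + c - dl))%:E <= \int[P]_w abspow (X t w) q)%E.
  by apply: tau_gt_near; apply: lt_le_trans tq; rewrite lte_fin; lra.
have nm : \forall t \near +oo, (\int[P]_w abspow (X t w) (q - s) <= (t `^ (x0 * (q - s) + c + dl))%:E)%E.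
  by apply: tau_lt_near; apply: (le_lt_trans tm); rewrite lte_fin; lra.
have np : \forall t \near +oo, (\int[P]_w abspow (X t w) (q + s) <= (t `^ (x0 * (q + s) + c + dl))%:E)%E.
  by apply: tau_lt_near; apply: (le_lt_trans tp); rewrite lte_fin; lra.
near=> t; have t1 : 1 < t by near: t; exact: near1.
have t0 : 0 < t by lra.
set B := scale_event _ t; have mB : measurable B.
  by apply: measurable_scale_event; exact: measurable_ball.
have mIB : measurable_fun setT (fun w => (\1_B w : R)%:E) by apply/measurable_EFinP; exact: measurable_indic.
have PB : (\int[P]_w (\1_B w)%:E = P B)%E by rewrite integral_indic// setIT.
pose k0 := t `^ (q * (x0 + e)); pose k1 := t `^ (s * (x0 - e)); pose k2 := t `^ (- (s * (x0 + e))).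
have k00 : 0 <= k0 by exact: powR_ge0.
have k10 : 0 <= k1 by exact: powR_ge0.
have k20 : 0 <= k2 by exact: powR_ge0.
have m1 : measurable_fun setT (fun w => k1%:E * abspow (X t w) (q - s))%E by apply: measurable_funeM; exact: mabs.
have m2 : measurable_fun setT (fun w => k2%:E * abspow (X t w) (q + s))%E by apply: measurable_funeM; exact: mabs.
have n1 w : (0 <= k1%:E * abspow (X t w) (q - s))%E by rewrite mule_ge0 ?abspow_ge0.
have n2 w : (0 <= k2%:E * abspow (X t w) (q + s))%E by rewrite mule_ge0 ?abspow_ge0.
have m0 : measurable_fun setT (fun w => k0%:E * (\1_B w)%:E)%E by exact: measurable_funeM.
have n0 w : (0 <= k0%:E * (\1_B w)%:E)%E by rewrite mule_ge0.
have H : (\int[P]_w abspow (X t w) q <= k0%:E * P B +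
    (k1%:E * \int[P]_w abspow (X t w) (q - s) + k2%:E * \int[P]_w abspow (X t w) (q + s)))%E.
  have a0 r w : (0 <= abspow (X t w) r)%E by exact: abspow_ge0.
  have z0 : (k0%:E * P B = \int[P]_w (k0%:E * (\1_B w)%:E))%E.
    by rewrite ge0_integralZl_EFin// PB.
  have z1 : (k1%:E * \int[P]_w abspow (X t w) (q - s) = \int[P]_w (k1%:E * abspow (X t w) (q - s)))%E.
    by rewrite ge0_integralZl_EFin//; exact: mabs.
  have z2 : (k2%:E * \int[P]_w abspow (X t w) (q + s) = \int[P]_w (k2%:E * abspow (X t w) (q + s)))%E.
    by rewrite ge0_integralZl_EFin//; exact: mabs.
  have m12 : measurable_fun setT (fun w => k1%:E * abspow (X t w) (q - s) + k2%:E * abspow (X t w) (q + s))%E.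
    exact: (emeasurable_funD m1 m2).
  have n12 w : (0 <= k1%:E * abspow (X t w) (q - s) + k2%:E * abspow (X t w) (q + s))%E.
    by rewrite adde_ge0.
  rewrite z0 z1 z2 -(ge0_integralD P measurableT (fun w _ => n1 w) m1 (fun w _ => n2 w) m2).
  rewrite -(ge0_integralD P measurableT (fun w _ => n0 w) m0 (fun w _ => n12 w) m12).
  apply: ge0_le_integral => //.
  - exact: (emeasurable_funD m0 m12).
  move=> w _; have [xw|xw] := eqVneq (X t w) 0.
    have -> : abspow (X t w) q = 0%E.
      by rewrite xw abspowE; [rewrite normr0 powR0 ?gt_eqF|right; exact: ltW].
    by rewrite adde_ge0.
  rewrite !abspowE; [|by left..]; rewrite -!EFinM -!EFinD lee_fin.
  set z := ln `|X t w| / ln t.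
  have pz r : `|X t w| `^ r = t `^ (r * z) by exact: powR_scale.
  have I0 : 0 <= k0 * \1_B w by rewrite mulr_ge0.
  have J1 : 0 <= k1 * `|X t w| `^ (q - s) by rewrite mulr_ge0 ?powR_ge0.
  have J2 : 0 <= k2 * `|X t w| `^ (q + s) by rewrite mulr_ge0 ?powR_ge0.
  have [zp|zp] := leP (x0 + e) z.
    apply: (@le_trans _ _ (k2 * `|X t w| `^ (q + s))); last by rewrite addrA lerDr addr_ge0.
    rewrite !pz /k2 -powRD_gt0// ler_powR ?(ltW t1)//.
    by rewrite mulrDl addrCA lerDl addrC subr_ge0 ler_wpM2l// ltW.
  have [zm|zm] := leP z (x0 - e).
    apply: (@le_trans _ _ (k1 * `|X t w| `^ (q - s))); last by rewrite addrCA lerDl addr_ge0.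
    rewrite !pz /k1 -powRD_gt0// ler_powR ?(ltW t1)//.
    by rewrite mulrBl addrCA lerDl subr_ge0 ler_wpM2l// ltW.
  have -> : \1_B w = 1 :> R.
    rewrite indicE mem_set// /B /scale_event /=; split => //.
    by rewrite /ball /= -/z ltr_norml ltrNl opprB !ltrBlDl zp/= -ltrBlDr.
  rewrite mulr1; apply: (@le_trans _ _ k0); last by rewrite lerDl addr_ge0.
  by rewrite pz /k0 ler_powR ?(ltW t1)// ler_wpM2l ?(ltW q0)// ltW.
have PBf : P B \is a fin_num by rewrite fin_num_measure.
have h1 : ((t `^ (x0 * q + c - dl))%:E <= \int[P]_w abspow (X t w) q)%E by near: t.
have h2 : (\int[P]_w abspow (X t w) (q - s) <= (t `^ (x0 * (q - s) + c + dl))%:E)%E by near: t.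
have h3 : (\int[P]_w abspow (X t w) (q + s) <= (t `^ (x0 * (q + s) + c + dl))%:E)%E by near: t.
have {h1 H} := le_trans h1 H.
have {h2}h2 := lee_wpmul2l (_ : (0 <= k1%:E)%E) h2.
have {h3}h3 := lee_wpmul2l (_ : (0 <= k2%:E)%E) h3.
have {h2}h2 := h2 k10; have {h3}h3 := h3 k20.
move=> /le_trans/(_ (leeD2l _ (leeD h2 h3))).
rewrite -(fineK PBf) -!EFinM -!EFinD !lee_fin /k1 /k2 -!powRD_gt0//.
set u := x0 * q + c.
have -> : s * (x0 - e) + (x0 * (q - s) + c + dl) = u - s * e + dl by rewrite /u; ring.
have -> : - (s * (x0 + e)) + (x0 * (q + s) + c + dl) = u - s * e + dl by rewrite /u; ring.
have big : 4 <= t `^ (2 * dl) by near: t; apply: near_powR_ge; rewrite mulr_gt0.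
have e1 : t `^ (u - dl) = t `^ (u - s * e + dl) * t `^ (2 * dl).
  by rewrite -powRD_gt0//; congr powR; rewrite /dl; field.
have w0 : 0 <= t `^ (u - s * e + dl) by exact: powR_ge0.
have h4 := ler_wpM2l w0 big; rewrite -e1 in h4.
move=> h5; have {}h5 : t `^ (u - dl) / 2 <= k0 * fine (P B) by exact: half_le_of_le_add h4 h5.
have k0pos : 0 < k0 by rewrite powR_gt0.
have k0E : k0 * t `^ (- (q * (x0 + e))) = 1 by rewrite /k0 -powRD_gt0// subrr powRr0.
have h6 : t `^ (u - dl) * t `^ (- (q * (x0 + e))) / 2 <= fine (P B).
  rewrite -(ler_pM2l k0pos) mulrA; apply: le_trans h5.
  by rewrite [k0 * _]mulrCA k0E mulr1.
apply: le_trans h6; rewrite -powRD_gt0// ler_pdivlMr//.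
have two : 2 <= t `^ (2 * dl) by rewrite (le_trans _ big)// ler_nat.
apply: (@le_trans _ _ (t `^ (c - (s + q) * e) * t `^ (2 * dl))).
  by rewrite ler_wpM2l ?powR_ge0.
rewrite -powRD_gt0// ler_powR ?(ltW t1)//.
rewrite -subr_ge0 [leRHS](_ : _ = s * e / 4); first by rewrite divr_ge0 ?ltW.
by rewrite /u /dl; field.
Unshelve. all: by end_near. Qed.

Lemma legendre_ge0 x : (0 <= legendre tau x)%E.
Proof.
apply: ereal_sup_ubound; exists 0 => //.
by rewrite mul0r (tau0 tauE) sube0.
Qed.

Let lrate (A : set R) (t : R) : \bar R := (elog (P (scale_event A t)) * ((ln t)^-1)%:E)%E.

Lemma limsup_le (g : R -> \bar R) (y : R) :
  (\forall t \near +oo, (g t <= y%:E)%E) -> (limsup_infty g <= y%:E)%E.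
Proof.
move=> [M [_ hM]]; apply: ereal_inf_le.
exists (ereal_sup [set g t | t in `[(M + 1)%R, +oo[%classic]); first by exists (M + 1).
apply: ge_ereal_sup => _ [t + <-]; rewrite /= in_itv/= andbT => Mt.
by apply: hM; rewrite (lt_le_trans _ Mt)// ltrDl.
Qed.

Lemma liminf_ge (g : R -> \bar R) (y : R) :
  (\forall t \near +oo, (y%:E <= g t)%E) -> (y%:E <= liminf_infty g)%E.
Proof.
move=> [M [_ hM]]; apply: ereal_sup_ge.
exists (ereal_inf [set g t | t in `[(M + 1)%R, +oo[%classic]); first by exists (M + 1).
apply: le_ereal_inf_tmp => _ [t + <-]; rewrite /= in_itv/= andbT => Mt.
by apply: hM; rewrite (lt_le_trans _ Mt)// ltrDl.
Qed.

Lemma liminf_le_limsup (g : R -> \bar R) : (liminf_infty g <= limsup_infty g)%E.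
Proof.
apply: ge_ereal_sup => _ [T0 _ <-]; apply: le_ereal_inf_tmp => _ [T1 _ <-].
pose t := Num.max T0 T1.
apply: (@le_trans _ _ (g t)).
  by apply: ereal_inf_lbound; exists t => //; rewrite /= in_itv/= andbT le_max lexx.
by apply: ereal_sup_ubound; exists t => //; rewrite /= in_itv/= andbT le_max lexx orbT.
Qed.

Lemma limsup_rate_le A C y : measurable A ->
  (\forall t \near +oo, (P (scale_event A t) <= (C * t `^ (- y))%:E)%E) ->
  (limsup_infty (lrate A) <= (- y)%:E)%E.
Proof.
move=> mA h; apply/lee_addgt0Pr => e e0; rewrite -EFinD; apply: limsup_le.
near=> t; have t1 : 1 < t by near: t; exact: near1.
have t0 : 0 < t by lra.
rewrite /lrate elog_le_powR//.
apply: (@le_trans _ _ (C * t `^ (- y))%:E); first by near: t.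
rewrite lee_fin powRD_gt0// mulrC ler_wpM2l ?powR_ge0//.
by near: t; exact: near_powR_ge.
Unshelve. all: by end_near. Qed.

Lemma liminf_rate_ge A y : measurable A ->
  (\forall t \near +oo, ((t `^ y)%:E <= P (scale_event A t))%E) ->
  (y%:E <= liminf_infty (lrate A))%E.
Proof.
move=> mA h; apply/lee_subgt0Pr => e e0; rewrite -EFinB; apply: liminf_ge.
near=> t; have t1 : 1 < t by near: t; exact: near1.
have t0 : 0 < t by lra.
rewrite /lrate; apply: ltW; rewrite ltNge elog_le_powR// -ltNge.
apply: (@lt_le_trans _ _ (t `^ y)%:E); last by near: t.
by rewrite lte_fin gt1_ltr_powRr//; lra.
Unshelve. all: by end_near. Qed.

Variable H : R.
Hypothesis tau_ge_lin : forall q, ((H * q)%:E <= tau q)%E.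

(** Since tau q >= H q, a q that witnesses a nonnegative rate at x has the sign of x - H. *)
Let legH x q y : (y%:E < (q * x)%:E - tau q)%E -> 0 <= y -> 0 < q * (x - H) /\ (tau q < (q * x - y)%:E)%E.
Proof.
move=> h y0; have := tau_ge_lin q; move: h; case: (tau q) => [s| |] //.
rewrite -EFinB !lte_fin lee_fin => h1 h2; split; lra.
Qed.

(** A is cut at H. On either side the rate is tested at the point of the closure nearest to H only,
    because the q found for this point bounds the probability of the whole half-line beyond it. If H
    itself is in the closure, the infimum is 0 and the bound is trivial. *)
Lemma ldp_upper A : measurable A ->
  (limsup_infty (lrate A) <= - ereal_inf (legendre tau @` closure A))%E.
Proof.
move=> mA; rewrite leNgt; apply/negP => hlt.
have P1 t : (P (scale_event A t) <= 1)%E by apply: probability_le1; exact: measurable_scale_event.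
have lim0 : (limsup_infty (lrate A) <= (- 0)%:E)%E.
  apply: (@limsup_rate_le A 1) => //; apply: nearW => t.
  by rewrite oppr0 powRr0 mulr1.
(* If the bound failed, a real rate would fit strictly between its two sides. *)
have [y [yl ylim]] : exists y : R, (y%:E < ereal_inf (legendre tau @` closure A))%E /\
    ((- y)%:E < limsup_infty (lrate A))%E.
  move: hlt lim0; rewrite oppr0.
  case: (limsup_infty _) => [r| |]; case: (ereal_inf _) => [s| |] //=.
  - by rewrite lte_fin => rs _; exists ((s - r) / 2); rewrite !lte_fin; split; lra.
  - by move=> _ _; exists (1 - r); rewrite ltry lte_fin; split=> //; lra.
have {lim0}y0 : 0 <= y.
  by move: (lt_le_trans ylim lim0); rewrite lte_fin; lra.
have HA : ~ closure A H.
  move=> HA; have : (ereal_inf (legendre tau @` closure A) <= 0)%E.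
    apply: ereal_inf_le; exists (legendre tau H); first by exists H.
    apply: ge_ereal_sup => _ [q _ <-].
    have := tau_ge_lin q; case: (tau q) => [s| |]//; last by move=> _; rewrite /= leNye.
    by rewrite -EFinB !lee_fin; lra.
  by move=> /(lt_le_trans yl); rewrite lte_fin ltNge y0.
have hy x : closure A x -> exists q, 0 < q * (x - H) /\ (tau q < (q * x - y)%:E)%E.
  move=> xA; have : (y%:E < legendre tau x)%E.
    by apply: (lt_le_trans yl); apply: ereal_inf_lbound; exists x.
  by move=> /ereal_sup_gt[_ [q _ <-]] /legH/(_ y0); exists q.
pose A1 := A `&` [set z | z < H]; pose A2 := A `&` [set z | H < z].
have hal B : (B = A1 \/ B = A2) -> \forall t \near +oo, (P (scale_event B t) <= (t `^ (- y))%:E)%E.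
  move=> BE.
  have mB : measurable B.
    case: BE => ->; apply: measurableI => //.
      by rewrite (_ : [set z | z < H] = `]-oo, H[%classic)//; apply/seteqP; split => z /=; rewrite in_itv.
    by rewrite (_ : [set z | H < z] = `]H, +oo[%classic)//; apply/seteqP; split => z /=; rewrite in_itv/= andbT.
  have [->|/set0P[z0 Bz0]] := eqVneq B set0.
    apply: nearW => t; rewrite (_ : scale_event set0 t = set0) ?measure0 ?lee_fin ?powR_ge0//.
    by apply/seteqP; split => w //= -[].
  have [x [xA hx]] : exists x, closure A x /\ (forall z q, B z -> 0 < q * (x - H) -> q * x <= q * z).
    case: BE Bz0 mB => -> Bz0 mB.
      have hs : has_sup A1 by split; [exists z0|exists H => z [_ /ltW]].
      exists (sup A1); have sH : sup A1 <= H by apply: sup_le_ub => [|z [_ /ltW]//]; exists z0.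
      split; first by apply: (closure_subset (@subIsetl _ A _)); exact: closure_sup (proj1 hs) (proj2 hs).
      move=> z q Bz qp; have q0 : q < 0.
        by rewrite ltNge; apply/negP => q0; move: qp; rewrite ltNge mulr_ge0_le0//; lra.
      by rewrite ler_nM2l//; apply: ub_le_sup => //; exact: (proj2 hs).
    have hi : has_inf A2 by split; [exists z0|exists H => z [_ /ltW]].
    exists (inf A2); have sH : H <= inf A2 by apply: lb_le_inf => [|z [_ /ltW]//]; exists z0.
    split; first by apply: (closure_subset (@subIsetl _ A _)); exact: has_inf_closure.
    move=> z q Bz qp; have q0 : 0 < q.
      by rewrite ltNge; apply/negP => q0; move: qp; rewrite ltNge mulr_le0_ge0//; lra.
    by rewrite ler_pM2l//; apply: ge_inf => //; exact: (proj2 hi).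
  have [q [qp tq]] := hy x xA; have := chernoff tq.
  apply: filterS => t; apply: le_trans; apply: le_measure; rewrite ?inE.
  - exact: measurable_scale_event.
  - apply: measurable_scale_event.
    rewrite (_ : [set z : R | _] = setT `&` (fun z => q * z) @^-1` `[(q * x)%R, +oo[%classic).
      exact: (measurable_funM (measurable_cst q) (@measurable_id _ R setT)).
    by apply/seteqP; split => z /=; rewrite in_itv/= andbT; [split|case].
  - by move=> w [w0 /hx h]; split=> //=; exact: h.
have AE : A = A1 `|` A2.
  apply/seteqP; split => [z zA|z [] []//].
  have [zH|Hz|zH] := ltgtP z H; [by left|by right|].
  by exfalso; apply: HA; rewrite -zH; exact: subset_closure.
have : (limsup_infty (lrate A) <= (- y)%:E)%E.
  apply: (@limsup_rate_le A 2) => //.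
  have n1 := hal A1 (or_introl erefl); have n2 := hal A2 (or_intror erefl).
  have m1 : measurable A1.
    apply: measurableI => //.
    by rewrite (_ : [set z | z < H] = `]-oo, H[%classic)//; apply/seteqP; split => z /=; rewrite in_itv.
  have m2 : measurable A2.
    apply: measurableI => //.
    by rewrite (_ : [set z | H < z] = `]H, +oo[%classic)//; apply/seteqP; split => z /=; rewrite in_itv/= andbT.
  near=> t.
  have -> : scale_event A t = scale_event A1 t `|` scale_event A2 t.
    apply/seteqP; split => w.
      by move=> [w0 wA]; move: wA; rewrite {1}AE => -[wA|wA]; [left|right].
    by move=> [] [w0 [wA _]].
  apply: (le_trans (measureU2 _ _ _)); [exact: measurable_scale_event..|].
  rewrite (_ : (2 * t `^ (- y))%:E = (t `^ (- y))%:E + (t `^ (- y))%:E)%E; last by rewrite -EFinD; congr EFin; ring.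
  by apply: leeD; near: t.
by rewrite leNgt ylim.
Unshelve. all: by end_near. Qed.

Lemma ldp_lower_at (A : set R) (x0 c q s : R) : measurable A -> interior A x0 -> 0 < q -> 0 < s <= q ->
  ((x0 * q + c)%:E <= tau q)%E ->
  (tau (q - s) <= (x0 * (q - s) + c)%:E)%E -> (tau (q + s) <= (x0 * (q + s) + c)%:E)%E ->
  (c%:E <= liminf_infty (lrate A))%E.
Proof.
move=> mA /nbhs_ballP[e1 /= e10 hA] q0 sq tq tm tp.
have /andP[s0 _] := sq.
apply/lee_subgt0Pr => e e0; rewrite -EFinB.
pose e2 := Num.min e1 (e / (s + q)).
have sq0 : 0 < s + q by lra.
have e20 : 0 < e2 by rewrite lt_min e10 divr_gt0.
have := @tilting x0 c q s e2 q0 sq e20 tq tm tp => h.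
apply: liminf_rate_ge => //.
near=> t; have t1 : 1 < t by near: t; exact: near1.
apply: (@le_trans _ _ (t `^ (c - (s + q) * e2))%:E).
  rewrite lee_fin ler_powR ?(ltW t1)// lerD2l lerN2 mulrC -ler_pdivlMr//.
  by rewrite ge_min lexx orbT.
apply: (@le_trans _ _ (P (scale_event (ball x0 e2) t))); first by near: t.
apply: le_measure; rewrite ?inE.
- by apply: measurable_scale_event; exact: measurable_ball.
- exact: measurable_scale_event.
- move=> w [w0 wb]; split=> //; apply: hA.
  by apply: le_ball wb; rewrite ge_min lexx.
Unshelve. all: by end_near. Qed.

End LargeDeviations.

(** * The Legendre transform of a scaling function bounded by two lines *)

Section ScalingTheorem.
Context {R : realType} d (T : measurableType d) (P : probability T R).
Variables (X : R -> T -> R) (tau : R -> \bar R) (alpha H : R).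
Hypothesis mX : forall t, measurable_fun setT (X t).
Hypothesis tauE : forall q : R,
    (elog (\int[P]_w abspow (X t w) q) * ((ln t)^-1)%:E)%E @[t --> +oo%R] --> tau q.
Hypotheses (a0 : 0 < alpha) (H1 : H < 1).
Variables (m0 : nat) (q1 q2 : R).
Hypothesis tau_even : forall m, (m0 <= m)%N -> tau m.*2%:R = (m.*2%:R - alpha)%:E.
Hypotheses (q20 : 0 < q2) (q21 : q2 < q1).
Hypotheses (tq2 : ((H * q2)%:E <= tau q2)%E) (tq1 : (tau q1 <= (H * q1)%:E)%E).
Let q0 := alpha / (1 - H).
Hypothesis tq0 : forall e, 0 < e -> exists q, `|q - q0| < e /\ (tau q <= (H * q)%:E)%E.

(** [tau] vanishes at 0, is at least H q at q2 and at most H q at q1. Orders below q2 are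
    extrapolated from q1, orders above it from 0. *)
Lemma tau_ge_mono q : ((H * q)%:E <= tau q)%E.
Proof.
have h p lam r : 0 < lam < 1 -> q2 = lam * p + (1 - lam) * r -> (tau r <= (H * r)%:E)%E ->
    ((H * p)%:E <= tau p)%E.
  move=> l01 qE tr; rewrite -[H * p]addr0.
  by apply: (tau_convex_ge mX tauE l01 qE); rewrite addr0.
have q20' := q20; have q21' := q21.
have [qq2|qq2|->//] := ltgtP q q2.
  apply: (h q ((q1 - q2) / (q1 - q)) q1) => //.
    by rewrite divr_gt0 ?ltr_pdivrMr ?mul1r; lra.
  by field; rewrite gt_eqF//; lra.
apply: (h q (q2 / q) 0).
- by rewrite divr_gt0 ?ltr_pdivrMr ?mul1r; lra.
- by rewrite mulr0 addr0 divfK// gt_eqF//; lra.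
- by rewrite mulr0 (tau0 tauE).
Qed.

(** Backward extrapolation from two even orders D and D + 2 beyond q, at which [tau] lies on this
    line. *)
Lemma tau_ge_affine q : ((q - alpha)%:E <= tau q)%E.
Proof.
pose m := maxn m0 (Num.truncn `|q|).+1.
have mm0 : (m0 <= m)%N by rewrite leq_maxl.
have qm : q < m.*2%:R.
  apply: (@le_lt_trans _ _ `|q|); first exact: ler_norm.
  have h := truncnS_gt `|q|.
  apply: (lt_le_trans h); rewrite ler_nat.
  by apply: (@leq_trans m); [exact: leq_maxr|rewrite -addnn leq_addr].
pose D : R := m.*2%:R.
have D2 : m.+1.*2%:R = D + 2 :> R by rewrite doubleS -addn2 natrD.
rewrite -[q - alpha]/(q + - alpha) -[q in X in (X <= _)%E]mul1r.
apply: (tau_convex_ge mX tauE (lam := 2 / (D + 2 - q)) (q := D) (r := D + 2)).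
- by rewrite divr_gt0 ?ltr_pdivrMr ?mul1r /D; lra.
- by field; rewrite gt_eqF// /D; lra.
- by rewrite -D2 tau_even ?lee_fin ?D2 ?(leq_trans mm0)//; lra.
- by rewrite /D tau_even// lee_fin mul1r.
Qed.

(** Orders q >= 0 contribute q x - tau q <= q (x - H) <= 0, and q = 0 contributes 0. *)
Lemma legendre_lt x : x < H -> legendre tau x =
  Order.max (ereal_sup [set ((q * x)%:E - tau q)%E | q in [set q : R | q < 0]]) 0%E.
Proof.
move=> xH; apply/eqP; rewrite eq_le; apply/andP; split.
  apply: ge_ereal_sup => _ [q _ <-]; rewrite le_max; apply/orP.
  have [qn|qp] := ltP q 0; first by left; apply: ereal_sup_ubound; exists q.
  right; have := tau_ge_mono q; case: (tau q) => [s| |]//; last by move=> _; rewrite /= leNye.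
  rewrite -EFinB !lee_fin => h.
  have : q * (x - H) <= 0 by rewrite mulr_ge0_le0//; lra.
  lra.
rewrite ge_max (legendre_ge0 tauE) andbT; apply: ge_ereal_sup => _ [q _ <-].
by apply: ereal_sup_ubound; exists q.
Qed.

(** The two lines below [tau] cross at [q0]; H q bounds the supremum over q <= q0 and q - alpha over
    q > q0, both by q0 (x - H). This value is approached through the orders near [q0] that [tq0]
    provides. *)
Lemma legendre_mid x : H <= x <= 1 -> legendre tau x =
  (alpha / (1 - H) * x - alpha * H / (1 - H))%:E.
Proof.
move=> /andP[Hx x1]; have d0 : 0 < 1 - H by rewrite subr_gt0.
have aE : alpha = q0 * (1 - H) by rewrite /q0 divfK// gt_eqF.
have -> : alpha / (1 - H) * x - alpha * H / (1 - H) = q0 * (x - H) by rewrite /q0; field; rewrite gt_eqF.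
apply/eqP; rewrite eq_le; apply/andP; split.
  apply: ge_ereal_sup => _ [q _ <-].
  have := tau_ge_mono q; have := tau_ge_affine q.
  case: (tau q) => [s| |]//; last by move=> _ _; rewrite /= leNye.
  rewrite -EFinB !lee_fin => h1 h2.
  have [qq|qq] := leP q q0.
    have := ler_wpM2r (_ : 0 <= x - H) qq; rewrite subr_ge0 => /(_ Hx); lra.
  have := ler_wpM2r (_ : 0 <= 1 - x) (ltW qq); rewrite subr_ge0 => /(_ x1).
  rewrite aE in h1; lra.
apply/lee_subgt0Pr => e e0.
have k0 : 0 < 1 + (x - H) by lra.
have [q [qe tq]] := tq0 (divr_gt0 e0 k0).
apply: ereal_sup_ge; exists ((q * x)%:E - tau q)%E; first by exists q.
apply: (@le_trans _ _ ((q * x)%:E - (H * q)%:E)%E); last by rewrite leeB.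
rewrite -!EFinB lee_fin.
have : `|q - q0| * (x - H) <= e.
  apply: (@le_trans _ _ (e / (1 + (x - H)) * (1 + (x - H)))); last by rewrite divfK ?gt_eqF.
  by rewrite ler_pM//; lra.
have : (q0 - q) * (x - H) <= `|q - q0| * (x - H).
  by rewrite ler_wpM2r ?subr_ge0// distrC ler_norm.
by rewrite mulrBl; lra.
Qed.

(** At large even orders tau q = q - alpha, so q x - tau q grows like q (x - 1). *)
Lemma legendre_gt x : 1 < x -> legendre tau x = +oo%E.
Proof.
move=> x1; apply/eqyP => A A0; have d0 : 0 < x - 1 by rewrite subr_gt0.
pose m := maxn m0 (Num.truncn (A / (x - 1))).+1.
have mm0 : (m0 <= m)%N by rewrite leq_maxl.
have mA : A <= m.*2%:R * (x - 1).
  rewrite -ler_pdivrMr//; apply: (le_trans (ltW (truncnS_gt _))); rewrite ler_nat.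
  by apply: (@leq_trans m); [exact: leq_maxr|rewrite -addnn leq_addr].
apply: ereal_sup_ge; exists ((m.*2%:R * x)%:E - tau m.*2%:R)%E; first by exists m.*2%:R.
by rewrite tau_even// -EFinB lee_fin; have := a0; lra.
Qed.

Lemma scaling_theorem :
  (forall A : set R, measurable A ->
    let g := fun t : R =>
      (elog (P [set w | (X t w != 0)%R /\ A (ln `|X t w| / ln t)%R])
        * ((ln t)^-1)%:E)%E in
    (- ereal_inf (legendre tau @` (interior A `&` [set H; 1%R]))
       <= liminf_infty g)%E /\
    (liminf_infty g <= limsup_infty g)%E /\
    (limsup_infty g <= - ereal_inf (legendre tau @` closure A))%E) /\
  (forall x : R, legendre tau x =
     if x < H then
       Order.max (ereal_sup [set ((q * x)%:E - tau q)%E | q in [set q : R | q < 0]]) 0%E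
     else if x <= 1 then
       (alpha / (1 - H) * x - alpha * H / (1 - H))%:E
     else +oo%E).
Proof.
split; last first.
  move=> x; case: ltP => [/legendre_lt//|Hx].
  by case: leP => [x1|/legendre_gt//]; apply: legendre_mid; rewrite Hx.
move=> A mA g; split; last first.
  split; first exact: liminf_le_limsup.
  exact: (ldp_upper mX tauE tau_ge_mono mA).
rewrite leeNl; apply: le_ereal_inf_tmp => _ [x [xA xH] <-].
case: xH => [xE|xE]; rewrite {x}xE in xA *.
  have l0 : (0%:E <= liminf_infty g)%E.
    have qh : 0 < q1 / 2 by rewrite divr_gt0// (lt_trans q20).
    (* The slope H is tested at q1 / 2, with neighbours 0 and q1. *)
    apply: (@ldp_lower_at R d T P X tau mX tauE A H 0 (q1 / 2) (q1 / 2)) => //.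
    - by rewrite qh lexx.
    - by rewrite addr0; exact: tau_ge_mono.
    - by rewrite subrr mulr0 addr0 (tau0 tauE).
    - by rewrite -splitr addr0.
  by apply: (@le_trans _ _ 0%E); [rewrite leeNl oppe0|exact: legendre_ge0].
have l1 : ((- alpha)%:E <= liminf_infty g)%E.
  pose D : R := m0.*2%:R; have D0 : 0 <= D by [].
  have D2 : m0.+1.*2%:R = D + 2 :> R by rewrite doubleS -addn2 natrD.
  have D4 : m0.+2.*2%:R = D + 2 + 2 :> R by rewrite !doubleS -addn2 natrD -addn2 natrD.
  (* The slope 1 is tested at D + 2, with the even orders D and D + 4 as neighbours. *)
  apply: (@ldp_lower_at R d T P X tau mX tauE A 1 (- alpha) (D + 2) 2) => //.
  - by lra.
  - by apply/andP; split; lra.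
  - by rewrite mul1r; exact: tau_ge_affine.
  - by rewrite addrK mul1r tau_even.
  - by rewrite -D4 mul1r tau_even// -addn2 leq_addr.
apply: (@le_trans _ _ alpha%:E); first by rewrite leeNl.
apply: ereal_sup_ge; exists ((m0.*2%:R * 1)%:E - tau m0.*2%:R)%E; first by exists m0.*2%:R.
by rewrite tau_even// -EFinB lee_fin; lra.
Qed.

End ScalingTheorem.

(** * Lévy measures *)

Section LevyMeasure.
Context {R : realType} (mu : {measure set R -> \bar R}).
Hypothesis levy : is_levy_measure mu.

Lemma measurable_norm_itv (x0 x1 : R) : measurable [set x : R | (x0 <= `|x| <= x1)%R].
Proof.
rewrite (_ : [set x : R | _] = setT `&` (fun x : R => `|x|) @^-1` `[x0, x1]%classic).
  exact: (@normr_measurable R setT).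
by apply/seteqP; split => x /=; rewrite in_itv/=; [split|case].
Qed.

Lemma measurable_norm_ge (x0 : R) : measurable [set x : R | (x0 <= `|x|)%R].
Proof.
rewrite (_ : [set x : R | _] = setT `&` (fun x : R => `|x|) @^-1` `[x0, +oo[%classic).
  exact: (@normr_measurable R setT).
by apply/seteqP; split => x /=; rewrite in_itv/= andbT; [split|case].
Qed.

Lemma levy_tail_lty (x0 : R) : 0 < x0 -> (mu [set x | (x0 <= `|x|)%R] < +oo)%E.
Proof.
move=> x00; have mA := measurable_norm_ge x0; set A := [set x | _] in mA *.
pose c := Num.min 1 (x0 ^+ 2); have c0 : 0 < c by rewrite lt_min ltr01 exprn_gt0.
have : (c%:E * mu A <= \int[mu]_x (Num.min 1 (x ^+ 2))%:E)%E.
  rewrite -(setIT A) -integral_indic// -ge0_integralZl_EFin ?(ltW c0)//; last first.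
    by apply/measurable_EFinP; exact: measurable_indic.
  apply: ge0_le_integral => //.
  - by move=> x _; rewrite -EFinM lee_fin mulr_ge0// ltW.
  - by apply: measurable_funeM; apply/measurable_EFinP; exact: measurable_indic.
  - by apply/measurable_EFinP; apply: measurable_minr => //; exact: measurable_funX.
  move=> x _; rewrite -EFinM lee_fin indicE.
  case: (boolP (x \in A)) => [|_]; last by rewrite mulr0 le_min ler01 sqr_ge0.
  rewrite inE /A /= => xA; rewrite mulr1 le_min /c ge_min lexx/= ge_min.
  by rewrite -[x ^+ 2]real_normK ?num_real// lerXn2r ?nnegrE ?(ltW x00)// orbT.
move=> /le_lt_trans/(_ levy.2) h; rewrite ltey; apply/eqP => muA.
by move: h; rewrite muA gt0_muley ?lte_fin// ltxx.
Qed.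

(** A Lévy measure is finite on |x| >= 1 / (n + 1) and does not charge 0. Sigma-finiteness is what
    Tonelli's theorem asks for in the products with mu. *)
Lemma levy_sigma_finite : sigma_finite setT mu.
Proof.
exists (fun n => [set 0] `|` [set x : R | (n.+1%:R^-1 <= `|x|)%R]).
  apply/esym/seteqP; split => // x _.
  have [->|x0] := eqVneq x 0; first by exists 0%N => //; left.
  have nx : 0 < `|x| by rewrite normr_gt0.
  exists (Num.truncn `|x|^-1) => //; right => /=.
  rewrite -[leRHS]invrK lef_pV2 ?posrE ?invr_gt0//.
  exact: ltW (truncnS_gt _).
move=> n; have mA := measurable_norm_ge (n.+1%:R^-1 : R).
split; first exact: measurableU.
apply: (@le_lt_trans _ _ (mu [set 0%R] + mu [set x : R | (n.+1%:R^-1 <= `|x|)%R])%E).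
  exact: measureU2.
by rewrite levy.1 add0e levy_tail_lty.
Qed.

(** The annuli 1 / (n + 1) <= |x| <= n + 1 exhaust the complement of the origin, so one of them is
    charged. Box estimates need jumps bounded away from 0 and infinity. *)
Lemma levy_mass : (exists A : set R, measurable A /\ mu A != 0%E) ->
  exists x0 x1 m : R, [/\ 0 < x0 <= x1, 0 < m & (m%:E <= mu [set x | (x0 <= `|x| <= x1)%R])%E].
Proof.
move=> [A [mA muA]].
pose B n := [set x : R | (n.+1%:R^-1 <= `|x| <= n.+1%:R)%R].
have [[n Bn]|hB] := pselect (exists n, mu (B n) != 0%E).
  exists n.+1%:R^-1, n.+1%:R.
  have fB : (mu (B n) < +oo)%E.
    have p : 0 < n.+1%:R^-1 :> R by rewrite invr_gt0.
    apply: le_lt_trans (levy_tail_lty p); apply: le_measure; rewrite ?inE.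
    - exact: measurable_norm_itv.
    - exact: measurable_norm_ge.
    - by move=> x /andP[].
  exists (fine (mu (B n))); split.
  - by rewrite invr_gt0 ltr0Sn/= (@le_trans _ _ 1)// ?invf_le1 ?ler1n.
  - by rewrite fine_gt0// fB andbT lt0e Bn measure_ge0.
  - by rewrite fineK// ge0_fin_numE.
exfalso; move/eqP: muA; apply.
have B0 k : mu (B k) = 0%E by apply: contrapT => h; apply: hB; exists k; exact/eqP.
have mB n : measurable (B n) by exact: measurable_norm_itv.
have cov : A `<=` [set 0] `|` \bigcup_n B n.
  move=> x _; have [->|x0] := eqVneq x 0; first by left.
  have nx : 0 < `|x| by rewrite normr_gt0.
  right; pose n := maxn (Num.truncn `|x|^-1) (Num.truncn `|x|); exists n => //=.
  apply/andP; split.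
    rewrite -[leRHS]invrK lef_pV2 ?posrE ?invr_gt0//.
    apply: (le_trans (ltW (truncnS_gt _))); rewrite ler_nat ltnS; exact: leq_maxl.
  apply: (le_trans (ltW (truncnS_gt _))); rewrite ler_nat ltnS; exact: leq_maxr.
apply/eqP; rewrite eq_le measure_ge0 andbT.
apply: (@le_trans _ _ (mu ([set 0] `|` \bigcup_n B n))).
  apply: le_measure; rewrite ?inE//; apply: measurableU => //; exact: bigcup_measurable.
apply: (@le_trans _ _ (mu [set 0%R] + mu (\bigcup_n B n))%E).
  by apply: measureU2 => //; exact: bigcup_measurable.
rewrite levy.1 add0e.
apply: (@le_trans _ _ (\sum_(k <oo) mu (B k))%E); last by rewrite eseries0// => k _ _; exact: B0.
apply: measure_sigma_subadditive => //; exact: bigcup_measurable.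
Qed.

Lemma even_moment_gt0 x0 x1 m j : 0 < x0 <= x1 -> 0 < m ->
  (m%:E <= mu [set x | (x0 <= `|x| <= x1)%R])%E ->
  (\int[mu]_x (x ^+ j.*2)%:E < +oo)%E -> 0 < fine (\int[mu]_x (x ^+ j.*2)%:E)%E.
Proof.
move=> /andP[x00 x01] m_gt0 mB fin; set B := [set x | _] in mB.
have mBs : measurable B by exact: measurable_norm_itv.
have c0 : 0 < x0 ^+ j.*2 by rewrite exprn_gt0.
rewrite fine_gt0// fin andbT.
apply: (@lt_le_trans _ _ ((x0 ^+ j.*2)%:E * mu B)%E).
  by rewrite mule_gt0// (lt_le_trans _ mB).
rewrite -(setIT B) -integral_indic// -ge0_integralZl_EFin ?(ltW c0)//; last first.
  by apply/measurable_EFinP; exact: measurable_indic.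
apply: ge0_le_integral => //.
- by move=> x _; rewrite -EFinM lee_fin mulr_ge0// ltW.
- by apply: measurable_funeM; apply/measurable_EFinP; exact: measurable_indic.
- by apply/measurable_EFinP; exact: measurable_funX.
move=> x _; rewrite -EFinM lee_fin indicE expr2_powR.
case: (boolP (x \in B)) => [|_]; last by rewrite mulr0 powR_ge0.
by rewrite inE => /andP[xB _]; rewrite mulr1 powR_mulrn// lerXn2r ?nnegrE ?(ltW x00).
Qed.

Hypothesis m2 : (\int[mu]_x (x ^+ 2)%:E < +oo)%E.

(** Where |x| >= k one has |x|^g <= k^(g - 2) x^2, so that only the part near 0 remains to be
    checked. *)
Lemma powR_moment_lty (D : set R) (k g : R) : measurable D -> 0 < k ->
  (forall x, ~ D x -> k <= `|x|) -> g <= 2 ->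
  (\int[mu]_(x in D) (`|x| `^ g)%:E < +oo)%E -> (\int[mu]_x (`|x| `^ g)%:E < +oo)%E.
Proof.
move=> mD k0 hD g2 fin.
have mp : measurable_fun setT (fun x : R => (`|x| `^ g)%:E).
  by apply/measurable_EFinP; exact: (measurableT_comp (@measurable_powR R g) (@normr_measurable R setT)).
pose c := k `^ (g - 2); have c0 : 0 <= c by exact: powR_ge0.
have mx2 : measurable_fun setT (fun x : R => (x ^+ 2)%:E).
  by apply/measurable_EFinP; exact: measurable_funX.
have x2 (x : R) : (0 <= (x ^+ 2)%:E)%E by rewrite lee_fin sqr_ge0.
have mr : measurable_fun setT ((fun x : R => (`|x| `^ g)%:E) \_ D).
  by apply/(measurable_restrictT _ _).1 => //; exact: measurable_funTS.
have r0 (x : R) : (0 <= ((fun x : R => (`|x| `^ g)%:E) \_ D) x)%E.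
  by rewrite patchE; case: ifP => // _; rewrite lee_fin powR_ge0.
apply: (@le_lt_trans _ _ (\int[mu]_x (((fun x : R => (`|x| `^ g)%:E) \_ D) x + c%:E * (x ^+ 2)%:E)%E)%E).
  have mc : measurable_fun setT (fun x : R => c%:E * (x ^+ 2)%:E)%E by exact: measurable_funeM.
  apply: ge0_le_integral => //.
  - exact: (emeasurable_funD mr mc).
  move=> x _; rewrite patchE; case: ifPn => [_|].
    by rewrite leeDl// mule_ge0.
  rewrite notin_setE => xD; have kx := hD x xD.
  rewrite add0e -EFinM lee_fin.
  have nx : 0 < `|x| by apply: lt_le_trans kx.
  rewrite -[x ^+ 2]real_normK ?num_real// -powR_mulrn//.
  rewrite [X in `|x| `^ X](_ : g = (g - 2) + 2); last by ring.
  rewrite powRD_gt0// ler_wpM2r ?powR_ge0// /c.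
  rewrite /powR (gt_eqF nx) (gt_eqF k0) ler_expR ler_wnM2l//; first by lra.
  by rewrite ler_ln.
have mc : measurable_fun setT (fun x : R => c%:E * (x ^+ 2)%:E)%E by exact: measurable_funeM.
have c2 (x : R) : (0 <= c%:E * (x ^+ 2)%:E)%E by rewrite mule_ge0.
rewrite (ge0_integralD mu measurableT (fun x _ => r0 x) mr (fun x _ => c2 x) mc).
rewrite -integral_mkcond ge0_integralZl_EFin// lte_add_pinfty//.
by rewrite lte_mul_pinfty.
Qed.

Lemma BG_moment_lty (g : R) : g <= 2 -> (BG_index mu < g%:E)%E ->
  (\int[mu]_x (`|x| `^ g)%:E < +oo)%E.
Proof.
move=> g2 /ereal_inf_lt[_ [g0 [g00 fin] <-]]; rewrite lte_fin => gg.
apply: (powR_moment_lty (measurable_itv `[(-1)%R, 1%R]) ltr01 _ g2) => [x|].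
  rewrite /= in_itv/= => /negP; rewrite -ler_norml -ltNge => /ltW//.
apply: le_lt_trans fin; apply: ge0_le_integral => //.
- apply: measurable_funTS; apply/measurable_EFinP.
  exact: (measurableT_comp (@measurable_powR R g) (@normr_measurable R setT)).
- apply: measurable_funTS; apply/measurable_EFinP.
  exact: (measurableT_comp (@measurable_powR R g0) (@normr_measurable R setT)).
move=> x; rewrite /= in_itv/= -ler_norml => x1; rewrite lee_fin.
have [->|x0] := eqVneq x 0.
  rewrite normr0 [leLHS]powR0 ?powR_ge0// gt_eqF//; lra.
rewrite /powR normr_eq0 (negPf x0) ler_expR ler_wnM2r ?ln_le0//; lra.
Qed.

Section Stable.
Variables (cp cm beta : R).
Hypotheses (cp0 : 0 <= cp) (cm0 : 0 <= cm) (c0 : 0 < cp + cm) (be1 : 1 < beta).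
Hypothesis hp : ((x `^ beta)%:E * mu `[x, +oo[%classic)%E @[x --> 0^'+] --> cp%:E.
Hypothesis hm : ((x `^ beta)%:E * mu `]-oo, (- x)%R]%classic)%E @[x --> 0^'+] --> cm%:E.
Let C := cp + cm.
Let N (z : R) := mu [set x | (z <= `|x|)%R].

Let NE z : 0 < z -> N z = (mu `[z, +oo[%classic + mu `]-oo, (- z)%R]%classic)%E.
Proof.
move=> z0; rewrite /N -measureU//; last first.
  apply/seteqP; split => x //=; rewrite !in_itv/= andbT => -[h1 h2]; lra.
congr (mu _); apply/seteqP; split => x /=; rewrite !in_itv/= andbT.
  by rewrite ler_normr => /orP[]; [left|rewrite lerNr; right].
by rewrite ler_normr => -[->//|]; rewrite lerNr => ->; rewrite orbT.
Qed.

Let tail_bounds : exists2 z0 : R, 0 < z0 & forall z, 0 < z <= z0 ->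
  ((3 / 4 * C * z `^ (- beta))%:E <= N z)%E /\ (N z <= (5 / 4 * C * z `^ (- beta))%:E)%E.
Proof.
have h : ((x `^ beta)%:E * N x)%E @[x --> 0^'+] --> C%:E.
  have dd : (cp%:E +? cm%:E)%E by [].
  have h1 : ((x `^ beta)%:E * mu `[x, +oo[%classic + (x `^ beta)%:E * mu `]-oo, (- x)%R]%classic)%E
      @[x --> 0^'+] --> C%:E by exact: (cvgeD dd hp hm).
  apply: cvg_trans h1; apply: near_eq_cvg; near=> x.
  have x0 : 0 < x by near: x; exact: nbhs_right_gt.
  by rewrite NE// ge0_muleDr.
have C0 : 0 < C := c0.
have l1 : (C%:E < (5 / 4 * C)%:E)%E by rewrite lte_fin; lra.
have l2 : ((3 / 4 * C)%:E < C%:E)%E by rewrite lte_fin; lra.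
have n1 := h _ (open_ereal_lt' l1); have n2 := h _ (open_ereal_gt' l2).
have [e e0 he] := (near_at_right0P _).1 (filterI n1 n2).
exists (e / 2); first by rewrite divr_gt0.
move=> z /andP[z0 ze]; have [|/ltW u1 /ltW u2] := he z; first by rewrite z0/=; lra.
have zb : 0 < z `^ beta by rewrite powR_gt0.
have zE : z `^ beta * z `^ (- beta) = 1 by rewrite -powRD_gt0// subrr powRr0.
have b0 : (0 <= (z `^ (- beta))%:E)%E by rewrite lee_fin powR_ge0.
have NzE : ((z `^ (- beta))%:E * ((z `^ beta)%:E * N z) = N z)%E.
  by rewrite muleA -EFinM mulrC zE mul1e.
by split; rewrite -NzE mulrC EFinM; exact: lee_wpmul2l.
Unshelve. all: by end_near. Qed.

(** Halving z at least doubles z^(- beta), so the tails at z / 2 and z differ by at least (2 x 3/4 -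
    5/4) C z^(- beta) = C z^(- beta) / 4. This is what the constants 3/4 and 5/4 of [tail_bounds]
    are for. *)
Lemma stable_block : exists c z0 : R, [/\ 0 < c, 0 < z0 & forall z, 0 < z <= z0 ->
    ((c * z `^ (- beta))%:E <= mu [set x | (z / 2 <= `|x| <= z)%R])%E].
Proof.
have [z0 z00 hz] := tail_bounds; have C0 : 0 < C := c0.
exists (C / 4), z0; split=> //; first by rewrite divr_gt0.
move=> z zz; have /andP[zp zz0] := zz; set B := [set x | _].
have mB : measurable B by exact: measurable_norm_itv.
have z2 : 0 < z / 2 <= z0 by rewrite divr_gt0//=; lra.
have [lo _] := hz _ z2; have [_ up] := hz _ zz.
have le : (N (z / 2) <= mu B + N z)%E.
  apply: le_trans (measureU2 _ _ _) => //; last exact: measurable_norm_ge.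
  apply: le_measure; rewrite ?inE.
  - exact: measurable_norm_ge.
  - by apply: measurableU => //; exact: measurable_norm_ge.
  - move=> x /= xz; have [xz'|xz'] := leP `|x| z; [left|right => /=; exact: ltW].
    by rewrite /B /= xz.
have {lo}lo := le_trans lo (le_trans le (leeD2l _ up)).
have zb0 : 0 <= z `^ (- beta) by exact: powR_ge0.
have two : 2 * z `^ (- beta) <= (z / 2) `^ (- beta).
  rewrite powRM ?invr_ge0 ?(ltW zp)// mulrC ler_wpM2l//.
  rewrite -powR_inv1// -powRrM mulN1r opprK -[leLHS](powRr1 (ler0n _ 2)).
  by rewrite ler_powR ?ler1n// ltW.
have := ler_wpM2l (_ : 0 <= 3 / 4 * C) two; rewrite mulr_ge0 ?(ltW C0)// => /(_ isT) h.
move: lo; case: (mu B) => [r| |].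
- by rewrite -EFinD !lee_fin => lo; lra.
- by move=> _; rewrite leey.
- by rewrite /= leeNy_eq.
Qed.

(** On the block where |x| is of order 2^(- n) z0 the integrand is of order 2^(- g n) and the mass
    at most of order 2^(beta n): a geometric series for g > beta. *)
Lemma stable_moment_lty g : beta < g <= 2 -> (\int[mu]_x (`|x| `^ g)%:E < +oo)%E.
Proof.
move=> /andP[bg g2]; have [z0 z00 hz] := tail_bounds; have C0 : 0 < C := c0.
have mf : measurable_fun setT (fun x : R => (`|x| `^ g)%:E).
  by apply/measurable_EFinP; exact: (measurableT_comp (@measurable_powR R g) (@normr_measurable R setT)).
pose h (x : R) := z0^-1 * `|x|.
have mh : measurable_fun setT h by apply: measurable_funM => //; exact: (@normr_measurable R setT).
have g0 : 0 < g by have := be1; lra.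
pose K := 5 / 4 * C * (z0 / 2) `^ (- beta) * z0 `^ g.
have K0 : 0 <= K by rewrite !mulr_ge0 ?powR_ge0// ltW.
pose rho := 2 `^ (- (g - beta)) : R.
have rho01 : 0 <= rho < 1.
  by rewrite powR_ge0/= -[X in _ < X](powRr0 2) gt1_ltr_powRr ?ltr1n//; lra.
have f0 (x : R) : (0 <= (`|x| `^ g)%:E)%E by rewrite lee_fin powR_ge0.
have := @geometric_integral_le R _ _ mu h (fun x => (`|x| `^ g)%:E) K rho mh mf f0 K0 rho01 => G.
apply: (@powR_moment_lty ([set 0] `|` [set x | (0 < h x <= 1)%R]) z0) => //.
- apply: measurableU => //.
  rewrite (_ : [set x | _] = setT `&` h @^-1` `]0, 1]%classic); first exact: mh.
  by apply/seteqP; split => w /=; rewrite in_itv/=; [split|case].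
- move=> x /not_orP[/eqP x0 /negP]; rewrite negb_and => /orP[|].
    by rewrite mulr_gt0 ?invr_gt0 ?normr_gt0.
  by rewrite -ltNge /h mulrC ltr_pdivlMr// mul1r => /ltW.
rewrite ge0_integral_setU//; last 3 first.
- rewrite (_ : [set x | _] = setT `&` h @^-1` `]0, 1]%classic); first exact: mh.
  by apply/seteqP; split => w /=; rewrite in_itv/=; [split|case].
- exact: measurable_funTS.
- by apply/disj_setPS => x [-> /=]; rewrite /h normr0 mulr0 ltxx.
rewrite null_set_integral ?levy.1 ?add0e//; last exact: measurable_funTS.
apply: (le_lt_trans (G _)); last exact: ltry.
move=> n; set D := [set x | _].
pose zn := z0 * 2^-1 ^+ n.+1.
have h2 : 0 < 2^-1 ^+ n :> R by rewrite exprn_gt0.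
have zn0 : 0 < zn by rewrite mulr_gt0// exprn_gt0.
have znz : 0 < zn <= z0 by rewrite zn0/= ler_piMr ?(ltW z00)// exprn_ile1// invf_le1// ler1n.
have mD : measurable D.
  rewrite (_ : D = setT `&` h @^-1` `](2^-1 ^+ n.+1), (2^-1 ^+ n)]%classic); first exact: mh.
  by apply/seteqP; split => w /=; rewrite /D /dyblock /= in_itv/=; [split|case].
pose M := (z0 * 2^-1 ^+ n) `^ g.
apply: (@le_trans _ _ (\int[mu]_(x in D) (cst M%:E) x)%E).
  apply: ge0_le_integral => //.
  - exact: measurable_funTS.
  move=> x; rewrite /D /dyblock /= => /andP[_ hx]; rewrite lee_fin /M.
  apply: ge0_ler_powR; rewrite ?nnegrE ?(ltW g0)//; first by rewrite mulr_ge0// ltW.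
  by move: hx; rewrite /h ler_pdivrMl.
rewrite integral_cst//.
have DN : (mu D <= N zn)%E.
  apply: le_measure; rewrite ?inE//; first exact: measurable_norm_ge.
  move=> x; rewrite /D /dyblock /= => /andP[hx _].
  by move: hx; rewrite /h /zn ltr_pdivlMl// => /ltW.
have M0 : (0 <= M%:E)%E by rewrite lee_fin powR_ge0.
apply: (le_trans (lee_wpmul2l M0 (le_trans DN (hz _ znz).2))).
rewrite -EFinM lee_fin /M /K /zn.
rewrite exprS mulrA !powRM ?mulr_ge0 ?(ltW z00) ?(ltW h2)// !powR_half.
have -> : 2 `^ (- - beta) ^+ n = (2 `^ beta) ^+ n :> R by rewrite opprK.
have -> : rho ^+ n = (2 `^ (- g)) ^+ n * (2 `^ beta) ^+ n :> R.
  by rewrite -exprMn /rho -powRD_gt0//; congr (powR _ _ ^+ _); ring.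
rewrite le_eqVlt; apply/orP; left; apply/eqP; ring.
Qed.

End Stable.
End LevyMeasure.

Section SigmaFiniteOf.
Context {R : realType} (mu : {measure set R -> \bar R}).
Hypothesis h : sigma_finite setT mu.

Let mus : set R -> \bar R := mu.
HB.instance Definition _ := Measure.copy mus mu.
HB.instance Definition _ := Measure_isSigmaFinite.Build _ _ _ mus h.

(** The same set function as mu, so that statements about it are, by conversion, statements about
    mu. *)
Definition sigma_finite_of : {sigma_finite_measure set R -> \bar R} := mus.

End SigmaFiniteOf.

(** * Proof of the theorem *)

(** For |x| <= K^(1/q) the negative power already exceeds K, and beyond that threshold the quadratic
    term does. *)
Lemma abspow_ge_sub {R : realType} (x q K : R) : q < 0 -> 0 < K ->
  (K%:E <= abspow x q + ((K / (K `^ q^-1) ^+ 2) * x ^+ 2)%:E)%E.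
Proof.
move=> q0 K0; set dl := K `^ q^-1; have dl0 : 0 < dl by rewrite powR_gt0.
have c0 : 0 <= K / dl ^+ 2 by rewrite divr_ge0 ?(ltW K0)// exprn_ge0// ltW.
have [->|x0] := eqVneq x 0; first by rewrite /abspow eqxx q0/= leey.
have nx : 0 < `|x| by rewrite normr_gt0.
rewrite abspowE; last by left.
rewrite -EFinD lee_fin; have [xd|xd] := leP `|x| dl.
  have -> : K = dl `^ q by rewrite /dl -powRrM mulVf ?powRr1 ?lt_eqF// ltW.
  apply: (@le_trans _ _ (`|x| `^ q)).
    rewrite /powR (gt_eqF nx) (gt_eqF dl0) ler_expR ler_wnM2l ?(ltW q0)//.
    by rewrite ler_ln.
  by rewrite lerDl mulr_ge0 ?sqr_ge0// divr_ge0 ?powR_ge0// exprn_ge0// powR_ge0.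
apply: (@le_trans _ _ (K / dl ^+ 2 * x ^+ 2)); last by rewrite lerDr powR_ge0.
rewrite mulrAC ler_pdivlMr ?exprn_gt0// ler_pM2l//.
by rewrite -[leRHS]real_normK ?num_real// lerXn2r ?nnegrE ?ltW.
Qed.

(** Jensen's inequality and Tonelli give E X(t)^2 = 0, so adding a multiple of X(t)^2 changes no
    expectation, and by [abspow_ge_sub] the negative moment exceeds every K. *)
Lemma degenerate_integrated {R : realType} d (T : measurableType d) (P : probability T R)
  (Y : R -> T -> R) (t q : R) :
  measurable_fun [set: R * T] (fun p : R * T => Y p.1 p.2) ->
  (forall r, (\int[P]_w (`|Y r w| `^ 2)%:E = 0)%E) -> 0 < t -> q < 0 ->
  (\int[P]_w abspow (integrated Y t w) q = +oo)%E.
Proof.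
move=> mY Y0 t0 q0; pose X := integrated Y t.
have mX : measurable_fun setT X by exact: (measurable_fine_time_integral (measurable_itv `[0, t]) mY).
pose f (z : R * T) := `|Y z.1 z.2| `^ 2.
have mf : measurable_fun setT f.
  by apply: (measurableT_comp (@measurable_powR R 2)); apply: measurableT_comp => //; exact: mY.
have f0 z : 0 <= f z by exact: powR_ge0.
have mYw w : measurable_fun `[0, t]%classic (fun s => Y s w).
  by apply: measurable_funTS; exact: (measurableT_comp mY (pair2_measurable w)).
have J w := @jensen_powR R _ _ (@lebesgue_measure R) `[0, t]%classic (fun s => Y s w) t 2
  (measurable_itv _) (mYw w) (lebesgue_0t (ltW t0)) t0 (ler1n _ 2).
have mX2 : measurable_fun setT (fun w => (X w ^+ 2)%:E) by apply/measurable_EFinP; exact: measurable_funX.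
have X20 w : (0 <= (X w ^+ 2)%:E)%E by rewrite lee_fin sqr_ge0.
have ti0 : 0 <= t^-1 by rewrite invr_ge0 ltW.
have tX : (t^-1%:E * \int[P]_w (X w ^+ 2)%:E <= 0)%E.
  rewrite -ge0_integralZl_EFin//.
  apply: (@le_trans _ _ (\int[P]_w \int[@lebesgue_measure R]_(s in `[0%R, t]) (f (s, w))%:E)%E).
    apply: ge0_le_integral => //.
    - by move=> w _; rewrite mule_ge0.
    - exact: measurable_funeM.
    - by apply: measurable_time_integral.
    move=> w _; apply: (le_trans _ (J w)); rewrite -EFinM lee_fin -/(integrated Y t w) -/(X w).
    rewrite powR_mulrn ?divr_ge0 ?(ltW t0)// expr_div_n real_normK ?num_real//.
    rewrite le_eqVlt; apply/orP; left; apply/eqP; by field; rewrite gt_eqF.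
  rewrite (tonelli_time P (measurable_itv `[0, t]) mf f0).
  under eq_integral do rewrite Y0.
  by rewrite integral0.
have EX : (\int[P]_w (X w ^+ 2)%:E = 0)%E.
  apply/eqP; rewrite eq_le integral_ge0// andbT leNgt; apply/negP => h.
  by move: tX; rewrite leNgt mule_gt0// lte_fin invr_gt0.
apply/eqyP => K K0; pose c := K / (K `^ q^-1) ^+ 2.
have c0 : 0 <= c by rewrite divr_ge0 ?(ltW K0)// exprn_ge0// powR_ge0.
have ma : measurable_fun setT (fun w => abspow (X w) q) by exact: (measurable_abspow (fun=> mX) t q).
have mc : measurable_fun setT (fun w => c%:E * (X w ^+ 2)%:E)%E by exact: measurable_funeM.
have c2 w : (0 <= c%:E * (X w ^+ 2)%:E)%E by rewrite mule_ge0.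
have a0 w : (0 <= abspow (X w) q)%E by exact: abspow_ge0.
have -> : (\int[P]_w abspow (integrated Y t w) q =
    \int[P]_w (abspow (X w) q + c%:E * (X w ^+ 2)%:E))%E.
  rewrite (ge0_integralD P measurableT (fun w _ => a0 w) ma (fun w _ => c2 w) mc).
  by rewrite ge0_integralZl_EFin// EX mule0 adde0.
apply: (@le_trans _ _ (\int[P]_w (cst K%:E) w)%E).
  by rewrite integral_cst//= probability_setT mule1.
apply: ge0_le_integral => //.
- by move=> w _; rewrite lee_fin ltW.
- exact: (emeasurable_funD ma mc).
- by move=> w _; rewrite -EFinM; exact: abspow_ge_sub.
Qed.

(** * Exponents of the integrated process in the four cases *)

Section Assembly.
Context {R : realType} d (T : measurableType d) (P : probability T R).
Variables (Y : R -> T -> R) (a b alpha H : R) (mu : {sigma_finite_measure set R -> \bar R})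
  (pi : probability R R) (tau : R -> \bar R).
Hypotheses (b0 : 0 <= b) (levy : is_levy_measure mu) (supY : is_supOU P Y a b mu pi).
Hypothesis Y0 : forall t, P.-integrable [set: T] (fun w => (Y t w)%:E) /\
             (\int[P]_w (Y t w)%:E = 0)%E.
Hypothesis Yexp : exists2 theta : R, 0 < theta &
     forall t, (\int[P]_w (expR (theta * `|Y t w|))%:E < +oo)%E.
Hypothesis m2 : (\int[mu]_x (x ^+ 2)%:E < +oo)%E.
Hypothesis a0 : 0 < alpha.
Hypothesis pi0 : pi `]-oo, 0%R]%classic = 0%E.
Hypothesis Hinv : forall q, 0 <= q < alpha ->
  (\int[pi]_(x in `]0%R, +oo[) (x `^ (- q))%:E < +oo)%E.
Hypothesis Hlow : forall e, 0 < e -> exists c r : R, [/\ 0 < c, 0 < r &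
  forall x, 0 < x <= r -> ((c * x `^ (alpha + e))%:E <= pi `[x, (4 * x)%R]%classic)%E].
Hypothesis mu0 : exists A : set R, measurable A /\ mu A != 0%E.
Hypothesis tauE : forall q : R,
    (elog (\int[P]_w abspow (integrated Y t w) q) * ((ln t)^-1)%:E)%E
       @[t --> +oo%R] --> tau q.
Local Notation X := (integrated Y).
Local Notation Q := (P \x P)%E.
Local Notation S := (fun t => sym (X t)).

Let pi0' : pi `]-oo, 0%R[%classic = 0%E.
Proof.
apply/eqP; rewrite eq_le measure_ge0 andbT -pi0.
by apply: le_measure; rewrite ?inE// => x /=; rewrite !in_itv/= => /ltW.
Qed.

Let mX t : measurable_fun setT (X t) := measurable_X supY t.
Let mS t : measurable_fun setT (S t) := measurable_sym (mX t).
Let mu_even := levy_even_lty b0 levy supY Yexp m2.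
Let Xmom t n (t0 : 0 < t) := X_moment b0 levy supY Y0 Yexp m2 n t0.

Let Smom t n : 0 < t -> (\int[Q]_w (S t w ^+ n.*2)%:E < +oo)%E.
Proof.
move=> t0; apply: sym_moment_fin => //.
by under eq_integral do rewrite -expr2_powR; exact: Xmom.
Qed.

Let hS t u : 0 < t ->
  (\int[Q]_w (cos (u * S t w))%:E = (expR (- (2 * fine (chexp mu pi b (Fk t) u))))%:E)%E.
Proof. by move=> t0; exact: (sym_integrated_chf b0 levy supY Y0 Yexp m2 pi0' t0). Qed.

Let mass := levy_mass levy mu0.

Let Mpos j : (0 < j)%N -> 0 < fine (\int[mu]_x (x ^+ j.*2)%:E)%E.
Proof.
move=> j0; have [x0 [x1 [m [h1 h2 h3]]]] := mass.
by apply: (even_moment_gt0 h1 h2 h3); exact: mu_even.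
Qed.

Let near_ge (t1 : R) : \forall t \near +oo, t1 <= t.
Proof. by apply: nbhs_pinfty_ge; exact: num_real. Qed.

(** Upper bounds pass from the symmetrized variable to X(t) by Jensen's inequality, which asks for q
    >= 1 and mean 0; lower bounds pass by the triangle inequality in [tau_lo]. *)
Let tau_up q C y : 1 <= q ->
  (forall t, 1 <= t -> (\int[Q]_w (`|S t w| `^ q)%:E <= (C * t `^ y)%:E)%E) -> (tau q <= y%:E)%E.
Proof.
move=> q1 h; apply: (tau_le tauE (C := C)); near=> t.
have t1 : 1 <= t by near: t; exact: near_ge.
have t0 : 0 < t by lra.
apply: le_trans (h t t1).
have -> : (\int[P]_w abspow (X t w) q = \int[P]_w (`|X t w| `^ q)%:E)%E.
  by apply: eq_integral => w _; rewrite abspowE//; right; lra.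
apply: (le_sym_moment (mX t) q1).
- exact: (integrated_integrable b0 levy supY Y0 Yexp m2 t0).
- exact: (integrated_mean0 b0 levy supY Y0 Yexp m2 pi0' t0).
Unshelve. all: by end_near. Qed.

Let tau_lo q c y t1 : 0 <= q -> 0 < c ->
  (forall t, t1 <= t -> ((c * t `^ y)%:E <= \int[Q]_w (`|S t w| `^ q)%:E)%E) -> (y%:E <= tau q)%E.
Proof.
move=> q0 c0 h; pose k := 2 `^ q * 2 : R; have k0 : 0 < k by rewrite mulr_gt0 ?powR_gt0.
apply: (tau_ge tauE (c := c / k)); first by rewrite divr_gt0.
near=> t; have tt : t1 <= t by near: t; exact: near_ge.
have -> : (\int[P]_w abspow (X t w) q = \int[P]_w (`|X t w| `^ q)%:E)%E.
  by apply: eq_integral => w _; rewrite abspowE//; right.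
have := le_trans (h t tt) (sym_moment_le P (mX t) q0); rewrite -/k => h1.
have ki : (0 <= k^-1%:E)%E by rewrite lee_fin invr_ge0 ltW.
have := lee_wpmul2l ki h1; rewrite muleA -!EFinM mulVf ?gt_eqF// mul1e.
by rewrite mulrA [k^-1 * c]mulrC.
Unshelve. all: by end_near. Qed.

Let smomE t j : 0 < t -> (\int[Q]_w (`|S t w| `^ j.*2%:R)%:E = (smom Q (S t) j * j.*2`!%:R)%:E)%E.
Proof.
move=> t0; under eq_integral do rewrite -expr2_powR.
rewrite /smom divfK ?pnatr_eq0 -?lt0n ?fact_gt0// fineK// ge0_fin_numE ?Smom//.
by apply: integral_ge0 => w _; rewrite lee_fin expr2_powR powR_ge0.
Qed.

Let smom_up := smom_upper b0 a0 mu_even pi0 Hinv mS Smom hS.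

Let tau_even_le m : (0 < m)%N -> (tau m.*2%:R <= (Num.max m%:R (m.*2%:R - alpha))%:E)%E.
Proof.
move=> mp; set M := Num.max _ _; apply/lee_addgt0Pr => e e0.
have m0 : 0 < m%:R :> R by rewrite ltr0n.
pose e' := Num.min alpha (e / m%:R).
have e'0 : 0 < e' <= alpha by rewrite lt_min a0 divr_gt0//= ge_min lexx.
have [C C0 hC] := smom_up e'0 m.
rewrite -EFinD; apply: (@tau_up _ (C * m.*2`!%:R)).
  by rewrite ler1n double_gt0.
move=> t t1; have t0 : 0 < t by lra.
rewrite smomE// lee_fin [leRHS]mulrAC ler_wpM2r//.
apply: (le_trans (hC m t (leqnn m) t1)); rewrite ler_wpM2l// ler_powR//.
rewrite -/M lerD2l mulrC -ler_pdivlMr//.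
by rewrite ge_min lexx orbT.
Qed.

Let tau_even_ge m : (0 < m)%N -> ((m.*2%:R - alpha)%:E <= tau m.*2%:R)%E.
Proof.
move=> mp; apply/lee_subgt0Pr => e e0; rewrite -EFinB.
have [c [t1 [c0 t11 h]]] := smom_lower b0 a0 mu_even pi0 Hinv Hlow mS Smom hS Mpos e0 mp.
apply: (@tau_lo _ (c * m.*2`!%:R) _ t1) => //.
  by rewrite mulr_gt0// ltr0n fact_gt0.
move=> t tt; have t0 : 0 < t by lra.
by rewrite smomE// lee_fin [leLHS]mulrAC ler_wpM2r// h.
Qed.

(** For m >= alpha the maximum in the upper bound is 2m - alpha, which meets the lower bound. *)
Let tau_even m : alpha <= m%:R -> tau m.*2%:R = (m.*2%:R - alpha)%:E.
Proof.
move=> am; have mp : (0 < m)%N by rewrite -(ltr0n R) (lt_le_trans a0).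
apply/eqP; rewrite eq_le tau_even_ge// andbT (le_trans (tau_even_le mp))// lee_fin.
have m2E : m.*2%:R = m%:R + m%:R :> R by rewrite -addnn natrD.
by rewrite ge_max lexx andbT m2E; lra.
Qed.

(** Small e suffice for the limit. The bound 1/2 is chosen below 1 / (1 + alpha) for alpha < 1, as
    [chexp_lower_jump] demands. *)
Let tau_first h : (forall e, 0 < e < 2^-1 -> exists c t1 : R, [/\ 0 < c, 1 <= t1 &
    forall t, t1 <= t -> (c%:E <= chexp mu pi b (Fk t) (t `^ (- (h - e))))%E]) ->
  (h%:E <= tau 1)%E.
Proof.
move=> hc; apply/lee_subgt0Pr => e e0; rewrite -EFinB.
pose e' := Num.min e (4^-1 : R).
have e'h : 0 < e' < 2^-1.
  rewrite lt_min e0/= invr_gt0 ltr0n/= gt_min; apply/orP; right; lra.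
have [c [t1 [c0 t11 hh]]] := hc e' e'h.
have [c' c'0 hl] := first_moment_lower b0 a0 mu_even pi0 Hinv mS hS c0 t11 hh.
apply: (@tau_lo _ c' _ t1) => // t tt.
have t0 : 0 < t by lra.
apply: (@le_trans _ _ (c' * t `^ (h - e'))%:E).
  rewrite lee_fin ler_wpM2l ?(ltW c'0)// ler_powR//; first by lra.
  by rewrite lerB// ge_min lexx.
apply: (le_trans (hl t tt)); rewrite le_eqVlt; apply/orP; left; apply/eqP.
by apply: eq_integral => w _; rewrite powRr1.
Qed.

Let mom_up := moment_upper b0 a0 mu_even pi0 Hinv mS hS.

Let conclude := fun H1 => @scaling_theorem R d T P X tau alpha H mX tauE a0 H1.

Let m0 := (Num.truncn alpha).+1.

Let tau_m0 m : (m0 <= m)%N -> tau m.*2%:R = (m.*2%:R - alpha)%:E.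
Proof.
by move=> h; apply: tau_even; apply: (le_trans (ltW (truncnS_gt _))); rewrite ler_nat.
Qed.

Let Conclusion :=
  (forall A : set R, measurable A ->
    let g := fun t : R =>
      (elog (P [set w | (integrated Y t w != 0)%R /\
                        A (ln `|integrated Y t w| / ln t)%R])
        * ((ln t)^-1)%:E)%E in
    (- ereal_inf (legendre tau @` (interior A `&` [set H; 1%R]))
       <= liminf_infty g)%E /\
    (liminf_infty g <= limsup_infty g)%E /\
    (limsup_infty g <= - ereal_inf (legendre tau @` closure A))%E) /\
  (forall x : R, legendre tau x =
     if x < H then
       Order.max (ereal_sup [set ((q * x)%:E - tau q)%E | q in [set q : R | q < 0]]) 0%E
     else if x <= 1 then
       (alpha / (1 - H) * x - alpha * H / (1 - H))%:E
     else +oo%E).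

(** For alpha < 1 the crossing order q0 is 2, 1 + alpha or beta in the three cases. As it exceeds 1,
    the orders 1 and (1 + q0) / 2 can serve as q2 and q1, and orders just below q0 approximate the
    crossing. *)
Let conclude_fractional (q0 : R) : H < 1 -> 1 < q0 -> q0 = alpha / (1 - H) ->
  (H%:E <= tau 1)%E -> (forall q, 1 <= q < q0 -> (tau q <= (H * q)%:E)%E) -> Conclusion.
Proof.
move=> H1 q01 q0E t1 tq; pose q1 := (1 + q0) / 2.
apply: (conclude H1 tau_m0 (q1 := q1) (q2 := 1)) => //.
- by rewrite /q1; lra.
- by rewrite mulr1.
- by apply: tq; rewrite /q1; apply/andP; split; lra.
move=> e e0; rewrite -q0E; exists (Num.max 1 (q0 - e / 2)); split.
  have [h|h] := leP 1 (q0 - e / 2); rewrite ltr_norml; apply/andP; split; lra.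
by apply: tq; rewrite le_max lexx/= gt_max q01/=; lra.
Qed.

Lemma conclude_gauss : 0 < b -> alpha < 1 -> H = 1 - alpha / 2 -> Conclusion.
Proof.
move=> bpos a1 HE.
apply: (@conclude_fractional 2).
- by rewrite HE; have := a0; lra.
- lra.
- by rewrite HE; field; rewrite gt_eqF//; have := a0; lra.
- apply: tau_first => e /andP[e0 _]; rewrite HE.
  exact: (chexp_lower_gauss b0 a0 mu_even pi0 Hinv Hlow bpos e0).
move=> q /andP[q1 q2]; apply/lee_addgt0Pr => e e0; rewrite -EFinD.
pose e' := Num.min alpha e; have e'0 : 0 < e' by rewrite lt_min a0.
have e'a : e' <= alpha by rewrite ge_min lexx.
have e'e : e' <= e by rewrite ge_min lexx orbT.
have fin2 : (\int[mu]_x (`|x| `^ 2)%:E < +oo)%E.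
  by under eq_integral do rewrite powR_mulrn// real_normK ?num_real//.
have [||||||C C0 hC] := @mom_up 2 (alpha - e') q => //.
- by apply/andP; split; lra.
- by apply/andP; split; lra.
- lra.
- by right.
- by apply/andP; split; lra.
apply: (@tau_up _ C) => // t t1; apply: (le_trans (hC t t1)).
rewrite lee_fin ler_wpM2l// ler_powR// HE.
have : e' * q <= e * 2.
  by apply: ler_pM => //; [exact: ltW|exact: le_trans ler01 q1|exact: ltW].
lra.
Qed.

Lemma conclude_BG : b = 0 -> alpha < 1 -> (BG_index mu < (1 + alpha)%:E)%E ->
  H = (1 + alpha)^-1 -> Conclusion.
Proof.
move=> bz a1 hBG HE; have a00 := a0.
have aa : 0 < 1 + alpha by lra.
have Hh : 2^-1 < H by rewrite HE ltf_pV2 ?posrE//; lra.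
apply: (@conclude_fractional (1 + alpha)).
- by rewrite HE invf_lt1//; lra.
- lra.
- by rewrite HE; field; rewrite !gt_eqF//; lra.
- apply: tau_first => e /andP[e0 eh]; rewrite HE.
  have [x0 [x1 [m [h1 h2 h3]]]] := mass.
  apply: (@chexp_lower_jump R b alpha mu pi b0 a0 Hlow e x0 x1 m _ h1 h2 h3).
  by rewrite e0 -HE; lra.
move=> q /andP[q1 q2]; apply/lee_addgt0Pr => e e0; rewrite -EFinD.
have [g0 [hg0 g0a]] : exists g0 : R, (BG_index mu < g0%:E)%E /\ g0 < 1 + alpha.
  move: hBG => /ereal_inf_lt[_ [g [g00 fin] <-]]; rewrite lte_fin => gg.
  exists ((g + (1 + alpha)) / 2); split; last by lra.
  apply: (@le_lt_trans _ _ g%:E); last by rewrite lte_fin; lra.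
  by apply: ereal_inf_lbound; exists g.
(* g has to exceed the index of mu for a finite moment, exceed q for [moment_upper], and come within
   e / 2 of 1 + alpha, so that q / g <= q / (1 + alpha) + e. *)
pose g := Num.max (Num.max g0 ((q + (1 + alpha)) / 2)) (1 + alpha - e / 2).
have gg0 : g0 <= g by rewrite !le_max lexx.
have gq : (q + (1 + alpha)) / 2 <= g by rewrite !le_max lexx orbT.
have ge : 1 + alpha - e / 2 <= g by rewrite !le_max lexx !orbT.
have ga : g < 1 + alpha by rewrite !gt_max g0a/=; apply/andP; split; lra.
have fin : (\int[mu]_x (`|x| `^ g)%:E < +oo)%E.
  apply: (BG_moment_lty m2); first by lra.
  by apply: (lt_le_trans hg0); rewrite lee_fin.
have [||||||C C0 hC] := @mom_up g (g - 1) q => //.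
- by apply/andP; split; lra.
- by apply/andP; split; lra.
- by left.
- by apply/andP; split; lra.
apply: (@tau_up _ C) => // t t1; apply: (le_trans (hC t t1)).
rewrite lee_fin ler_wpM2l// ler_powR// HE.
have g1 : 1 < g by lra.
have -> : (g - (g - 1)) * (q / g) = (1 + alpha)^-1 * q + q * (1 + alpha - g) / (g * (1 + alpha)).
  by field; rewrite !gt_eqF//; lra.
rewrite lerD2l ler_pdivrMr ?mulr_gt0//; last by lra.
have h1 : q * (1 + alpha - g) <= 2 * (e / 2).
  apply: ler_pM.
  - exact: le_trans ler01 q1.
  - by rewrite subr_ge0 ltW.
  - by rewrite (le_trans (ltW q2))// (_ : 2 = 1 + 1 :> R)// lerD2l ltW.
  - by rewrite lerBlDr [leRHS]addrC -lerBlDr.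
have h2 : 1 <= g * (1 + alpha) by rewrite mulr_ege1 ?(ltW g1)// lerDl ltW.
have := ler_wpM2l (ltW e0) h2; lra.
Qed.

Lemma conclude_stable cp cm beta : b = 0 -> alpha < 1 ->
  [/\ 0 <= cp, 0 <= cm, 0 < cp + cm & 1 + alpha < beta < 2] ->
  ((x `^ beta)%:E * mu `[x, +oo[%classic)%E @[x --> 0^'+] --> cp%:E ->
  ((x `^ beta)%:E * mu `]-oo, (- x)%R]%classic)%E @[x --> 0^'+] --> cm%:E ->
  H = 1 - alpha / beta -> Conclusion.
Proof.
move=> bz a1 [cp0 cm0 c0 /andP[ab b2]] hp hm HE; have a00 := a0.
have be0 : 0 < beta by lra.
have be1 : 1 < beta by lra.
have abe : 0 < alpha / beta by rewrite divr_gt0.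
apply: (@conclude_fractional beta).
- by rewrite HE; lra.
- lra.
- by rewrite HE; field; rewrite !gt_eqF//; lra.
- apply: tau_first => e /andP[e0 eh]; rewrite HE.
  apply: (@chexp_lower_stable R b alpha mu pi b0 a0 Hlow e beta e0 _ (stable_block c0 be1 hp hm)).
  lra.
move=> q /andP[q1 q2]; apply/lee_addgt0Pr => e e0; rewrite -EFinD.
(* Three constraints: alpha - e' >= 0, beta + e' <= 2, and a final error of at most e. *)
pose e' := Num.min alpha (Num.min (2 - beta) (e / 4)).
have e'0 : 0 < e' by rewrite !lt_min a0/= divr_gt0//= andbT; lra.
have e'a : e' <= alpha by rewrite ge_min lexx.
have e'b : e' <= 2 - beta by rewrite !ge_min lexx orbT.
have e'e : e' <= e / 4 by rewrite !ge_min lexx !orbT.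
pose g := beta + e'.
have fin : (\int[mu]_x (`|x| `^ g)%:E < +oo)%E.
  by apply: (stable_moment_lty levy m2 c0 be1 hp hm); rewrite /g; apply/andP; split; lra.
have [||||||C C0 hC] := @mom_up g (alpha - e') q => //.
- by rewrite /g; apply/andP; split; lra.
- by apply/andP; split; lra.
- by rewrite /g; lra.
- by left.
- by rewrite /g; apply/andP; split; lra.
apply: (@tau_up _ C) => // t t1; apply: (le_trans (hC t t1)).
rewrite lee_fin ler_wpM2l// ler_powR// HE.
have g1 : 1 < g by rewrite /g; lra.
have -> : (g - (alpha - e')) * (q / g) = (1 - alpha / beta) * q + (q * e') * ((alpha + beta) / (beta * g)).
  by rewrite /g; field; rewrite !gt_eqF//; lra.
rewrite lerD2l.
have h1 : q * e' <= 2 * (e / 4).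
  by apply: ler_pM => //; [exact: le_trans ler01 q1|exact: ltW|exact: ltW (lt_trans q2 b2)].
have h2 : (alpha + beta) / (beta * g) <= 2.
  rewrite ler_pdivrMr ?mulr_gt0//; last by lra.
  have : beta * 1 <= beta * g by rewrite ler_pM2l// ltW.
  lra.
apply: (@le_trans _ _ (2 * (e / 4) * 2)); last by lra.
apply: ler_pM => //; first by rewrite mulr_ge0 ?(ltW e'0)// (le_trans ler01).
by rewrite divr_ge0 ?addr_ge0 ?mulr_ge0 ?(ltW a00) ?(ltW be0)// ltW// (lt_trans ltr01 g1).
Qed.

(** At the integer k = alpha the exponents k and 2k - alpha coincide, so tau (2 alpha) <= alpha,
    which is H q at q = 2 alpha; this even order is exactly the crossing point of the two lines. As
    alpha > 1, it lies beyond the order 2, where the linear lower bound gives tau 2 >= 1. *)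
Lemma conclude_integer : 1 < alpha -> alpha \is a Num.int -> H = 1 / 2 -> Conclusion.
Proof.
move=> a1 aint HE.
have [k kE] : exists k : nat, alpha = k%:R by apply/natrP; rewrite natrEint aint/= ltW.
have k1 : (1 < k)%N by rewrite -(ltr_nat R) -kE.
have H1 : H < 1 by rewrite HE; lra.
have k2E : k.*2%:R = 2 * alpha :> R by rewrite kE -mul2n natrM.
have tk : (tau k.*2%:R <= (H * k.*2%:R)%:E)%E.
  apply: (le_trans (tau_even_le (ltnW k1))); rewrite lee_fin k2E HE -kE.
  by rewrite ge_max; apply/andP; split; lra.
apply: (conclude H1 tau_m0 (q1 := k.*2%:R) (q2 := 1.*2%:R)) => //.
- by rewrite ltr_nat ltn_double.
- have [c [t1 [c0 t11 h]]] := smom1_linear b0 a0 mu_even pi0 Hinv Hlow mS Smom hS Mpos.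
  rewrite HE (_ : 1 / 2 * _ = 1); last by rewrite (_ : 1.*2%:R = 2 :> R)//; lra.
  apply: (@tau_lo _ (c * 2) _ t1) => // [|t tt]; first by rewrite mulr_gt0.
  have t0 : 0 < t by lra.
  rewrite smomE// lee_fin powRr1 ?(ltW t0)// (_ : 1.*2`!%:R = 2 :> R)//.
  by have := h t tt; lra.
move=> e e0; exists k.*2%:R; split=> //.
by rewrite (_ : _ - _ = 0) ?normr0//; rewrite k2E HE; field.
Qed.

End Assembly.

Section SigmaFiniteCase.
Context {R : realType} d (T : measurableType d) (P : probability T R).
Variables (Y : R -> T -> R) (a b alpha H : R) (mu : {sigma_finite_measure set R -> \bar R})
  (pi : probability R R) (p l : R -> R) (tau : R -> \bar R).

Lemma theorem5p3_sigma_finite :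
  0 <= b -> is_levy_measure mu ->
  is_supOU P Y a b mu pi ->
  (forall t, P.-integrable [set: T] (fun w => (Y t w)%:E) /\
             (\int[P]_w (Y t w)%:E = 0)%E) ->
  has_density pi p -> 0 < alpha -> slowly_varying l ->
  (p x / (alpha * l x^-1 * x `^ (alpha - 1))) @[x --> 0^'+] --> (1 : R) ->
  (1 < alpha -> alpha \is a Num.int) ->
  (exists2 theta : R, 0 < theta &
     forall t, (\int[P]_w (expR (theta * `|Y t w|))%:E < +oo)%E) ->
  (exists A : set R, measurable A /\ mu A != 0%E) ->
  [\/ [/\ 0 < b, 0 < alpha < 1 & H = 1 - alpha / 2],
      [/\ b = 0, 0 < alpha < 1, (BG_index mu < (1 + alpha)%:E)%E
        & H = (1 + alpha)^-1],
      [/\ b = 0, 0 < alpha < 1 &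
        exists cp cm beta : R,
          [/\ 0 <= cp, 0 <= cm, 0 < cp + cm & 1 + alpha < beta < 2] /\
          ((x `^ beta)%:E * mu `[x, +oo[%classic)%E @[x --> 0^'+] --> cp%:E /\
          ((x `^ beta)%:E * mu `]-oo, (- x)%R]%classic)%E @[x --> 0^'+] --> cm%:E /\
          H = 1 - alpha / beta]
    | 1 < alpha /\ H = 1 / 2] ->
  (forall q : R,
     (elog (\int[P]_w abspow (integrated Y t w) q) * ((ln t)^-1)%:E)%E
       @[t --> +oo%R] --> tau q) ->
  (interior [set q : R | (tau q < +oo)%E]) 0 ->
  (forall A : set R, measurable A ->
    let g := fun t : R =>
      (elog (P [set w | (integrated Y t w != 0)%R /\
                        A (ln `|integrated Y t w| / ln t)%R])
        * ((ln t)^-1)%:E)%E in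
    (- ereal_inf (legendre tau @` (interior A `&` [set H; 1%R]))
       <= liminf_infty g)%E /\
    (liminf_infty g <= limsup_infty g)%E /\
    (limsup_infty g <= - ereal_inf (legendre tau @` closure A))%E) /\
  (forall x : R, legendre tau x =
     if x < H then
       Order.max (ereal_sup [set ((q * x)%:E - tau q)%E | q in [set q : R | q < 0]]) 0%E
     else if x <= 1 then
       (alpha / (1 - H) * x - alpha * H / (1 - H))%:E
     else +oo%E).
Proof.
move=> b0 levy supY Y0 dens a0 lsv pl aint Yexp mu0 hcase tauE int0.
have pi0 := density_pos dens.
have Hinv := fun q => @integral_inv_powR R pi p l alpha dens a0 lsv pl q.
have Hlow := fun e => @mass_lower R pi p l alpha dens a0 lsv pl e.
have [m2|Ydeg] := levy_sqr_or_degenerate b0 levy supY Y0 Yexp; last first.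
  (* In the degenerate case every neighbourhood of 0 contains some q < 0, and there tau q = +oo. *)
  exfalso; move: int0 => /nbhs_ballP[e /= e0 /(_ (- (e / 2)))].
  have bl : ball 0 e (- (e / 2)).
    by rewrite /ball /= sub0r opprK ger0_norm; lra.
  move=> /(_ bl) /=; have en : - (e / 2) < 0 by lra.
  rewrite ltNge leye_eq => /negP; apply; apply/eqP/eqyP => A A0.
  apply: (@tau_ge R d T P (integrated Y) tau tauE _ A 1 ltr01).
  near=> t; have t0 : 0 < t by near: t; apply: nbhs_pinfty_gt; exact: num_real.
  by rewrite (degenerate_integrated supY.1 Ydeg t0 en) leey.
case: hcase => [[bp /andP[_ a1] HE]|[bz /andP[_ a1] BG HE]|[bz /andP[_ a1] [cp [cm [beta [hb [hp [hm HE]]]]]]]|[a1 HE]].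
- exact: (conclude_gauss b0 levy supY Y0 Yexp m2 a0 pi0 Hinv Hlow mu0 tauE bp a1 HE).
- exact: (conclude_BG b0 levy supY Y0 Yexp m2 a0 pi0 Hinv Hlow mu0 tauE bz a1 BG HE).
- exact: (conclude_stable b0 levy supY Y0 Yexp m2 a0 pi0 Hinv Hlow mu0 tauE bz a1 hb hp hm HE).
- exact: (conclude_integer b0 levy supY Y0 Yexp m2 a0 pi0 Hinv Hlow mu0 tauE a1 (aint a1) HE).
Unshelve. all: by end_near. Qed.

End SigmaFiniteCase.

Unset Implicit Arguments.

Theorem theorem5p3 (R : realType) (d : measure_display) (T : measurableType d)
  (P : probability T R) (Y : R -> T -> R)
  (a b : R) (mu : {measure set R -> \bar R}) (pi : probability R R)
  (p l : R -> R) (alpha H : R) (tau : R -> \bar R) :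
  (* characteristic quadruple *)
  0 <= b -> is_levy_measure mu ->
  is_supOU P Y a b mu pi ->
  (* E Y(t) = 0 and E Y(t)^2 < oo *)
  (forall t, P.-integrable [set: T] (fun w => (Y t w)%:E) /\
             (\int[P]_w (Y t w)%:E = 0)%E) ->
  (forall t, (\int[P]_w ((Y t w) ^+ 2)%:E < +oo)%E) ->
  (* (1) *)
  has_density pi p -> 0 < alpha -> slowly_varying l ->
  (p x / (alpha * l x^-1 * x `^ (alpha - 1))) @[x --> 0^'+] --> (1 : R) ->
  (1 < alpha -> alpha \is a Num.int) ->
  (* (2) *)
  (exists2 theta : R, 0 < theta &
     forall t, (\int[P]_w (expR (theta * `|Y t w|))%:E < +oo)%E) ->
  (* (3) *)
  (exists A : set R, measurable A /\ mu A != 0%E) ->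
  (* (4) *)
  [\/ [/\ 0 < b, 0 < alpha < 1 & H = 1 - alpha / 2],
      [/\ b = 0, 0 < alpha < 1, (BG_index mu < (1 + alpha)%:E)%E
        & H = (1 + alpha)^-1],
      [/\ b = 0, 0 < alpha < 1 &
        exists cp cm beta : R,
          [/\ 0 <= cp, 0 <= cm, 0 < cp + cm & 1 + alpha < beta < 2] /\
          ((x `^ beta)%:E * mu `[x, +oo[%classic)%E @[x --> 0^'+] --> cp%:E /\
          ((x `^ beta)%:E * mu `]-oo, (- x)%R]%classic)%E @[x --> 0^'+] --> cm%:E /\
          H = 1 - alpha / beta]
    | 1 < alpha /\ H = 1 / 2] ->
  (* (5) *)
  (forall q : R,
     (elog (\int[P]_w abspow (integrated Y t w) q) * ((ln t)^-1)%:E)%E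
       @[t --> +oo%R] --> tau q) ->
  (interior [set q : R | (tau q < +oo)%E]) 0 ->
  (* conclusion *)
  (forall A : set R, measurable A ->
    let g := fun t : R =>
      (elog (P [set w | (integrated Y t w != 0)%R /\
                        A (ln `|integrated Y t w| / ln t)%R])
        * ((ln t)^-1)%:E)%E in
    (- ereal_inf (legendre tau @` (interior A `&` [set H; 1%R]))
       <= liminf_infty g)%E /\
    (liminf_infty g <= limsup_infty g)%E /\
    (limsup_infty g <= - ereal_inf (legendre tau @` closure A))%E) /\
  (forall x : R, legendre tau x =
     if x < H then
       Order.max (ereal_sup [set ((q * x)%:E - tau q)%E | q in [set q : R | q < 0]]) 0%E
     else if x <= 1 then
       (alpha / (1 - H) * x - alpha * H / (1 - H))%:E
     else +oo%E).
Proof.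
move=> b0 levy supY Y0 _ dens a0 lsv pl aint Yexp mu0 hcase tauE int0.
exact: (@theorem5p3_sigma_finite R d T P Y a b alpha H
  (sigma_finite_of (levy_sigma_finite levy)) pi p l tau
  b0 levy supY Y0 dens a0 lsv pl aint Yexp mu0 hcase tauE int0).
Qed.
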